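(* Let $n\ge1$ and let $(\psi,\tilde\psi)=(\psi^{(\epsilon)},\tilde\psi^{(\epsilon)})$ be any one of the pairs of generators of a pair of band-limited biorthogonal Riesz wavelet bases of $L^2(\mathbb{R}^n)$ (see context), with $\psi\in M^\tau$ and $\tilde\psi\in\mathcal{D}_\sigma$ for some $\tau>0$ and $\sigma>2n$. Let $1<p<\infty$, $w\in A_p$, $\gamma:=n+n/p'$, $\gamma':=n+n/p$, let $\zeta$ be the Riemann zeta function, and let $\theta(p):=\frac12\max\{1,(p-1)^{-1}\}$. Let $K_U:=K_U(\psi)$ and $K_L:=K_L(\tilde\psi)$ be as in the context. (a) For every $j\in\mathbb{Z}$, every finite $\Lambda\subset\mathbb{Z}^n$ and all $\{c_{j,k}\}_{k\in\Lambda}\subset\mathbb{C}$, the sum $r^{(j)}_\Lambda:=\sum_{k\in\Lambda}c_{j,k}\psi_{j,k}$ satisfies $$K_L^{-1}[w]_{A_p}^{-1/p}\,2^{jn/2}\Bigl(\sum_{k\in\Lambda}|c_{j,k}|^p\,w(Q_{j,k})\Bigr)^{1/p}\le\bigl\|r^{(j)}_\Lambda\bigr\|_{L^p_w}\le K_U[w]_{A_p}^{1/p}\,2^{jn/2}\Bigl(\sum_{k\in\Lambda}|c_{j,k}|^p\,w(Q_{j,k})\Bigr)^{1/p},$$ where $$K_U\le|\psi|_{M^\tau}\bigl(1+2\gamma\,3^{\gamma-1}\zeta(1+\tau+n/p)\bigr),\qquad K_L\le\mathrm{L}_\sigma(\tilde\psi)\bigl(1+2\gamma'\,3^{\gamma'-1}\zeta(1+\sigma-n-n/p)\bigr).$$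 Moreover $1/p\le\theta(p)$, with equality exactly at $p=2$, and consequently the preceding two-sided estimate implies $$c\,[w]_{A_p}^{-\theta(p)}\,2^{jn/2}\Bigl(\sum_{k\in\Lambda}|c_{j,k}|^p\,w(Q_{j,k})\Bigr)^{1/p}\le\bigl\|r^{(j)}_\Lambda\bigr\|_{L^p_w}\le C\,[w]_{A_p}^{\theta(p)}\,2^{jn/2}\Bigl(\sum_{k\in\Lambda}|c_{j,k}|^p\,w(Q_{j,k})\Bigr)^{1/p},$$ with constants $c,C>0$ depending on $n$, $p$, the Riesz bounds $A,B$ and the decay parameters $\tau,\sigma$ (in the sense of the context), and independent of $j$, $\Lambda$ and $\{c_{j,k}\}$. (b) The proof of the upper estimate in (a) uses the generator only through its decay envelope. Consequently, for every $h\in\mathcal{S}(\mathbb{R}^n)$, with $h_{j,k}(x):=2^{jn/2}h(2^jx-k)$, and all $j$, finite $\Lambda$ and $\{c_{j,k}\}$ as in (a), $$\Bigl\|\sum_{k\in\Lambda}c_{j,k}\,h_{j,k}\Bigr\|_{L^p_w}\le K_U(h)\,[w]_{A_p}^{1/p}\,2^{jn/2}\Bigl(\sum_{k\in\Lambda}|c_{j,k}|^p\,w(Q_{j,k})\Bigr)^{1/p},$$ and $K_U(h)\le|h|_{M^\tau}\bigl(1+2\gamma\,3^{\gamma-1}\zeta(1+\tau+n/p)\bigr)$. (c) Let $h$ be a measurable function with $|h(x)|\le\mathrm{L}\,(1+|x|)^{-\sigma}$ for some $\sigma>2n$. Then $$\int_{\mathbb{R}^n}|g|\,|h|\le K_L(h)\,[w]_{A_p}^{1/p}\,w(Q_{0,0})^{-1/p}\,\|g\|_{L^p_w},\qquad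 g\in L^p_w,$$ and $K_L(h)\le\mathrm{L}\bigl(1+2\gamma'\,3^{\gamma'-1}\zeta(1+\sigma-n-n/p)\bigr)$. Applied to Schwartz functions, this shows that every $g\in L^p_w$ defines a tempered distribution, and that the coefficients $\langle g,\tilde\psi_{j,k}\rangle$ are given by absolutely convergent integrals. (d) Let $s>0$, $0<q<\infty$, $\ell\in\mathbb{Z}$, and let $r=\sum_{k\in\Lambda}c_k\,\psi_{\ell,k}$ be a finite single-scale sum. Then, with $M$, $C_M$, $C'_M$ as in the context, $$C_M^{-1}\,2^{\ell s}\,\|r\|_{L^p_w}\le\|r\|_{\dot{B}^s_{p,q}(w)}\le C'_M\,K_\eta\,[w]_{A_p}^{1/p}\,2^{\ell(s+n/2)}\Bigl(\sum_{k\in\Lambda}|c_k|^p\,w(Q_{\ell,k})\Bigr)^{1/p},\qquad K_\eta:=\max_{|i|\le M}K_U(\varphi_i*\psi).$$ Indeed, $\hat r$ is supported in $\{2^\ell a\le|\xi|\le2^\ell b\}$, so $r=\sum_{|i|\le M}\Delta_{\ell+i}r$ and $\Delta_{j'}r=0$ for $|j'-\ell|>M$. The left inequality then follows from the triangle inequality and $2^{j's}\|\Delta_{j'}r\|_{L^p_w}\le\|r\|_{\dot B^s_{p,q}(w)}$. For the right inequality, $\varphi_{\ell+i}*\psi_{\ell,k}=(\varphi_i*\psi)_{\ell,k}$, so $\Delta_{\ell+i}r$ is a single-scale sum with the Schwartz generator $\varphi_i*\psi$ and (b) applies; finally $\|r\|_{\dot{B}^s_{p,q}(w)}\le2^{\ell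 s}C'_M\max_{|i|\le M}\|\Delta_{\ell+i}r\|_{L^p_w}$.
   Context: Conventions. $\hat f(\xi)=\int_{\mathbb{R}^n} f(x)e^{-2\pi i x\cdot\xi}dx$. $\mathcal{S}(\mathbb{R}^n)$ is the Schwartz space, $\mathcal{S}'(\mathbb{R}^n)$ the tempered distributions, $\mathcal{P}$ the polynomials. $|\cdot|$ is the Euclidean norm, $|\cdot|_\infty$ the maximum norm. $\langle f,g\rangle=\int f\,\overline{g}$. $1/p+1/p'=1$. For a function $h$, $h_{j,k}(x):=2^{jn/2}h(2^jx-k)$ for $j\in\mathbb{Z}$, $k\in\mathbb{Z}^n$. $Q_{j,k}:=2^{-j}(k+[0,1)^n)$, $w(E):=\int_E w$, $\|g\|_{L^p_w}:=(\int|g|^pw)^{1/p}$. Wavelet system. For a fixed integer $L\ge1$, generators $\psi^{(1)},\dots,\psi^{(L)}$ and dual generators $\tilde\psi^{(1)},\dots,\tilde\psi^{(L)}$ have Fourier transforms in $C_c^\infty(\mathbb{R}^n)$ supported in $\{a\le|\xi|\le b\}$ for fixed $0<a<b$ (band-limited). Each of the systems $\{\psi^{(\epsilon)}_{j,k}\}$, $\{\tilde\psi^{(\epsilon)}_{j,k}\}$ ($1\le\epsilon\le L$, $j\in\mathbb{Z}$, $k\in\mathbb{Z}^n$) is a Riesz basis of $L^2(\mathbb{R}^n)$: its closed linear span is $L^2$ and, for the first system, $A\sum|c^{(\epsilon)}_{j,k}|^2\le\|\sum c^{(\epsilon)}_{j,k}\psi^{(\epsilon)}_{j,k}\|_{L^2}^2\le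 B\sum|c^{(\epsilon)}_{j,k}|^2$ for finitely supported coefficients (Riesz bounds $A,B>0$), similarly for the dual system; $\langle\psi^{(\epsilon)}_{j,k},\tilde\psi^{(\epsilon')}_{j',k'}\rangle=\delta_{\epsilon,\epsilon'}\delta_{j,j'}\delta_{k,k'}$; and every $f\in L^2$ satisfies $f=\sum_{\epsilon,j,k}\langle f,\tilde\psi^{(\epsilon)}_{j,k}\rangle\psi^{(\epsilon)}_{j,k}$ in $L^2$. Weights. A weight is a locally integrable, a.e. positive function on $\mathbb{R}^n$; $w\in A_p$ iff $[w]_{A_p}:=\sup_Q(\frac1{|Q|}\int_Qw)(\frac1{|Q|}\int_Qw^{-1/(p-1)})^{p-1}<\infty$, the supremum being over cubes with sides parallel to the axes. Decay quantities. $|\psi|_{M^\tau}:=\sup_x(1+|x|)^{2n+\tau}|\psi(x)|$, and $\psi\in M^\tau$ iff this is finite; $|\tilde\psi|_{\mathcal{D}_\sigma}:=\int(1+|x|^\sigma)|\tilde\psi(x)|dx$, and $\tilde\psi\in\mathcal{D}_\sigma$ iff this is finite; $\mathrm{L}_\sigma(\tilde\psi):=\sup_x(1+|x|)^\sigma|\tilde\psi(x)|$, which is finite under the hypotheses. A constant depending on the decay parameter $\tau$ depends on $\tau$ and $|\psi|_{M^\tau}$; a constant depending on the decay parameter $\sigma$ depends on $\sigma$, $|\tilde\psi|_{\mathcal{D}_\sigma}$ and the radii $a,b$ (in both cases with the maximum over the generator label $\epsilon$). For a function $h$, its decay envelope is $\beta_0(h):=\sup|h|$, $\beta_m(h):=\sup\{|h(z)|:|z|_\infty\ge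 m-1\}$ for $m\ge1$, and $$K_U(h):=\sum_{i\ge0}(\beta_i(h)-\beta_{i+1}(h))(2i+1)^{n+n/p'},\qquad K_L(h):=\sum_{i\ge0}(\beta_i(h)-\beta_{i+1}(h))(2i+1)^{n+n/p}.$$ Littlewood–Paley operators and Besov space. Fix $\varphi\in\mathcal{S}(\mathbb{R}^n)$ with $\hat\varphi$ real-valued, radial, supported in $\{c_1\le|\xi|\le c_2\}$ for fixed $0<c_1<c_2$, and $\sum_{j\in\mathbb{Z}}\hat\varphi(2^{-j}\xi)=1$ for $\xi\ne0$. Put $\varphi_j(x):=2^{jn}\varphi(2^jx)$ and $\Delta_jf:=\varphi_j*f$. For $s>0$, $0<q<\infty$, $\dot B^s_{p,q}(w)$ consists of all $f\in\mathcal{S}'(\mathbb{R}^n)/\mathcal{P}$ with $\|f\|_{\dot B^s_{p,q}(w)}:=\bigl(\sum_{j\in\mathbb{Z}}2^{jsq}\|\Delta_jf\|_{L^p_w}^q\bigr)^{1/q}<\infty$. Finite-band constants. $$M:=\Bigl\lceil\max\Bigl\{\log_2\frac{b}{c_1},\log_2\frac{c_2}{a},0\Bigr\}\Bigr\rceil,\qquad C_M:=\sum_{|i|\le M}2^{is},\qquad C'_M:=\Bigl(\sum_{|i|\le M}2^{isq}\Bigr)^{1/q}.$$ *)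

(* Defs.v *)
From HB Require Import structures.
From mathcomp Require Import all_boot all_order all_algebra finmap.
From mathcomp Require Import all_classical all_reals all_analysis.
From mathcomp Require Import complex.

Set Implicit Arguments.
Unset Strict Implicit.
Unset Printing Implicit Defensive.
Import Order.TTheory GRing.Theory Num.Theory.
Import numFieldNormedType.Exports.
Local Open Scope classical_set_scope.
Local Open Scope ring_scope.

(* 'rV[R]_n carries the product (equivalently, Borel) sigma-algebra, generated
   by the coordinates. *)
Section measurable_rV.
Context {R : realType} (n : nat).

Definition coord_rV (i : 'I_n) (x : 'rV[R]_n) : measurableTypeR R := x ord0 i.

Let rV_set0 : g_sigma_preimage coord_rV set0.
Proof. exact: sigma_algebra0. Qed.

Let rV_setC A : g_sigma_preimage coord_rV A -> g_sigma_preimage coord_rV (~` A).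
Proof. exact: sigma_algebraC. Qed.

Let rV_bigcup (F : _^nat) : (forall i, g_sigma_preimage coord_rV (F i)) ->
  g_sigma_preimage coord_rV (\bigcup_i (F i)).
Proof. exact: sigma_algebra_bigcup. Qed.

HB.instance Definition _ :=
  @isMeasurable.Build (measure_tuple_display default_measure_display)
  'rV[R]_n (g_sigma_preimage coord_rV) rV_set0 rV_setC rV_bigcup.

End measurable_rV.

Lemma measurable_coord_rV {R : realType} (n : nat) (i : 'I_n) :
  measurable_fun [set: 'rV[R]_n] (coord_rV i).
Proof.
move=> _ Y mY; rewrite setTI; apply: sub_sigma_algebra => /=.
rewrite -bigcup_seq/=; exists i => /=; first by rewrite mem_index_enum.
by exists Y => //; rewrite setTI.
Qed.

Lemma measurable_fun_rV {R : realType} (n : nat) d (S : measurableType d)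
    (f : S -> 'rV[R]_n) :
  (forall i, measurable_fun [set: S] (coord_rV i \o f)) ->
  measurable_fun [set: S] f.
Proof.
move=> mf.
suff : g_sigma_preimage (fun i => coord_rV i \o f) `<=` measurable.
  rewrite g_sigma_preimage_comp => prefS.
  by move=> _ A mA; apply: prefS; exists A.
apply: smallest_sub; first exact: sigma_algebra_measurable.
case: n f mf => [|m] f mf; first by rewrite big_ord0.
rewrite -bigcup_mkord_ord; apply: bigcup_sub => i Ii.
by move=> A [B mB <-]; exact: mf.
Qed.

Definition cons_rV {R : realType} (n : nat) (xv : measurableTypeR R * 'rV[R]_n) :
  'rV[R]_n.+1 := \row_i oapp (xv.2 ord0) xv.1 (unlift ord0 i).

Definition uncons_rV {R : realType} (n : nat) (x : 'rV[R]_n.+1) :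
  measurableTypeR R * 'rV[R]_n := (x ord0 ord0, \row_j x ord0 (lift ord0 j)).

Lemma cons_rVK {R : realType} (n : nat) : cancel (@cons_rV R n) (@uncons_rV R n).
Proof.
move=> [x v]; rewrite /uncons_rV mxE unlift_none; congr pair.
by apply/rowP => j; rewrite !mxE liftK.
Qed.

Lemma measurable_cons_rV {R : realType} (n : nat) :
  measurable_fun setT (@cons_rV R n).
Proof.
apply: measurable_fun_rV => i; have [j ij|i0] := unliftP ord0 i.
- rewrite (_ : _ \o _ = coord_rV j \o snd); last first.
    by apply/funext => xv; rewrite /= /coord_rV mxE ij liftK.
  exact: (measurableT_comp (measurable_coord_rV j) measurable_snd).
- rewrite (_ : _ \o _ = fst); first exact: measurable_fst.
  by apply/funext => xv; rewrite /= /coord_rV mxE i0 unlift_none.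
Qed.

Lemma measurable_uncons_rV {R : realType} (n : nat) :
  measurable_fun setT (@uncons_rV R n).
Proof.
apply: measurable_fun_pair; first exact: (measurable_coord_rV ord0).
apply: measurable_fun_rV => j.
rewrite (_ : _ \o _ = coord_rV (lift ord0 j)); first exact: measurable_coord_rV.
by apply/funext => x; rewrite /= /coord_rV mxE.
Qed.

Section lebesgue_rVS.
Context {R : realType} (n : nat).
Variable mu : {sigma_finite_measure set 'rV[R]_n -> \bar R}.

Definition lebesgue_rVS : set 'rV[R]_n.+1 -> \bar R :=
  pushforward (lebesgue_measure \x mu)%E (@cons_rV R n).

Let mcons := @measurable_cons_rV R n.

Let lebesgue_rVS0 : lebesgue_rVS set0 = 0%E.
Proof. exact: measure0. Qed.

Let lebesgue_rVS_ge0 A : (0 <= lebesgue_rVS A)%E.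
Proof. exact: measure_ge0. Qed.

Let lebesgue_rVS_sigma_additive : semi_sigma_additive lebesgue_rVS.
Proof. exact: measure_semi_sigma_additive. Qed.

HB.instance Definition _ := isMeasure.Build _ _ _ lebesgue_rVS
  lebesgue_rVS0 lebesgue_rVS_ge0 lebesgue_rVS_sigma_additive.

Let lebesgue_rVS_sigma_finite : sigma_finite setT lebesgue_rVS.
Proof.
have /sigma_finiteP[F [TF ndF Foo]] :=
  sigma_finiteT (lebesgue_measure : set (measurableTypeR R) -> \bar R).
have /sigma_finiteP[G [TG ndG Goo]] := sigma_finiteT mu.
exists (fun k => @uncons_rV R n @^-1` (F k `*` G k)) => [|k].
  rewrite predeqE => x; split=> // _.
  have [i _ Fi] : (\bigcup_i F i) (uncons_rV x).1 by rewrite -TF.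
  have [j _ Gj] : (\bigcup_i G i) (uncons_rV x).2 by rewrite -TG.
  exists (maxn i j) => //; split.
  - by move: Fi; exact/subsetPset/ndF/leq_maxl.
  - by move: Gj; exact/subsetPset/ndG/leq_maxr.
have [mF Fk] := Foo k; have [mG Gk] := Goo k; split.
  by rewrite -[X in measurable X]setTI; apply: measurable_uncons_rV => //;
     exact: measurableX.
rewrite /lebesgue_rVS /pushforward -comp_preimage.
rewrite (_ : _ \o _ = id); last by apply/funext => x; exact: cons_rVK.
by rewrite preimage_id product_measure1E// lte_mul_pinfty// ge0_fin_numE.
Qed.

HB.instance Definition _ := Measure_isSigmaFinite.Build _ _ _ lebesgue_rVS
  lebesgue_rVS_sigma_finite.

End lebesgue_rVS.

Section lebesgue_rV.
Context {R : realType}.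

Let sigma_finite_rV0 : sigma_finite setT (\d_(0 : 'rV[R]_0) : set _ -> \bar R).
Proof.
by apply: fin_num_fun_sigma_finite; [rewrite measure0|exact: fin_num_measure].
Qed.

Fixpoint lebesgue_rV (n : nat) : {sigma_finite_measure set 'rV[R]_n -> \bar R} :=
  match n with
  | 0 => \d_(0 : 'rV[R]_0)
  | m.+1 => lebesgue_rVS (lebesgue_rV m)
  end.
End lebesgue_rV.

Lemma lebesgue_rV_box {R : realType} (n : nat) (A : 'I_n -> set R) :
  (forall i, measurable (A i)) ->
  lebesgue_rV n [set x : 'rV[R]_n | forall i, A i (x ord0 i)] =
  (\prod_(i < n) lebesgue_measure (A i))%E.
Proof.
elim: n A => [|n IHn] A mA.
  rewrite big_ord0 /= diracE.
  by rewrite mem_set//= => -[i ilt0].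
rewrite big_ord_recl -IHn; last by move=> i; exact: mA.
rewrite /= /lebesgue_rVS /pushforward.
rewrite -product_measure1E//; first last.
- rewrite (_ : [set _ | _] =
    \bigcap_(i in [set: 'I_n]) (coord_rV i @^-1` A (lift ord0 i))); last first.
    by apply/seteqP; split=> x /= h; [move=> i _; exact: h|move=> i; exact: (h i)].
  apply: fin_bigcap_measurable => // i _.
  rewrite -[X in measurable X]setTI; apply: measurable_coord_rV => //.
  exact: mA.
- exact: mA.
rewrite (_ : _ @^-1` _ = A ord0 `*`
  [set x : 'rV[R]_n | forall i, A (lift ord0 i) (x ord0 i)])//.
apply/seteqP; split=> -[x v] /= h.
- split=> [|i]; first by have := h ord0; rewrite mxE unlift_none.
  by have := h (lift ord0 i); rewrite mxE liftK.
- move=> i; rewrite mxE; case: unliftP => [j ->|->] /=; first exact: h.2.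
  exact: h.1.
Qed.

Local Open Scope complex_scope.
Notation normc := Normc.normc.

Section euclidean.
Context {R : realType} {n : nat}.
Implicit Types (x y : 'rV[R]_n).

Definition dotp x y : R := \sum_(i < n) x ord0 i * y ord0 i.

(* The maximum norm is the library norm `|x| on 'rV[R]_n. *)
Definition enorm x : R := Num.sqrt (dotp x x).

Definition intv (k : 'rV[int]_n) : 'rV[R]_n := map_mx intr k.

End euclidean.

Section integration.
Context {R : realType} {n : nat}.
Implicit Types (f : 'rV[R]_n -> R) (g h : 'rV[R]_n -> R[i]).
Local Notation leb := (@lebesgue_rV R n).

(* Lebesgue (not only Borel) measurability. The library integral of a
   nonnegative function is the supremum of the integrals of the Borel simple
   functions below it, which on Lebesgue measurable functions is the Lebesgue
   integral. *)
Definition lmeasurable f : Prop :=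
  exists2 f' : 'rV[R]_n -> R,
    measurable_fun [set: 'rV[R]_n] f' & {ae leb, forall x, f x = f' x}.

Definition clmeasurable g : Prop :=
  lmeasurable (fun x => complex.Re (g x)) /\
  lmeasurable (fun x => complex.Im (g x)).

Definition cint g : R[i] :=
  (\int[leb]_x complex.Re (g x)) +i* (\int[leb]_x complex.Im (g x)).

Definition inner g h : R[i] := cint (fun x => g x * conjc (h x)).

Definition convolve g h : 'rV[R]_n -> R[i] :=
  fun x => cint (fun y => g (x - y) * h y).

Definition cis (t : R) : R[i] := cos t +i* sin t.

Definition fourier g : 'rV[R]_n -> R[i] :=
  fun xi => cint (fun x => g x * cis (- (2 * pi * dotp x xi))).

Definition L2sq g : \bar R := \int[leb]_x ((normc (g x)) ^+ 2)%:E.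

Definition in_L2 g : Prop := clmeasurable g /\ (L2sq g < +oo)%E.

End integration.

Section schwartz.
Context {R : realType} {n : nat}.
Implicit Types (f g h : 'rV[R]_n -> R[i]).

Definition cpartial (i : 'I_n) f : 'rV[R]_n -> R[i] :=
  fun x => 'D_(delta_mx ord0 i) (fun y => complex.Re (f y)) x +i*
           'D_(delta_mx ord0 i) (fun y => complex.Im (f y)) x.

Definition cpartials (s : seq 'I_n) f : 'rV[R]_n -> R[i] := foldr cpartial f s.

Definition smooth f : Prop := forall (s : seq 'I_n) (x : 'rV[R]_n),
  differentiable (fun y => complex.Re (cpartials s f y)) x /\
  differentiable (fun y => complex.Im (cpartials s f y)) x.

Definition schwartz_norm (N : nat) f : \bar R :=
  ereal_sup [set ((1 + enorm u.2) ^+ N * normc (cpartials u.1 f u.2))%:E |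
             u in [set u : seq 'I_n * 'rV[R]_n | (size u.1 <= N)%N]].

Definition schwartz f : Prop :=
  smooth f /\ forall N, (schwartz_norm N f < +oo)%E.

(* Only the values of T on Schwartz functions matter. *)
Definition tempered (T : ('rV[R]_n -> R[i]) -> R[i]) : Prop :=
  (forall (c : R[i]) g h, schwartz g -> schwartz h ->
     T (fun x => c * g x + h x) = c * T g + T h) /\
  exists (N : nat) (C : R), forall h, schwartz h ->
    ((normc (T h))%:E <= C%:E * schwartz_norm N h)%E.

Definition regular_dist g : ('rV[R]_n -> R[i]) -> R[i] :=
  fun h => cint (fun x => g x * h x).

End schwartz.

Section weights.
Context {R : realType} {n : nat}.
Implicit Types (w : 'rV[R]_n -> R) (g : 'rV[R]_n -> R[i]) (p : R).
Local Notation leb := (@lebesgue_rV R n).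

Definition wmass w (E : set 'rV[R]_n) : \bar R := \int[leb]_(x in E) (w x)%:E.

Definition weight w : Prop :=
  [/\ lmeasurable w,
      forall K : set 'rV[R]_n, compact K ->
        (\int[leb]_(x in K) `|w x|%:E < +oo)%E &
      {ae leb, forall x, 0 < w x}].

Definition cube (x : 'rV[R]_n) (l : R) : set 'rV[R]_n :=
  [set y | forall i, x ord0 i <= y ord0 i <= x ord0 i + l].

Definition mean (Q : set 'rV[R]_n) w : \bar R :=
  (((fine (leb Q))^-1)%:E * \int[leb]_(x in Q) (w x)%:E)%E.

Definition Ap_sup p w : \bar R :=
  ereal_sup [set (mean (cube u.1 u.2) w *
    mean (cube u.1 u.2) (fun x => (w x `^ (- (p - 1)^-1))%R) `^ (p - 1))%E |
    u in [set u : 'rV[R]_n * R | 0 < u.2]].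

Definition in_Ap p w : Prop := weight w /\ (Ap_sup p w < +oo)%E.

Definition Ap_const p w : R := fine (Ap_sup p w).

Definition Lpw_norm p w g : \bar R :=
  ((\int[leb]_x (normc (g x) `^ p * w x)%R%:E) `^ p^-1)%E.

Definition in_Lpw p w g : Prop := clmeasurable g /\ (Lpw_norm p w g < +oo)%E.

End weights.

Section wavelets.
Context {R : realType} {n : nat}.
Implicit Types (h : 'rV[R]_n -> R[i]) (j : int) (k : 'rV[int]_n).

Definition dilate h j k : 'rV[R]_n -> R[i] :=
  fun x => (2 `^ (j%:~R * n%:R / 2))%:C * h ((2 ^ j) *: x - intv k).

Definition dyadic j k : set 'rV[R]_n :=
  [set (2 ^ (- j)) *: (intv k + y) |
   y in [set y : 'rV[R]_n | forall i, 0 <= y ord0 i < 1]].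

Definition single_scale h j (Lam : {fset 'rV[int]_n}) (c : 'rV[int]_n -> R[i]) :
  'rV[R]_n -> R[i] := fun x => \sum_(k <- Lam) c k * dilate h j k x.

Definition coef_norm (p : R) (w : 'rV[R]_n -> R) j
    (Lam : {fset 'rV[int]_n}) (c : 'rV[int]_n -> R[i]) : \bar R :=
  ((\sum_(k <- Lam) (normc (c k) `^ p)%R%:E * wmass w (dyadic j k)) `^ p^-1)%E.

(* Among the functions with a given Fourier transform in C_c^oo, f is the
   continuous one. *)
Definition band_limited (a b : R) (f : 'rV[R]_n -> R[i]) : Prop :=
  [/\ continuous (fun x => complex.Re (f x)),
      continuous (fun x => complex.Im (f x)),
      (\int[lebesgue_rV n]_x (normc (f x))%:E < +oo)%E,
      smooth (fourier f) &
      forall xi, ~~ (a <= enorm xi <= b) -> fourier f xi = 0].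

Section system.
Context {L : nat}.
Implicit Types (psi : 'I_L -> 'rV[R]_n -> R[i]).

Local Notation wave_index := ('I_L * int * 'rV[int]_n)%type.

Definition wave psi (i : wave_index) : 'rV[R]_n -> R[i] :=
  dilate (psi i.1.1) i.1.2 i.2.

Definition wave_sum psi (F : {fset wave_index})
    (c : wave_index -> R[i]) : 'rV[R]_n -> R[i] :=
  fun x => \sum_(i <- F) c i * wave psi i x.

Definition riesz_basis (A B : R) psi : Prop :=
  [/\ 0 < A, 0 < B,
      forall (F : {fset wave_index}) (c : wave_index -> R[i]),
        let S := \sum_(i <- F) (normc (c i)) ^+ 2 in
        ((A * S)%:E <= L2sq (wave_sum psi F c) <= (B * S)%:E)%E &
      forall f, in_L2 f -> forall e : R, 0 < e ->
        exists (F : {fset wave_index}) c, (L2sq (fun x => (f x - wave_sum psi F c x)%R) < e%:E)%E].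

Record wavelet_system (a b A B : R) psi psit : Prop := WaveletSystem {
  ws_nonempty : (0 < L)%N ;
  ws_radii : 0 < a < b ;
  ws_primal : forall e, band_limited a b (psi e) ;
  ws_dual : forall e, band_limited a b (psit e) ;
  ws_riesz : riesz_basis A B psi ;
  ws_dual_riesz : exists A' B', riesz_basis A' B' psit ;
  ws_biorthogonal : forall i i',
    inner (wave psi i) (wave psit i') = (i == i')%:R ;
  ws_expansion : forall f, in_L2 f -> forall e : R, 0 < e ->
    exists F0 : {fset wave_index},
    forall F : {fset wave_index}, (F0 `<=` F)%fset ->
      (L2sq (fun x => (f x -
         wave_sum psi F (fun i => inner f (wave psit i)) x)%R) < e%:E)%E
}.

End system.

Definition M_norm (tau : R) h : \bar R :=
  ereal_sup (range (fun x : 'rV[R]_n =>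
    ((1 + enorm x) `^ (2 * n%:R + tau) * normc (h x))%:E)).

Definition D_norm (sigma : R) h : \bar R :=
  \int[lebesgue_rV n]_x ((1 + enorm x `^ sigma) * normc (h x))%:E.

Definition L_sup (sigma : R) h : \bar R :=
  ereal_sup (range (fun x : 'rV[R]_n =>
    ((1 + enorm x) `^ sigma * normc (h x))%:E)).

Definition envelope h (m : nat) : \bar R :=
  match m with
  | 0 => ereal_sup [set (normc (h z))%:E | z in [set: 'rV[R]_n]]
  | m'.+1 => ereal_sup [set (normc (h z))%:E |
                        z in [set z : 'rV[R]_n | m'%:R <= `|z|]]
  end.

(* Meant for bounded h, for which all the terms are nonnegative and finite. *)
Definition K_env (g : R) h : \bar R :=
  (\sum_(0 <= i <oo)
     (envelope h i - envelope h i.+1) * ((2 * i + 1)%:R `^ g)%R%:E)%E.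

End wavelets.

Section constants.
Context {R : realType}.
Implicit Types (n : nat) (p s q : R).

Definition conj_exp p : R := p / (p - 1).

Definition gamU n p : R := n%:R + n%:R / conj_exp p.

Definition gamL n p : R := n%:R + n%:R / p.

Definition K_U {n} p (h : 'rV[R]_n -> R[i]) : \bar R := K_env (gamU n p) h.

Definition K_L {n} p (h : 'rV[R]_n -> R[i]) : \bar R := K_env (gamL n p) h.

Definition zeta (t : R) : R := limn (series (fun m : nat => m.+1%:R `^ (- t))).

Definition zeta_factor (g t : R) : R := 1 + 2 * g * 3 `^ (g - 1) * zeta t.

Definition theta p : R := Num.max 1 (p - 1)^-1 / 2.

Definition log2 (x : R) : R := ln x / ln 2.

(* absz is harmless: the ceiling is nonnegative. *)
Definition band_width (a b c1 c2 : R) : nat :=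
  absz (Num.ceil (Num.max (Num.max (log2 (b / c1)) (log2 (c2 / a))) 0)).

(* The integers i with |i| <= M. *)
Definition zrange (M : nat) : seq int :=
  [seq i%:Z - M%:Z | i <- iota 0 (2 * M).+1].

Definition C_band (M : nat) s : R := \sum_(i <- zrange M) 2 `^ (i%:~R * s).

Definition C_band' (M : nat) s q : R :=
  (\sum_(i <- zrange M) 2 `^ (i%:~R * s * q)) `^ q^-1.

(* The generators with label e, under the decay hypotheses. *)
Definition wavelet_pair {n L} (a b A B : R) (psi psit : 'I_L -> 'rV[R]_n -> R[i])
    (e : 'I_L) (tau sigma : R) : Prop :=
  [/\ wavelet_system a b A B psi psit, 0 < tau, 2 * n%:R < sigma,
      (M_norm tau (psi e) < +oo)%E & (D_norm sigma (psit e) < +oo)%E].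

End constants.

Section besov.
Context {R : realType} {n : nat}.
Implicit Types (phi psi : 'rV[R]_n -> R[i]) (T : ('rV[R]_n -> R[i]) -> R[i]).

(* The sum over j is finitely supported. *)
Record lp_function (c1 c2 : R) phi : Prop := LPFunction {
  lp_radii : 0 < c1 < c2 ;
  lp_schwartz : schwartz phi ;
  lp_real : forall xi, complex.Im (fourier phi xi) = 0 ;
  lp_radial : forall xi eta, enorm xi = enorm eta ->
    fourier phi xi = fourier phi eta ;
  lp_support : forall xi, ~~ (c1 <= enorm xi <= c2) -> fourier phi xi = 0 ;
  lp_partition : forall xi, xi != 0 ->
    \sum_(j \in [set: int]) complex.Re (fourier phi ((2 ^ (- j)) *: xi)) = 1
}.

Definition lp_dilate phi (j : int) : 'rV[R]_n -> R[i] :=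
  fun x => (2 ^ (j * n%:Z))%:C * phi ((2 ^ j) *: x).

(* phi_j * T for a tempered distribution T; on regular_dist f it is
   convolve (lp_dilate phi j) f. *)
Definition lp_block phi (j : int) T : 'rV[R]_n -> R[i] :=
  fun x => T (fun y => lp_dilate phi j (x - y)).

(* Invariant under addition of a polynomial to T, since fourier phi vanishes
   near 0: it is a function of the class of T modulo polynomials. *)
Definition besov_norm phi (s p q : R) (w : 'rV[R]_n -> R) T : \bar R :=
  ((\esum_(j in [set: int])
      ((2 `^ (j%:~R * s * q))%R%:E * Lpw_norm p w (lp_block phi j T) `^ q))
   `^ q^-1)%E.

Definition in_besov phi (s p q : R) (w : 'rV[R]_n -> R) T : Prop :=
  tempered T /\ (besov_norm phi s p q w T < +oo)%E.

Definition K_eta (M : nat) (p : R) phi psi : \bar R :=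
  \big[maxe/0%E]_(i <- zrange M) K_U p (convolve (lp_dilate phi i) psi).

End besov.

(* Main.v *)
(** Write |h| as the layer cake of its decay envelope, a positive combination of indicators of
cubes of odd side 2 i + 1. On each of these cubes Hoelder's inequality and the A_p condition
compare the weighted mass with the one of the unit cube at the cost of (2 i + 1)^(n p) [w], and at
most (2 i + 1)^n translates overlap; the constant K_U is what is left after summation over i, and
the zeta bounds are an Abel summation. Convexity (Jensen) serves instead of Minkowski's inequality
throughout. The same computation in the dual exponent bounds the pairings with h, which is (c), and
by biorthogonality the coefficients of a single-scale sum, which is the lower half of (a).

The uniform constants require a pointwise bound of the dual generator by its weighted L^1 norm and
its spectral radius: a band-limited function is reproduced by convolution with a fixed kernel.
For (d), the blocks with |j' - l| > M vanish and the remaining ones add up to r because a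
continuous integrable function with integrable transform is determined by its transform. Only
inversion up to a multiplicative constant is needed, and it follows from an approximate identity
whose transform is an explicit compactly supported function (a convolution power of a tent), so
that no Gaussian integral has to be computed. *)

Require Import Defs.
From HB Require Import structures.
From mathcomp Require Import all_boot all_order all_algebra finmap.
From mathcomp Require Import all_classical all_reals all_analysis.
From mathcomp Require Import complex.
From mathcomp Require Import measurable_realfun ring lra zify.

Set Implicit Arguments.
Unset Strict Implicit.
Unset Printing Implicit Defensive.
Import Order.TTheory GRing.Theory Num.Theory.
Import numFieldNormedType.Exports.
Local Open Scope classical_set_scope.
Local Open Scope ring_scope.
Local Open Scope complex_scope.

(** * Measure and volume in R^n *)

(** Sharp constants shape the bookkeeping. Jensen's inequality over the shells uses the weights
    [denv h i * (2 i + 1)^gamma], whose total mass is K_U itself: its factor K_U^(p-1) and the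
    factor K_U left by the final summation make K_U^p, and the A_p constant enters each p-th power
    estimate linearly, so that the p-th root is exactly K_U [w]^(1/p). The dual side repeats this
    with gamma'. Measurability is the other constraint. Weights and elements of L^p_w are only
    Lebesgue measurable, and the single-scale estimate is stated for a generator of which only decay
    is known. Integrals of nonnegative functions are therefore compared as suprema over simple
    functions, which is monotone and blind to null sets, and Borel representatives are chosen before
    Fubini or a substitution is used. Derivatives of convolutions and dilations are found without
    interchanging limits: a uniform quadratic Taylor remainder survives integration and identifies
    the partial derivatives. *)

Section lower_integral.
Local Open Scope ereal_scope.
Context d (T : measurableType d) (R : realType).
Variable mu : {measure set T -> \bar R}.
Implicit Types f g : T -> \bar R.

Import HBNNSimple.

(** A simple function below f, multiplied by the indicator of the complement of the null set, is
    below g everywhere and keeps its integral. Hence no measurability of f or g enters the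
    comparison of the two suprema. *)
Lemma ae_ge0_le_lower_integral f g : {ae mu, forall x, f x <= g x} ->
  (forall x, 0 <= f x) -> (forall x, 0 <= g x) ->
  \int[mu]_x f x <= \int[mu]_x g x.
Proof.
move=> [N [mN N0 fgN]] f0 g0.
rewrite !ge0_integralTE//.
apply: ge_ereal_sup => _ [h /= hf <-].
apply: ereal_sup_ubound.
have iN x : measurable_realfun.mindic R (measurableC mN) x = \1_(~` N) x by [].
exists (indic_nnsfun R (measurableC mN) \* h)%R.
  move=> x /=; rewrite iN indicE.
  have [xN|xN] := pselect (N x).
    by rewrite memNset ?mul0r //=; exact/contrapT.
  rewrite mem_set //= mul1r (le_trans (hf x))//.
  by apply: contrapT => fgx; apply: xN; exact: fgN.
rewrite -!integralT_nnsfun.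
apply: ge0_ae_eq_integral => //.
- exact/measurable_EFinP.
- exact/measurable_EFinP.
- by move=> x _; rewrite lee_fin.
- by move=> x _; rewrite lee_fin.
- exists N; split => // x /= /not_implyP[_ hx]; apply: contrapT => xN; apply: hx.
  by rewrite iN indicE mem_set//= mul1r.
Qed.

Lemma ge0_le_lower_integral f g : (forall x, 0 <= f x) ->
  (forall x, f x <= g x) -> \int[mu]_x f x <= \int[mu]_x g x.
Proof.
move=> f0 fg; apply: ae_ge0_le_lower_integral => //.
- exact: aeW.
- by move=> x; exact: le_trans (fg x).
Qed.

(** Antisymmetry of the preceding comparison, on positive and negative parts. It is what allows
    weights and functions to be replaced by Borel representatives. *)
Lemma ae_eq_lower_integral (D : set T) f g : {ae mu, forall x, f x = g x} ->
  \int[mu]_(x in D) f x = \int[mu]_(x in D) g x.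
Proof.
move=> fg; rewrite integral_mkcond [RHS]integral_mkcond.
have {}fg : {ae mu, forall x, (f \_ D) x = (g \_ D) x}.
  by apply: filterS fg => x fgx; rewrite /patch; case: ifP.
rewrite integralE [RHS]integralE; congr (_ - _);
  apply/eqP; rewrite eq_le; apply/andP; split;
  apply: ae_ge0_le_lower_integral => //;
  by apply: filterS fg => x; rewrite ?funeposE ?funenegE => ->.
Qed.

End lower_integral.

Section rV_basics.
Context {R : realType} {n : nat}.
Implicit Types x y v : 'rV[R]_n.
Local Notation leb := (@lebesgue_rV R n).

Lemma normrV_ltP x (e : R) : 0 < e ->
  (forall i, `|x ord0 i| < e) <-> `|x| < e.
Proof.
move=> e0; have -> : `|x| = mx_norm x by [].
rewrite mx_normrE; split=> [h|/bigmax_ltP[_ h] i].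
  by apply/bigmax_ltP; split => // -[i j] _ /=; rewrite (ord1 i).
exact: (h (ord0, i)).
Qed.

Lemma normrV_leP x (e : R) : 0 <= e ->
  (forall i, `|x ord0 i| <= e) <-> `|x| <= e.
Proof.
move=> e0; have -> : `|x| = mx_norm x by [].
rewrite mx_normrE; split=> [h|/bigmax_leP[_ h] i].
  by apply/bigmax_leP; split => // -[i j] _ /=; rewrite (ord1 i).
exact: (h (ord0, i)).
Qed.

Lemma ler_normrV x i : `|x ord0 i| <= `|x|.
Proof. exact: (normrV_leP x (normr_ge0 x)).2. Qed.

Lemma measurable_boxrV (A : 'I_n -> set R) : (forall i, measurable (A i)) ->
  measurable [set x : 'rV[R]_n | forall i, A i (x ord0 i)].
Proof.
move=> mA.
rewrite (_ : [set _ | _] =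
    \bigcap_(i in [set: 'I_n]) (coord_rV i @^-1` A i)); last first.
  by apply/seteqP; split=> x /= h; [move=> i _; exact: h|move=> i; exact: (h i)].
apply: fin_bigcap_measurable => // i _.
by rewrite -[X in measurable X]setTI; apply: measurable_coord_rV => //; exact: mA.
Qed.

(** The sigma-algebra is generated by the coordinates, so open sets have to be written as countable
    unions of boxes: the open cubes with centre [k / (m + 1)] and half side [1 / (m + 1)] that are
    contained in U, enumerated by pickling the pairs [(k, m)]. *)
Lemma open_measurable_rV (U : set 'rV[R]_n) : open U -> measurable U.
Proof.
move=> oU.
pose B (km : 'rV[int]_n * nat) : set 'rV[R]_n :=
  [set y | forall i, (km.1 ord0 i)%:~R / km.2.+1%:R - km.2.+1%:R^-1 < y ord0 i
                     < (km.1 ord0 i)%:~R / km.2.+1%:R + km.2.+1%:R^-1].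
have mB km : measurable (B km).
  rewrite (_ : B km = [set x : 'rV[R]_n | forall i, `](km.1 ord0 i)%:~R / km.2.+1%:R - km.2.+1%:R^-1,
    (km.1 ord0 i)%:~R / km.2.+1%:R + km.2.+1%:R^-1[%classic (x ord0 i)]); last first.
    by apply/seteqP; split => x /= h i; have := h i; rewrite /= in_itv.
  apply: (@measurable_boxrV (fun i => `](km.1 ord0 i)%:~R / km.2.+1%:R - km.2.+1%:R^-1,
    (km.1 ord0 i)%:~R / km.2.+1%:R + km.2.+1%:R^-1[%classic)) => i; exact: measurable_itv.
rewrite (_ : U = \bigcup_(km in [set km | B km `<=` U]) B km).
  pose C (i : nat) := if choice.unpickle i is Some km then
    if pselect (B km `<=` U) then B km else set0 else set0.
  rewrite (_ : \bigcup_(km in _) _ = \bigcup_i C i).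
    apply: bigcupT_measurable => i; rewrite /C.
    case: (choice.unpickle i) => [km|]; last exact: measurable0.
    by case: pselect => _ /=; [exact: mB|exact: measurable0].
  apply/seteqP; split => [x [km kmU Bx]|x [i _]].
    exists (choice.pickle km) => //; rewrite /C choice.pickleK; case: pselect => // _; exact: kmU.
  rewrite /C; case: (choice.unpickle i) => // km; case: pselect => // kmU Bx.
  by exists km.
apply/seteqP; split => [x Ux|x [km /= + Bx]]; last exact.
move: oU; rewrite openE => /(_ x Ux); rewrite /interior.
move=> /nbhs_ballP[e /= e0 eU].
(* The cube has side [2 / (m + 1)], and this value of m makes the side smaller than e. *)
pose m := Num.truncn (2 / e).
have m1 : 0 < m.+1%:R :> R by rewrite ltr0n.
have me : 2 / m.+1%:R < e.
  rewrite ltr_pdivrMr// mulrC -ltr_pdivrMr//.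
  exact: (truncnS_gt (2 / e)).
exists (\row_i Num.floor (m.+1%:R * x ord0 i), m) => /=; last first.
  move=> i; rewrite mxE /=.
  have := floorD1_gt (m.+1%:R * x ord0 i); have := ge_floor (m.+1%:R * x ord0 i).
  set k := Num.floor _; rewrite intrD => h1 h2.
  have -> : k%:~R / m.+1%:R - m.+1%:R^-1 = (k%:~R - 1) / m.+1%:R :> R by rewrite mulrBl mul1r.
  have -> : k%:~R / m.+1%:R + m.+1%:R^-1 = (k%:~R + 1) / m.+1%:R :> R by rewrite mulrDl mul1r.
  rewrite ltr_pdivrMr// ltr_pdivlMr// mulrC.
  by apply/andP; split; lra.
move=> y By; apply: eU; rewrite mx_norm_ball /ball_ /=.
apply: le_lt_trans me; apply/normrV_leP; first by rewrite divr_ge0.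
move=> i; have := By i; rewrite !mxE /=.
have := floorD1_gt (m.+1%:R * x ord0 i); have := ge_floor (m.+1%:R * x ord0 i).
set k := Num.floor _; rewrite intrD => h1 h2.
  have -> : k%:~R / m.+1%:R - m.+1%:R^-1 = (k%:~R - 1) / m.+1%:R :> R by rewrite mulrBl mul1r.
  have -> : k%:~R / m.+1%:R + m.+1%:R^-1 = (k%:~R + 1) / m.+1%:R :> R by rewrite mulrDl mul1r.
rewrite ltr_pdivrMr// ltr_pdivlMr// => /andP[h3 h4].
rewrite ler_pdivlMr// -[X in _ * X]gtr0_norm// -normrM ler_norml.
by rewrite mulrBl; apply/andP; split; lra.
Qed.

Lemma continuous_measurable_rV (f : 'rV[R]_n -> R) : continuous f ->
  measurable_fun [set: 'rV[R]_n] f.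
Proof.
move=> cf; apply: (measurability _ (RGenOpens.measurableE R)) => //.
move=> _ [_ [a [b ->] <-]]; rewrite setTI; apply: open_measurable_rV.
by move/continuousP : cf; apply; exact: interval_open.
Qed.

End rV_basics.

(** * Affine changes of variables *)

Section affine.
Context {R : realType}.

(** The pushforward, scaled by [|s|], agrees with Lebesgue measure on half-open intervals, and
    uniqueness does the rest. *)
Lemma lebesgue_measure_affine (s v : R) (A : set R) : s != 0 -> measurable A ->
  (lebesgue_measure ((fun x : measurableTypeR R => s * x + v)%R @^-1` A) =
   `|s|^-1%:E * lebesgue_measure A)%E.
Proof.
move=> s0 mA.
have mf : measurable_fun [set: measurableTypeR R] (fun x : measurableTypeR R => s * x + v : measurableTypeR R)%R.
  apply: measurable_funD => //; exact: measurable_funM.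
pose m1 := pushforward (@lebesgue_measure R) (fun x : measurableTypeR R => s * x + v : measurableTypeR R)%R.
have sp : 0 <= `|s| by [].
pose m2 := mscale (NngNum sp) m1.
have : lebesgue_measure A = m2 mf A.
  apply: lebesgue_measure_unique => // _ [[a b]] _ <-.
  transitivity (`|s|%:E * lebesgue_measure
    ((fun x : measurableTypeR R => s * x + v)%R @^-1` `]a, b]%classic))%E; last by [].
  have [s_gt0|s_lt0|] := ltgtP 0 s; last by move/eqP; rewrite eq_sym (negPf s0).
  - rewrite (_ : _ @^-1` _ = `](a - v) / s, (b - v) / s]%classic); last first.
      apply/seteqP; split => x /=; rewrite !in_itv /= ltr_pdivrMr// ler_pdivlMr//;
        by rewrite mulrC ltrBlDr lerBrDr.
    rewrite !lebesgue_measure_itv/= !lte_fin ltr_pM2r ?invr_gt0// ltrD2r.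
    case: ifPn => _; last by rewrite mule0.
    rewrite -!EFinB -EFinM gtr0_norm//; congr _%:E.
    by field.
  - have s' : 0 < - s by rewrite oppr_gt0.
    (* A negative s exchanges the open and the closed end of the interval; the length is not
       affected. *)
    rewrite (_ : _ @^-1` _ = `[(b - v) / s, (a - v) / s[%classic); last first.
      apply/seteqP; split => x /=; rewrite !in_itv /= ler_ndivrMr// ltr_ndivlMr//;
        by rewrite mulrC ltrBlDr lerBrDr andbC.
    rewrite !lebesgue_measure_itv/= !lte_fin ltr_nM2r ?invr_lt0// ltrD2r.
    case: ifPn => _; last by rewrite mule0.
    rewrite -!EFinB -EFinM ltr0_norm//; congr _%:E.
    by field.
move=> ->; rewrite /m2 /mscale /= muleA -EFinM mulVf ?mul1e//.
by rewrite normr_eq0.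
Qed.

End affine.

Section affine_rV.
Context {R : realType} {n : nat}.
Local Notation leb := (@lebesgue_rV R n).

Lemma measurable_affine_rV (s : R) (v : 'rV[R]_n) :
  measurable_fun [set: 'rV[R]_n] (fun x : 'rV[R]_n => s *: x + v).
Proof.
apply: measurable_fun_rV => i.
rewrite (_ : _ \o _ = fun x => s * coord_rV i x + v ord0 i)%R; last first.
  by apply/funext => x; rewrite /= /coord_rV !mxE.
by apply: measurable_funD => //; apply: measurable_funM => //; exact: measurable_coord_rV.
Qed.

(** Uniqueness of measures on the boxes: they are stable under intersection, generate the
    sigma-algebra, and the cubes [g k], of finite measure, exhaust the space. On a box the claim is
    the one-dimensional one in each factor. *)
Lemma lebesgue_rV_affine (s : R) (v : 'rV[R]_n) (A : set 'rV[R]_n) :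
  s != 0 -> measurable A ->
  (leb ((fun x : 'rV[R]_n => s *: x + v)%R @^-1` A) =
   (`|s| ^- n)%:E * leb A)%E.
Proof.
move=> s0 mA.
pose f := (fun x : 'rV[R]_n => s *: x + v)%R.
have sp : 0 <= `|s| ^+ n by apply: exprn_ge0.
have sp0 : `|s| ^+ n != 0 by rewrite expf_neq0// normr_eq0.
pose m2 := mscale (NngNum sp) (pushforward leb f).
pose G := [set B : set 'rV[R]_n | exists2 A : 'I_n -> set R,
  (forall i, measurable (A i)) & B = [set x : 'rV[R]_n | forall i, A i (x ord0 i)]].
suff : leb A = m2 (measurable_affine_rV s v) A.
  move=> ->; rewrite /m2 /mscale/= /pushforward/= muleA -EFinM mulVf// mul1e.
  by [].
pose g (k : nat) := [set x : 'rV[R]_n | forall i, `[- k%:R, k%:R]%classic (x ord0 i)].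
have Gg k : G (g k) by exists (fun=> `[- k%:R, k%:R]%classic).
apply: (measure_unique G g) => //.
- apply/seteqP; split; last first.
    apply: smallest_sub; first exact: sigma_algebra_measurable.
    by move=> _ [B mB ->]; exact: measurable_boxrV.
  apply: smallest_sub; first exact: smallest_sigma_algebra.
  rewrite -bigcup_seq; apply: bigcup_sub => i _ _ [B mB <-].
  apply: sub_sigma_algebra; exists (fun j => if j == i then B else setT) => /=.
    by move=> j; case: ifP.
  rewrite setTI; apply/seteqP; split => x /= h.
    by move=> j; case: eqP => // ->.
  by have := h i; rewrite eqxx.
- move=> _ _ [B1 mB1 ->] [B2 mB2 ->]; exists (fun i => B1 i `&` B2 i).
    by move=> i; exact: measurableI.
  apply/seteqP; split => x /= h => [i|].
    by split; [exact: h.1|exact: h.2].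
  by split=> i; [exact: (h i).1|exact: (h i).2].
- apply/seteqP; split => // x _; exists (Num.truncn `|x|).+1 => //.
  move=> i; rewrite /= in_itv /= -ler_norml.
  by rewrite (le_trans (ler_normrV x i))// ltW// truncnS_gt.
- move=> _ [B mB ->]; apply: (etrans (lebesgue_rV_box mB)).
  transitivity ((`|s| ^+ n)%:E *
     leb (f @^-1` [set x : 'rV_n | forall i, B i (x ord0 i)]))%E; last by [].
  rewrite (_ : f @^-1` _ = [set x : 'rV_n | forall i,
     ((fun y : measurableTypeR R => s * y + v ord0 i)%R @^-1` B i) (x ord0 i)]); last first.
    by apply/seteqP; split => x /= h i; have := h i; rewrite !mxE.
  have mP i : measurable ((fun y : measurableTypeR R => s * y + v ord0 i)%R @^-1` B i).
    rewrite -[X in measurable X]setTI.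
    suff mf : measurable_fun [set: measurableTypeR R]
      (fun x : measurableTypeR R => s * x + v ord0 i : measurableTypeR R)%R by apply: mf => //; exact: mB.
    apply: measurable_funD => //; exact: measurable_funM.
  have -> := lebesgue_rV_box mP.
  under [in RHS]eq_bigr do rewrite lebesgue_measure_affine//.
  rewrite big_split /= prodEFin prodr_const card_ord muleA -EFinM.
  by rewrite -exprMn mulfV ?normr_eq0// expr1n mul1e.
- move=> k; suff : (leb (g k) < +oo)%E by [].
  have -> := lebesgue_rV_box (fun i : 'I_n => @measurable_itv R `[- k%:R, k%:R]).
  under eq_bigr do rewrite lebesgue_measure_itv/=.
  rewrite (eq_bigr (fun=> (if (- k%:R < k%:R :> R)%R then k%:R - (- k%:R) else 0)%:E)).
    by rewrite prodEFin ltry.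
  by move=> i _; rewrite lte_fin; case: ifP.
Qed.

Lemma ge0_integral_rV_affine (s : R) (v : 'rV[R]_n) (f : 'rV[R]_n -> \bar R) :
  s != 0 -> measurable_fun setT f -> (forall x, 0 <= f x)%E ->
  (\int[leb]_x f (s *: x + v)%R = (`|s| ^- n)%:E * \int[leb]_x f x)%E.
Proof.
move=> s0 mf f0.
have sp : 0 <= `|s| ^- n by rewrite invr_ge0 exprn_ge0.
have H := @ge0_integral_pushforward _ _ _ _ _ _ (measurable_affine_rV s v) leb setT f measurableT mf.
rewrite preimage_setT in H.
rewrite -[LHS]H//.
transitivity (\int[mscale (NngNum sp) leb]_x f x)%E.
  apply: eq_measure_integral; first exact: measurable_affine_rV.
  by move=> ? A mA _; exact: lebesgue_rV_affine.
by rewrite ge0_integral_mscale.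
Qed.

(** Integrability is not assumed: the positive and the negative part are substituted apart, and the
    infinite values of their difference are checked at the end. *)
Lemma integral_rV_affine (s : R) (v : 'rV[R]_n) (f : 'rV[R]_n -> R) :
  s != 0 -> measurable_fun setT f ->
  (\int[leb]_x (f (s *: x + v)%R)%:E = (`|s| ^- n)%:E * \int[leb]_x (f x)%:E)%E.
Proof.
move=> s0 mf; rewrite integralE [in RHS]integralE.
have mEf : measurable_fun setT (EFin \o f) by exact/measurable_EFinP.
have Hp := @ge0_integral_rV_affine s v (fun x => maxe (f x)%:E 0%E) s0.
have Hn := @ge0_integral_rV_affine s v (fun x => maxe (- (f x)%:E)%E 0%E) s0.
have -> : (\int[leb]_x ((fun x0 => (f (s *: x0 + v))%:E)^\+ x) =
  \int[leb]_x (maxe (f (s *: x + v)%R)%:E 0))%E.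
  by apply: eq_integral => x _; rewrite funeposE.
have -> : (\int[leb]_x ((fun x0 => (f (s *: x0 + v))%:E)^\- x) =
  \int[leb]_x (maxe (- (f (s *: x + v)%R)%:E) 0))%E.
  by apply: eq_integral => x _; rewrite funenegE.
have -> : (\int[leb]_x ((fun x0 => (f x0)%:E)^\+ x) =
  \int[leb]_x (maxe (f x)%:E 0))%E.
  by apply: eq_integral => x _; rewrite funeposE.
have -> : (\int[leb]_x ((fun x0 => (f x0)%:E)^\- x) =
  \int[leb]_x (maxe (- (f x)%:E) 0))%E.
  by apply: eq_integral => x _; rewrite funenegE.
rewrite Hp; first last.
- by move=> x; rewrite le_max lexx orbT.
- exact: measurable_maxe.
rewrite Hn; first last.
- by move=> x; rewrite le_max lexx orbT.
- by apply: measurable_maxe => //; exact: measurableT_comp.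
have c0 : 0 < `|s| ^- n by rewrite invr_gt0 exprn_gt0// normr_gt0.
move: (\int[leb]_x _)%E (\int[leb]_x _)%E => [a| |] [b| |] //=;
  by rewrite ?(gt0_muley, gt0_muleNy) ?lte_fin// -?EFinB -?EFinM ?mulrBr.
Qed.

Lemma Rintegral_rV_affine (s : R) (v : 'rV[R]_n) (f : 'rV[R]_n -> R) :
  s != 0 -> measurable_fun setT f ->
  \int[leb]_x (f (s *: x + v)) = `|s| ^- n * \int[leb]_x (f x).
Proof.
move=> s0 mf; rewrite /Rintegral integral_rV_affine//.
have c0 : 0 < `|s| ^- n by rewrite invr_gt0 exprn_gt0// normr_gt0.
(* The real value attached to an infinite integral is 0, so both sides vanish in that case. *)
by case: (\int[leb]_x _)%E => [a| |] //=;
  rewrite ?(gt0_muley, gt0_muleNy) ?lte_fin//= mulr0.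
Qed.

End affine_rV.

(** * Cubes, the maximum norm and the Euclidean norm *)

Section cubes.
Context {R : realType} {n : nat}.
Local Notation leb := (@lebesgue_rV R n).

Lemma cubeE (x : 'rV[R]_n) (l : R) :
  cube x l = [set y | forall i, `[x ord0 i, x ord0 i + l]%classic (y ord0 i)].
Proof. by apply/seteqP; split => y /= h i; have := h i; rewrite in_itv. Qed.

Lemma measurable_cube (x : 'rV[R]_n) (l : R) : measurable (cube x l).
Proof.
rewrite cubeE; apply: (@measurable_boxrV _ _ (fun i => `[x ord0 i, x ord0 i + l]%classic)) => i.
exact: measurable_itv.
Qed.

Lemma lebesgue_cube (x : 'rV[R]_n) (l : R) : 0 <= l -> leb (cube x l) = (l ^+ n)%:E.
Proof.
move=> l0; rewrite cubeE.
rewrite (@lebesgue_rV_box _ _ (fun i => `[x ord0 i, x ord0 i + l]%classic)); last first.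
  by move=> i; exact: measurable_itv.
transitivity (\prod_(i < n) l%:E)%E; last by rewrite prodEFin prodr_const card_ord.
apply: eq_bigr => i _; rewrite lebesgue_measure_itv/= lte_fin.
have [l1|l1] := ltP (x ord0 i) (x ord0 i + l).
  by rewrite -EFinD; congr _%:E; rewrite addrAC subrr add0r.
by congr _%:E; apply/eqP; rewrite eq_le l0/= -(lerD2l (x ord0 i)) addr0.
Qed.

Lemma cube_compact (x : 'rV[R]_n) (l : R) : compact (cube x l).
Proof.
rewrite cubeE.
apply: (@rV_compact R n (fun i => `[x ord0 i, x ord0 i + l]%classic)) => i.
exact: segment_compact.
Qed.

Lemma measurable_dyadic (j : int) (k : 'rV[int]_n) : measurable (@dyadic R n j k).
Proof.
have p0 : 0 < (2 : R) ^ j by rewrite exprz_gt0.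
rewrite (_ : dyadic j k = [set y | forall i,
  `[2 ^ (- j) * (k ord0 i)%:~R, 2 ^ (-j) * ((k ord0 i)%:~R + 1)[%classic (y ord0 i)]).
  apply: (@measurable_boxrV _ _ (fun i => `[2 ^ (- j) * (k ord0 i)%:~R, 2 ^ (-j) * ((k ord0 i)%:~R + 1)[%classic)) => i.
  exact: measurable_itv.
have q0 : 0 < (2 : R) ^ (- j) by rewrite exprz_gt0.
apply/seteqP; split => [_ [y Hy <-] i|y Hy].
  have := Hy i; rewrite /= !mxE /= in_itv/= => /andP[h1 h2].
  by rewrite ler_pM2l// ltr_pM2l// lerDl ltrD2l h1.
exists (2 ^ j *: y - intv k).
  move=> i; rewrite !mxE; have := Hy i; rewrite /= in_itv /= => /andP[].
  rewrite -(ler_pM2l p0) -(ltr_pM2l p0) !mulrA -!expfzDr// !subrr !expr0z !mul1r.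
  by move=> h1 h2; rewrite subr_ge0 h1/= ltrBlDl.
by rewrite addrC subrK scalerA -expfzDr// addNr expr0z scale1r.
Qed.

Lemma dyadicP (j : int) (k : 'rV[int]_n) (x : 'rV[R]_n) :
  dyadic j k x <-> forall i, 0 <= (2 ^ j *: x - intv k) ord0 i < 1.
Proof.
have q0 : (2 : R) != 0 by [].
split=> [[y Hy <-]|H].
  move=> i; have := Hy i; rewrite scalerA -expfzDr// subrr expr0z scale1r.
  by rewrite addrC addKr.
exists (2 ^ j *: x - intv k) => //.
by rewrite addrC subrK scalerA -expfzDr// addNr expr0z scale1r.
Qed.

Lemma measurable_normrV : measurable_fun [set: 'rV[R]_n] (fun x : 'rV[R]_n => `|x|).
Proof. by apply: continuous_measurable_rV => x; exact: norm_continuous. Qed.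

Lemma enorm_ge0 (x : 'rV[R]_n) : 0 <= enorm x.
Proof. exact: sqrtr_ge0. Qed.

Lemma dotp_ge0 (x : 'rV[R]_n) : 0 <= dotp x x.
Proof. by apply: sumr_ge0 => i _; rewrite -expr2 sqr_ge0. Qed.

Lemma ler_norm_enorm (x : 'rV[R]_n) : `|x| <= enorm x.
Proof.
apply/normrV_leP; first exact: enorm_ge0.
move=> i; rewrite -(ger0_norm (enorm_ge0 x)) -ler_sqr ?nnegrE//.
rewrite !real_normK ?num_real// sqr_sqrtr ?dotp_ge0//.
rewrite /dotp (bigD1 i)//= -expr2 lerDl.
by apply: sumr_ge0 => k _; rewrite -expr2 sqr_ge0.
Qed.

Lemma ler_enorm_norm (x : 'rV[R]_n) : enorm x <= n%:R * `|x|.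
Proof.
rewrite -(ger0_norm (enorm_ge0 x)) -[leRHS]ger0_norm ?mulr_ge0// -ler_sqr ?nnegrE//.
rewrite !real_normK ?num_real// sqr_sqrtr ?dotp_ge0//.
rewrite exprMn /dotp.
apply: (@le_trans _ _ (\sum_(i < n) `|x| ^+ 2)).
  apply: ler_sum => i _; rewrite -expr2 -[leLHS]real_normK ?num_real//.
  by rewrite ler_sqr ?nnegrE// ler_normrV.
rewrite sumr_const card_ord -[leLHS]mulr_natl ler_wpM2r ?sqr_ge0//.
by rewrite -natrX ler_nat; case: (n) => // m; rewrite expnS leq_pmulr.
Qed.

Lemma enormZ (s : R) (x : 'rV[R]_n) : enorm (s *: x) = `|s| * enorm x.
Proof.
rewrite /enorm -sqrtr_sqr -sqrtrM ?sqr_ge0//; congr Num.sqrt.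
rewrite /dotp mulr_sumr; apply: eq_bigr => i _; rewrite !mxE.
by rewrite expr2 mulrACA.
Qed.

Lemma dotpDl (x y z : 'rV[R]_n) : dotp (x + y) z = dotp x z + dotp y z.
Proof. by rewrite /dotp -big_split /=; apply: eq_bigr => i _; rewrite mxE mulrDl. Qed.

Lemma dotpZl (s : R) (x z : 'rV[R]_n) : dotp (s *: x) z = s * dotp x z.
Proof. by rewrite /dotp mulr_sumr; apply: eq_bigr => i _; rewrite mxE mulrA. Qed.

Lemma dotpC (x y : 'rV[R]_n) : dotp x y = dotp y x.
Proof. by apply: eq_bigr => i _; rewrite mulrC. Qed.

Lemma dotpDr (x y z : 'rV[R]_n) : dotp z (x + y) = dotp z x + dotp z y.
Proof. by rewrite dotpC dotpDl !(dotpC _ z). Qed.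

Lemma dotpZr (s : R) (x z : 'rV[R]_n) : dotp z (s *: x) = s * dotp z x.
Proof. by rewrite dotpC dotpZl dotpC. Qed.

(** Cauchy-Schwarz: for [dotp y y] nonzero, expand the nonnegative square of
    [x - (dotp x y / dotp y y) y]. *)
Lemma dotp_le (x y : 'rV[R]_n) : dotp x y <= enorm x * enorm y.
Proof.
have [y0|y0] := eqVneq (dotp y y) 0.
  have yz i : y ord0 i = 0.
    have /eqP := y0; rewrite psumr_eq0 => [/allP/(_ i)|k _]; last by rewrite -expr2 sqr_ge0.
    by rewrite mem_index_enum => /(_ isT); rewrite /= -expr2 sqrf_eq0 => /eqP.
  rewrite /enorm y0 sqrtr0 mulr0 /dotp big1// => i _.
  by rewrite yz mulr0.
have yp : 0 < dotp y y by rewrite lt_neqAle eq_sym y0 dotp_ge0.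
apply: (le_trans (ler_norm _)).
rewrite -[leRHS]ger0_norm ?mulr_ge0 ?enorm_ge0// -ler_sqr ?nnegrE//.
rewrite !real_normK ?num_real// exprMn !sqr_sqrtr ?dotp_ge0//.
have := dotp_ge0 (x + (- (dotp x y / dotp y y)) *: y).
rewrite dotpDl !dotpDr !dotpZl !dotpZr (dotpC y x).
set a := dotp x x; set b := dotp x y; set c := dotp y y in yp *.
move=> H; rewrite -subr_ge0.
have -> : a * c - b ^+ 2 = c * (a + - (b / c) * b + (- (b / c) * b + - (b / c) * (- (b / c) * c))).
  by field; rewrite gt_eqF.
by rewrite mulr_ge0// ltW.
Qed.

Lemma ler_enormD (x y : 'rV[R]_n) : enorm (x + y) <= enorm x + enorm y.
Proof.
rewrite -(ger0_norm (enorm_ge0 _)) -[leRHS]ger0_norm ?addr_ge0 ?enorm_ge0// -ler_sqr ?nnegrE//.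
rewrite !real_normK ?num_real// sqrrD !sqr_sqrtr ?dotp_ge0//.
rewrite dotpDl !dotpDr (dotpC y x) addrA lerD2r -addrA lerD2l -mulr2n.
by rewrite lerMn2r/= dotp_le.
Qed.

Lemma continuous_enorm : continuous (@enorm R n).
Proof.
move=> x; have Fx : Filter (nbhs x) by exact: nbhs_filter.
apply/(@cvgrPdist_le _ R^o _ _ Fx) => /= e e0.
have n1 : 0 < n%:R + 1 :> R by rewrite ltr_wpDl.
near=> y.
have H (u v : 'rV[R]_n) : enorm u - enorm v <= n%:R * `|u - v|.
  rewrite lerBlDr; apply: le_trans (lerD (ler_enorm_norm _) (lexx _)).
  by apply: le_trans (ler_enormD _ _); rewrite subrK.
apply: (@le_trans _ _ (n%:R * `|x - y|)).
  by rewrite ler_norml H lerNl opprB distrC H.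
apply: (@le_trans _ _ ((n%:R + 1) * (e / (n%:R + 1)))).
  rewrite ler_pM ?lerDl//; near: y.
  by apply: cvgr_dist_le => //; rewrite divr_gt0.
by rewrite mulrCA mulfV ?mulr1// gt_eqF.
Unshelve. all: by end_near. Qed.

End cubes.

(** * Jensen's inequality, zeta sums and the decay envelope *)

(** By convexity the graph of the p-th power lies above its tangent at a. This is Young's inequality
    for the numbers t and [a^(p-1)] with the exponents p and [p / (p - 1)]. *)
Lemma powR_tangent (R : realType) (p a t : R) : 1 < p -> 0 <= a -> 0 <= t ->
  a `^ p + p * a `^ (p - 1) * (t - a) <= t `^ p.
Proof.
move=> p1 a0 t0.
have p0 : 0 < p by apply: lt_trans p1.
have pm : 0 < p - 1 by rewrite subr_gt0.
have := @conjugate_powR R t (a `^ (p - 1)) p (p / (p - 1)) t0 (powR_ge0 _ _) p0.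
rewrite divr_gt0// => /(_ isT); rewrite -powRrM mulrCA mulfV ?gt_eqF// mulr1.
rewrite invf_div => H.
have {}H : t * a `^ (p - 1) <= t `^ p / p + a `^ p * ((p - 1) / p).
  by apply: H; field; rewrite gt_eqF.
have aE : a * a `^ (p - 1) = a `^ p by rewrite mulr_powRB1.
rewrite -(ler_pM2l p0) in H.
have E : p * (t `^ p / p + a `^ p * ((p - 1) / p)) = t `^ p + (p - 1) * a `^ p.
  by field; rewrite gt_eqF.
rewrite E in H; rewrite mulrBr -[X in _ - X]mulrA (mulrC _ a) aE.
by move: H; rewrite mulrCA (mulrC _ t) mulrA; lra.
Qed.

Section jensen.
Context {R : realType}.

(** The weights are not normalised, hence the factor [A^(p-1)]. The tangent inequality at the mean
    [m = B / A] is summed, and its linear terms cancel. *)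
Lemma jensen_sum (I : Type) (r : seq I) (a t : I -> R) (p : R) : 1 < p ->
  (forall i, 0 <= a i) -> (forall i, 0 <= t i) ->
  (\sum_(i <- r) a i * t i) `^ p <=
  (\sum_(i <- r) a i) `^ (p - 1) * \sum_(i <- r) a i * t i `^ p.
Proof.
move=> p1 a0 t0.
have p0 : 0 < p by apply: lt_trans p1.
have pm : 0 < p - 1 by rewrite subr_gt0.
set A := \sum_(i <- r) a i; set B := \sum_(i <- r) a i * t i.
have A0 : 0 <= A by apply: sumr_ge0.
have B0 : 0 <= B by apply: sumr_ge0 => i _; rewrite mulr_ge0.
have [A00|An0] := eqVneq A 0.
  have B00 : B = 0.
    rewrite /B; have : \sum_(i <- r) a i == 0 by apply/eqP.
    elim: r {A A0 A00 B B0} => [|i r IH]; rewrite ?big_nil// !big_cons.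
    rewrite paddr_eq0 ?sumr_ge0// => /andP[/eqP -> /IH ->].
    by rewrite mul0r addr0.
  rewrite B00 powR0 ?gt_eqF// mulr_ge0 ?powR_ge0//.
  by apply: sumr_ge0 => i _; rewrite mulr_ge0 ?powR_ge0.
have Ap : 0 < A by rewrite lt_neqAle eq_sym An0.
set m := B / A.
have m0 : 0 <= m by rewrite divr_ge0.
have BE : B = A * m by rewrite /m mulrCA mulfV ?mulr1.
have -> : B `^ p = A `^ (p - 1) * (A * m `^ p).
  by rewrite BE powRM// mulrA -(mulr_powRB1 A0 p0) (mulrC A).
rewrite ler_wpM2l ?powR_ge0//.
apply: (@le_trans _ _ (\sum_(i <- r) a i * (m `^ p + p * m `^ (p - 1) * (t i - m)))).
  under eq_bigr do rewrite mulrDr mulrCA mulrBr.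
  rewrite big_split/= -mulr_suml -mulr_sumr sumrB -mulr_suml -/A -/B.
  by rewrite BE subrr mulr0 addr0.
by apply: ler_sum => i _; rewrite ler_wpM2l// powR_tangent.
Qed.

Lemma jensen_series (a t : nat -> R) (S p : R) : 1 < p ->
  (forall i, 0 <= a i) -> (forall i, 0 <= t i) ->
  (forall N, \sum_(0 <= i < N) a i <= S) ->
  ((\sum_(0 <= i <oo) (a i * t i)%:E) `^ p <=
   (S `^ (p - 1))%R%:E * \sum_(0 <= i <oo) (a i * t i `^ p)%R%:E)%E.
Proof.
move=> p1 a0 t0 aS.
have p0 : 0 < p by apply: lt_trans p1.
have pm : 0 < p - 1 by rewrite subr_gt0.
set X := (_ * _)%E.
have S0 : 0 <= S by have := aS 0%N; rewrite big_geq.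
have X0 : (0 <= X)%E.
  by rewrite mule_ge0 ?lee_fin ?powR_ge0// nneseries_ge0// => i _ _; rewrite lee_fin mulr_ge0// powR_ge0.
(* After the p-th root the series stands alone on the left, and it suffices to bound its partial
   sums; no limit has to be taken through a power. *)
suff H : (\sum_(0 <= i <oo) (a i * t i)%:E <= X `^ p^-1)%E.
  apply: (@le_trans _ _ ((X `^ p^-1) `^ p)%E).
    apply: gt0_ler_poweR => //; first exact: ltW.
    - rewrite in_itv/= leey andbT nneseries_ge0// => i _ _; by rewrite lee_fin mulr_ge0.
    - by rewrite in_itv/= leey andbT poweR_ge0.
  by rewrite -poweRrM mulVf ?gt_eqF// poweRe1.
apply: lime_le; first by apply: is_cvg_nneseries => i _ _; rewrite lee_fin mulr_ge0.
near=> N.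
rewrite sumEFin.
have E : (((\sum_(0 <= i < N) a i * t i) `^ p)%R%:E <= X)%E.
  apply: (@le_trans _ _ ((S `^ (p - 1))%R%:E * \sum_(0 <= i < N) (a i * t i `^ p)%R%:E)%E).
    rewrite sumEFin -EFinM lee_fin (le_trans (jensen_sum _ p1 a0 t0))//.
    apply: ler_wpM2r; first by apply: sumr_ge0 => i _; rewrite mulr_ge0 ?powR_ge0.
    by apply: ge0_ler_powR; rewrite ?nnegrE ?(ltW pm)// sumr_ge0.
  rewrite lee_wpmul2l ?lee_fin ?powR_ge0//.
  by apply: nneseries_lim_ge => i _ _; rewrite lee_fin mulr_ge0 ?powR_ge0.
have -> : (\sum_(0 <= i < N) a i * t i)%:E = (((\sum_(0 <= i < N) a i * t i) `^ p)%R%:E `^ p^-1)%E.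
  rewrite poweR_EFin -powRrM mulfV ?gt_eqF// powRr1// sumr_ge0// => i _.
  by rewrite mulr_ge0.
apply: gt0_ler_poweR => //; first by rewrite invr_ge0 ltW.
- by rewrite in_itv/= lee_fin powR_ge0 leey.
- by rewrite in_itv/= X0 leey.
Unshelve. all: by end_near. Qed.

(** A discrete form of the comparison with the integral of [x^(-t)]. With [u = (m + 1) / (m + 2)]
    and [s = t - 1] it reduces to [1 + s (1 - u) <= u^(-s)], which follows from [1 + y <= exp y] at
    [y = - s ln u] and from [ln u <= u - 1]. *)
Lemma riemann_step (t : R) (m : nat) : 1 < t ->
  (t - 1) * (m.+2%:R `^ (- t)) <= m.+1%:R `^ (1 - t) - m.+2%:R `^ (1 - t).
Proof.
move=> t1; set s := t - 1.
have s0 : 0 < s by rewrite subr_gt0.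
have -> : 1 - t = - s by rewrite opprB.
have m2 : 0 < m.+2%:R :> R by rewrite ltr0n.
have m1 : 0 < m.+1%:R :> R by rewrite ltr0n.
set u := m.+1%:R / m.+2%:R :> R.
have u0 : 0 < u by rewrite divr_gt0.
have -> : m.+1%:R `^ (- s) = m.+2%:R `^ (- s) * u `^ (- s).
  by rewrite -powRM ?ltW// /u mulrCA mulfV ?mulr1// gt_eqF.
have -> : m.+2%:R `^ (- t) = m.+2%:R `^ (- s) * m.+2%:R^-1 :> R.
  rewrite -powR_inv1 ?ltW// -powRD; last by rewrite (gt_eqF m2) implybT.
  by congr (_ `^ _); rewrite /s; lra.
rewrite mulrCA -[X in _ <= _ - X]mulr1 -mulrBr ler_wpM2l ?powR_ge0//.
rewrite lerBrDr -lerBrDl.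
have u1 : 1 - u = m.+2%:R^-1.
  rewrite /u -[in m.+2%:R]addn1 natrD; set v := m.+1%:R.
  by field; rewrite gt_eqF// ltr_wpDl.
rewrite lerBrDl -u1 (le_trans _ (_ : 1 + - s * ln u <= _)) //; last first.
  by rewrite /powR gt_eqF// expR_ge1Dx.
rewrite addrC lerD2l mulNr -mulrN ler_wpM2l ?(ltW s0)//.
rewrite lerNr opprB.
have := @le_ln1Dx R (u - 1); rewrite [1 + _]addrC subrK; apply.
by rewrite ltrBrDl subrr.
Qed.

Lemma riemann_sum (t : R) (N : nat) : 1 < t ->
  \sum_(0 <= m < N) m.+1%:R `^ (- t) <= 1 + (t - 1)^-1.
Proof.
move=> t1; have s0 : 0 < t - 1 by rewrite subr_gt0.
case: N => [|N]; first by rewrite big_geq// addr_ge0// invr_ge0 ltW.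
rewrite big_nat_recl//= powR1 lerD2l.
have H : (t - 1) * \sum_(0 <= i < N) i.+2%:R `^ (- t) <= 1 - N.+1%:R `^ (1 - t).
  elim: N => [|N IH]; first by rewrite big_geq// mulr0 powR1 subrr.
  rewrite big_nat_recr//= mulrDr (le_trans (lerD IH (riemann_step N t1)))//.
  by rewrite addrA subrK.
rewrite -(ler_pM2l s0) mulfV ?gt_eqF//.
by rewrite (le_trans H)// gerBl powR_ge0.
Qed.

Lemma zeta_series_nd (t : R) : nondecreasing_seq (series (fun m : nat => m.+1%:R `^ (- t))).
Proof.
apply/nondecreasing_seqP => m; rewrite -subr_ge0 seriesSB.
exact: powR_ge0.
Qed.

Lemma zeta_series_cvg (t : R) : 1 < t ->
  cvgn (series (fun m : nat => m.+1%:R `^ (- t))).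
Proof.
move=> t1; apply: nondecreasing_is_cvgn; first exact: zeta_series_nd.
by exists (1 + (t - 1)^-1) => _ [N _ <-]; exact: riemann_sum.
Qed.

Lemma zeta_sum_le (t : R) (N : nat) : 1 < t ->
  \sum_(0 <= m < N) m.+1%:R `^ (- t) <= zeta t.
Proof.
by move=> t1; exact: (nondecreasing_cvgn_le (zeta_series_nd t) (zeta_series_cvg t1)).
Qed.

Lemma zeta_ge0 (t : R) : 1 < t -> 0 <= zeta t.
Proof. by move=> t1; have := zeta_sum_le 0 t1; rewrite big_geq. Qed.

Lemma zeta_factor_gt0 (g t : R) : 0 <= g -> 1 < t -> 0 < zeta_factor g t.
Proof.
move=> g0 t1; rewrite /zeta_factor ltr_wpDr//.
by rewrite !mulr_ge0 ?powR_ge0 ?zeta_ge0.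
Qed.

End jensen.

(** * The decay envelope, its layer cake and the zeta bounds *)

Section envelope.
Context {R : realType} {n : nat}.
Hypothesis n_gt0 : (0 < n)%N.
Implicit Types (h : 'rV[R]_n -> R[i]).

Definition decays h (C s : R) := forall z, normc (h z) <= C * (1 + enorm z) `^ (- s).

Lemma normc_ge0 (z : R[i]) : 0 <= normc z.
Proof. by case: z => a b; exact: sqrtr_ge0. Qed.

Lemma const_mx_norm (r : R) : 0 <= r -> `|const_mx r : 'rV[R]_n| = r.
Proof.
move=> r0; apply/eqP; rewrite eq_le; apply/andP; split.
  by apply/normrV_leP => // i; rewrite mxE ger0_norm.
by have := ler_normrV (const_mx r : 'rV[R]_n) (Ordinal n_gt0); rewrite mxE ger0_norm.
Qed.

Variables (h : 'rV[R]_n -> R[i]) (C s : R).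
Hypotheses (s_gt0 : 0 < s) (hC : decays h C s).

Lemma decays_ge0 : 0 <= C.
Proof.
have := hC 0; rewrite /enorm /dotp big1 => [|i _]; last by rewrite mxE mul0r.
by rewrite sqrtr0 addr0 powR1 mulr1; apply: le_trans; exact: normc_ge0.
Qed.

Let C0 := decays_ge0.

Lemma decays_shell (z : 'rV[R]_n) (m : nat) : m%:R <= `|z| -> normc (h z) <= C * m.+1%:R `^ (- s).
Proof.
move=> mz; apply: (le_trans (hC z)); rewrite ler_wpM2l// !powRN lef_pV2 ?posrE ?powR_gt0//; last first.
  by rewrite ltr_wpDr ?enorm_ge0.
apply: ge0_ler_powR; rewrite ?nnegrE ?(ltW s_gt0)//; first by rewrite addr_ge0 ?enorm_ge0.
by rewrite -natr1 addrC lerD2l (le_trans mz)// ler_norm_enorm.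
Qed.

Definition env (m : nat) : R := fine (envelope h m).

Lemma envelopeE (m : nat) : envelope h m = (env m)%:E.
Proof.
rewrite /env fineK//; case: m => [|m] /=; apply/fin_numPlt; apply/andP; split.
- by apply: (@lt_le_trans _ _ (normc (h 0))%:E); [exact: ltNyr|apply: ereal_sup_ubound; exists 0].
- apply: (@le_lt_trans _ _ C%:E); last exact: ltry.
  apply: ge_ereal_sup => _ [z _ <-]; rewrite lee_fin.
  have := @decays_shell z 0; rewrite powR1 mulr1; exact.
(* The constant row witnesses that the supremum is over a nonempty set. In dimension 0 the set would
   be empty for positive m, and the supremum -oo. *)
- apply: (@lt_le_trans _ _ (normc (h (const_mx m%:R)))%:E); first exact: ltNyr.
  by apply: ereal_sup_ubound; exists (const_mx m%:R) => //=; rewrite const_mx_norm.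
- apply: (@le_lt_trans _ _ (C * m.+1%:R `^ (- s))%:E); last exact: ltry.
  by apply: ge_ereal_sup => _ [z mz <-]; rewrite lee_fin; exact: decays_shell.
Qed.

Lemma env0_ge (z : 'rV[R]_n) : normc (h z) <= env 0.
Proof. by rewrite -lee_fin -envelopeE; apply: ereal_sup_ubound; exists z. Qed.

Lemma envS_ge (m : nat) (z : 'rV[R]_n) : m%:R <= `|z| -> normc (h z) <= env m.+1.
Proof. by move=> mz; rewrite -lee_fin -envelopeE; apply: ereal_sup_ubound; exists z. Qed.

Lemma env_ge0 (m : nat) : 0 <= env m.
Proof.
case: m => [|m]; first by rewrite (le_trans (normc_ge0 (h 0)))// env0_ge.
by rewrite (le_trans (normc_ge0 (h (const_mx m%:R))))// envS_ge// const_mx_norm.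
Qed.

Lemma env_noninc (m : nat) : env m.+1 <= env m.
Proof.
rewrite -lee_fin -[leLHS]envelopeE; apply: ge_ereal_sup => _ [z mz <-].
rewrite lee_fin; case: m mz => [|m] mz; first exact: env0_ge.
by apply: envS_ge; apply: le_trans mz; rewrite ler_nat.
Qed.

Lemma env0_le : env 0 <= C.
Proof.
rewrite -lee_fin -envelopeE; apply: ge_ereal_sup => _ [z _ <-]; rewrite lee_fin.
by have := @decays_shell z 0; rewrite powR1 mulr1; exact.
Qed.

Lemma envS_le (m : nat) : env m.+1 <= C * m.+1%:R `^ (- s).
Proof.
rewrite -lee_fin -[leLHS]envelopeE; apply: ge_ereal_sup => _ [z mz <-].
by rewrite lee_fin; exact: decays_shell.
Qed.

Definition denv (m : nat) : R := env m - env m.+1.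

Lemma denv_ge0 (m : nat) : 0 <= denv m.
Proof. by rewrite subr_ge0 env_noninc. Qed.

Lemma K_envE (g : R) : K_env g h =
  (\sum_(0 <= i <oo) (denv i * (2 * i + 1)%:R `^ g)%:E)%E.
Proof.
rewrite /K_env; apply: congr_lim; apply/funext => N; apply: eq_bigr => i _.
by rewrite !envelopeE.
Qed.

Lemma sum_denv (m N : nat) : (m <= N)%N ->
  \sum_(m <= i < N) denv i = env m - env N.
Proof. move=> mN; rewrite (@telescope_sumr_eq _ _ _ (fun i => - env i))// => [|i _].
  by rewrite opprK addrC.
by rewrite /denv opprK addrC. Qed.

Lemma env_small (e : R) : 0 < e -> exists N, forall m, (N <= m)%N -> env m <= e.
Proof.
(* This solves [C (N + 1)^(-s) <= e] for N. *)
move=> e0; set N := Num.truncn ((C / e) `^ s^-1).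
have nd : {homo env : m k / (m <= k)%N >-> k <= m}.
  by apply: homo_leq => [m|k l m /[swap]|]; [exact: lexx|exact: le_trans|exact: env_noninc].
exists N.+1 => m Nm; apply: (le_trans (nd _ _ Nm)); apply: (le_trans (envS_le N)).
have p1 : 0 < N.+1%:R `^ s :> R by rewrite powR_gt0.
rewrite powRN ler_pdivrMr// mulrC -ler_pdivrMr//.
have -> : C / e = ((C / e) `^ s^-1) `^ s.
  by rewrite -powRrM mulVf ?gt_eqF// powRr1// divr_ge0// ltW.
apply: ge0_ler_powR; rewrite ?nnegrE ?powR_ge0 ?ler0n ?(ltW s_gt0)//.
by rewrite ltW// truncnS_gt.
Qed.

(** The active shells are those with [i >= m + 1], where m is the integer part of the norm. Their
    increments telescope to [env (m + 1)], which dominates the value at z because it is the supremum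
    outside radius m. The tail of the telescope is removed by [env_small]. *)
Lemma layer_cake (z : 'rV[R]_n) : ((normc (h z))%:E <=
  \sum_(0 <= i <oo) (denv i * (`|z| < i%:R)%R%:R)%:E)%E.
Proof.
apply/lee_addgt0Pr => e e0.
have [N HN] := env_small e0.
pose m := Num.truncn `|z|.
pose K := maxn N m.+1.
apply: (@le_trans _ _ ((\sum_(0 <= i < K) denv i * (`|z| < i%:R)%R%:R) + env K)%:E).
  rewrite lee_fin (@big_cat_nat _ _ _ m.+1)/= ?leq_maxr//.
  rewrite [X in _ + X + _](eq_big_nat _ _ (F2 := denv)); last first.
    move=> i /andP[mi _]; rewrite (_ : _ < _) ?mulr1//.
    by rewrite (lt_le_trans (truncnS_gt _))// ler_nat.
  rewrite sum_denv ?leq_maxr// -addrA subrK.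
  apply: (@le_trans _ _ (env m.+1)).
    by apply: envS_ge; rewrite /m truncn_le.
  by rewrite lerDr sumr_ge0// => i _; rewrite mulr_ge0// denv_ge0.
rewrite EFinD leeD//; last by rewrite lee_fin HN// leq_maxl.
rewrite -sumEFin; apply: nneseries_lim_ge => i _ _.
by rewrite lee_fin mulr_ge0// denv_ge0.
Qed.

Lemma abel_denv (A : nat -> R) (N : nat) : A 0%N = 1 ->
  \sum_(0 <= i < N.+1) denv i * A i =
  env 0 + \sum_(0 <= i < N) env i.+1 * (A i.+1 - A i) - env N.+1 * A N.
Proof.
move=> A0; elim: N => [|N IH].
  by rewrite big_nat1 big_geq// A0 !mulr1 addr0.
rewrite big_nat_recr//= IH [in RHS]big_nat_recr//= /denv.
by ring.
Qed.

(** The tangent of the g-th power at the larger point [2 i + 3] bounds the increment by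
    [2 g (2 i + 3)^(g-1)], and [2 i + 3 <= 3 (i + 1)]. This is the origin of the factor
    [2 g 3^(g-1)]. *)
Lemma pow_step (g : R) (i : nat) : 1 < g ->
  (2 * i.+1 + 1)%:R `^ g - (2 * i + 1)%:R `^ g <= 2 * g * 3 `^ (g - 1) * i.+1%:R `^ (g - 1) :> R.
Proof.
move=> g1; have g0 : 0 < g by apply: lt_trans g1.
have := @powR_tangent R g (2 * i.+1 + 1)%:R (2 * i + 1)%:R g1 (ler0n _ _) (ler0n _ _).
have -> : (2 * i + 1)%:R - (2 * i.+1 + 1)%:R = - 2 :> R.
  by rewrite !natrD !natrM -[in i.+1%:R]addn1 natrD; lra.
move=> H.
have H2 : (2 * i.+1 + 1)%:R `^ (g - 1) <= 3 `^ (g - 1) * i.+1%:R `^ (g - 1) :> R.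
  rewrite -powRM//; apply: ge0_ler_powR; rewrite ?nnegrE//; first by rewrite subr_ge0 ltW.
  by rewrite -natrM ler_nat; lia.
have : g * (2 * i.+1 + 1)%:R `^ (g - 1) <= g * (3 `^ (g - 1) * i.+1%:R `^ (g - 1)) :> R.
  by rewrite ler_wpM2l// ltW.
set a := (_ `^ g) in H *; set b := (_ `^ g) in H *.
set c := _ `^ (g - 1) in H H2 *; set d := _ * _ `^ (g - 1) in H2 *.
rewrite -!mulrA -/d.
move: H; lra.
Qed.

(** In the Abel sum the term [env 0] gives the 1 of [zeta_factor], the increments of [(2 i + 1)^g]
    against [C (i + 1)^(-s)] give the zeta series with exponent [1 + s - g], and the boundary term
    has the favourable sign. *)
Lemma K_env_partial (g : R) (N : nat) : 1 < g -> g < s ->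
  \sum_(0 <= i < N) denv i * (2 * i + 1)%:R `^ g <= C * zeta_factor g (1 + s - g).
Proof.
move=> g1 gs; have g0 : 0 < g by apply: lt_trans g1.
have t1 : 1 < 1 + s - g by rewrite -addrA ltrDl subr_gt0.
case: N => [|N].
  by rewrite big_geq// mulr_ge0// ltW// zeta_factor_gt0// ltW.
rewrite (@abel_denv (fun i => (2 * i + 1)%:R `^ g)) ?muln0 ?powR1//.
apply: (@le_trans _ _ (C + \sum_(0 <= i < N) C * (2 * g * 3 `^ (g - 1)) * i.+1%:R `^ (- (1 + s - g)))).
  rewrite -[leRHS]subr0 lerD//; last first.
    by rewrite lerN2 mulr_ge0 ?env_ge0 ?powR_ge0.
  rewrite lerD ?env0_le//; apply: ler_sum_nat => i _.
  apply: (@le_trans _ _ (C * i.+1%:R `^ (- s) * (2 * g * 3 `^ (g - 1) * i.+1%:R `^ (g - 1)))).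
    rewrite ler_pM ?env_ge0 ?envS_le ?pow_step// subr_ge0.
    by apply: ge0_ler_powR; rewrite ?nnegrE ?ler0n ?(ltW g0)// ler_nat; lia.
  have -> : - (1 + s - g) = - s + (g - 1) by lra.
  rewrite (@powRD _ i.+1%:R (- s)); last by rewrite pnatr_eq0/= implybT.
  by rewrite [leLHS]mulrACA.
rewrite -mulr_sumr /zeta_factor mulrDr mulr1 -!mulrA lerD2l.
rewrite !ler_wpM2l ?powR_ge0 ?(ltW g0)//.
exact: zeta_sum_le.
Qed.

Lemma K_env_le (g : R) : 1 < g -> g < s ->
  (K_env g h <= (C * zeta_factor g (1 + s - g))%:E)%E.
Proof.
move=> g1 gs; rewrite K_envE; apply: lime_le.
  by apply: is_cvg_nneseries => i _ _; rewrite lee_fin mulr_ge0 ?denv_ge0 ?powR_ge0.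
by apply: nearW => N; rewrite sumEFin lee_fin; exact: K_env_partial.
Qed.

Lemma K_env_ge0 (g : R) : (0 <= K_env g h)%E.
Proof.
by rewrite K_envE nneseries_ge0// => i _ _; rewrite lee_fin mulr_ge0 ?denv_ge0 ?powR_ge0.
Qed.

Lemma K_env_fin (g : R) : 1 < g -> g < s -> K_env g h = (fine (K_env g h))%:E.
Proof.
move=> g1 gs; rewrite fineK// ge0_fin_numE ?K_env_ge0//.
by rewrite (le_lt_trans (K_env_le g1 gs))// ltry.
Qed.

Lemma K_env_sum_le (g : R) (N : nat) : 1 < g -> g < s ->
  \sum_(0 <= i < N) denv i * (2 * i + 1)%:R `^ g <= fine (K_env g h).
Proof.
move=> g1 gs; rewrite -lee_fin -K_env_fin// K_envE -sumEFin.
by apply: nneseries_lim_ge => i _ _; rewrite lee_fin mulr_ge0 ?denv_ge0 ?powR_ge0.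
Qed.

End envelope.

Section overlap.
Context {R : realType} {n : nat}.

(** For each such k the integers [k_l - floor y_l + i] lie between 0 and [2 i], so that k is encoded
    injectively by n numbers with [2 i + 1] possible values. *)
Lemma overlap_count (Lam : {fset 'rV[int]_n}) (y : 'rV[R]_n) (i : nat) :
  \sum_(k <- Lam) (`|y - intv k| < i%:R)%R%:R <= ((2 * i + 1) ^ n)%:R :> R.
Proof.
pose P (k : 'rV[int]_n) := `|y - intv k| < i%:R.
have -> : \sum_(k <- Lam) (`|y - intv k| < i%:R)%R%:R = (size [seq k <- Lam | P k])%:R :> R.
  rewrite -sum1_size big_filter natr_sum [RHS]big_mkcond /=; apply: eq_bigr => k _.
  by rewrite /P; case: ifP.
rewrite ler_nat.
pose phi (k : 'rV[int]_n) : {ffun 'I_n -> 'I_(2 * i).+1} :=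
  [ffun l => inord (absz (k ord0 l - Num.floor (y ord0 l) + i%:Z))].
have range k l : P k -> 0 <= k ord0 l - Num.floor (y ord0 l) + i%:Z <= (2 * i)%:Z.
  move=> Pk; have i0 : 0 < i%:R :> R by apply: le_lt_trans Pk.
  move/(normrV_ltP _ i0)/(_ l) : Pk; rewrite !mxE ltr_norml => /andP[h1 h2].
  have := floorD1_gt (y ord0 l); have := ge_floor (y ord0 l).
  set f := Num.floor _; rewrite intrD => h3 h4.
  apply/andP; split.
    have : f%:~R - i%:R < (k ord0 l)%:~R :> R by lra.
    rewrite -[i%:R]/(i%:Z%:~R) -intrB ltr_int; lia.
  have : (k ord0 l)%:~R < f%:~R + 1 + i%:R :> R by lra.
  rewrite -[i%:R]/(i%:Z%:~R) -[1]/(1%:~R) -!intrD ltr_int; lia.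
have inj : {in [seq k <- Lam | P k] &, injective phi}.
  move=> k k'; rewrite !mem_filter => /andP[Pk _] /andP[Pk' _] /ffunP E.
  apply/rowP => l; have := E l; rewrite !ffunE => /(congr1 val) /=.
  have := range k l Pk; have := range k' l Pk'.
  rewrite -![inord _ : nat]/(nat_of_ord (inord _)).
  move=> r1 r2; rewrite !inordK; [|lia|lia].
  move: r1 r2 => /andP[r1 _] /andP[r2 _] E'.
  have : k ord0 l - Num.floor (y ord0 l) + i%:Z = k' ord0 l - Num.floor (y ord0 l) + i%:Z.
    by rewrite -(gez0_abs r2) E' (gez0_abs r1).
  by move/addIr/addIr.
rewrite -(size_map phi).
have U : uniq [seq phi k | k <- [seq k <- Lam | P k]].
  by rewrite map_inj_in_uniq// filter_uniq// fset_uniq.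
rewrite -(card_uniqP U) (leq_trans (max_card _))// card_ffun !card_ord.
by rewrite addn1.
Qed.

End overlap.

(** * A_p weights *)

Section weighted_hoelder.
Local Open Scope ereal_scope.
Context d (T : measurableType d) (R : realType).
Variable mu : {measure set T -> \bar R}.

(** Hoelder's inequality for the factors [f w^(1/p)] and [w^(-1/p)], with [q = p / (p - 1)], raised
    to the power p. The exponent of the dual weight is [- q / p], and the outer power is [p / q]. *)
Lemma weighted_hoelder (p : R) (D : set T) (f w : T -> R) : (1 < p)%R ->
  measurable D -> measurable_fun setT f -> measurable_fun setT w ->
  (forall x, 0 <= f x)%R -> (forall x, 0 < w x)%R ->
  (\int[mu]_(x in D) (f x)%:E) `^ p <=
  (\int[mu]_(x in D) (f x `^ p * w x)%R%:E) *
  (\int[mu]_(x in D) (w x `^ (- (p - 1)^-1))%R%:E) `^ (p - 1).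
Proof.
move=> p1 mD mf mw f0 w0.
have p0 : (0 < p)%R by apply: lt_trans p1.
have pm : (0 < p - 1)%R by rewrite subr_gt0.
have pn0 : (p != 0)%R by rewrite gt_eqF.
pose q := (p / (p - 1))%R.
have q0 : (0 < q)%R by rewrite divr_gt0.
pose F x := (f x * w x `^ p^-1 * \1_D x)%R.
pose G x := (w x `^ (- p^-1) * \1_D x)%R.
have mD1 : measurable_fun setT (\1_D : T -> R) by exact: measurable_indic.
have mwp r : measurable_fun setT (fun x => w x `^ r)%R.
  by apply: (measurableT_comp (measurable_powR r)).
have mF : measurable_fun setT F by do 2 apply: measurable_funM => //.
have mG : measurable_fun setT G by apply: measurable_funM.
have pq : (p^-1 + q^-1 = 1)%R by rewrite /q invf_div; field.
have H := @hoelder _ _ _ mu F G p q mF mG p0 q0 pq.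
have HL : 'N[mu]_1 [(EFin \o (F \* G)%R)] = \int[mu]_(x in D) (f x)%:E.
  rewrite Lnorm1 [RHS]integral_mkcond; apply: eq_integral => x _.
  rewrite /F /G /= epatch_indic /= !indicE; case: (x \in D); last first.
    by rewrite !mulr0 normr0 mule0.
  rewrite !mulr1 -mulrA -powRD; last by rewrite (gt_eqF (w0 x)) implybT.
  by rewrite subrr powRr0 mulr1 ger0_norm// mule1.
have HF : 'N[mu]_p%:E [EFin \o F] `^ p = \int[mu]_(x in D) (f x `^ p * w x)%R%:E.
  rewrite poweR_Lnorm// [RHS]integral_mkcond; apply: eq_integral => x _.
  rewrite /F /= epatch_indic /= !indicE; case: (x \in D).
    rewrite mulr1 mule1 ger0_norm ?mulr_ge0 ?powR_ge0// powRM ?powR_ge0//.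
    by rewrite -powRrM mulVf// powRr1// ltW.
  by rewrite !mulr0 normr0 powR0// mule0.
have HG : 'N[mu]_q%:E [EFin \o G] `^ p =
    (\int[mu]_(x in D) (w x `^ (- (p - 1)^-1))%R%:E) `^ (p - 1).
  have -> : p = (q * (p - 1))%R by rewrite /q mulrVK// unitfE gt_eqF.
  rewrite [in LHS]poweRrM poweR_Lnorm ?gt_eqF//.
  have -> : (q * (p - 1) - 1 = p - 1)%R by rewrite /q mulrVK// unitfE gt_eqF.
  congr (_ `^ _); rewrite [RHS]integral_mkcond; apply: eq_integral => x _.
  rewrite /G /= epatch_indic /= !indicE; case: (x \in D).
    rewrite mulr1 mule1 ger0_norm ?powR_ge0// -powRrM.
    have -> : (- p^-1 * q = - (p - 1)^-1)%R by rewrite /q; field; rewrite pn0 gt_eqF.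
    by [].
  by rewrite mulr0 normr0 powR0 ?mule0// gt_eqF.
rewrite HL in H.
rewrite -HF -HG -poweRM ?Lnorm_ge0//.
apply: gt0_ler_poweR => //; first exact: ltW.
- by rewrite in_itv/= leey andbT integral_ge0// => x _; rewrite lee_fin.
- by rewrite in_itv/= leey andbT mule_ge0 ?Lnorm_ge0.
Qed.

End weighted_hoelder.

Section ae_weights.
Context {R : realType} {n : nat}.
Local Notation leb := (@lebesgue_rV R n).
Implicit Types (w : 'rV[R]_n -> R) (g : 'rV[R]_n -> R[i]) (p : R).

(* A weight of class A_p agrees almost everywhere with such a function, and all the quantities of
   the theorem are lower integrals, which ignore null sets even without measurability. *)
Definition nice_weight p w := [/\ measurable_fun [set: 'rV[R]_n] w,
  forall x, 0 < w x,
  forall K : set 'rV[R]_n, compact K -> (\int[leb]_(x in K) (w x)%:E < +oo)%E &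
  (Ap_sup p w < +oo)%E].

Lemma ae_wmass w w' : {ae leb, forall x, w x = w' x} -> wmass w = wmass w'.
Proof.
move=> ww; apply/funext => E; apply: ae_eq_lower_integral.
by apply: filterS ww => x ->.
Qed.

Lemma ae_Lpw_norm p w w' : {ae leb, forall x, w x = w' x} -> Lpw_norm p w = Lpw_norm p w'.
Proof.
move=> ww; apply/funext => g; congr (_ `^ _)%E; apply: ae_eq_lower_integral.
by apply: filterS ww => x ->.
Qed.

Lemma ae_coef_norm p w w' : {ae leb, forall x, w x = w' x} -> @coef_norm R n p w = coef_norm p w'.
Proof. by move=> ww; rewrite /coef_norm (ae_wmass ww). Qed.

Lemma ae_mean Q w w' : {ae leb, forall x, w x = w' x} -> mean Q w = mean Q w'.
Proof.
move=> ww; rewrite /mean.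
have H : {ae leb, forall x, (w x)%:E = (w' x)%:E} by apply: filterS ww => x ->.
by rewrite (ae_eq_lower_integral Q H).
Qed.

Lemma ae_Ap_sup p w w' : {ae leb, forall x, w x = w' x} -> Ap_sup p w = Ap_sup p w'.
Proof.
move=> ww; rewrite /Ap_sup.
have H : {ae leb, forall x, w x `^ (- (p - 1)^-1) = w' x `^ (- (p - 1)^-1)}.
  by apply: filterS ww => x ->.
have E : (fun u : 'rV[R]_n * R => mean (cube u.1 u.2) w *
    mean (cube u.1 u.2) (fun x => (w x `^ (- (p - 1)^-1))%R) `^ (p - 1))%E =
  (fun u => mean (cube u.1 u.2) w' *
    mean (cube u.1 u.2) (fun x => (w' x `^ (- (p - 1)^-1))%R) `^ (p - 1))%E.
  by apply/funext => u; rewrite (ae_mean _ ww) (ae_mean _ H).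
exact: (congr1 (fun F => ereal_sup (image [set u : 'rV[R]_n * R | 0 < u.2] F)) E).
Qed.

Lemma nice_weight_exists p w : in_Ap p w ->
  exists2 w', nice_weight p w' & {ae leb, forall x, w x = w' x}.
Proof.
move=> [[[w1 mw1 ww1] wloc wpos] wA].
(* The Borel representative may fail to be positive on a null set; the value 1 there makes it
   positive everywhere. *)
pose w' x := if 0 < w1 x then w1 x else 1.
have ww' : {ae leb, forall x, w x = w' x}.
  apply: filterS2 ww1 wpos => x e wx; rewrite /w' -e.
  by rewrite wx.
exists w'; last exact: ww'.
split.
- rewrite /w'; apply: measurable_fun_ifT => //.
  by apply: measurable_fun_ltr.
- by move=> x; rewrite /w'; case: ifPn.
- move=> K cK; rewrite (le_lt_trans _ (wloc K cK))//.
  have H : {ae leb, forall x, (w' x)%:E = `|w x|%:E}.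
    by apply: filterS2 ww' wpos => x <- h; rewrite gtr0_norm.
  by rewrite (ae_eq_lower_integral K H).
- by rewrite -(ae_Ap_sup p ww').
Qed.

End ae_weights.

(** * The A_p inequality on cubes *)

Section Ap_estimates.
Context {R : realType} {n : nat}.
Local Notation leb := (@lebesgue_rV R n).
Hypothesis n_gt0 : (0 < n)%N.
Variables (p : R) (w : 'rV[R]_n -> R).
Hypotheses (p_gt1 : 1 < p) (wn : nice_weight p w).

Let mw : measurable_fun setT w. Proof. by case: wn. Qed.
Let w0 x : 0 < w x. Proof. by case: wn. Qed.
Let p0 : 0 < p. Proof. exact: lt_trans p_gt1. Qed.
Let pm : 0 < p - 1. Proof. by rewrite subr_gt0. Qed.

(** Hoelder's inequality with f = 1 bounds [|D|^p] by the weighted mass of D times a dual factor. If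
    the mass were 0, the product would be 0 even for an infinite dual factor. *)
Lemma wmass_gt0 (D : set 'rV[R]_n) : measurable D -> (0 < leb D)%E -> (0 < wmass w D)%E.
Proof.
move=> mD D0; rewrite lt_neqAle eq_sym; apply/andP; split; last first.
  by apply: integral_ge0 => x _; rewrite lee_fin ltW.
apply/eqP => E.
have := @weighted_hoelder _ _ _ leb p D (fun=> 1) w p_gt1 mD (measurable_cst _) mw
  (fun=> ler01) w0.
rewrite integral_cst// mul1e.
under eq_integral do rewrite powR1 mul1r.
rewrite -/(wmass w D) E mul0e leNgt; apply/negP/negPn.
exact: poweR_gt0.
Qed.

Lemma wmass_cube_lty x l : (wmass w (cube x l) < +oo)%E.
Proof. by case: wn => _ _ H _; apply: H; exact: cube_compact. Qed.

Lemma le_wmass (D E : set 'rV[R]_n) : measurable D -> measurable E -> D `<=` E ->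
  (wmass w D <= wmass w E)%E.
Proof.
move=> mD mE DE; apply: ge0_subset_integral => //.
- by apply/measurable_EFinP; exact: measurable_funTS.
- by move=> x _; rewrite lee_fin ltW.
Qed.

Lemma Ap_supE : Ap_sup p w = (Ap_const p w)%:E.
Proof.
rewrite /Ap_const fineK// ge0_fin_numE; first by case: wn.
pose u : 'rV[R]_n * R := (0, 1).
apply: le_trans (ereal_sup_ubound _); last by exists u => //=.
by rewrite mule_ge0// ?poweR_ge0// /mean mule_ge0// ?lee_fin ?invr_ge0 ?fine_ge0//
  integral_ge0// => x _; rewrite lee_fin ltW.
Qed.

(** Hoelder's inequality on the cube, multiplied by its weighted mass, leaves exactly the A_p
    product. The later estimates use the A_p constant only through this form: the indicator of a
    small cube gives doubling, a function cut to a shell gives the dual bound, and the constant 1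
    gives [1 <= [w]]. *)
Lemma Ap_ineq (x0 : 'rV[R]_n) (l : R) (f : 'rV[R]_n -> R) : 0 < l ->
  measurable_fun setT f -> (forall x, 0 <= f x) ->
  ((\int[leb]_(x in cube x0 l) (f x)%:E) `^ p * wmass w (cube x0 l) <=
   (Ap_const p w * (l ^+ n) `^ p)%R%:E *
   \int[leb]_(x in cube x0 l) (f x `^ p * w x)%R%:E)%E.
Proof.
move=> l0 mf f0; set Q := cube x0 l.
have mQ : measurable Q by exact: measurable_cube.
have ln0 : 0 < l ^+ n by rewrite exprn_gt0.
have lQ : leb Q = (l ^+ n)%:E by apply: lebesgue_cube; exact: ltW.
have wQ0 : (0 < wmass w Q)%E by apply: wmass_gt0 => //; rewrite lQ lte_fin.
have wQE : wmass w Q = (fine (wmass w Q))%:E.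
  by rewrite fineK// gt0_fin_numE// wmass_cube_lty.
have a0 : 0 < fine (wmass w Q) by rewrite -lte_fin -wQE.
set a := fine (wmass w Q) in wQE a0.
set B := (\int[leb]_(x in Q) (w x `^ (- (p - 1)^-1))%R%:E)%E.
have B0 : (0 <= B)%E by apply: integral_ge0 => x _; rewrite lee_fin powR_ge0.
have HA : ((l ^- n * a)%:E * ((l ^- n)%:E * B) `^ (p - 1) <= (Ap_const p w)%:E)%E.
  rewrite -Ap_supE; apply: ereal_sup_ubound; exists (x0, l) => //=.
  by rewrite /mean -/Q lQ /= -[X in (_ * X * _)%E]/(wmass w Q) wQE.
(* The dual mass is finite: otherwise its product with the positive mean of w would make the A_p
   supremum infinite. *)
have [b bE] : exists b, B = b%:E.
  case: B B0 HA => [b _ _|_|//]; first by exists b.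
  rewrite gt0_muley ?lte_fin ?invr_gt0// poweRyr ?gt_eqF//.
  by rewrite gt0_muley ?lte_fin ?mulr_gt0 ?invr_gt0.
rewrite bE lee_fin in B0.
have {}HA : (l ^- n * a) * ((l ^- n * b) `^ (p - 1)) <= Ap_const p w.
  by rewrite -lee_fin EFinM -poweR_EFin (EFinM _ b) -bE.
have {}HA : b `^ (p - 1) * a <= Ap_const p w * (l ^+ n) `^ p.
  have lp : 0 < (l ^+ n) `^ p by rewrite powR_gt0.
  rewrite -ler_pdivrMr//; apply: le_trans HA.
  have E1 : (l ^- n) `^ (p - 1) = ((l ^+ n) `^ (p - 1))^-1.
    by rewrite -powR_inv1 ?(ltW ln0)// -powRrM mulN1r powRN.
  rewrite powRM ?invr_ge0 ?(ltW ln0)// -(mulr_powRB1 (ltW ln0) p0) invfM E1.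
  by rewrite le_eqVlt; apply/orP; left; apply/eqP; ring.
have H := @weighted_hoelder _ _ _ leb p Q f w p_gt1 mQ mf mw f0 w0.
rewrite wQE; apply: le_trans (lee_wpmul2r _ H) _; first by rewrite lee_fin ltW.
rewrite -/B bE poweR_EFin -muleA -EFinM muleC.
by rewrite lee_wpmul2r ?lee_fin// integral_ge0// => x _; rewrite lee_fin mulr_ge0 ?powR_ge0 ?ltW.
Qed.

Lemma Ap_const_ge1 : 1 <= Ap_const p w.
Proof.
have := @Ap_ineq 0 1 (fun=> 1) ltr01 (measurable_cst _) (fun=> ler01).
have -> : (\int[leb]_(x in cube 0 1) (1%:E) = 1)%E.
  rewrite integral_cst; last exact: measurable_cube.
  by rewrite mul1e; apply: (etrans (lebesgue_cube _ ler01)); rewrite expr1n.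
under eq_integral do rewrite powR1 mul1r.
rewrite expr1n poweR_EFin powR1 mul1e mulr1.
have Q0 : (0 < wmass w (cube 0 1))%E.
  by apply: wmass_gt0; [exact: measurable_cube|rewrite lebesgue_cube// expr1n lte_fin].
rewrite -/(wmass w (cube 0 1)) -(@fineK _ (wmass w _)); last first.
  by rewrite gt0_fin_numE// wmass_cube_lty.
rewrite -EFinM lee_fin -{1}[fine _]mul1r ler_pM2r// fine_gt0//.
by rewrite Q0 wmass_cube_lty.
Qed.

End Ap_estimates.

(** * Single-scale sums *)

Section single_scale_estimates.
Context {R : realType} {n : nat}.
Local Notation leb := (@lebesgue_rV R n).
Hypothesis n_gt0 : (0 < n)%N.
Variables (p : R) (w : 'rV[R]_n -> R).
Hypotheses (p_gt1 : 1 < p) (wn : nice_weight p w).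

Let mw : measurable_fun setT w. Proof. by case: wn. Qed.
Let w0 x : 0 < w x. Proof. by case: wn. Qed.
Let p0 : 0 < p. Proof. exact: lt_trans p_gt1. Qed.
Let pm : 0 < p - 1. Proof. by rewrite subr_gt0. Qed.

Definition shell (j : int) (k : 'rV[int]_n) (i : nat) : set 'rV[R]_n :=
  [set x | `|2 ^ j *: x - intv k| < i%:R].

(** In the coordinates [2^j x - k] this is the cube from -i to i + 1. It contains the shell, which
    lies between -i and i, as well as the dyadic cube, which lies between 0 and 1; hence the odd
    side. *)
Definition big_cube (j : int) (k : 'rV[int]_n) (i : nat) : set 'rV[R]_n :=
  cube (2 ^ (- j) *: (intv k - const_mx i%:R)) (2 ^ (- j) * (2 * i + 1)%:R).

Lemma measurable_rescale (j : int) (k : 'rV[int]_n) :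
  measurable_fun setT (fun x : 'rV[R]_n => 2 ^ j *: x - intv k).
Proof. exact: measurable_affine_rV. Qed.

Lemma measurable_shell j k i : measurable (shell j k i).
Proof.
rewrite /shell -[X in measurable X]setTI.
have m : measurable_fun setT (fun x : 'rV[R]_n => `|2 ^ j *: x - intv k| < i%:R).
  apply: measurable_fun_ltr => //.
  exact: (measurableT_comp measurable_normrV (measurable_rescale j k)).
by have := m measurableT [set true] I; rewrite preimage_true.
Qed.

Lemma pow2_gt0 (j : int) : 0 < (2 : R) ^ j.
Proof. exact: exprz_gt0. Qed.

Lemma pow2VM (j : int) : (2 : R) ^ (- j) * 2 ^ j = 1.
Proof. by rewrite -expfzDr// addNr expr0z. Qed.

Lemma big_cubeP j k i (x : 'rV[R]_n) : big_cube j k i x <->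
  forall l, (- i%:R <= (2 ^ j *: x - intv k) ord0 l <= i%:R + 1).
Proof.
have r0 := pow2_gt0 j.
have rq : (2 : R) ^ j * 2 ^ (- j) = 1 by rewrite mulrC pow2VM.
have E l : (2 ^ (- j) * ((k ord0 l)%:~R - i%:R) <= x ord0 l <=
     2 ^ (- j) * ((k ord0 l)%:~R - i%:R) + 2 ^ (- j) * (2 * i + 1)%:R) =
   ((k ord0 l)%:~R - i%:R <= 2 ^ j * x ord0 l <= (k ord0 l)%:~R - i%:R + (2 * i + 1)%:R).
  by rewrite -(ler_pM2l r0) -[X in _ && X](ler_pM2l r0) [2 ^ j * (_ * _ + _ * _)]mulrDr !mulrA rq !mul1r.
split=> H l; have := H l; rewrite !mxE E natrD natrM => /andP[h1 h2];
  apply/andP; split; lra.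
Qed.

Lemma shell_big_cube j k i : shell j k i `<=` big_cube j k i.
Proof.
move=> x sx; apply/big_cubeP => l.
have i0 : 0 < i%:R :> R by apply: le_lt_trans sx.
move/(normrV_ltP _ i0)/(_ l) : sx; rewrite ltr_norml => /andP[h1 h2].
by apply/andP; split; lra.
Qed.

Lemma dyadic_big_cube j k i : dyadic j k `<=` big_cube j k i.
Proof.
move=> x /dyadicP dx; apply/big_cubeP => l; have /andP[h1 h2] := dx l.
have i0 : 0 <= i%:R :> R by [].
by apply/andP; split; lra.
Qed.

Lemma lebesgue_dyadic j k : leb (dyadic j k) = ((2 ^ (- j)) ^+ n)%:E.
Proof.
have q0 := pow2_gt0 (- j).
rewrite (_ : dyadic j k = [set y : 'rV[R]_n | forall i,
  `[2 ^ (- j) * (k ord0 i)%:~R, 2 ^ (-j) * (k ord0 i)%:~R + 2 ^ (- j)[%classic (y ord0 i)]).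
  rewrite (@lebesgue_rV_box _ _ (fun i =>
    `[2 ^ (- j) * (k ord0 i)%:~R, 2 ^ (-j) * (k ord0 i)%:~R + 2 ^ (- j)[%classic)); last first.
    by move=> i; exact: measurable_itv.
  transitivity (\prod_(i < n) (2 ^ (- j) : R)%:E)%E; last by rewrite prodEFin prodr_const card_ord.
  apply: eq_bigr => i _; rewrite lebesgue_measure_itv/= lte_fin ltrDl q0.
  by rewrite -EFinD addrAC subrr add0r.
have r0 := pow2_gt0 j.
have rq : (2 : R) ^ j * 2 ^ (- j) = 1 by rewrite mulrC pow2VM.
have E (x : 'rV[R]_n) l : (2 ^ (- j) * (k ord0 l)%:~R <= x ord0 l < 2 ^ (- j) * (k ord0 l)%:~R + 2 ^ (- j)) =
    ((k ord0 l)%:~R <= 2 ^ j * x ord0 l < (k ord0 l)%:~R + 1).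
  by rewrite -(ler_pM2l r0) -(ltr_pM2l r0) mulrDr !mulrA rq !mul1r.
apply/seteqP; split => x; rewrite dyadicP => H i; have := H i;
  rewrite /= in_itv/= E !mxE => /andP[h1 h2]; apply/andP; split; lra.
Qed.

Definition wQ (j : int) (k : 'rV[int]_n) : R := fine (wmass w (dyadic j k)).

Lemma wQE j k : wmass w (dyadic j k) = (wQ j k)%:E.
Proof.
rewrite /wQ fineK// ge0_fin_numE; last by apply: integral_ge0 => x _; rewrite lee_fin ltW.
apply: le_lt_trans (wmass_cube_lty wn _ _).
exact: (le_wmass wn (measurable_dyadic j k) (measurable_cube _ _) (@dyadic_big_cube j k 0)).
Qed.

Lemma wQ_gt0 j k : 0 < wQ j k.
Proof.
rewrite -lte_fin -wQE; apply: (wmass_gt0 p_gt1 wn); first exact: measurable_dyadic.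
by rewrite lebesgue_dyadic lte_fin exprn_gt0// pow2_gt0.
Qed.

Let cube_side j i : 0 < 2 ^ (- j) * (2 * i + 1)%:R :> R.
Proof. by rewrite mulr_gt0 ?pow2_gt0// ltr0n addn1. Qed.

(** [Ap_ineq] on the large cube for the indicator of the dyadic one: the ratio of the two volumes is
    [(2 i + 1)^n], and it enters with the power p. *)
Lemma doubling j k i :
  (wmass w (shell j k i) <= (Ap_const p w * ((2 * i + 1)%:R ^+ n) `^ p * wQ j k)%:E)%E.
Proof.
have mC : measurable (big_cube j k i) by exact: measurable_cube.
have mD := measurable_dyadic (R := R) j k.
apply: (@le_trans _ _ (wmass w (big_cube j k i))).
  apply: (le_wmass wn) => //; first exact: measurable_shell.
  exact: shell_big_cube.
have := @Ap_ineq _ _ _ _ p_gt1 wn (2 ^ (- j) *: (intv k - const_mx i%:R)) _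
  (\1_(dyadic j k)) (cube_side j i) (measurable_indic mD) _.
rewrite -/(big_cube j k i).
have -> : (\int[leb]_(x in big_cube j k i) (\1_(dyadic j k) x)%:E)%E = ((2 ^ (- j)) ^+ n)%:E.
  rewrite integral_indic// setIidl; last exact: dyadic_big_cube.
  exact: lebesgue_dyadic.
have -> : (\int[leb]_(x in big_cube j k i) ((\1_(dyadic j k) x) `^ p * w x)%R%:E)%E = (wQ j k)%:E.
  rewrite -wQE /wmass integral_mkcond [RHS]integral_mkcond; apply: eq_integral => x _.
  rewrite !epatch_indic /= !indicE.
  have [xD|xD] := boolP (x \in dyadic j k).
    rewrite (mem_set (dyadic_big_cube _ (set_mem xD))).
    by rewrite powR1 mul1r.
  by rewrite powR0 ?gt_eqF// mul0r mul0e mule0.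
move=> /(_ (fun x => ler0n _ _)).
have q0 : 0 < (2 ^ (- j) : R) ^+ n by rewrite exprn_gt0// pow2_gt0.
rewrite poweR_EFin exprMn powRM ?exprn_ge0 ?ler0n ?(ltW (pow2_gt0 _))//.
have q1 : 0 < ((2 ^ (- j) : R) ^+ n) `^ p by rewrite powR_gt0.
rewrite -EFinM => H.
rewrite -(@lee_pmul2l _ (((2 ^ (- j) : R) ^+ n) `^ p)%:E) ?lte_fin//.
by apply: (le_trans H); rewrite -EFinM lee_fin le_eqVlt; apply/orP; left; apply/eqP; ring.
Qed.

Lemma measurable_funrX (f : 'rV[R]_n -> R) (r : R) : measurable_fun setT f ->
  measurable_fun setT (fun x => f x `^ r).
Proof. by move=> mf; apply: (measurableT_comp (measurable_powR r)). Qed.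

Lemma measurable_shell_indic j k i :
  measurable_fun setT (fun x : 'rV[R]_n => (`|2 ^ j *: x - intv k| < i%:R)%R%:R : R).
Proof.
have -> : (fun x : 'rV[R]_n => (`|2 ^ j *: x - intv k| < i%:R)%R%:R : R) = \1_(shell j k i).
  apply/funext => x; rewrite indicE.
  have [h|h] := boolP (`|2 ^ j *: x - intv k| < i%:R); first by rewrite mem_set.
  by rewrite memNset//; exact/negP.
exact: measurable_indic (measurable_shell j k i).
Qed.

(** * Upper estimate for a single-scale sum *)

Section upper.
Variables (h : 'rV[R]_n -> R[i]) (C s : R).
Hypotheses (hC : decays h C s) (gs : gamU n p < s).

Let gam1 : 1 < gamU n p.
Proof.
rewrite /gamU /conj_exp; apply: (@lt_le_trans _ _ (n%:R + n%:R / (p / (p - 1)))) => //.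
rewrite invf_div ltr_pwDr//; first by rewrite mulr_gt0 ?ltr0n// divr_gt0.
by rewrite ler1n.
Qed.

Let s0 : 0 < s. Proof. by rewrite (lt_trans _ gs)// (lt_trans _ gam1). Qed.
Let S : R := fine (K_U p h).
Let S0 : 0 <= S. Proof. by apply: fine_ge0; exact: (K_env_ge0 n_gt0 s0 hC). Qed.
Let d := denv h.
Let d0 i : 0 <= d i. Proof. exact: (denv_ge0 n_gt0 s0 hC). Qed.
Let A (i : nat) : R := (2 * i + 1)%:R `^ gamU n p.
Let A0 i : 0 < A i. Proof. by rewrite powR_gt0// ltr0n addn1. Qed.

Let dA0 i : 0 <= d i * A i. Proof. by rewrite mulr_ge0// ltW. Qed.

Lemma K_U_fin : K_U p h = S%:E.
Proof. by rewrite /S /K_U -(K_env_fin n_gt0 s0 hC gam1 gs). Qed.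

Variables (j : int) (Lam : {fset 'rV[int]_n}) (c : 'rV[int]_n -> R[i]).
Let ch k (x : 'rV[R]_n) i : R := (`|2 ^ j *: x - intv k| < i%:R)%R%:R.
Let lam : R := 2 `^ (j%:~R * n%:R / 2).

(** Division by [A i] makes [d i * A i] the weights of Jensen's inequality over i; their sum is
    K_U. *)
Let t (x : 'rV[R]_n) (i : nat) : R := (A i)^-1 * \sum_(k <- Lam) normc (c k) * ch k x i.

Let t_ge0 x i : 0 <= t x i.
Proof.
by rewrite mulr_ge0 ?invr_ge0 ?(ltW (A0 i))// sumr_ge0// => k _; rewrite mulr_ge0 ?normc_ge0.
Qed.

Lemma normc_sum (I : Type) (r : seq I) (F : I -> R[i]) :
  normc (\sum_(i <- r) F i) <= \sum_(i <- r) normc (F i).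
Proof.
elim: r => [|a r IH]; first by rewrite !big_nil Normc.normc0.
by rewrite !big_cons (le_trans (le_normcD _ _))// lerD2l.
Qed.

Lemma normc_real (r : R) : normc (r%:C)%C = `|r|.
Proof. by rewrite /= expr0n/= addr0 sqrtr_sqr. Qed.

Let pt1 x : ((normc (single_scale h j Lam c x))%:E <=
  lam%:E * \sum_(0 <= i <oo) (d i * A i * t x i)%:E)%E.
Proof.
apply: (@le_trans _ _ (\sum_(k <- Lam) (lam * normc (c k))%:E * \sum_(0 <= i <oo) (d i * ch k x i)%:E)%E).
  apply: (@le_trans _ _ (\sum_(k <- Lam) normc (c k * dilate h j k x))%:E).
    by rewrite lee_fin normc_sum.
  rewrite -sumEFin; apply: lee_sum => k _.
  rewrite /dilate !Normc.normcM normc_real ger0_norm ?powR_ge0// mulrCA -/lam mulrA EFinM.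
  rewrite lee_wpmul2l ?lee_fin ?mulr_ge0 ?powR_ge0 ?normc_ge0//.
  exact: (layer_cake n_gt0 s0 hC).
have E1 k : ((lam * normc (c k))%:E * \sum_(0 <= i <oo) (d i * ch k x i)%:E =
   \sum_(0 <= i <oo) (lam * normc (c k) * (d i * ch k x i))%:E)%E.
  by rewrite -nneseriesZl// => i _; rewrite lee_fin mulr_ge0.
under eq_bigr do rewrite E1.
rewrite -nneseries_sum; last first.
  by move=> k i _; rewrite lee_fin !mulr_ge0 ?powR_ge0 ?normc_ge0.
have -> : (lam%:E * \sum_(0 <= i <oo) (d i * A i * t x i)%:E =
   \sum_(0 <= i <oo) (lam * (d i * A i * t x i))%:E)%E.
  by rewrite -nneseriesZl// => i _; rewrite lee_fin mulr_ge0.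
rewrite le_eqVlt; apply/orP; left; apply/eqP; apply: congr_lim; apply/funext => N.
apply: eq_bigr => i _; rewrite sumEFin; congr _%:E.
rewrite /t -!mulrA [A i * _]mulrA mulfV ?gt_eqF// mul1r !mulr_sumr.
by apply: eq_bigr => k _; ring.
Qed.

Let B (i : nat) : R := (2 * i + 1)%:R ^+ n.
Let B0 i : 0 < B i. Proof. by rewrite exprn_gt0// ltr0n addn1. Qed.

(** This balance fixes [gamma = n + n / p']: [B^p] pays for doubling, and [B^(p-1)] for the overlap
    in Jensen's inequality over k. *)
Let AB i : A i `^ p = B i `^ p * B i `^ (p - 1).
Proof.
have q0 : 0 < (2 * i + 1)%:R :> R by rewrite ltr0n addn1.
rewrite /A /B -powR_mulrn ?(ltW q0)// -!powRrM -powRD; last by rewrite (gt_eqF q0) implybT.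
congr (_ `^ _); rewrite /gamU /conj_exp; field.
by rewrite (gt_eqF p0) (gt_eqF pm).
Qed.

(** A second use of Jensen's inequality, over k with weights 0 and 1, whose sum is at most the
    overlap count. *)
Let tp x i : t x i `^ p <= (B i `^ p)^-1 * \sum_(k <- Lam) ch k x i * normc (c k) `^ p.
Proof.
rewrite /t powRM ?invr_ge0 ?(ltW (A0 i))//; last first.
  by rewrite sumr_ge0// => k _; rewrite mulr_ge0 ?normc_ge0.
have -> : (A i)^-1 `^ p = (A i `^ p)^-1.
  by rewrite -powR_inv1 ?(ltW (A0 i))// powRAC powR_inv1 ?powR_ge0.
rewrite AB invfM -mulrA ler_wpM2l ?invr_ge0 ?powR_ge0//.
rewrite ler_pdivrMl ?powR_gt0//.
under eq_bigr do rewrite mulrC.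
apply: (le_trans (jensen_sum _ p_gt1 (fun k => ler0n _ _) (fun k => normc_ge0 _))).
rewrite ler_wpM2r ?sumr_ge0// => [k _|]; first by rewrite mulr_ge0 ?powR_ge0.
apply: ge0_ler_powR; rewrite ?nnegrE ?(ltW pm) ?(ltW (B0 i)) ?sumr_ge0//.
by rewrite /B -natrX; exact: overlap_count.
Qed.

Let X : R := \sum_(k <- Lam) normc (c k) `^ p * wQ j k.
Let X0 : 0 <= X.
Proof. by apply: sumr_ge0 => k _; rewrite mulr_ge0 ?powR_ge0// ltW// wQ_gt0. Qed.

Lemma coef_normE : coef_norm p w j Lam c = (X `^ p^-1)%:E.
Proof.
rewrite /coef_norm -poweR_EFin; congr (_ `^ _)%E.
by rewrite /X -sumEFin; apply: eq_bigr => k _; rewrite wQE.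
Qed.

Let g (i : nat) (x : 'rV[R]_n) : R :=
  d i * A i * (B i `^ p)^-1 * \sum_(k <- Lam) normc (c k) `^ p * (ch k x i * w x).

Let g0 i x : 0 <= g i x.
Proof.
rewrite !mulr_ge0 ?invr_ge0 ?powR_ge0// sumr_ge0// => k _.
by rewrite !mulr_ge0 ?powR_ge0// ltW.
Qed.

Let mg i : measurable_fun setT (g i).
Proof.
apply: measurable_funM => //; apply: measurable_sum => k.
apply: measurable_funM => //; apply: measurable_funM => //.
exact: measurable_shell_indic.
Qed.

Let pt2 x : ((normc (single_scale h j Lam c x) `^ p * w x)%R%:E <=
  (lam `^ p * S `^ (p - 1))%R%:E * \sum_(0 <= i <oo) (g i x)%:E)%E.
Proof.
have lam0 : 0 <= lam by exact: powR_ge0.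
rewrite EFinM -poweR_EFin.
apply: (@le_trans _ _ ((lam%:E * \sum_(0 <= i <oo) (d i * A i * t x i)%:E) `^ p * (w x)%:E)%E).
  rewrite lee_wpmul2r ?lee_fin ?(ltW (w0 x))//.
  apply: gt0_ler_poweR => //; first exact: ltW.
  - by rewrite in_itv/= leey andbT lee_fin normc_ge0.
  - rewrite in_itv/= leey andbT mule_ge0 ?lee_fin// nneseries_ge0// => i _ _.
    by rewrite lee_fin mulr_ge0.
have T0 : (0 <= \sum_(0 <= i <oo) (d i * A i * t x i)%:E)%E.
  by rewrite nneseries_ge0// => i _ _; rewrite lee_fin mulr_ge0.
rewrite poweRM ?lee_fin// poweR_EFin [in leRHS]EFinM -!muleA.
rewrite lee_wpmul2l ?lee_fin ?powR_ge0//.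
have J := jensen_series p_gt1 dA0 (t_ge0 x)
  (fun N => @K_env_sum_le _ _ n_gt0 _ _ _ s0 hC _ N gam1 gs).
apply: (le_trans (lee_wpmul2r _ J)); first by rewrite lee_fin ltW.
rewrite -/(K_U p h) -/S -muleA lee_wpmul2l ?lee_fin ?powR_ge0//.
rewrite muleC -nneseriesZl; last by move=> i _; rewrite lee_fin mulr_ge0 ?powR_ge0.
apply: lee_nneseries => [i _ _|i _]; first by rewrite -EFinM lee_fin !mulr_ge0 ?powR_ge0 ?(ltW (w0 x)).
rewrite -EFinM lee_fin /g.
apply: (@le_trans _ _ (w x * (d i * A i * ((B i `^ p)^-1 * \sum_(k <- Lam) ch k x i * normc (c k) `^ p)))).
  by rewrite ler_wpM2l ?(ltW (w0 x))// ler_wpM2l.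
rewrite le_eqVlt; apply/orP; left; apply/eqP.
rewrite !mulr_sumr; apply: eq_bigr => k _; ring.
Qed.

Lemma shell_mass k i : (\int[leb]_x (ch k x i * w x)%:E = wmass w (shell j k i))%E.
Proof.
rewrite /wmass [RHS]integral_mkcond; apply: eq_integral => x _.
rewrite epatch_indic /= indicE /ch EFinM muleC; congr (_ * _%:E)%E.
have [H|H] := boolP (`|2 ^ j *: x - intv k| < i%:R); first by rewrite mem_set.
by rewrite memNset//; exact/negP.
Qed.

Let int_g i : (\int[leb]_x (g i x)%:E <= (d i * A i * (Ap_const p w * X))%:E)%E.
Proof.
have dAB : 0 <= d i * A i * (B i `^ p)^-1.
  by rewrite !mulr_ge0 ?invr_ge0 ?powR_ge0.
rewrite /g; under eq_integral do rewrite EFinM -sumEFin.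
have mk k : measurable_fun setT (fun x => (normc (c k) `^ p * (ch k x i * w x))%R%:E).
  apply/measurable_EFinP; apply: measurable_funM => //; apply: measurable_funM => //.
  exact: measurable_shell_indic.
have k0 k x : (0 <= (normc (c k) `^ p * (ch k x i * w x))%R%:E)%E.
  by rewrite lee_fin !mulr_ge0 ?powR_ge0 ?(ltW (w0 x)).
rewrite ge0_integralZl//; last 2 first.
- by apply: emeasurable_sum => k; exact: mk.
- by move=> x _; rewrite sume_ge0.
rewrite ge0_integral_sum//.
apply: (@le_trans _ _ ((d i * A i * (B i `^ p)^-1)%:E *
  \sum_(k <- Lam) (normc (c k) `^ p * (Ap_const p w * B i `^ p * wQ j k))%R%:E)%E).
  rewrite lee_wpmul2l ?lee_fin//; apply: lee_sum => k _.
  under eq_integral do rewrite EFinM.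
  rewrite ge0_integralZl ?lee_fin ?powR_ge0//; last 2 first.
  - apply/measurable_EFinP; apply: measurable_funM => //; exact: measurable_shell_indic.
  - by move=> x _; rewrite lee_fin mulr_ge0// ltW.
  rewrite shell_mass [in leRHS]EFinM lee_wpmul2l ?lee_fin ?powR_ge0//.
  exact: doubling.
rewrite sumEFin -EFinM lee_fin le_eqVlt; apply/orP; left; apply/eqP.
rewrite /X !mulr_sumr; apply: eq_bigr => k _.
by field; rewrite gt_eqF// powR_gt0.
Qed.

Lemma single_scale_upper :
  (Lpw_norm p w (single_scale h j Lam c) <=
   K_U p h * (Ap_const p w `^ p^-1 * lam)%R%:E * coef_norm p w j Lam c)%E.
Proof.
have lam0 : 0 <= lam by exact: powR_ge0.
have Ap0 : 0 <= Ap_const p w by apply: le_trans (Ap_const_ge1 p_gt1 wn).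
rewrite coef_normE K_U_fin -!EFinM.
(* Jensen's inequality leaves [S^(p-1)] and the sum over i a further S; the p-th root of the product
   returns S itself. *)
have -> : S * (Ap_const p w `^ p^-1 * lam) * X `^ p^-1 =
  (lam `^ p * S `^ (p - 1) * (S * (Ap_const p w * X))) `^ p^-1.
  have -> : lam `^ p * S `^ (p - 1) * (S * (Ap_const p w * X)) = (lam * S) `^ p * (Ap_const p w * X).
    by rewrite powRM// -(mulr_powRB1 S0 p0); ring.
  rewrite powRM ?powR_ge0 ?mulr_ge0// -powRrM mulfV ?gt_eqF// powRr1 ?mulr_ge0//.
  by rewrite powRM//; ring.
rewrite -poweR_EFin /Lpw_norm.
apply: gt0_ler_poweR; first by rewrite invr_ge0 ltW.
- by rewrite in_itv/= leey andbT integral_ge0// => x _; rewrite lee_fin mulr_ge0 ?powR_ge0// ltW.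
- by rewrite in_itv/= leey andbT lee_fin !mulr_ge0 ?powR_ge0.
apply: (@le_trans _ _ (\int[leb]_x ((lam `^ p * S `^ (p - 1))%R%:E * \sum_(0 <= i <oo) (g i x)%:E))%E).
  (* Only decay is known of h, so the left integrand need not be measurable, and the pointwise bound
     is integrated in the lower sense. *)
  apply: ge0_le_lower_integral => [x|x]; last exact: pt2.
  by rewrite lee_fin mulr_ge0 ?powR_ge0// ltW.
have mgE i : measurable_fun setT (fun x => (g i x)%:E) by apply/measurable_EFinP.
rewrite ge0_integralZl//; first last.
- by rewrite lee_fin mulr_ge0 ?powR_ge0.
- by move=> x _; rewrite nneseries_ge0// => i _ _; rewrite lee_fin.
- by apply: ge0_emeasurable_sum => // i x _ _; rewrite lee_fin.
rewrite [in leRHS]EFinM lee_wpmul2l ?lee_fin ?mulr_ge0 ?powR_ge0//.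
rewrite integral_nneseries//; last by move=> i x _; rewrite lee_fin.
apply: lime_le.
  by apply: is_cvg_nneseries => i _ _; apply: integral_ge0 => x _; rewrite lee_fin.
apply: nearW => N.
apply: (@le_trans _ _ (\sum_(0 <= i < N) (d i * A i * (Ap_const p w * X))%:E)%E).
  by apply: lee_sum => i _; exact: int_g.
rewrite sumEFin -mulr_suml lee_fin ler_wpM2r ?mulr_ge0//.
exact: (@K_env_sum_le _ _ n_gt0 _ _ _ s0 hC _ N gam1 gs).
Qed.

End upper.

(** * Pairings with the translates of a decaying function *)

Section lower.
Variables (h : 'rV[R]_n -> R[i]) (C s : R).
Hypotheses (hC : decays h C s) (gs : gamL n p < s).

Let gam1 : 1 < gamL n p.
Proof.
rewrite /gamL ltr_pwDr//; first by rewrite divr_gt0// ltr0n.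
by rewrite ler1n.
Qed.

Let s0 : 0 < s. Proof. by rewrite (lt_trans _ gs)// (lt_trans _ gam1). Qed.
Let S : R := fine (K_L p h).
Let S0 : 0 <= S. Proof. by apply: fine_ge0; exact: (K_env_ge0 n_gt0 s0 hC). Qed.
Let d := denv h.
Let d0 i : 0 <= d i. Proof. exact: (denv_ge0 n_gt0 s0 hC). Qed.
Let A (i : nat) : R := (2 * i + 1)%:R `^ gamL n p.
Let A0 i : 0 < A i. Proof. by rewrite powR_gt0// ltr0n addn1. Qed.
Let dA0 i : 0 <= d i * A i. Proof. by rewrite mulr_ge0// ltW. Qed.

Lemma K_L_fin : K_L p h = S%:E.
Proof. by rewrite /S /K_L -(K_env_fin n_gt0 s0 hC gam1 gs). Qed.

Variables (f : 'rV[R]_n -> R).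
Hypotheses (mf : measurable_fun setT f) (f0 : forall x, 0 <= f x).
Let F := (\int[leb]_x (f x `^ p * w x)%R%:E)%E.
Hypothesis Foo : (F < +oo)%E.
Variables (j : int) (Lam : {fset 'rV[int]_n}).

Let ch k (x : 'rV[R]_n) i : R := (`|2 ^ j *: x - intv k| < i%:R)%R%:R.
Let B (i : nat) : R := (2 * i + 1)%:R ^+ n.
Let B0 i : 0 < B i. Proof. by rewrite exprn_gt0// ltr0n addn1. Qed.
Let l : R := (2 ^ (- j)) ^+ n.
Let l0 : 0 < l. Proof. by rewrite exprn_gt0// pow2_gt0. Qed.
Let mch k i : measurable_fun setT (fun x => ch k x i).
Proof. exact: measurable_shell_indic. Qed.
Let Fw0 x : 0 <= f x `^ p * w x. Proof. by rewrite mulr_ge0 ?powR_ge0// ltW. Qed.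
Let F0 : (0 <= F)%E. Proof. by apply: integral_ge0 => x _; rewrite lee_fin. Qed.
Let mFw : measurable_fun setT (fun x => f x `^ p * w x).
Proof. by apply: measurable_funM => //; exact: measurable_funrX. Qed.

Let v k i := (\int[leb]_x (f x * ch k x i)%R%:E)%E.
Let phi k i := (\int[leb]_x (ch k x i * (f x `^ p * w x))%R%:E)%E.

Let v0 k i : (0 <= v k i)%E.
Proof. by apply: integral_ge0 => x _; rewrite lee_fin mulr_ge0. Qed.

Let phi0 k i : (0 <= phi k i)%E.
Proof. by apply: integral_ge0 => x _; rewrite lee_fin mulr_ge0. Qed.

Let ch_le1 k x i : ch k x i <= 1.
Proof. by rewrite /ch; case: (_ < _). Qed.

Let phi_le k i : (phi k i <= F)%E.
Proof.
apply: ge0_le_lower_integral => x; first by rewrite lee_fin mulr_ge0.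
by rewrite lee_fin ler_piMl.
Qed.

(** [Ap_ineq] on the large cube for f cut to the shell; the mass of the large cube on the left is
    then lowered to that of the dyadic cube inside it. *)
Let v_phi k i : (v k i `^ p * (wQ j k)%:E <= (Ap_const p w * (l * B i) `^ p)%R%:E * phi k i)%E.
Proof.
have Ap0 : 0 <= Ap_const p w by apply: le_trans (Ap_const_ge1 p_gt1 wn).
have mC : measurable (big_cube j k i) by exact: measurable_cube.
have mfc : measurable_fun setT (fun x => f x * ch k x i) by exact: measurable_funM.
have fc0 x : 0 <= f x * ch k x i by rewrite mulr_ge0.
have := @Ap_ineq _ _ _ _ p_gt1 wn (2 ^ (- j) *: (intv k - const_mx i%:R)) _ _
  (cube_side j i) mfc fc0.
rewrite -/(big_cube j k i) exprMn -/l -/(B i) => H.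
have vE : v k i = (\int[leb]_(x in big_cube j k i) (f x * ch k x i)%R%:E)%E.
  rewrite [RHS]integral_mkcond; apply: eq_integral => x _.
  rewrite epatch_indic /= indicE /ch.
  have [sx|sx] := boolP (`|2 ^ j *: x - intv k| < i%:R); last by rewrite mulr0 mul0e.
  by rewrite mem_set ?mule1//; exact: shell_big_cube.
rewrite vE; apply: le_trans (le_trans H _).
  rewrite lee_wpmul2l ?poweR_ge0// -wQE.
  by apply: (le_wmass wn) => //; [exact: measurable_dyadic|exact: dyadic_big_cube].
rewrite lee_wpmul2l ?lee_fin ?mulr_ge0 ?powR_ge0//.
rewrite integral_mkcond; apply: ge0_le_lower_integral => x.
  by rewrite epatch_indic /= mule_ge0// lee_fin ?mulr_ge0 ?powR_ge0// ltW.
rewrite epatch_indic /= /ch; case: (_ < _).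
  by rewrite mulr1 mul1r -[leRHS]mule1 lee_wpmul2l ?lee_fin// indicE; case: (_ \in _).
by rewrite mulr0 powR0 ?gt_eqF// !mul0r mul0e.
Qed.

Let vE k i : v k i = (fine (v k i))%:E.
Proof.
rewrite fineK// ge0_fin_numE//.
have Q0 := wQ_gt0 j k.
have : (v k i `^ p < +oo)%E.
  rewrite -(@lte_pmul2r _ (wQ j k)%:E) ?lte_fin// mulyr gtr0_sg// mul1e.
  apply: le_lt_trans (v_phi k i) _.
  rewrite lte_mul_pinfty ?lee_fin ?mulr_ge0 ?powR_ge0//.
  - by apply: le_trans (Ap_const_ge1 p_gt1 wn).
  - exact: le_lt_trans (phi_le k i) Foo.
by apply: lty_poweRy; rewrite gt_eqF.
Qed.

Let u k i : R := fine (v k i).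
Let u0 k i : 0 <= u k i. Proof. exact: fine_ge0. Qed.
Let tt k := (\int[leb]_x (f x * normc (h (2 ^ j *: x - intv k)))%R%:E)%E.

Let tt_le k : (tt k <= \sum_(0 <= i <oo) (d i * A i * (u k i / A i))%:E)%E.
Proof.
have -> : (\sum_(0 <= i <oo) (d i * A i * (u k i / A i))%:E =
    \int[leb]_x \sum_(0 <= i <oo) (d i * (f x * ch k x i))%:E)%E.
  rewrite integral_nneseries//; last 2 first.
  - by move=> i; apply/measurable_EFinP; apply: measurable_funM => //; exact: measurable_funM.
  - by move=> i x _; rewrite lee_fin !mulr_ge0.
  apply: congr_lim; apply/funext => N; apply: eq_bigr => i _.
  under eq_integral do rewrite EFinM.
  rewrite ge0_integralZl//; last 3 first.
  - by apply/measurable_EFinP; exact: measurable_funM.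
  - by move=> x _; rewrite lee_fin mulr_ge0.
  - by rewrite lee_fin.
  rewrite -/(v k i) vE -EFinM; congr _%:E; rewrite -/(u k i).
  by rewrite -mulrA [A i * _]mulrCA mulfV ?mulr1// gt_eqF.
apply: ge0_le_lower_integral => x; first by rewrite lee_fin mulr_ge0 ?normc_ge0.
apply: (@le_trans _ _ ((f x)%:E * \sum_(0 <= i <oo) (d i * ch k x i)%:E)%E).
  by rewrite EFinM lee_wpmul2l ?lee_fin//; exact: (layer_cake n_gt0 s0 hC).
rewrite -nneseriesZl; last by move=> i _; rewrite lee_fin mulr_ge0.
rewrite le_eqVlt; apply/orP; left; apply/eqP; apply: congr_lim; apply/funext => N.
by apply: eq_bigr => i _; rewrite -EFinM; congr _%:E; rewrite mulrCA.
Qed.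

(** The dual balance, which fixes [gamma' = n + n / p]: [B^p] is the volume factor of [v_phi], and
    the overlap enters only once, linearly, when the shell integrals are summed over k. *)
Let AB i : A i `^ p = B i `^ p * B i.
Proof.
have q0 : 0 < (2 * i + 1)%:R :> R by rewrite ltr0n addn1.
rewrite -[X in _ = _ * X](@powRr1 _ (B i)) ?(ltW (B0 i))//.
rewrite /A /B -powR_mulrn ?(ltW q0)// -!powRrM -powRD; last by rewrite (gt_eqF q0) implybT.
by congr (_ `^ _); rewrite /gamL; field; rewrite (gt_eqF p0).
Qed.

Let b k i : R := d i * A i * ((u k i / A i) `^ p * wQ j k).
Let b0 k i : 0 <= b k i.
Proof. by rewrite mulr_ge0// mulr_ge0 ?powR_ge0// ltW// wQ_gt0. Qed.

Let tt_p k : (tt k `^ p * (wQ j k)%:E <=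
   (S `^ (p - 1))%R%:E * \sum_(0 <= i <oo) (b k i)%:E)%E.
Proof.
have uA i : 0 <= u k i / A i by rewrite divr_ge0// ltW.
have tt0 : (0 <= tt k)%E.
  by apply: integral_ge0 => x _; rewrite lee_fin mulr_ge0 ?normc_ge0.
have Q0 := wQ_gt0 j k.
have J := jensen_series p_gt1 dA0 uA
  (fun N => @K_env_sum_le _ _ n_gt0 _ _ _ s0 hC _ N gam1 gs).
apply: (@le_trans _ _ (((S `^ (p - 1))%R%:E * \sum_(0 <= i <oo) (d i * A i * (u k i / A i) `^ p)%:E) * (wQ j k)%:E)%E).
  rewrite lee_wpmul2r ?lee_fin ?(ltW Q0)//; apply: le_trans J.
  apply: gt0_ler_poweR => //; first exact: ltW.
  - by rewrite in_itv/= leey andbT.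
  - rewrite in_itv/= leey andbT nneseries_ge0// => i _ _.
    by rewrite lee_fin mulr_ge0.
rewrite -muleA lee_wpmul2l ?lee_fin ?powR_ge0//.
rewrite muleC -nneseriesZl; last by move=> i _; rewrite lee_fin mulr_ge0 ?powR_ge0.
rewrite le_eqVlt; apply/orP; left; apply/eqP; apply: congr_lim; apply/funext => N.
by apply: eq_bigr => i _; rewrite -EFinM; congr _%:E; rewrite /b; ring.
Qed.

Let sum_phi i : (\sum_(k <- Lam) phi k i <= (B i)%:E * F)%E.
Proof.
rewrite /phi -ge0_integral_sum//; last 2 first.
- by move=> k; apply/measurable_EFinP; exact: measurable_funM.
- by move=> k x _; rewrite lee_fin mulr_ge0.
rewrite /F -ge0_integralZl//; last 3 first.
- exact/measurable_EFinP.
- by move=> x _; rewrite lee_fin.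
- by rewrite lee_fin ltW.
apply: ge0_le_lower_integral => x.
  by apply: sume_ge0 => k _; rewrite lee_fin mulr_ge0.
rewrite sumEFin -EFinM lee_fin -mulr_suml ler_wpM2r// /B -natrX.
exact: overlap_count.
Qed.

(** It serves twice: for j = 0 and the single index 0 it is the pairing estimate of (c), and for f
    the modulus of a single-scale sum it bounds the coefficients in (a). The factor [(2^(-j))^n] is
    the volume of a dyadic cube. *)
Lemma single_scale_lower : (\sum_(k <- Lam)
    (\int[leb]_x (f x * normc (h (2 ^ j *: x - intv k)))%R%:E) `^ p * (wQ j k)%:E <=
  (((2 ^ (- j)) ^+ n * S) `^ p * Ap_const p w)%R%:E * F)%E.
Proof.
have Ap0 : 0 <= Ap_const p w by apply: le_trans (Ap_const_ge1 p_gt1 wn).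
have FE : F = (fine F)%:E by rewrite fineK// ge0_fin_numE.
have fF0 : 0 <= fine F by exact: fine_ge0.
apply: (@le_trans _ _ (\sum_(k <- Lam) ((S `^ (p - 1))%R%:E * \sum_(0 <= i <oo) (b k i)%:E))%E).
  by apply: lee_sum => k _; exact: tt_p.
rewrite -ge0_sume_distrr; last by move=> k _; rewrite nneseries_ge0// => i _ _; rewrite lee_fin.
rewrite -nneseries_sum; last by move=> k i _; rewrite lee_fin.
rewrite -/l FE -EFinM.
have -> : (l * S) `^ p * Ap_const p w * fine F =
    S `^ (p - 1) * (S * (l `^ p * Ap_const p w * fine F)).
  by rewrite powRM ?(ltW l0)// -[S `^ p](mulr_powRB1 S0 p0); ring.
rewrite [in leRHS]EFinM lee_wpmul2l ?lee_fin ?powR_ge0//.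
apply: lime_le.
  by apply: is_cvg_nneseries => i _ _; apply: sume_ge0 => k _; rewrite lee_fin.
apply: nearW => N.
apply: (@le_trans _ _ (\sum_(0 <= i < N) (d i * A i * (l `^ p * Ap_const p w * fine F))%:E)%E); last first.
  rewrite sumEFin -mulr_suml lee_fin ler_wpM2r ?mulr_ge0 ?powR_ge0//.
  exact: (@K_env_sum_le _ _ n_gt0 _ _ _ s0 hC _ N gam1 gs).
apply: lee_sum => i _.
apply: (@le_trans _ _ (\sum_(k <- Lam) (d i * A i * (A i `^ p)^-1)%:E *
    ((Ap_const p w * (l * B i) `^ p)%R%:E * phi k i))%E).
  apply: lee_sum => k _; apply: le_trans (lee_wpmul2l _ (v_phi k i)); last first.
    by rewrite lee_fin mulr_ge0// invr_ge0 powR_ge0.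
  rewrite vE -/(u k i) poweR_EFin -!EFinM lee_fin /b.
  rewrite powRM ?invr_ge0 ?(ltW (A0 i))//.
  have -> : (A i)^-1 `^ p = (A i `^ p)^-1.
    by rewrite -powR_inv1 ?(ltW (A0 i))// powRAC powR_inv1 ?powR_ge0.
  by rewrite le_eqVlt; apply/orP; left; apply/eqP; ring.
rewrite -ge0_sume_distrr; last by move=> k _; rewrite mule_ge0// lee_fin mulr_ge0 ?powR_ge0.
rewrite -ge0_sume_distrr//.
apply: (@le_trans _ _ ((d i * A i / A i `^ p)%:E * ((Ap_const p w * (l * B i) `^ p)%R%:E * ((B i)%:E * F)))%E).
  rewrite lee_wpmul2l ?lee_fin ?mulr_ge0 ?invr_ge0 ?powR_ge0//.
  by rewrite lee_wpmul2l ?lee_fin ?mulr_ge0 ?invr_ge0 ?powR_ge0.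
rewrite FE -!EFinM lee_fin AB powRM ?(ltW l0) ?(ltW (B0 i))//.
rewrite le_eqVlt; apply/orP; left; apply/eqP; field.
by rewrite !gt_eqF ?powR_gt0.
Qed.

End lower.

End single_scale_estimates.

(** * Complex integration and the Fourier transform *)

Section normc_theory.
Context {R : realType}.
Implicit Types z w : R[i].

Lemma complex_ext z w : complex.Re z = complex.Re w -> complex.Im z = complex.Im w -> z = w.
Proof. by case: z => a b; case: w => c d /= -> ->. Qed.

Lemma normcE2 z : normc z = Num.sqrt (complex.Re z ^+ 2 + complex.Im z ^+ 2).
Proof. by case: z. Qed.

Lemma normr_Re_le z : `|complex.Re z| <= normc z.
Proof. by rewrite normcE2 -sqrtr_sqr ler_wsqrtr// lerDl sqr_ge0. Qed.

Lemma normr_Im_le z : `|complex.Im z| <= normc z.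
Proof. by rewrite normcE2 -sqrtr_sqr ler_wsqrtr// lerDr sqr_ge0. Qed.

Lemma normc_le_ReIm z : normc z <= `|complex.Re z| + `|complex.Im z|.
Proof.
case: z => a b /=; rewrite -[leRHS]ger0_norm ?addr_ge0// -sqrtr_sqr ler_wsqrtr//.
by rewrite sqrrD !real_normK ?num_real// lerD2r lerDl mulrn_wge0 ?mulr_ge0.
Qed.

Lemma normc_conj z : normc (conjc z) = normc z.
Proof. by case: z => a b /=; rewrite sqrrN. Qed.

Lemma ReD z w : complex.Re (z + w) = complex.Re z + complex.Re w.
Proof. by case: z; case: w. Qed.
Lemma ImD z w : complex.Im (z + w) = complex.Im z + complex.Im w.
Proof. by case: z; case: w. Qed.
Lemma ReN z : complex.Re (- z) = - complex.Re z.
Proof. by case: z. Qed.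
Lemma ImN z : complex.Im (- z) = - complex.Im z.
Proof. by case: z. Qed.
Lemma ReM z w : complex.Re (z * w) = complex.Re z * complex.Re w - complex.Im z * complex.Im w.
Proof. by case: z; case: w. Qed.
Lemma ImM z w : complex.Im (z * w) = complex.Re z * complex.Im w + complex.Im z * complex.Re w.
Proof. by case: z => a b; case: w => c d /=; rewrite [b * c]mulrC. Qed.
Lemma Re_conj z : complex.Re (conjc z) = complex.Re z.
Proof. by case: z. Qed.
Lemma Im_conj z : complex.Im (conjc z) = - complex.Im z.
Proof. by case: z. Qed.
Lemma ReC (r : R) : complex.Re r%:C = r. Proof. by []. Qed.
Lemma ImC (r : R) : complex.Im r%:C = 0. Proof. by []. Qed.

Lemma normc_conjM z : conjc z * z = ((normc z) ^+ 2)%:C.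
Proof.
case: z => a b /=; rewrite sqr_sqrtr ?addr_ge0 ?sqr_ge0//.
by apply: complex_ext; rewrite /= ?ReM ?ImM /=; ring.
Qed.

Lemma ler_normcB z w : normc z - normc w <= normc (z - w).
Proof. by rewrite lerBlDr (le_trans _ (le_normcD _ _))// subrK. Qed.

Lemma normc_gt0 z : z != 0 -> 0 < normc z.
Proof.
move=> z0; rewrite lt_neqAle normc_ge0 andbT eq_sym.
by apply: contra_neq z0 => /Normc.eq0_normc.
Qed.

Lemma cisD (a b : R) : cis (a + b) = cis a * cis b.
Proof. by apply: complex_ext; rewrite /cis ?ReM ?ImM/= ?cosD ?sinD// addrC. Qed.

Lemma cis0 : cis 0 = 1 :> R[i].
Proof. by rewrite /cis cos0 sin0. Qed.

Lemma normc_cis (a : R) : normc (cis a) = 1.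
Proof. by rewrite /cis /= cos2Dsin2 sqrtr1. Qed.

Lemma conjc_cis (a : R) : conjc (cis a) = cis (- a).
Proof. by rewrite /cis /= cosN sinN. Qed.

End normc_theory.

Section cmeasurable.
Context d (T : measurableType d) {R : realType}.
Implicit Types f g : T -> R[i].

Definition cmeas f := measurable_fun [set: T] (fun x => complex.Re (f x)) /\
  measurable_fun [set: T] (fun x => complex.Im (f x)).

Lemma cmeas_cst (c : R[i]) : cmeas (fun=> c).
Proof. by split; exact: measurable_cst. Qed.

Lemma cmeasD f g : cmeas f -> cmeas g -> cmeas (fun x => f x + g x).
Proof.
move=> [f1 f2] [g1 g2]; split.
  by under eq_fun do rewrite ReD; exact: measurable_funD.
by under eq_fun do rewrite ImD; exact: measurable_funD.
Qed.

Lemma cmeasN f : cmeas f -> cmeas (fun x => - f x).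
Proof.
move=> [f1 f2]; split.
  by under eq_fun do rewrite ReN; exact: measurable_funN.
by under eq_fun do rewrite ImN; exact: measurable_funN.
Qed.

Lemma cmeasB f g : cmeas f -> cmeas g -> cmeas (fun x => f x - g x).
Proof. by move=> mf mg; apply: cmeasD => //; exact: cmeasN. Qed.

Lemma cmeasM f g : cmeas f -> cmeas g -> cmeas (fun x => f x * g x).
Proof.
move=> [f1 f2] [g1 g2]; split.
  by under eq_fun do rewrite ReM; apply: measurable_funB; exact: measurable_funM.
by under eq_fun do rewrite ImM; apply: measurable_funD; exact: measurable_funM.
Qed.

Lemma cmeas_real (h : T -> R) : measurable_fun [set: T] h -> cmeas (fun x => (h x)%:C).
Proof. by move=> mh; split => //; exact: measurable_cst. Qed.

Lemma cmeas_conj f : cmeas f -> cmeas (fun x => conjc (f x)).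
Proof.
move=> [f1 f2]; split; first by under eq_fun do rewrite Re_conj.
by under eq_fun do rewrite Im_conj; exact: measurable_funN.
Qed.

Lemma measurable_normc f : cmeas f -> measurable_fun [set: T] (fun x => normc (f x)).
Proof.
move=> [f1 f2]; under eq_fun do rewrite normcE2.
apply: (measurableT_comp (continuous_measurable_fun (@sqrt_continuous R))).
by apply: measurable_funD; exact: measurable_funX.
Qed.

Lemma cmeas_cis (h : T -> R) : measurable_fun [set: T] h -> cmeas (fun x => cis (h x)).
Proof.
move=> mh; split => /=.
  exact: (measurableT_comp (continuous_measurable_fun (@continuous_cos R))).
exact: (measurableT_comp (continuous_measurable_fun (@continuous_sin R))).
Qed.

End cmeasurable.

Lemma cmeas_comp d d' (S : measurableType d) (T : measurableType d') (R : realType)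
    (f : T -> R[i]) (h : S -> T) :
  cmeas f -> measurable_fun [set: S] h -> cmeas (fun x => f (h x)).
Proof. by move=> [f1 f2] mh; split; [exact: (measurableT_comp f1)|exact: (measurableT_comp f2)]. Qed.

Section cintegral.
Context {R : realType} {n : nat}.
Local Notation leb := (@lebesgue_rV R n).
Local Notation V := 'rV[R]_n.
Implicit Types f g : V -> R[i].

(** Borel measurability is built in for the sake of Fubini and of affine substitutions; Lebesgue
    measurable functions are first replaced by means of [clmeasurable_cmeas]. *)
Definition cL1 f := cmeas f /\ (\int[leb]_x (normc (f x))%:E < +oo)%E.

Definition norm1 f : R := fine (\int[leb]_x (normc (f x))%:E)%E.

Lemma norm1E f : cL1 f -> (\int[leb]_x (normc (f x))%:E = (norm1 f)%:E)%E.
Proof.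
move=> [_ fo]; rewrite /norm1 fineK// ge0_fin_numE//.
by apply: integral_ge0 => x _; rewrite lee_fin normc_ge0.
Qed.

Lemma norm1_ge0 f : 0 <= norm1 f.
Proof. by apply: fine_ge0; apply: integral_ge0 => x _; rewrite lee_fin normc_ge0. Qed.

Lemma cL1_dom f (F : V -> R) : cmeas f -> (forall x, normc (f x) <= F x) ->
  (\int[leb]_x (F x)%:E < +oo)%E -> cL1 f.
Proof.
move=> mf fF Foo; split => //; apply: le_lt_trans Foo.
by apply: ge0_le_lower_integral => x; rewrite lee_fin ?normc_ge0.
Qed.

Lemma cL1_integrable_Re f : cL1 f -> leb.-integrable setT (EFin \o (fun x => complex.Re (f x))).
Proof.
move=> [[f1 f2] fo]; apply/integrableP; split; first exact/measurable_EFinP.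
apply: le_lt_trans fo; apply: ge0_le_lower_integral => x //=.
by rewrite lee_fin normr_Re_le.
Qed.

Lemma cL1_integrable_Im f : cL1 f -> leb.-integrable setT (EFin \o (fun x => complex.Im (f x))).
Proof.
move=> [[f1 f2] fo]; apply/integrableP; split; first exact/measurable_EFinP.
apply: le_lt_trans fo; apply: ge0_le_lower_integral => x //=.
by rewrite lee_fin normr_Im_le.
Qed.

Lemma cL1_integrable_normc f : cL1 f -> leb.-integrable setT (EFin \o (fun x => normc (f x))).
Proof.
move=> [mf fo]; apply/integrableP; split; first by apply/measurable_EFinP; exact: measurable_normc.
by under eq_integral do rewrite /= ger0_norm ?normc_ge0//.
Qed.

Lemma cL1D f g : cL1 f -> cL1 g -> cL1 (fun x => f x + g x).
Proof.
move=> f1 g1; apply: (@cL1_dom _ (fun x => normc (f x) + normc (g x))).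
- by apply: cmeasD; [exact: f1.1|exact: g1.1].
- by move=> x; exact: le_normcD.
- under eq_integral do rewrite EFinD.
  rewrite ge0_integralD//; last 4 first.
  + by move=> x _; rewrite lee_fin normc_ge0.
  + by apply/measurable_EFinP; exact: measurable_normc f1.1.
  + by move=> x _; rewrite lee_fin normc_ge0.
  + by apply/measurable_EFinP; exact: measurable_normc g1.1.
  by rewrite lte_add_pinfty//; [exact: f1.2|exact: g1.2].
Qed.

Lemma cL1M_bounded f g (C : R) : cL1 f -> cmeas g -> (forall x, normc (g x) <= C) ->
  cL1 (fun x => f x * g x).
Proof.
move=> f1 mg gC; have C0 : 0 <= C by apply: le_trans (gC 0); exact: normc_ge0.
apply: (@cL1_dom _ (fun x => C * normc (f x))).
- by apply: cmeasM => //; exact: f1.1.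
- by move=> x; rewrite Normc.normcM mulrC ler_wpM2r ?normc_ge0.
- under eq_integral do rewrite EFinM.
  rewrite ge0_integralZl//; last 2 first.
  + by apply/measurable_EFinP; exact: measurable_normc f1.1.
  + by move=> x _; rewrite lee_fin normc_ge0.
  by rewrite lte_mul_pinfty// f1.2.
Qed.

Lemma cL1Z (c : R[i]) f : cL1 f -> cL1 (fun x => c * f x).
Proof.
move=> f1; under eq_fun do rewrite mulrC.
by apply: (@cL1M_bounded _ _ (normc c)) => //; exact: cmeas_cst.
Qed.

Lemma cL1Zr (c : R[i]) f : cL1 f -> cL1 (fun x => f x * c).
Proof.
by move=> f1; apply: (@cL1M_bounded _ _ (normc c)) => //; exact: cmeas_cst.
Qed.

Lemma cL1N f : cL1 f -> cL1 (fun x => - f x).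
Proof.
by move=> f1; under eq_fun do rewrite -mulN1r; exact: cL1Z.
Qed.

Lemma cL1B f g : cL1 f -> cL1 g -> cL1 (fun x => f x - g x).
Proof. by move=> f1 g1; apply: cL1D => //; exact: cL1N. Qed.

Lemma cL10 : cL1 (fun=> 0).
Proof.
split; first exact: cmeas_cst.
by under eq_integral do rewrite Normc.normc0; rewrite integral0.
Qed.

Lemma cL1_sum (I : Type) (r : seq I) (F : I -> V -> R[i]) : (forall i, cL1 (F i)) ->
  cL1 (fun x => \sum_(i <- r) F i x).
Proof.
move=> mF; elim: r => [|i r IH].
  by under eq_fun do rewrite big_nil; exact: cL10.
by under eq_fun do rewrite big_cons; exact: cL1D.
Qed.

Lemma eq_cint f g : f =1 g -> cint f = cint g.
Proof. by move=> /funext ->. Qed.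

Lemma cintD f g : cL1 f -> cL1 g -> cint (fun x => f x + g x) = cint f + cint g.
Proof.
move=> f1 g1; apply: complex_ext; rewrite /cint ?ReD ?ImD /=.
  under eq_Rintegral do rewrite ReD.
  by rewrite RintegralD//; exact: cL1_integrable_Re.
under eq_Rintegral do rewrite ImD.
by rewrite RintegralD//; exact: cL1_integrable_Im.
Qed.

Lemma cintZ (c : R[i]) f : cL1 f -> cint (fun x => c * f x) = c * cint f.
Proof.
move=> f1; apply: complex_ext; rewrite /cint ?ReM ?ImM /=.
  under eq_Rintegral do rewrite ReM.
  rewrite RintegralB//; first last.
  - exact: (integrableZl measurableT (complex.Im c) (cL1_integrable_Im f1)).
  - exact: (integrableZl measurableT (complex.Re c) (cL1_integrable_Re f1)).
  by rewrite !RintegralZl//; [exact: cL1_integrable_Im|exact: cL1_integrable_Re].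
under eq_Rintegral do rewrite ImM.
rewrite RintegralD//; first last.
- exact: (integrableZl measurableT (complex.Im c) (cL1_integrable_Re f1)).
- exact: (integrableZl measurableT (complex.Re c) (cL1_integrable_Im f1)).
by rewrite !RintegralZl//; [exact: cL1_integrable_Re|exact: cL1_integrable_Im].
Qed.

Lemma cintZr (c : R[i]) f : cL1 f -> cint (fun x => f x * c) = cint f * c.
Proof. by move=> f1; rewrite [RHS]mulrC -cintZ//; apply: eq_cint => x; rewrite mulrC. Qed.

Lemma cintN f : cL1 f -> cint (fun x => - f x) = - cint f.
Proof. by move=> f1; rewrite -mulN1r -cintZ//; apply: eq_cint => x; rewrite mulN1r. Qed.

Lemma cintB f g : cL1 f -> cL1 g -> cint (fun x => f x - g x) = cint f - cint g.
Proof. by move=> f1 g1; rewrite cintD// ?cintN//; exact: cL1N. Qed.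

Lemma cint0 : @cint R n (fun=> 0) = 0.
Proof.
transitivity (0 * @cint R n (fun=> 0)); last by rewrite mul0r.
by rewrite -cintZ; [apply: eq_cint => x; rewrite mulr0|exact: cL10].
Qed.

Lemma cint_sum (I : Type) (r : seq I) (F : I -> V -> R[i]) : (forall i, cL1 (F i)) ->
  cint (fun x => \sum_(i <- r) F i x) = \sum_(i <- r) cint (F i).
Proof.
move=> mF; elim: r => [|i r IH].
  by rewrite [RHS]big_nil -[RHS]cint0; apply: eq_cint => x; rewrite big_nil.
rewrite big_cons -IH -cintD//; last exact: cL1_sum.
by apply: eq_cint => x; rewrite big_cons.
Qed.

Lemma cint_conj f : cL1 f -> cint (fun x => conjc (f x)) = conjc (cint f).
Proof.
move=> f1; apply: complex_ext; rewrite /cint ?Re_conj ?Im_conj /=.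
  by apply: eq_Rintegral => x _; rewrite Re_conj.
under eq_Rintegral do rewrite Im_conj -mulN1r.
by rewrite RintegralZl// ?mulN1r//; exact: cL1_integrable_Im.
Qed.

(** Multiplication by the conjugate of the integral z makes it real: [|z|^2] is the integral of the
    real part of [conjc z * f], hence at most [|z|] times the norm of f. *)
Lemma normc_cint_le f : cL1 f -> normc (cint f) <= norm1 f.
Proof.
move=> f1; set z := cint f.
have [z0|z0] := eqVneq z 0; first by rewrite z0 Normc.normc0 norm1_ge0.
have zp := normc_gt0 z0.
rewrite -(ler_pM2l zp) -expr2.
have -> : normc z ^+ 2 = complex.Re (cint (fun x => conjc z * f x)).
  by rewrite cintZ// -/z normc_conjM.
rewrite /cint /=.
have f2 := cL1Z (conjc z) f1.
rewrite /norm1 -/(Rintegral leb setT (fun x => normc (f x))) -RintegralZl//; last exact: cL1_integrable_normc.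
apply: le_Rintegral => //.
- exact: cL1_integrable_Re f2.
- exact: (integrableZl measurableT (normc z) (cL1_integrable_normc f1)).
- move=> x _; apply: le_trans (ler_norm _) _; apply: le_trans (normr_Re_le _) _.
  have H : normc (conjc z * f x) <= normc z * normc (f x) by rewrite Normc.normcM normc_conj.
  exact: H.
Qed.

Lemma norm1_le f (F : V -> R) (C : R) : cL1 f -> (forall x, normc (f x) <= F x) ->
  (\int[leb]_x (F x)%:E <= C%:E)%E -> norm1 f <= C.
Proof.
move=> f1 fF FC; rewrite -lee_fin -norm1E//; apply: le_trans FC.
by apply: ge0_le_lower_integral => x; rewrite lee_fin ?normc_ge0.
Qed.

Lemma cint_affine (s : R) (v : V) f : s != 0 -> cmeas f ->
  cint (fun x => f (s *: x + v)) = (`|s| ^- n)%:C * cint f.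
Proof.
move=> s0 [f1 f2]; apply: complex_ext; rewrite /cint ?ReM ?ImM /= ?mul0r ?subr0 ?addr0.
  by rewrite (Rintegral_rV_affine v s0 f1).
by rewrite (Rintegral_rV_affine v s0 f2).
Qed.

Lemma cmeas_affine (s : R) (v : V) f : cmeas f -> cmeas (fun x : V => f (s *: x + v)).
Proof. by move=> mf; apply: (cmeas_comp mf); exact: measurable_affine_rV. Qed.

Lemma cL1_affine (s : R) (v : V) f : s != 0 -> cL1 f -> cL1 (fun x => f (s *: x + v)).
Proof.
move=> s0 [mf fo]; split; first exact: cmeas_affine.
rewrite (@ge0_integral_rV_affine _ _ s v (fun x => (normc (f x))%:E) s0)//.
- by rewrite lte_mul_pinfty// lee_fin invr_ge0 exprn_ge0.
- by apply/measurable_EFinP; exact: measurable_normc.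
- by move=> x; rewrite lee_fin normc_ge0.
Qed.

Lemma cint_shift (v : V) f : cmeas f -> cint (fun x => f (x + v)) = cint f.
Proof.
move=> mf; rewrite -[RHS]mul1r.
have := @cint_affine 1 v f (oner_neq0 _) mf; rewrite normr1 expr1n invr1 => <-.
by apply: eq_cint => x; rewrite scale1r.
Qed.

Lemma cL1_shift (v : V) f : cL1 f -> cL1 (fun x => f (x + v)).
Proof.
by move=> f1; have := @cL1_affine 1 v f (oner_neq0 _) f1; under eq_fun do rewrite scale1r.
Qed.

Lemma cint_reflect (v : V) f : cmeas f -> cint (fun x => f (v - x)) = cint f.
Proof.
move=> mf; have N1 : (-1 : R) != 0 by rewrite oppr_eq0 oner_neq0.
have := @cint_affine (-1) v f N1 mf; rewrite normrN1 expr1n invr1 mul1r => <-.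
by apply: eq_cint => x; rewrite scaleN1r addrC.
Qed.

Lemma cL1_reflect (v : V) f : cL1 f -> cL1 (fun x => f (v - x)).
Proof.
move=> f1; have N1 : (-1 : R) != 0 by rewrite oppr_eq0 oner_neq0.
have := @cL1_affine (-1) v f N1 f1; congr cL1; apply/funext => x.
by rewrite scaleN1r addrC.
Qed.

(** Real dominated convergence is applied to [normc (f_ m x - f x)], which [2 F] dominates. *)
Lemma cint_dct (f_ : nat -> V -> R[i]) f (F : V -> R) : (forall m, cmeas (f_ m)) -> cmeas f ->
  (forall x, (fun m => normc (f_ m x - f x)) @ \oo --> (0 : R)) ->
  (forall m x, normc (f_ m x) <= F x) -> (forall x, normc (f x) <= F x) ->
  leb.-integrable setT (EFin \o F) ->
  (fun m => normc (cint (f_ m) - cint f)) @ \oo --> (0 : R).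
Proof.
move=> mf_ mf f_f f_F fF iF.
have Foo : (\int[leb]_x (F x)%:E < +oo)%E by exact: integrable_lty.
have f_1 m : cL1 (f_ m) by exact: cL1_dom (f_F m) Foo.
have f1 : cL1 f by exact: cL1_dom fF Foo.
have [|||||_ _] := @dominated_convergence _ _ _ leb setT measurableT
  (fun m x => (normc (f_ m x - f x))%:E) (fun=> 0%E) (fun x => (2 * F x)%:E).
- by move=> m; apply/measurable_EFinP; apply: measurable_normc; exact: cmeasB.
- exact: measurable_cst.
- by apply: aeW => x _; apply/cvg_EFin => //; [exact: nearW|exact: f_f].
- exact: (integrableZl measurableT 2 iF).
- apply: aeW => x m _; rewrite /= lee_fin ger0_norm ?normc_ge0//.
  by rewrite (le_trans (le_normcD _ _))// normcN mulrDl mul1r lerD.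
rewrite integral0 => H.
have H' : (fun m => norm1 (fun x => f_ m x - f x)) @ \oo --> (0 : R).
  exact: (fine_cvg H).
apply: (@squeeze_cvgr _ _ _ _ (fun=> 0) (fun m => norm1 (fun x => f_ m x - f x))) => //.
- apply: nearW => m; rewrite normc_ge0 -(cintB (f_1 m) f1).
  by apply: normc_cint_le; exact: cL1B.
- exact: cvg_cst.
Qed.

End cintegral.

(** * Fubini's theorem for complex integrands *)

Section cfubini.
Context {R : realType} {n m : nat}.
Local Notation V := 'rV[R]_n.
Local Notation W := 'rV[R]_m.
Variable F : V -> W -> R[i].
Hypotheses (mF : cmeas (fun z => F z.1 z.2))
  (Foo : (\int[lebesgue_rV n]_x \int[lebesgue_rV m]_y (normc (F x y))%:E < +oo)%E)
  (F1 : forall x, cL1 (fun y => F x y)) (F2 : forall y, cL1 (fun x => F x y)).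

Let iRe : (lebesgue_rV n \x lebesgue_rV m)%E.-integrable setT (fun z => (complex.Re (F z.1 z.2))%:E).
Proof.
apply/integrable12ltyP; first by apply/measurable_EFinP; exact: mF.1.
apply: le_lt_trans Foo; apply: ge0_le_lower_integral => x; first exact: integral_ge0.
by apply: ge0_le_lower_integral => y //=; rewrite lee_fin normr_Re_le.
Qed.

Let iIm : (lebesgue_rV n \x lebesgue_rV m)%E.-integrable setT (fun z => (complex.Im (F z.1 z.2))%:E).
Proof.
apply/integrable12ltyP; first by apply/measurable_EFinP; exact: mF.2.
apply: le_lt_trans Foo; apply: ge0_le_lower_integral => x; first exact: integral_ge0.
by apply: ge0_le_lower_integral => y //=; rewrite lee_fin normr_Im_le.
Qed.

Let E1 (h : R[i] -> R) : (forall x, (lebesgue_rV m).-integrable setT (EFin \o (fun y => h (F x y)))) ->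
  forall x, (\int[lebesgue_rV m]_y h (F x y))%:E = (\int[lebesgue_rV m]_y (h (F x y))%:E)%E.
Proof. by move=> H x; rewrite /Rintegral fineK//; exact: (integrable_fin_num _ (H x)). Qed.

Let E2 (h : R[i] -> R) : (forall y, (lebesgue_rV n).-integrable setT (EFin \o (fun x => h (F x y)))) ->
  forall y, (\int[lebesgue_rV n]_x h (F x y))%:E = (\int[lebesgue_rV n]_x (h (F x y))%:E)%E.
Proof. by move=> H x; rewrite /Rintegral fineK//; exact: (integrable_fin_num _ (H x)). Qed.

Let inner_Re := E1 (fun x => cL1_integrable_Re (F1 x)).
Let inner_Im := E1 (fun x => cL1_integrable_Im (F1 x)).

Lemma cL1_fubini : cL1 (fun x => cint (fun y => F x y)).
Proof.
split.
- split; rewrite /cint /=.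
    apply/measurable_EFinP; rewrite (_ : _ \o _ = fubini_F (lebesgue_rV m) (fun z => (complex.Re (F z.1 z.2))%:E)).
      exact: (measurable_fubini_F iRe).
    by apply/funext => x; rewrite /= inner_Re.
  apply/measurable_EFinP; rewrite (_ : _ \o _ = fubini_F (lebesgue_rV m) (fun z => (complex.Im (F z.1 z.2))%:E)).
    exact: (measurable_fubini_F iIm).
  by apply/funext => x; rewrite /= inner_Im.
- apply: le_lt_trans Foo; apply: ge0_le_lower_integral => x; first by rewrite lee_fin normc_ge0.
  by rewrite (norm1E (F1 x)) lee_fin normc_cint_le.
Qed.

Lemma cfubini : cint (fun x => cint (fun y => F x y)) = cint (fun y => cint (fun x => F x y)).
Proof.
apply: complex_ext; rewrite /cint /Rintegral /=; congr fine.
  under eq_integral do rewrite inner_Re.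
  under [RHS]eq_integral do rewrite (E2 (fun y => cL1_integrable_Re (F2 y))).
  exact: (Fubini iRe).
under eq_integral do rewrite inner_Im.
under [RHS]eq_integral do rewrite (E2 (fun y => cL1_integrable_Im (F2 y))).
exact: (Fubini iIm).
Qed.

End cfubini.

(** * Characters and the Fourier transform *)

Section fourier_basics.
Context {R : realType} {n : nat}.
Local Notation leb := (@lebesgue_rV R n).
Local Notation V := 'rV[R]_n.
Implicit Types f g : V -> R[i].

Definition chr (x xi : V) : R[i] := cis (2 * pi * dotp x xi).

Lemma chrDl x y xi : chr (x + y) xi = chr x xi * chr y xi.
Proof. by rewrite /chr dotpDl mulrDr cisD. Qed.

Lemma chrDr x y xi : chr xi (x + y) = chr xi x * chr xi y.
Proof. by rewrite /chr dotpDr mulrDr cisD. Qed.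

Lemma chrC x y : chr x y = chr y x.
Proof. by rewrite /chr dotpC. Qed.

Lemma chr0 x : chr x 0 = 1.
Proof. by rewrite /chr -(scale0r x) dotpZr mul0r mulr0 cis0. Qed.

Lemma chrZl s x y : chr (s *: x) y = chr x (s *: y).
Proof. by rewrite /chr dotpZl dotpZr. Qed.

Lemma chrN x y : chr (- x) y = chr x (- y).
Proof. by rewrite -scaleN1r chrZl scaleN1r. Qed.

Lemma chrNM x y : chr (- x) y * chr x y = 1.
Proof. by rewrite -chrDl addNr chrC chr0. Qed.

Lemma dotpNl (x y : V) : dotp (- x) y = - dotp x y.
Proof. by rewrite -scaleN1r dotpZl mulN1r. Qed.

Lemma conj_chr x y : conjc (chr x y) = chr (- x) y.
Proof. by rewrite /chr conjc_cis dotpNl mulrN. Qed.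

Lemma normc_chr x y : normc (chr x y) = 1.
Proof. exact: normc_cis. Qed.

Lemma fourierE f xi : fourier f xi = cint (fun x => f x * chr (- x) xi).
Proof.
by apply: eq_cint => x; rewrite /chr dotpNl mulrN.
Qed.

Lemma measurable_dotp : measurable_fun [set: V * V] (fun z : V * V => dotp z.1 z.2).
Proof.
rewrite /dotp; apply: measurable_sum => i; apply: measurable_funM.
  exact: (measurableT_comp (measurable_coord_rV i) measurable_fst).
exact: (measurableT_comp (measurable_coord_rV i) measurable_snd).
Qed.

Lemma cmeas_chr2 : cmeas (fun z : V * V => chr z.1 z.2).
Proof. by apply: cmeas_cis; apply: measurable_funM => //; exact: measurable_dotp. Qed.

Lemma measurable_rVD d (S : measurableType d) (f g : S -> V) :
  measurable_fun setT f -> measurable_fun setT g -> measurable_fun setT (fun x => f x + g x).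
Proof.
move=> mf mg; apply: measurable_fun_rV => i.
rewrite (_ : _ \o _ = (fun x => coord_rV i (f x) + coord_rV i (g x))%R); last first.
  by apply/funext => x; rewrite /= /coord_rV mxE.
by apply: measurable_funD; apply: (measurableT_comp (measurable_coord_rV i)).
Qed.

Lemma measurable_rVZ d (S : measurableType d) (s : R) (f : S -> V) :
  measurable_fun setT f -> measurable_fun setT (fun x => s *: f x).
Proof.
move=> mf; apply: measurable_fun_rV => i.
rewrite (_ : _ \o _ = (fun x => s * coord_rV i (f x))%R); last first.
  by apply/funext => x; rewrite /= /coord_rV mxE.
by apply: measurable_funM => //; apply: (measurableT_comp (measurable_coord_rV i)).
Qed.

Lemma measurable_rVN d (S : measurableType d) (f : S -> V) :
  measurable_fun setT f -> measurable_fun setT (fun x => - f x).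
Proof. by move=> mf; under eq_fun do rewrite -scaleN1r; exact: measurable_rVZ. Qed.

Lemma cmeas_chr d (S : measurableType d) (f g : S -> V) :
  measurable_fun setT f -> measurable_fun setT g -> cmeas (fun x => chr (f x) (g x)).
Proof.
move=> mf mg; apply: (cmeas_comp cmeas_chr2 (h := fun x => (f x, g x))).
exact: measurable_fun_pair.
Qed.

Lemma cL1_chr f (a : V -> V) y : cL1 f -> measurable_fun setT a ->
  cL1 (fun x => f x * chr (a x) y).
Proof.
move=> f1 ma; apply: (cL1M_bounded (C := 1)) => //; first exact: cmeas_chr.
by move=> x; rewrite normc_chr.
Qed.

Lemma normc_fourier_le f xi : cL1 f -> normc (fourier f xi) <= norm1 f.
Proof.
move=> f1; rewrite fourierE.
have f2 : cL1 (fun x => f x * chr (- x) xi) by apply: cL1_chr => //; exact: measurable_rVN.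
apply: le_trans (normc_cint_le f2) _.
rewrite /norm1 le_eqVlt; apply/orP; left; apply/eqP; congr fine.
by apply: eq_integral => x _; rewrite Normc.normcM normc_chr mulr1.
Qed.

End fourier_basics.

(** * Convolution and the multiplication formula *)

Section convolution.
Context {R : realType} {n : nat}.
Local Notation leb := (@lebesgue_rV R n).
Local Notation V := 'rV[R]_n.
Implicit Types f g h : V -> R[i].

Lemma measurable_rVB d (S : measurableType d) (f g : S -> V) :
  measurable_fun setT f -> measurable_fun setT g -> measurable_fun setT (fun x => f x - g x).
Proof. by move=> mf mg; apply: measurable_rVD => //; exact: measurable_rVN. Qed.

Lemma cmeas_convolve2 g h : cmeas g -> cmeas h ->
  cmeas (fun z : V * V => g (z.1 - z.2) * h z.2).
Proof.
move=> mg mh; apply: cmeasM.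
  apply: (cmeas_comp mg (h := fun z : V * V => z.1 - z.2)).
  by apply: measurable_rVB; [exact: measurable_fst|exact: measurable_snd].
exact: (cmeas_comp mh (h := snd)).
Qed.

Lemma cL1_convolve_in g h (C : R) x : cmeas g -> (forall y, normc (g y) <= C) -> cL1 h ->
  cL1 (fun y => g (x - y) * h y).
Proof.
move=> mg gC h1; under eq_fun do rewrite mulrC.
apply: (cL1M_bounded (C := C)) => //.
have := cmeas_affine (-1) x mg; congr cmeas; apply/funext => y.
by rewrite scaleN1r addrC.
Qed.

Lemma normc_convolve_le g h (C : R) x : cmeas g -> (forall y, normc (g y) <= C) -> cL1 h ->
  normc (convolve g h x) <= C * norm1 h.
Proof.
move=> mg gC h1; have c1 := cL1_convolve_in x mg gC h1.
have C0 : 0 <= C by apply: le_trans (gC 0); exact: normc_ge0.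
apply: (le_trans (normc_cint_le c1)).
apply: (@norm1_le _ _ _ (fun y => C * normc (h y))) => //.
  by move=> y; rewrite Normc.normcM ler_wpM2r ?normc_ge0.
under eq_integral do rewrite EFinM.
rewrite ge0_integralZl//; last 2 first.
  by apply/measurable_EFinP; exact: measurable_normc h1.1.
  by move=> y _; rewrite lee_fin normc_ge0.
by rewrite norm1E.
Qed.

Lemma integral_normc_translate g (y : V) : cmeas g ->
  (\int[leb]_x (normc (g (x - y)))%:E = \int[leb]_x (normc (g x))%:E)%E.
Proof.
move=> mg; have mnf : measurable_fun setT (fun x => (normc (g x))%:E).
  by apply/measurable_EFinP; exact: measurable_normc.
have := @ge0_integral_rV_affine _ _ 1 (- y) (fun x => (normc (g x))%:E) (oner_neq0 _) mnf
  (fun x => _).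
rewrite normr1 expr1n invr1 mul1e => <- //.
- by apply: eq_integral => x _; rewrite scale1r.
- by move=> x; rewrite lee_fin normc_ge0.
Qed.

(* The double integral of [|g (x - y) h y|], in the order that [cfubini] expects. *)
Lemma convolve_tonelli g h : cL1 g -> cL1 h ->
  (\int[leb]_x \int[leb]_y (normc (g (x - y) * h y))%:E < +oo)%E.
Proof.
move=> g1 h1.
have mgh := measurable_normc (cmeas_convolve2 g1.1 h1.1).
rewrite (@fubini_tonelli _ _ _ _ _ leb leb (fun z => (normc (g (z.1 - z.2) * h z.2))%:E))//; last 2 first.
- exact/measurable_EFinP.
- by move=> z; rewrite lee_fin normc_ge0.
rewrite /=.
under eq_integral.
  move=> y _.
  under eq_integral do rewrite Normc.normcM mulrC EFinM.
  rewrite ge0_integralZl//; first last.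
  - by rewrite lee_fin normc_ge0.
  - by move=> x _; rewrite lee_fin normc_ge0.
  - apply/measurable_EFinP; apply: measurable_normc.
    have := cmeas_affine 1 (- y) g1.1; congr cmeas; apply/funext => x.
    by rewrite scale1r.
  rewrite integral_normc_translate; last exact: g1.1.
  rewrite norm1E//.
  over.
rewrite ge0_integralZr//; last 3 first.
- by apply/measurable_EFinP; exact: measurable_normc h1.1.
- by move=> x _; rewrite lee_fin normc_ge0.
- by rewrite lee_fin norm1_ge0.
by rewrite norm1E// -EFinM ltry.
Qed.

Section bounded.
Variables (g h : V -> R[i]) (C : R).
Hypotheses (g1 : cL1 g) (gC : forall y, normc (g y) <= C) (h1 : cL1 h).

Lemma cL1_convolve : cL1 (convolve g h).
Proof.
apply: (@cL1_fubini _ _ _ (fun x y => g (x - y) * h y)).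
- exact: cmeas_convolve2 g1.1 h1.1.
- exact: (convolve_tonelli g1 h1).
- by move=> x; apply: (cL1_convolve_in _ g1.1 gC).
Qed.

Lemma fourier_convolve xi : fourier (convolve g h) xi = fourier g xi * fourier h xi.
Proof.
rewrite !fourierE.
transitivity (cint (fun x => cint (fun y => (g (x - y) * h y) * chr (- x) xi))).
  apply: eq_cint => x; rewrite cintZr//.
  exact: (cL1_convolve_in _ g1.1 gC).
have m3 : cmeas (fun z : V * V => g (z.1 - z.2) * h z.2 * chr (- z.1) xi).
  apply: cmeasM; first exact: cmeas_convolve2 g1.1 h1.1.
  apply: (@cmeas_chr _ _ _ _ (fun z : V * V => - z.1) (fun=> xi)) => //.
  by apply: measurable_rVN; exact: measurable_fst.
rewrite (@cfubini _ _ _ (fun x y => g (x - y) * h y * chr (- x) xi))//.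
- rewrite mulrC -cintZr; last by apply: cL1_chr => //; exact: measurable_rVN.
  apply: eq_cint => y.
  have cg : cL1 (fun x => g x * chr (- x) xi) by apply: cL1_chr => //; exact: measurable_rVN.
  transitivity (cint (fun x => h y * chr (- y) xi * (g (x - y) * chr (- (x - y)) xi))).
    apply: eq_cint => x; rewrite (_ : - x = - y - (x - y)); last by rewrite opprB addKr.
    by rewrite chrDl; ring.
  rewrite cintZ; last exact: (cL1_shift (- y) cg).
  by rewrite (@cint_shift _ _ (- y) (fun x => g x * chr (- x) xi)) //; exact: cg.1.
- apply: le_lt_trans (convolve_tonelli g1 h1).
  apply: ge0_le_lower_integral => x; first by apply: integral_ge0 => y _; rewrite lee_fin normc_ge0.
  apply: ge0_le_lower_integral => y; first by rewrite lee_fin normc_ge0.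
  by rewrite [normc (_ * chr _ _)]Normc.normcM normc_chr mulr1.
- move=> x; apply: (cL1M_bounded (C := 1)); last by move=> y; rewrite normc_chr.
    exact: (cL1_convolve_in _ g1.1 gC).
  exact: cmeas_cst.
- move=> y; apply: cL1_chr; last exact: measurable_rVN.
  by apply: cL1Zr; exact: (cL1_shift (- y) g1).
Qed.

End bounded.

Lemma normc_convolve_lip g h (K C : R) x x' : cmeas g -> (forall y, normc (g y) <= C) -> cL1 h ->
  (forall y y', normc (g y - g y') <= K * `|y - y'|) ->
  normc (convolve g h x - convolve g h x') <= K * norm1 h * `|x - x'|.
Proof.
move=> mg gC h1 gK.
have i1 := cL1_convolve_in x mg gC h1; have i2 := cL1_convolve_in x' mg gC h1.
rewrite /convolve -cintB//.
have e y : g (x - y) * h y - g (x' - y) * h y = (g (x - y) - g (x' - y)) * h y by rewrite mulrBl.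
apply: (le_trans (normc_cint_le (cL1B i1 i2))).
apply: (@norm1_le _ _ _ (fun y => K * `|x - x'| * normc (h y))); first exact: cL1B.
  move=> y; rewrite e Normc.normcM ler_wpM2r ?normc_ge0//.
  apply: le_trans (gK _ _) _.
  by rewrite (_ : x - y - (x' - y) = x - x')// opprB addrA subrK.
have K0 : 0 <= K * `|x - x'| by apply: le_trans (gK _ _); exact: normc_ge0.
under eq_integral do rewrite EFinM.
rewrite ge0_integralZl//; last 2 first.
  by apply/measurable_EFinP; exact: measurable_normc h1.1.
  by move=> y _; rewrite lee_fin normc_ge0.
by rewrite norm1E// -EFinM lee_fin mulrAC.
Qed.

(** Fubini for [f y * h xi * chr (x - y) xi]. Both the inversion formula and the reproducing kernel
    rest on it: it moves a multiplier h to an averaging kernel around x. *)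
Lemma fourier_multiplication f h x : cL1 f -> cL1 h ->
  cint (fun xi => fourier f xi * h xi * chr x xi) =
  cint (fun y => f y * fourier h (y - x)).
Proof.
move=> f1 h1.
pose F (xi y : V) := f y * h xi * chr (x - y) xi.
have mF : cmeas (fun z => F z.1 z.2).
  apply: cmeasM; last first.
    apply: (@cmeas_chr _ _ _ _ (fun z : V * V => x - z.2) fst) => //.
    by apply: measurable_rVB => //; exact: measurable_snd.
  apply: cmeasM.
    exact: (cmeas_comp f1.1 (h := snd)).
  exact: (cmeas_comp h1.1 (h := fst)).
have F1 xi : cL1 (fun y => F xi y).
  apply: (cL1M_bounded (C := 1)); last by move=> y; rewrite normc_chr.
    exact: cL1Zr.
  apply: (cmeas_chr (f := fun y : V => x - y) (g := fun=> xi)) => //.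
  exact: measurable_rVB.
have F2 y : cL1 (fun xi => F xi y).
  apply: (cL1M_bounded (C := 1)); last by move=> xi; rewrite normc_chr.
    exact: cL1Z.
  exact: (@cmeas_chr _ _ _ _ (fun=> x - y) id).
transitivity (cint (fun xi => cint (fun y => F xi y))).
  apply: eq_cint => xi; rewrite fourierE -mulrA -cintZr; last first.
    by apply: cL1_chr => //; exact: measurable_rVN.
  apply: eq_cint => y; rewrite /F chrDl; ring.
rewrite cfubini//; last first.
  apply: (@le_lt_trans _ _ (\int[leb]_xi \int[leb]_y ((normc (h xi))%:E * (normc (f y))%:E))%E).
    apply: ge0_le_lower_integral => xi; first by apply: integral_ge0 => y _; rewrite lee_fin normc_ge0.
    apply: ge0_le_lower_integral => y; first by rewrite lee_fin normc_ge0.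
    by rewrite /F !Normc.normcM [normc (chr _ _)]normc_chr mulr1 mulrC EFinM.
  under eq_integral.
    move=> xi _; rewrite ge0_integralZl//; first last.
    - by rewrite lee_fin normc_ge0.
    - by move=> y _; rewrite lee_fin normc_ge0.
    - by apply/measurable_EFinP; exact: measurable_normc f1.1.
    rewrite norm1E//.
    over.
  rewrite ge0_integralZr//; last 3 first.
  - by apply/measurable_EFinP; exact: measurable_normc h1.1.
  - by move=> y _; rewrite lee_fin normc_ge0.
  - by rewrite lee_fin norm1_ge0.
  by rewrite norm1E// -EFinM ltry.
apply: eq_cint => y; rewrite fourierE -cintZ; last first.
  by apply: cL1_chr => //; exact: measurable_rVN.
apply: eq_cint => xi; rewrite /F (_ : chr (x - y) xi = chr (- xi) (y - x)).
  by rewrite mulrA.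
by rewrite [RHS]chrC -[x - y]opprB chrN.
Qed.

Lemma fourier_dilate h (s : R) x : s != 0 -> cL1 h ->
  fourier (fun xi => h (s *: xi)) x = (`|s| ^- n)%:C * fourier h (s^-1 *: x).
Proof.
move=> s0 h1; rewrite !fourierE.
have c : cL1 (fun xi => h xi * chr (- xi) (s^-1 *: x)) by apply: cL1_chr => //; exact: measurable_rVN.
rewrite -(cint_affine 0 s0 c.1); apply: eq_cint => xi.
rewrite addr0; congr (_ * _).
by rewrite -chrZl scalerN scalerA mulVf// scale1r.
Qed.

Lemma fourier_translate f (v : V) x : cL1 f ->
  fourier (fun xi => f (xi + v)) x = chr v x * fourier f x.
Proof.
move=> f1; rewrite !fourierE.
have c : cL1 (fun xi => f xi * chr (- xi) x) by apply: cL1_chr => //; exact: measurable_rVN.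
rewrite -cintZ// -(cint_shift v (cL1Z (chr v x) c).1).
apply: eq_cint => xi; rewrite opprD chrDl mulrCA; congr (_ * _).
by rewrite mulrC -mulrA chrNM mulr1.
Qed.

End convolution.

Lemma cis_pi {R : realType} : cis pi = -1 :> R[i].
Proof. by apply: complex_ext; rewrite /cis /= ?cospi ?sinpi ?oppr0. Qed.

(** * Fourier inversion up to a constant *)

Section decay_integral.
Context {R : realType} {n : nat}.
Local Notation leb := (@lebesgue_rV R n).
Local Notation V := 'rV[R]_n.

Lemma measurable_unit_ball (r : R) : measurable [set x : V | `|x| < r].
Proof.
rewrite -[X in measurable X]setTI.
have m : measurable_fun setT (fun x : V => `|x| < r).
  by apply: measurable_fun_ltr => //; exact: measurable_normrV.
by have := m measurableT [set true] I; rewrite preimage_true.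
Qed.

Lemma lebesgue_ball_le (r : R) : 0 <= r -> (leb [set x : V | (`|x| < r)%R] <= ((2 * r) ^+ n)%:E)%E.
Proof.
move=> r0; rewrite -(lebesgue_cube (const_mx (- r))) ?mulr_ge0//.
apply: le_measure; rewrite ?inE; [exact: measurable_unit_ball|exact: measurable_cube|].
move=> x /= xr i; rewrite mxE.
have := le_lt_trans (ler_normrV x i) xr; rewrite ltr_norml => /andP[h1 h2].
by apply/andP; split; lra.
Qed.

(** The ball of radius [m + 1] has volume at most [2^n (m + 1)^n], so that a layer of height
    [(m + 1)^-(n+2)] contributes at most [2^n (m + 1)^-2]. The exponent n + 2 is chosen to leave
    this convergent series. *)
Lemma decay_integral_lty : (\int[leb]_x ((1 + `|x|) ^- (n + 2))%:E < +oo)%E.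
Proof.
pose c (m : nat) : R := m.+1%:R ^- (n + 2).
pose ind (m : nat) : V -> R := \1_([set x : V | `|x| < m.+1%:R]).
have c0 m : 0 <= c m by rewrite invr_ge0 exprn_ge0.
apply: (@le_lt_trans _ _ (\int[leb]_x \sum_(0 <= m <oo) (c m * ind m x)%:E)%E).
  apply: ge0_le_lower_integral => x; first by rewrite lee_fin invr_ge0 exprn_ge0// addr_ge0.
  pose m := Num.truncn `|x|.
  apply: (@le_trans _ _ (c m * ind m x)%:E).
    rewrite /ind indicE mem_set /=; last exact: truncnS_gt.
    rewrite mulr1 lee_fin lef_pV2 ?posrE ?exprn_gt0// ?ltr_pwDl//.
    rewrite lerXn2r ?nnegrE ?addr_ge0//.
    by rewrite -natr1 addrC lerD2l truncn_le.
  rewrite (_ : (c m * ind m x)%:E = (\sum_(m <= k < m.+1) (c k * ind k x)%:E)%E); last by rewrite big_nat1.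
  apply: le_trans (_ : (\sum_(0 <= k < m.+1) (c k * ind k x)%:E <= _)%E).
    rewrite [leRHS](@big_cat_nat _ _ _ m)//= leeDr// sume_ge0// => k _.
    by rewrite lee_fin mulr_ge0// /ind indicE.
  apply: nneseries_lim_ge => k _ _.
  by rewrite lee_fin mulr_ge0// /ind indicE.
have mi m : measurable_fun setT (fun x => (c m * ind m x)%:E).
  apply/measurable_EFinP; apply: measurable_funM => //.
  by apply: measurable_indic; exact: measurable_unit_ball.
rewrite integral_nneseries//; last by move=> m x _; rewrite lee_fin mulr_ge0// /ind indicE.
apply: (@le_lt_trans _ _ (2 ^+ n * (1 + (2 - 1)^-1))%:E); last exact: ltry.
apply: lime_le.
  by apply: is_cvg_nneseries => m _ _; apply: integral_ge0 => x _; rewrite lee_fin mulr_ge0// /ind indicE.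
apply: nearW => N.
apply: (@le_trans _ _ (\sum_(0 <= m < N) (2 ^+ n * m.+1%:R `^ (- 2))%:E)%E); last first.
  rewrite sumEFin -mulr_sumr lee_fin ler_wpM2l ?exprn_ge0//.
  by apply: riemann_sum; rewrite ltr1n.
apply: lee_sum => m _.
under eq_integral do rewrite EFinM.
rewrite ge0_integralZl//; first last.
- by rewrite lee_fin.
- by move=> x _; rewrite lee_fin /ind indicE.
- by apply/measurable_EFinP; apply: measurable_indic; exact: measurable_unit_ball.
rewrite integral_indic//; last exact: measurable_unit_ball.
rewrite setIT; apply: (le_trans (lee_wpmul2l _ (lebesgue_ball_le _))) => //; first by rewrite lee_fin.
rewrite -EFinM lee_fin /c exprMn mulrCA ler_wpM2l ?exprn_ge0//.
have m0 : 0 < m.+1%:R :> R by rewrite ltr0n.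
by rewrite powR_invn// exprD invfM mulrC mulrA mulfV ?mul1r.
Qed.

Lemma cL1_decay (f : V -> R[i]) (C : R) : cmeas f ->
  (forall x, normc (f x) <= C * (1 + `|x|) ^- (n + 2)) -> cL1 f.
Proof.
move=> mf fC; have C0 : 0 <= C.
  have := fC 0; rewrite normr0 addr0 expr1n invr1 mulr1.
  by apply: le_trans; exact: normc_ge0.
apply: (cL1_dom mf fC).
under eq_integral do rewrite EFinM.
rewrite ge0_integralZl ?lee_fin//; last first.
  apply/measurable_EFinP.
  rewrite (_ : (fun x => _) = (fun x => (1 + `|x|) `^ (- (n + 2)%:R))); last first.
    by apply/funext => x; rewrite powR_invn// addr_ge0.
  apply: (measurableT_comp (measurable_powR _)); apply: measurable_funD => //.
  exact: measurable_normrV.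
by rewrite lte_mul_pinfty// decay_integral_lty.
Qed.

End decay_integral.

(** * Tents, plateaus and the first-order decay of their transforms *)

Section plateau.
Context {R : realType} {n : nat}.
Local Notation leb := (@lebesgue_rV R n).
Local Notation V := 'rV[R]_n.

(* [plat 0] is a tent; [plat c] is 1 on the cube [|x| <= c], where [`|x|] is the maximum norm. *)
Definition plat (c : R) (x : V) : R := Num.max 0 (Num.min 1 (c + 1 - `|x|)).

Definition cplat (c : R) (x : V) : R[i] := (plat c x)%:C.

Lemma plat_ge0 c x : 0 <= plat c x.
Proof. by rewrite /plat le_max lexx. Qed.

Lemma plat_le1 c x : plat c x <= 1.
Proof. by rewrite /plat ge_max ler01 ge_min lexx. Qed.

Lemma plat1 c x : `|x| <= c -> plat c x = 1.
Proof.
move=> xc; rewrite /plat (@min_l _ _ 1) ?max_r//.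
by rewrite -addrA addrCA lerDl subr_ge0.
Qed.

Lemma plat0 c x : c + 1 <= `|x| -> plat c x = 0.
Proof.
move=> xc; rewrite /plat max_l// ge_min subr_le0 xc orbT//.
Qed.

Lemma platN c x : plat c (- x) = plat c x.
Proof. by rewrite /plat normrN. Qed.

Lemma plat_lip c x y : `|plat c x - plat c y| <= `|x - y|.
Proof.
wlog xy : x y / `|x| <= `|y|.
  move=> H; have [/H//|/ltW/H] := leP `|x| `|y|.
  by rewrite distrC [leRHS]distrC.
have h : `|y| - `|x| <= `|x - y| by rewrite distrC lerB_dist.
rewrite /plat /Num.max /Num.min; move: h.
set a := `|x| in xy *; set b := `|y| in xy *; set d := `|x - y|; move=> h.
have d0 : 0 <= d by exact: normr_ge0.
by do ![case: ifPn]; rewrite ?ltNge ?negbK; move=> *; rewrite ler_norml; apply/andP; split; lra.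
Qed.

Lemma continuous_plat c : continuous (plat c).
Proof.
move=> x; have Fx : Filter (nbhs x) by exact: nbhs_filter.
apply/(@cvgrPdist_le _ R^o _ _ Fx) => /= e e0.
near=> y; apply: (le_trans (plat_lip c x y)); near: y.
exact: cvgr_dist_le.
Unshelve. all: by end_near. Qed.

Lemma cmeas_cplat c : cmeas (cplat c).
Proof. by apply: cmeas_real; apply: continuous_measurable_rV; exact: continuous_plat. Qed.

Lemma normc_cplat c x : normc (cplat c x) = plat c x.
Proof. by rewrite normc_real ger0_norm// plat_ge0. Qed.

Lemma cL1_cplat c : 0 <= c -> cL1 (cplat c).
Proof.
move=> c0; apply: (@cL1_dom _ _ _ \1_([set x : V | `|x| < c + 1])).
- exact: cmeas_cplat.
- move=> x; rewrite normc_cplat indicE; have [h|h] := ltP `|x| (c + 1).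
    by rewrite mem_set//= plat_le1.
  by rewrite plat0.
- rewrite integral_indic//; last exact: measurable_unit_ball.
  rewrite setIT; apply: le_lt_trans (lebesgue_ball_le _) (ltry _).
  by rewrite addr_ge0.
Qed.

Lemma normc_cplat_le1 c x : normc (cplat c x) <= 1.
Proof. by rewrite normc_cplat plat_le1. Qed.

Lemma cplat_lip c x y : normc (cplat c x - cplat c y) <= 1 * `|x - y|.
Proof. by rewrite mul1r /cplat -rmorphB normc_real plat_lip. Qed.

(** The Lipschitz constant 1 times a volume: for a shift of length at most 1 both terms vanish
    outside radius c + 2. *)
Lemma plat_diff_norm1 c (v : V) : 0 <= c -> `|v| <= 1 ->
  norm1 (fun x => cplat c (x + v) - cplat c x) <= (2 * (c + 2)) ^+ n * `|v|.
Proof.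
move=> c0 v1.
apply: (@norm1_le _ _ _ (fun x => `|v| * \1_([set x : V | `|x| < c + 2]) x)).
- by apply: cL1B; [apply: cL1_shift|]; exact: cL1_cplat.
- move=> x; rewrite indicE; have [h|h] := ltP `|x| (c + 2).
    rewrite mem_set//= mulr1; apply: (le_trans (cplat_lip _ _ _)).
    by rewrite mul1r addrAC subrr add0r.
  have h1 : c + 1 <= `|x| by lra.
  have h2 : c + 1 <= `|x + v| by have := lerB_normD x v; lra.
  by rewrite /cplat (plat0 h1) (plat0 h2) subrr Normc.normc0 mulr_ge0.
- under eq_integral do rewrite EFinM.
  have mB := @measurable_unit_ball R n (c + 2).
  rewrite ge0_integralZl ?lee_fin//; last by apply/measurable_EFinP; exact: measurable_indic.
  rewrite integral_indic// setIT mulrC EFinM lee_wpmul2l ?lee_fin//.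
  by apply: lebesgue_ball_le; rewrite addr_ge0.
Qed.

Definition unit_rV (i : 'I_n) (h : R) : V := h *: delta_mx ord0 i.

Lemma norm_unit_rV i h : `|unit_rV i h| <= `|h|.
Proof.
apply/normrV_leP => // k; rewrite !mxE eqxx/= normrM.
by case: (_ == _); rewrite ?normr1 ?normr0 ?mulr1 ?mulr0.
Qed.

Lemma dotp_unit_rV i h x : dotp (unit_rV i h) x = h * x ord0 i.
Proof.
rewrite dotpZl /dotp (bigD1 i)//= mxE !eqxx mul1r big1 ?addr0// => k ki.
by rewrite mxE (negbTE ki) andbF mul0r.
Qed.

Lemma chr_half (i : 'I_n) (x : V) : x ord0 i != 0 -> chr (unit_rV i (2 * x ord0 i)^-1) x = -1.
Proof.
move=> x0; rewrite /chr dotp_unit_rV -cis_pi; congr cis.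
by field.
Qed.

(* Translating by half a period in the direction [i] turns smoothness into decay. *)
Lemma fourier_half_translate (f : V -> R[i]) (i : 'I_n) (x : V) : cL1 f -> x ord0 i != 0 ->
  fourier (fun y => f (y + unit_rV i (2 * x ord0 i)^-1) - f y) x = - 2%:R * fourier f x.
Proof.
move=> f1 x0; rewrite fourierE.
have m : measurable_fun setT (fun y : V => - y) by exact: measurable_rVN.
have fs := cL1_shift (unit_rV i (2 * x ord0 i)^-1) f1.
transitivity (fourier (fun y => f (y + unit_rV i (2 * x ord0 i)^-1)) x - fourier f x).
  rewrite !fourierE -cintB; [|exact: cL1_chr|exact: cL1_chr].
  by apply: eq_cint => y; rewrite mulrBl.
rewrite fourier_translate// chr_half//.
by rewrite mulN1r -opprD -mulr2n mulNr mulr_natl.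
Qed.

Definition plat_decay (c : R) : R := (2 * (c + 2)) ^+ n.

(** For small x the trivial bound suffices. For large x a shift by half a period, of length at most
    [1 / (2 |x|)], changes the plateau by little in L^1 and multiplies the transform by -1. Higher
    orders of decay are obtained later from convolution powers. *)
Lemma fourier_plat_decay c x : 0 <= c ->
  normc (fourier (cplat c) x) * (1 + `|x|) <= 3 * plat_decay c.
Proof.
move=> c0; have D0 : 0 <= plat_decay c by rewrite exprn_ge0// mulr_ge0// addr_ge0.
have P1 := cL1_cplat c0.
have B0 : normc (fourier (cplat c) x) <= plat_decay c.
  apply: (le_trans (normc_fourier_le _ P1)).
  apply: (@norm1_le _ _ _ (\1_([set x : V | `|x| < c + 2]))) => //.
    move=> y; rewrite normc_cplat indicE; have [h|h] := ltP `|y| (c + 2).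
      by rewrite mem_set//= plat_le1.
    by rewrite plat0//; lra.
  rewrite integral_indic//; last exact: measurable_unit_ball.
  by rewrite setIT; apply: lebesgue_ball_le; rewrite addr_ge0.
have [x1|x1] := leP `|x| 1.
  rewrite (le_trans (ler_pM (normc_ge0 _) _ B0 (_ : _ <= 2)))//; try by rewrite addr_ge0.
    by lra.
  by rewrite mulrC ler_wpM2r// ler_nat.
(* A coordinate that attains the maximum norm gives the direction of the shift. *)
have [i xi] : exists i, `|x ord0 i| = `|x|.
  have [|[k1 k2] e] := @mx_norm_neq0 R 1 n x.
    by apply: contraTneq x1 => x0; rewrite -leNgt /Num.norm/= x0.
  by exists k2; rewrite [RHS]e (ord1 k1).
have xi0 : x ord0 i != 0 by rewrite -normr_eq0 xi gt_eqF// (lt_trans ltr01).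
have := fourier_half_translate P1 xi0 => /(congr1 (@Normc.normc R)).
rewrite Normc.normcM normcN normcMn Normc.normc1 => E.
have h1 : `|unit_rV i (2 * x ord0 i)^-1| <= (2 * `|x|)^-1.
  by apply: (le_trans (norm_unit_rV _ _)); rewrite normfV normrM xi ger0_norm.
have x0 : 0 < `|x| by apply: lt_trans x1.
have h2 : (2 * `|x|)^-1 <= 1 by rewrite invf_le1 ?mulr_gt0//; lra.
have := normc_fourier_le x (cL1B (cL1_shift (unit_rV i (2 * x ord0 i)^-1) P1) P1).
rewrite E => /le_trans/(_ (plat_diff_norm1 c0 (le_trans h1 h2))).
rewrite -/(plat_decay c) => /le_trans/(_ (ler_wpM2l D0 h1)).
set F := normc _; rewrite invfM mulrA ler_pdivlMr// => H.
have F0 : 0 <= F by exact: normc_ge0.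
move: B0; rewrite -/F mulrDr mulr1; lra.
Qed.

End plateau.

Section measurable_fourier.
Context {R : realType} {n : nat}.
Local Notation leb := (@lebesgue_rV R n).
Local Notation V := 'rV[R]_n.

Lemma measurable_japanese (k : nat) : measurable_fun setT (fun x : V => (1 + `|x|) ^- k).
Proof.
rewrite (_ : (fun x => _) = (fun x => (1 + `|x|) `^ (- k%:R))); last first.
  by apply/funext => x; rewrite powR_invn// addr_ge0.
apply: (measurableT_comp (measurable_powR _)); apply: measurable_funD => //.
exact: measurable_normrV.
Qed.

(* The weight makes the double integral converge, so that Fubini applies. *)
Lemma cmeas_fourier (f : V -> R[i]) : cL1 f -> cmeas (fourier f).
Proof.
move=> f1; pose j (x : V) : R := (1 + `|x|) ^- (n + 2).
have j1 (x : V) : 0 < 1 + `|x| by apply: ltr_pwDl.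
have j0 x : 0 <= j x by rewrite invr_ge0 exprn_ge0// ltW.
have mN : measurable_fun setT (fun y : V => - y) by exact: measurable_rVN.
have mj : cmeas (fun x => (j x)%:C) by apply: cmeas_real; exact: measurable_japanese.
have F1 xi : cL1 (fun x => (j xi)%:C * (f x * chr (- x) xi)) by apply: cL1Z; exact: cL1_chr.
have [m _] : cL1 (fun xi => cint (fun x => (j xi)%:C * (f x * chr (- x) xi))).
  apply: (@cL1_fubini _ _ _ (fun xi x => (j xi)%:C * (f x * chr (- x) xi))) => //.
    apply: cmeasM; first exact: (cmeas_comp mj (h := fst)).
    apply: cmeasM; first exact: (cmeas_comp f1.1 (h := snd)).
    apply: (@cmeas_chr _ _ _ _ (fun z : V * V => - z.2) fst) => //.
    by apply: measurable_rVN; exact: measurable_snd.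
  apply: (@le_lt_trans _ _ (\int[leb]_xi ((j xi)%:E * (norm1 f)%:E))%E).
    apply: ge0_le_lower_integral => xi; first by apply: integral_ge0 => y _; rewrite lee_fin normc_ge0.
    rewrite -norm1E// -ge0_integralZl ?lee_fin//; last 2 first.
    - by apply/measurable_EFinP; exact: measurable_normc f1.1.
    - by move=> x _; rewrite lee_fin normc_ge0.
    apply: ge0_le_lower_integral => y; first by rewrite lee_fin normc_ge0.
    by rewrite !Normc.normcM normc_chr mulr1 normc_real ger0_norm.
  rewrite ge0_integralZr ?lee_fin ?norm1_ge0//; last 2 first.
  - by apply/measurable_EFinP; exact: measurable_japanese.
  - by move=> x _; rewrite lee_fin.
  by rewrite muleC lte_mul_pinfty ?lee_fin ?norm1_ge0 ?decay_integral_lty.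
rewrite (_ : fourier f = fun xi => ((1 + `|xi|) ^+ (n + 2))%:C *
    cint (fun x => (j xi)%:C * (f x * chr (- x) xi))).
  apply: cmeasM m; apply: cmeas_real; apply: measurable_funX.
  by apply: measurable_funD => //; exact: measurable_normrV.
apply/funext => xi; rewrite cintZ; last exact: cL1_chr.
by rewrite fourierE mulrA -rmorphM /= mulfV ?mul1r// gt_eqF// exprn_gt0.
Qed.

End measurable_fourier.

(* [bump 0 (bump_deg n)] has 2 n + 4 factors: its transform is a nonnegative even power of the one
   of the tent, and decays faster than the integrable [|x|^-(n+1)]. *)
Definition bump_deg (n : nat) : nat := (2 * n + 3)%N.

(** * Convolution powers of the tent and the summability kernel *)

Section bump.
Context {R : realType} {n : nat}.
Local Notation leb := (@lebesgue_rV R n).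
Local Notation V := 'rV[R]_n.

Lemma integral_indic_cube (x : V) (l : R) : 0 <= l ->
  (\int[leb]_y (\1_(cube x l) y)%:E = (l ^+ n)%:E)%E.
Proof.
move=> l0; have mQ := measurable_cube x l.
by rewrite integral_indic// setIT; exact: lebesgue_cube.
Qed.

Lemma integrable_indic_cube (x : V) (l : R) : 0 <= l ->
  integrable leb setT (EFin \o \1_(cube x l)).
Proof.
move=> l0; have mQ := measurable_cube x l; apply/integrableP; split.
  by apply/measurable_EFinP; exact: measurable_indic.
under eq_integral do rewrite /= ger0_norm//.
by rewrite integral_indic_cube// ltry.
Qed.

(** Convolution with k tents multiplies the transform by the k-th power of that of the tent, which
    buys k orders of decay, and keeps the function constant on a smaller cube. With c = 0 it yields
    the approximate identity, with a large c a multiplier that is constant on a given spectrum. *)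
Definition bump (c : R) (k : nat) : V -> R[i] := iter k (convolve (cplat 0)) (cplat c).

Lemma cL1_bump c k : 0 <= c -> cL1 (bump c k).
Proof.
move=> c0; elim: k => [|k IH]; first exact: cL1_cplat.
by apply: (cL1_convolve (C := 1)) => //; [exact: cL1_cplat|exact: normc_cplat_le1].
Qed.

Lemma fourier_bump c k x : 0 <= c ->
  fourier (bump c k) x = fourier (cplat 0) x ^+ k * fourier (cplat c) x.
Proof.
move=> c0; elim: k => [|k IH]; first by rewrite expr0 mul1r.
rewrite /bump iterS (fourier_convolve (C := 1)) //.
- by rewrite -/(bump c k) IH exprS mulrA.
- exact: cL1_cplat.
- exact: normc_cplat_le1.
- exact: cL1_bump.
Qed.

Lemma bump_bounded c k : 0 <= c -> exists2 C, 0 <= C & forall x, normc (bump c k x) <= C.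
Proof.
move=> c0; case: k => [|k]; first by exists 1 => // x; exact: normc_cplat_le1.
exists (1 * norm1 (bump c k)); first by rewrite mulr_ge0 ?norm1_ge0.
move=> x; apply: normc_convolve_le; [exact: cmeas_cplat|exact: normc_cplat_le1|exact: cL1_bump].
Qed.

Lemma bump_lip c k : 0 <= c -> exists2 K, 0 <= K &
  forall x y, normc (bump c k x - bump c k y) <= K * `|x - y|.
Proof.
move=> c0; case: k => [|k]; first by exists 1 => // x y; exact: cplat_lip.
exists (1 * norm1 (bump c k)); first by rewrite mulr_ge0 ?norm1_ge0.
move=> x y; apply: (normc_convolve_lip (C := 1)).
- exact: cmeas_cplat.
- exact: normc_cplat_le1.
- exact: cL1_bump.
- exact: cplat_lip.
Qed.

(** The tent lives on the unit ball of the maximum norm, so each convolution shrinks the flat region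
    by 1 and multiplies the constant by the integral of the tent. *)
Lemma bump_flat c k (x : V) : 0 <= c -> `|x| <= c - k%:R -> bump c k x = cint (@cplat R n 0) ^+ k.
Proof.
move=> c0; elim: k x => [|k IH] x xc; first by rewrite subr0 in xc; rewrite expr0 /bump /= /cplat plat1.
rewrite /bump iterS /convolve -/(bump c k).
transitivity (cint (fun y => cplat 0 (x - y) * cint (@cplat R n 0) ^+ k)).
  apply: eq_cint => y; have [h|h] := leP 1 `|x - y|.
    by rewrite /cplat (@plat0 _ _ 0) ?add0r// !mul0r.
  rewrite IH//; have := lerB_normD y (x - y); rewrite [y + _]addrC subrK => h2.
  by move: xc; rewrite -natr1 => xc; lra.
by rewrite cintZr ?exprS ?cint_reflect//; [exact: cmeas_cplat|apply: cL1_reflect; exact: cL1_cplat].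
Qed.

(** The plateau is real and even. With real values, the even power in [fourier_bumpE] is
    nonnegative. *)
Lemma Im_fourier_cplat c x : 0 <= c -> complex.Im (fourier (@cplat R n c) x) = 0.
Proof.
move=> c0; have P1 := @cL1_cplat R n c c0.
have m : measurable_fun setT (fun y : V => - y) by exact: measurable_rVN.
suff H : conjc (fourier (cplat c) x) = fourier (cplat c) x.
  by have := Im_conj (fourier (@cplat R n c) x); rewrite H => h; lra.
rewrite fourierE -cint_conj; last exact: cL1_chr.
rewrite -[RHS](cint_reflect 0); last by have [] := cL1_chr x P1 m.
apply: eq_cint => y; rewrite sub0r opprK /cplat platN -conj_chr.
by apply: complex_ext; rewrite ?Re_conj ?Im_conj ?ReM ?ImM ?Re_conj ?Im_conj ?ReC ?ImC; ring.
Qed.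

(** Near 0 the cosine in the transform is at least 1/2 on the support of the tent, and the tent is
    at least 1/2 on the centred cube of side 1; the product of the two is the constant 1/4. *)
Lemma Re_fourier_tent : exists2 r : R, 0 < r &
  forall x, `|x| < r -> 4^-1 <= complex.Re (fourier (@cplat R n 0) x).
Proof.
have [d d0 dP] : exists2 d : R, 0 < d & forall a, `|a| < d -> 2^-1 <= cos a.
  have /cvgrPdist_lt/(_ (2^-1)) := @continuous_cos R 0.
  rewrite invr_gt0 => /(_ (ltr0Sn _ _)) /nbhs_ballP[d /= d0 dP]; exists d => // a ad.
  have := dP a; rewrite /ball /= sub0r normrN => /(_ ad).
  rewrite cos0 ltr_distlC => /andP[h _].
  by move: h; lra.
have n10 : 0 < 2 * pi * (n%:R + 1) :> R by rewrite mulr_gt0 ?mulr_gt0 ?pi_gt0// ltr_wpDl.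
(* On the support of the tent the phase is at most [2 pi n |x|], so this radius keeps it below d; n
   + 1 instead of n makes the denominator positive. *)
exists (d / (2 * pi * (n%:R + 1))); first by rewrite divr_gt0.
move=> x xr; have P1 := @cL1_cplat R n 0 (lexx 0).
have m : measurable_fun setT (fun y : V => - y) by exact: measurable_rVN.
rewrite fourierE (_ : complex.Re (cint _) = \int[leb]_y complex.Re (cplat 0 y * chr (- y) x))//.
have E1 : integrable leb setT (EFin \o (fun y => complex.Re (cplat 0 y * chr (- y) x))).
  by apply: cL1_integrable_Re; exact: cL1_chr.
have E2 : integrable leb setT (EFin \o (fun y : V => 2^-1 * plat 0 y)).
  exact: (integrableZl measurableT 2^-1 (cL1_integrable_Re P1)).
apply: (@le_trans _ _ (\int[leb]_y (2^-1 * plat 0 y))); last first.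
  have e y : complex.Re (cplat 0 y * chr (- y) x) = plat 0 y * cos (2 * pi * dotp (- y) x).
    by rewrite /cplat ReM ReC ImC mul0r subr0.
  under [leRHS]eq_Rintegral do rewrite e.
  have E1' : integrable leb setT (EFin \o (fun y => plat 0 y * cos (2 * pi * dotp (- y) x))).
    apply: eq_integrable E1 => // y _; congr EFin; exact: e.
  apply: le_Rintegral => // y _; rewrite mulrC.
  have [h|h] := leP 1 `|y|; first by rewrite plat0 ?add0r// !mul0r.
  apply: ler_wpM2l; first exact: plat_ge0.
  apply: dP; rewrite normrM.
  have h1 : `|dotp (- y) x| <= n%:R * `|x|.
    apply: (le_trans (ler_norm_sum _ _ _)).
    apply: (@le_trans _ _ (\sum_(i < n) `|x|)); last by rewrite sumr_const card_ord mulr_natl.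
    apply: ler_sum => i _; rewrite normrM mxE normrN.
    rewrite -[leRHS]mul1r ler_pM ?ler_normrV//.
    by apply: le_trans (ler_normrV _ _) (ltW h).
  rewrite ger0_norm ?mulr_ge0 ?pi_ge0//.
  rewrite ltr_pdivlMr// mulrC in xr.
  apply: le_lt_trans xr; rewrite -[leRHS]mulrA ler_wpM2l ?mulr_ge0 ?pi_ge0//.
  by apply: (le_trans h1); rewrite ler_wpM2r// lerDl.
pose Q : set V := cube (const_mx (- 2^-1)) 1.
have mQ : measurable Q by exact: measurable_cube.
have E3 : integrable leb setT (EFin \o (fun y : V => 4^-1 * \1_Q y)).
  exact: (integrableZl measurableT 4^-1 (integrable_indic_cube _ ler01)).
have -> : 4^-1 = \int[leb]_y (4^-1 * \1_Q y) :> R.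
  rewrite RintegralZl//; last exact: integrable_indic_cube.
  by rewrite /Rintegral integral_indic_cube// expr1n mulr1.
apply: le_Rintegral => // y _; rewrite indicE.
have [h|h] := boolP (y \in Q); last by rewrite mulr0 mulr_ge0 ?plat_ge0.
rewrite mulr1; have yl : `|y| <= 2^-1.
  apply/normrV_leP => // i; have := set_mem h => /(_ i).
  by rewrite mxE ler_norml => /andP[h1 h2]; apply/andP; split; lra.
suff : 2^-1 <= plat 0 y by move=> ?; lra.
by rewrite /plat le_max le_min; apply/orP; right; apply/andP; split; lra.
Qed.

Local Notation E := (bump 0 (bump_deg n)).

Local Notation K := (fourier E).

Lemma fourier_bumpE x : K x = (complex.Re (fourier (@cplat R n 0) x) ^+ (2 * (n + 2)))%:C.
Proof.
rewrite fourier_bump// -exprSr [in RHS]rmorphXn /=.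
rewrite (_ : (bump_deg n).+1 = (2 * (n + 2))%N); last by rewrite /bump_deg; lia.
congr (_ ^+ _); apply: complex_ext; rewrite ?ReC ?ImC//.
by rewrite Im_fourier_cplat.
Qed.

Lemma fourier_bump_decay : exists2 D, 0 <= D & forall x, normc (K x) <= D * (1 + `|x|) ^- (n + 2).
Proof.
pose D0 := 3 * @plat_decay R n 0.
have D00 : 0 <= D0 by rewrite mulr_ge0// exprn_ge0// mulr_ge0// addr_ge0.
exists (D0 ^+ (2 * (n + 2))); first exact: exprn_ge0.
move=> x; set y : R := 1 + `|x|.
have y1 : 1 <= y by rewrite lerDl.
have y0 : 0 < y by apply: lt_le_trans y1.
rewrite fourier_bumpE normc_real normrX.
apply: (@le_trans _ _ ((D0 / y) ^+ (2 * (n + 2)))).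
  rewrite lerXn2r ?nnegrE ?divr_ge0 ?(ltW y0)//.
  rewrite ler_pdivlMr//; apply: le_trans (fourier_plat_decay x (lexx 0)).
  by rewrite ler_wpM2r ?(ltW y0)// normr_Re_le.
rewrite exprMn ler_wpM2l ?exprn_ge0// exprVn lef_pV2 ?posrE ?exprn_gt0//.
by rewrite ler_weXn2l//; lia.
Qed.

Lemma cL1_fourier_bump : cL1 K.
Proof.
have [D D0 KD] := fourier_bump_decay; apply: cL1_decay KD.
by apply: cmeas_fourier; exact: cL1_bump.
Qed.

(** The integrand is an even power of a real number, hence nonnegative, and near 0 it is bounded
    below by a power of 1/4 on a cube of positive volume. *)
Lemma cint_fourier_bump_neq0 : cint K != 0.
Proof.
have [r r0 rP] := Re_fourier_tent.
pose Q : set V := cube (const_mx 0) (r / 2).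
have mQ : measurable Q by exact: measurable_cube.
pose c : R := 4^-1 ^+ (2 * (n + 2)).
have r20 : 0 <= r / 2 by rewrite divr_ge0 ?(ltW r0).
have iQ : integrable leb setT (EFin \o \1_Q).
  exact: integrable_indic_cube.
suff : 0 < complex.Re (cint K) by move=> h; apply/eqP => k0; rewrite k0 ltxx in h.
rewrite (_ : complex.Re (cint K) = \int[leb]_x complex.Re (K x))//.
apply: (@lt_le_trans _ _ (\int[leb]_y (c * \1_Q y))).
  rewrite RintegralZl// /Rintegral integral_indic_cube//=.
  by rewrite mulr_gt0// ?exprn_gt0// divr_gt0.
apply: le_Rintegral => //.
- exact: (integrableZl measurableT c iQ).
- exact: cL1_integrable_Re cL1_fourier_bump.
move=> y _; rewrite fourier_bumpE ReC indicE.
have [h|h] := boolP (y \in Q); last by rewrite mulr0 mulnC exprM sqr_ge0.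
rewrite mulr1 /c lerXn2r ?nnegrE//.
  apply: (@le_trans _ _ 4^-1); first by rewrite invr_ge0.
  apply: rP; apply/normrV_ltP => // i; have := set_mem h => /(_ i).
  by rewrite mxE => /andP[h1 h2]; rewrite ger0_norm//; lra.
apply: rP; apply/normrV_ltP => // i; have := set_mem h => /(_ i).
by rewrite mxE => /andP[h1 h2]; rewrite ger0_norm//; lra.
Qed.

End bump.

(** * Inversion at a point by means of an approximate identity *)

Section inversion.
Context {R : realType} {n : nat}.
Local Notation leb := (@lebesgue_rV R n).
Local Notation V := 'rV[R]_n.
Local Notation E := (@bump R n 0 (bump_deg n)).
Local Notation K := (fourier E).
Implicit Types f : V -> R[i].

Definition ccontinuous f := forall x (e : R), 0 < e ->
  exists2 d, 0 < d & forall y, `|y - x| < d -> normc (f y - f x) < e.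

Let eps (m : nat) : R := harmonic m.

Let eps_gt0 m : 0 < eps m. Proof. exact: harmonic_gt0. Qed.

Let eps_cvg0 (c e : R) : 0 < e -> \forall m \near \oo, c * eps m < e.
Proof.
move=> e0; have h : (fun m => c * eps m) @ \oo --> (0 : R).
  by rewrite -[X in _ --> X](mulr0 c); apply: cvgM; [exact: cvg_cst|exact: cvg_harmonic].
move/cvgrPdist_lt/(_ e e0) : h; apply: filterS => m.
by rewrite sub0r normrN; apply: le_lt_trans; exact: ler_norm.
Qed.

Let eps_le1 m : eps m <= 1.
Proof. by rewrite /eps /= invf_le1// ler1n. Qed.

Let cvg0P (u : nat -> R) : (forall m, 0 <= u m) ->
  (forall e, 0 < e -> \forall m \near \oo, u m < e) -> u @ \oo --> (0 : R).
Proof.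
move=> u0 H; apply/cvgrPdist_lt => e /H; apply: filterS => m um.
by rewrite sub0r normrN ger0_norm.
Qed.

Section point.
Variables (f : V -> R[i]) (x : V).
Hypotheses (f1 : cL1 f) (ff1 : cL1 (fourier f)) (fc : ccontinuous f).

Let D_ex := @fourier_bump_decay R n.
Let K1 := @cL1_fourier_bump R n.

Let B (g : V -> R[i]) (m : nat) : R[i] := cint (fun z => g (eps m *: z + x) * K z).

(** The damping factor [E (eps m * xi)] on the Fourier side becomes, by the multiplication formula
    and a rescaling, an average of f around x with the kernel K at scale [eps m]. *)
Let mean_eq m : cint (fun xi => fourier f xi * E (eps m *: xi) * chr x xi) = B f m.
Proof.
have em0 : eps m != 0 by rewrite gt_eqF.
have E1 : cL1 (fun xi => E (eps m *: xi)).
  have := cL1_affine 0 em0 (@cL1_bump R n 0 (bump_deg n) (lexx 0)).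
  by congr cL1; apply/funext => xi; rewrite addr0.
rewrite (fourier_multiplication x f1 E1).
pose F (y : V) := f y * K ((eps m)^-1 *: (y - x)).
have [D D0 KD] := D_ex.
have F1 : cL1 F.
  apply: (cL1M_bounded (C := D)) => //.
    have := cmeas_affine (eps m)^-1 (- ((eps m)^-1 *: x)) K1.1.
    by congr cmeas; apply/funext => y; rewrite scalerBr.
  move=> y; apply: le_trans (KD _) _; rewrite ler_piMr// invf_le1 ?exprn_gt0 ?ltr_pwDl//.
  by rewrite exprn_ege1// lerDl.
have := cint_affine x em0 F1.1; rewrite /B => E2.
transitivity (((`|eps m| ^- n)%:C) * cint F).
  rewrite -cintZ//; apply: eq_cint => y; rewrite fourier_dilate//; last exact: cL1_bump.
  by rewrite mulrCA.
rewrite -E2; apply: eq_cint => z.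
by rewrite /F addrK scalerA mulVf// scale1r.
Qed.

(** Dominated convergence: the bump is bounded and, being Lipschitz, [E (eps m * xi)] tends to
    [E 0]. *)
Let left_cvg : (fun m => normc (B f m - E 0 * cint (fun xi => fourier f xi * chr x xi))) @ \oo --> (0 : R).
Proof.
have [C C0 EC] := @bump_bounded R n 0 (bump_deg n) (lexx 0).
have [L L0 EL] := @bump_lip R n 0 (bump_deg n) (lexx 0).
have mE := (@cL1_bump R n 0 (bump_deg n) (lexx 0)).1.
have mc : cmeas (fun xi => chr x xi) by exact: (@cmeas_chr _ _ _ _ (fun=> x) id).
have c1 : cL1 (fun xi => fourier f xi * chr x xi).
  by apply: (cL1M_bounded (C := 1)) => // xi; rewrite normc_chr.
under eq_fun do rewrite -mean_eq.
rewrite -cintZ//.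
apply: (@cint_dct _ _ _ _ (fun xi => C * normc (fourier f xi))).
- move=> m; apply: cmeasM => //; apply: cmeasM; first exact: ff1.1.
  by have := cmeas_affine (eps m) 0 mE; congr cmeas; apply/funext => xi; rewrite addr0.
- by apply: cmeasM; [exact: cmeas_cst|exact: c1.1].
- move=> xi; apply: cvg0P => [m|e e0]; first exact: normc_ge0.
  near=> m.
  rewrite (_ : _ - _ = fourier f xi * chr x xi * (E (eps m *: xi) - E 0)); last by ring.
  rewrite !Normc.normcM normc_chr mulr1.
  apply: le_lt_trans (ler_wpM2l (normc_ge0 _) (EL _ _)) _.
  rewrite subr0 normrZ gtr0_norm//.
  rewrite (_ : _ * _ = normc (fourier f xi) * L * `|xi| * eps m); last by ring.
  by near: m; exact: eps_cvg0.
- move=> m xi; rewrite !Normc.normcM normc_chr mulr1 mulrC.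
  by rewrite ler_wpM2r ?normc_ge0.
- move=> xi; rewrite !Normc.normcM normc_chr mulr1.
  by rewrite ler_wpM2r ?normc_ge0.
- exact: (integrableZl measurableT C (cL1_integrable_normc ff1)).
Unshelve. all: by end_near. Qed.

(** The function f may be unbounded away from x, so it is cut at a distance d from x. The near part
    is bounded by [normc (f x) + 1], and dominated convergence applies. The far part only sees K at
    arguments of norm at least [d / eps m]: the decay of order n + 2 beats the Jacobian [eps^(-n)]
    and leaves [eps^2]. *)
Let right_cvg : (fun m => normc (B f m - f x * cint K)) @ \oo --> (0 : R).
Proof.
have [D D0 KD] := D_ex.
have [d d0 dP] := fc x ltr01.
pose ind (y : V) : R := \1_([set y : V | `|y| < d]) (1 *: y + - x).
have mind : measurable_fun setT ind.
  have h : measurable_fun setT (\1_([set y : V | `|y| < d]) : V -> R).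
    by apply: measurable_indic; exact: measurable_unit_ball.
  exact: (measurableT_comp h (measurable_affine_rV 1 (- x))).
have indE y : ind y = if `|y - x| < d then 1 else 0.
  rewrite /ind scale1r indicE; case: ifPn => h; first by rewrite mem_set.
  by rewrite memNset// => /= h2; rewrite h2 in h.
have ind1 y : normc (ind y)%:C <= 1 by rewrite normc_real indE; case: (_ < _); rewrite ?normr1 ?normr0.
have mi : cmeas (fun y => (ind y)%:C) by exact: cmeas_real.
pose g1 y := f y * (ind y)%:C; pose g2 y := f y - g1 y.
have g11 : cL1 g1 by exact: (cL1M_bounded f1 mi ind1).
have g21 : cL1 g2 by exact: cL1B.
have KC z : normc (K z) <= D.
  apply: le_trans (KD _) _; rewrite ler_piMr// invf_le1 ?exprn_gt0 ?ltr_pwDl//.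
  by rewrite exprn_ege1// lerDl.
have gK1 (g : V -> R[i]) m : cL1 g -> cL1 (fun z => g (eps m *: z + x) * K z).
  move=> g1'; apply: (cL1M_bounded (C := D)) => //; last exact: K1.1.
  by apply: cL1_affine => //; rewrite gt_eqF.
have Bsplit m : B f m = B g1 m + B g2 m.
  rewrite /B -cintD; [|exact: gK1|exact: gK1].
  by apply: eq_cint => z; rewrite /g2; ring.
have near1 : (fun m => normc (B g1 m - f x * cint K)) @ \oo --> (0 : R).
  rewrite -cintZ//.
  apply: (@cint_dct _ _ _ _ (fun z => (normc (f x) + 1) * normc (K z))).
  - by move=> m; exact: (gK1 g1 m g11).1.
  - by apply: cmeasM; [exact: cmeas_cst|exact: K1.1].
  - move=> z; apply: cvg0P => [m|e e0]; first exact: normc_ge0.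
    have e' : 0 < e / (D + 1) by rewrite divr_gt0// ltr_wpDl.
    have [d' d'0 d'P] := fc x e'.
    near=> m.
    have s1 : `|eps m *: z| < d.
      by rewrite normrZ gtr0_norm// mulrC; near: m; exact: eps_cvg0.
    have s2 : `|eps m *: z| < d'.
      by rewrite normrZ gtr0_norm// mulrC; near: m; exact: eps_cvg0.
    rewrite -mulrBl /g1 indE addrK s1 mulr1 Normc.normcM.
    have := d'P (eps m *: z + x); rewrite addrK => /(_ s2) h.
    apply: (@le_lt_trans _ _ (normc (f (eps m *: z + x) - f x) * (D + 1))).
      rewrite ler_wpM2l ?normc_ge0//; apply: le_trans (KC z) _.
      by rewrite lerDl.
    by rewrite -ltr_pdivlMr// ltr_wpDl.
  - move=> m z; rewrite Normc.normcM ler_wpM2r ?normc_ge0//.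
    rewrite /g1 indE Normc.normcM normc_real.
    case: ltP => h; last by rewrite normr0 mulr0 addr_ge0 ?normc_ge0.
    rewrite normr1 mulr1 -lerBlDl.
    by apply: le_trans (ler_normcB _ _) (ltW (dP _ h)).
  - move=> z; rewrite Normc.normcM ler_wpM2r ?normc_ge0//.
    by rewrite lerDl.
  - exact: (integrableZl measurableT _ (cL1_integrable_normc K1)).
have near2 : (fun m => normc (B g2 m)) @ \oo --> (0 : R).
  pose c := D * d ^- (n + 2) * norm1 g2.
  apply: cvg0P => [m|e e0]; first exact: normc_ge0.
  have alg (u : R) : u ^+ n != 0 -> D * (u / d) ^+ (n + 2) * (u ^- n * norm1 g2) = c * u ^+ 2.
    move=> u0; have e2 : d ^+ (n + 2) != 0 by rewrite gt_eqF// exprn_gt0.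
    by rewrite /c exprMn exprVn exprD; field; rewrite u0 e2.
  near=> m.
  have h : normc (B g2 m) <= c * eps m ^+ 2.
    apply: (le_trans (normc_cint_le (gK1 g2 m g21))).
    apply: (@norm1_le _ _ _ (fun z => D * (eps m / d) ^+ (n + 2) * normc (g2 (eps m *: z + x)))).
    + exact: gK1.
    + move=> z; rewrite Normc.normcM mulrC.
      have [s|s] := ltP `|eps m *: z| d.
        rewrite (_ : g2 _ = 0) ?Normc.normc0 ?mulr0//.
        by rewrite /g2 /g1 indE addrK s mulr1 subrr.
      rewrite ler_wpM2r ?normc_ge0//; apply: le_trans (KD z) _.
      rewrite ler_wpM2l// -exprVn lerXn2r ?nnegrE ?divr_ge0 ?invr_ge0 ?addr_ge0 ?(ltW (eps_gt0 m)) ?(ltW d0)//.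
      rewrite -[eps m / d]invrK lef_pV2 ?posrE ?invr_gt0 ?divr_gt0 ?ltr_pwDl//.
      rewrite invf_div ler_pdivrMr// mulrDl mul1r.
      move: s; rewrite normrZ gtr0_norm// mulrC => /le_trans; apply.
      by rewrite lerDr ltW.
    + under eq_integral do rewrite EFinM.
      rewrite ge0_integralZl//; last 3 first.
      * apply/measurable_EFinP; apply: measurable_normc.
        by apply: cmeas_affine; exact: g21.1.
      * by move=> z _; rewrite lee_fin normc_ge0.
      * by rewrite lee_fin mulr_ge0// exprn_ge0// divr_ge0 ?ltW.
      have mg2 : measurable_fun setT (fun z => (normc (g2 z))%:E).
        by apply/measurable_EFinP; apply: measurable_normc; exact: g21.1.
      rewrite (@ge0_integral_rV_affine _ _ (eps m) x (fun z => (normc (g2 z))%:E))//; last 2 first.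
      * by rewrite gt_eqF.
      * by move=> z; rewrite lee_fin normc_ge0.
      by rewrite norm1E// -!EFinM lee_fin gtr0_norm// alg// gt_eqF// exprn_gt0.
  apply: (le_lt_trans h).
  have c0 : 0 <= c by rewrite !mulr_ge0 ?invr_ge0 ?exprn_ge0 ?norm1_ge0// ltW.
  apply: (@le_lt_trans _ _ (c * eps m)).
    by rewrite ler_wpM2l// expr2 ler_piMl// ltW.
  by near: m; exact: eps_cvg0.
apply: cvg0P => [m|e e0]; first exact: normc_ge0.
have e2 : 0 < e / 2 by rewrite divr_gt0.
near=> m.
rewrite Bsplit addrAC; apply: (le_lt_trans (le_normcD _ _)).
rewrite [e]splitr ltrD//; near: m.
- move/cvgrPdist_lt/(_ _ e2) : near1; apply: filterS => m.
  by rewrite sub0r normrN ger0_norm ?normc_ge0.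
- move/cvgrPdist_lt/(_ _ e2) : near2; apply: filterS => m.
  by rewrite sub0r normrN ger0_norm ?normc_ge0.
Unshelve. all: by end_near. Qed.

(* The constant is in fact 1, but its value is irrelevant here. *)
Definition inversion_cst : R[i] := E 0 / cint K.

(** The averages [B f m] tend both to [E 0] times the inverse integral and to [f x] times the
    integral of K, and the latter is not 0. *)
Lemma fourier_inversion :
  f x = inversion_cst * cint (fun xi => fourier f xi * chr x xi).
Proof.
set J := cint _; have k0 := @cint_fourier_bump_neq0 R n.
suff : E 0 * J = f x * cint K by rewrite /inversion_cst mulrAC => ->; rewrite mulfK.
apply/eqP; rewrite -subr_eq0; apply/negPn/negP => /normc_gt0 c0.
set c := normc _ in c0.
have c2 : 0 < c / 2 by rewrite divr_gt0.
near \oo => m.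
have a1 : normc (B f m - E 0 * J) < c / 2.
  near: m; move/cvgrPdist_lt/(_ _ c2) : left_cvg; apply: filterS => m.
  by rewrite sub0r normrN ger0_norm ?normc_ge0.
have a2 : normc (B f m - f x * cint K) < c / 2.
  near: m; move/cvgrPdist_lt/(_ _ c2) : right_cvg; apply: filterS => m.
  by rewrite sub0r normrN ger0_norm ?normc_ge0.
have : c <= normc (B f m - E 0 * J) + normc (B f m - f x * cint K).
  rewrite /c (_ : E 0 * J - f x * cint K = - (B f m - E 0 * J) + (B f m - f x * cint K)).
    by apply: (le_trans (le_normcD _ _)); rewrite normcN.
  by rewrite opprB -addrA; congr (_ + _); rewrite addrA addNr add0r.
by lra.
Unshelve. all: by end_near. Qed.

End point.

Lemma fourier_inj0 f : cL1 f -> ccontinuous f -> (forall xi, fourier f xi = 0) -> forall x, f x = 0.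
Proof.
move=> f1 fc f0 x.
have ff : fourier f = (fun=> 0) by apply/funext.
rewrite (fourier_inversion x f1 _ fc) ff; last exact: cL10.
rewrite (_ : cint _ = 0) ?mulr0// -[RHS](@cint0 R n); apply: eq_cint => xi.
by rewrite mul0r.
Qed.

End inversion.

(** * Band-limited functions *)

Section reproducing.
Context {R : realType} {n : nat}.
Local Notation leb := (@lebesgue_rV R n).
Local Notation V := 'rV[R]_n.
Implicit Types f : V -> R[i].

Lemma normcX (z : R[i]) (k : nat) : normc (z ^+ k) = normc z ^+ k.
Proof. by elim: k => [|k IH]; rewrite ?expr0 ?Normc.normc1// !exprS Normc.normcM IH. Qed.

(** It passes from the weight [(1 + |y|)^s] of the supremum norm to the weight [1 + |y|^s] of
    [D_norm]. *)
Lemma powR_1D_le (e s : R) : 0 <= e -> 0 <= s -> (1 + e) `^ s <= 2 `^ s * (1 + e `^ s).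
Proof.
move=> e0 s0; have [e1|e1] := leP e 1.
  apply: (@le_trans _ _ (2 `^ s)).
    by apply: ge0_ler_powR; rewrite ?nnegrE ?addr_ge0//; lra.
  by rewrite ler_peMr ?powR_ge0// lerDl powR_ge0.
apply: (@le_trans _ _ ((2 * e) `^ s)).
  by apply: ge0_ler_powR; rewrite ?nnegrE ?mulr_ge0 ?addr_ge0//; lra.
by rewrite powRM// ler_wpM2l ?powR_ge0// lerDr.
Qed.

(** Peetre's inequality, which shares a polynomial weight between the two factors of a
    convolution. *)
Lemma enorm_1B_le (x y : V) : 1 + enorm x <= (1 + enorm (x - y)) * (1 + enorm y).
Proof.
have := ler_enormD (x - y) y; rewrite subrK => h.
have := mulr_ge0 (enorm_ge0 (x - y)) (enorm_ge0 y).
by rewrite mulrDl mul1r mulrDr mulr1; lra.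
Qed.

Lemma enorm_1_le (x : V) : 1 + enorm x <= n.+1%:R * (1 + `|x|).
Proof.
have := ler_enorm_norm x; rewrite -natr1 mulrDl mul1r mulrDr mulr1 => h.
have := normr_ge0 x; have := ler0n R n; lra.
Qed.

Lemma enorm_1V_le (x : V) (k : nat) : (1 + enorm x) ^- k <= (1 + `|x|) ^- k.
Proof.
rewrite lef_pV2 ?posrE ?exprn_gt0 ?ltr_pwDl ?enorm_ge0//.
by rewrite lerXn2r ?nnegrE ?addr_ge0 ?enorm_ge0// lerD2l ler_norm_enorm.
Qed.

(* A function with spectrum in the ball of radius [b] is reproduced by convolution with a fixed
   rapidly decreasing kernel, so that an integral bound becomes a pointwise one. *)
Lemma band_limited_pointwise (b s : R) : 0 <= b -> 0 <= s -> exists2 C, 0 <= C &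
  forall f, cL1 f -> ccontinuous f -> cL1 (fourier f) ->
  (forall xi, b < enorm xi -> fourier f xi = 0) ->
  forall x, (((1 + enorm x) `^ s * normc (f x))%:E <= C%:E * D_norm s f)%E.
Proof.
(* With [k >= s] the kernel decays fast enough to absorb [(1 + |x - y|)^s]. Since k convolutions
   cost the plateau k units of radius, [c = b + k] keeps the bump constant on the ball of radius
   b. *)
move=> b0 s0; pose k := (Num.truncn s).+1; pose c : R := b + k%:R.
have c0 : 0 <= c by rewrite addr_ge0.
have sk : s <= k%:R by rewrite ltW// truncnS_gt.
pose th := @bump R n c k; pose I0 := cint (@cplat R n 0).
have th1 : cL1 th by exact: cL1_bump.
have [Cth Cth0 thC] := @bump_bounded R n c k c0.
have I00 : I0 != 0.
  have [r r0 /(_ 0)] := @Re_fourier_tent R n; rewrite normr0 => /(_ r0).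
  have -> : fourier (@cplat R n 0) 0 = I0.
    rewrite fourierE; apply: eq_cint => y.
    by rewrite chr0 mulr1.
  by move=> h; apply/eqP => I00; move: h; rewrite I00 /=; lra.
pose D0 : R := 3 * @plat_decay R n 0; pose D1 : R := 3 * @plat_decay R n c.
have D00 : 0 <= D0 by rewrite mulr_ge0// exprn_ge0// mulr_ge0// addr_ge0.
have D10 : 0 <= D1 by rewrite mulr_ge0// exprn_ge0// mulr_ge0// addr_ge0.
pose A := D0 ^+ k * D1.
have A0 : 0 <= A by rewrite mulr_ge0// exprn_ge0.
have thA z : normc (fourier th z) <= A * (1 + `|z|) ^- k.
  have z0 : 0 < 1 + `|z| by rewrite ltr_pwDl.
  rewrite fourier_bump// Normc.normcM normcX mulrAC ler_pM ?exprn_ge0 ?normc_ge0//.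
    rewrite -exprVn -exprMn lerXn2r ?nnegrE ?normc_ge0 ?divr_ge0 ?(ltW z0)//.
    by rewrite ler_pdivlMr// fourier_plat_decay.
  apply: le_trans (fourier_plat_decay z c0).
  by rewrite ler_peMr ?normc_ge0// lerDl.
(* On the spectrum of f the bump has the value [I0 ^+ k], by which one divides; the other factor is
   the constant of the inversion formula. *)
clearbody A; pose kap : R := normc (@inversion_cst R n) / normc I0 ^+ k.
have kap0 : 0 <= kap by rewrite divr_ge0 ?exprn_ge0 ?normc_ge0.
(* The power of n + 1 compares the Euclidean norm with the maximum norm, and the power of 2 comes
   from [powR_1D_le]. *)
pose C := kap * (A * (n.+1%:R `^ s * 2 `^ s)).
exists C; first by apply: mulr_ge0 => //; apply: mulr_ge0 => //; rewrite mulr_ge0 ?powR_ge0.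
move=> f f1 fc ff1 fb x.
pose G y := f y * fourier th (y - x).
have mth : cmeas (fun y : V => fourier th (y - x)).
  have := cmeas_affine 1 (- x) (cmeas_fourier th1).
  by congr cmeas; apply/funext => y; rewrite scale1r.
have G1 : cL1 G.
  apply: (cL1M_bounded (C := A)) => // y; apply: le_trans (thA _) _.
  rewrite ler_piMr// invf_le1 ?exprn_gt0 ?ltr_pwDl//.
  by rewrite exprn_ege1// lerDl.
(* The multiplier [th] acts on [fourier f] as the constant [I0 ^+ k], and the multiplication formula
   turns it into an integral of f against the transform of [th]. *)
have fE : I0 ^+ k * f x = @inversion_cst R n * cint G.
  rewrite (fourier_inversion x f1 ff1 fc) mulrCA; congr (_ * _).
  rewrite -(fourier_multiplication x f1 th1) -cintZ; last first.
    apply: (cL1M_bounded (C := 1)) => // [|xi]; last by rewrite normc_chr.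
    exact: (@cmeas_chr _ _ _ _ (fun=> x) id).
  apply: eq_cint => xi; have [h|h] := leP (enorm xi) b.
    rewrite /th bump_flat//; last by rewrite /c addrK (le_trans (ler_norm_enorm _)).
    by rewrite mulrA [_ * _ ^+ k]mulrC.
  by rewrite fb// !mul0r mulr0.
have {fE} fle : normc (f x) <= kap * normc (cint G).
  move: fE => /(f_equal (@Normc.normc R)); rewrite [LHS]Normc.normcM normcX [RHS]Normc.normcM => e.
  have i0 : 0 < normc I0 ^+ k by rewrite exprn_gt0// normc_gt0.
  by rewrite /kap mulrAC ler_pdivlMr// mulrC e.
have pw y : (1 + enorm x) `^ s * normc (G y) <=
    A * (n.+1%:R `^ s * 2 `^ s) * ((1 + enorm y `^ s) * normc (f y)).
  rewrite /G Normc.normcM mulrCA [leRHS]mulrA [leRHS]mulrC ler_wpM2l ?normc_ge0//.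
  apply: (@le_trans _ _ (((1 + enorm (x - y)) * (1 + enorm y)) `^ s * (A * (1 + `|y - x|) ^- k))).
    rewrite ler_pM ?powR_ge0 ?normc_ge0//.
    apply: ge0_ler_powR; rewrite ?nnegrE ?mulr_ge0 ?addr_ge0 ?enorm_ge0//.
    exact: enorm_1B_le.
  rewrite powRM ?addr_ge0 ?enorm_ge0// mulrCA -!mulrA ler_wpM2l//.
  have h0 : 0 < 1 + `|x - y| by rewrite ltr_pwDl.
  have h1 : (1 + enorm (x - y)) `^ s * (1 + `|y - x|) ^- k <= n.+1%:R `^ s.
    rewrite distrC ler_pdivrMr ?exprn_gt0//.
    apply: (@le_trans _ _ ((n.+1%:R * (1 + `|x - y|)) `^ s)).
      apply: ge0_ler_powR; rewrite ?nnegrE ?mulr_ge0 ?addr_ge0 ?enorm_ge0//.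
      exact: enorm_1_le.
    rewrite powRM ?(ltW h0)// ler_wpM2l ?powR_ge0//.
    by rewrite -powR_mulrn ?(ltW h0)// ler_powR// lerDl.
  rewrite mulrA mulrAC; apply: ler_pM => //.
  - by rewrite mulr_ge0 ?powR_ge0// invr_ge0 exprn_ge0// addr_ge0.
  - exact: powR_ge0.
  - by apply: powR_1D_le => //; exact: enorm_ge0.
have mD : measurable_fun setT (fun y : V => ((1 + enorm y `^ s) * normc (f y))%:E).
  apply/measurable_EFinP; apply: measurable_funM; last exact: measurable_normc f1.1.
  apply: measurable_funD => //; apply: (measurableT_comp (measurable_powR _)).
  by apply: continuous_measurable_rV; exact: continuous_enorm.
apply: (@le_trans _ _ ((kap * (1 + enorm x) `^ s)%:E * (norm1 G)%:E)%E).
  rewrite -EFinM lee_fin mulrC mulrAC mulrC.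
  rewrite [leRHS]mulrC mulrCA [leRHS]mulrCA ler_wpM2l ?powR_ge0//.
  by apply: (le_trans fle); apply: ler_wpM2l => //; exact: normc_cint_le.
rewrite -norm1E// /D_norm /C EFinM -muleA [in leRHS]EFinM -muleA lee_wpmul2l//.
rewrite -ge0_integralZl//; last 3 first.
- by apply/measurable_EFinP; exact: measurable_normc G1.1.
- by move=> y _; rewrite lee_fin normc_ge0.
- by rewrite lee_fin powR_ge0.
rewrite -ge0_integralZl//; last 2 first.
- by move=> y _; rewrite lee_fin mulr_ge0 ?normc_ge0// addr_ge0 ?powR_ge0.
- by rewrite lee_fin !mulr_ge0 ?powR_ge0.
apply: ge0_le_lower_integral => y; first by rewrite lee_fin mulr_ge0 ?powR_ge0 ?normc_ge0.
by rewrite -!EFinM lee_fin.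
Qed.

End reproducing.

(** * Smoothness and rapid decay *)

Section real_calculus.
Context {R : realType} {n : nat}.
Local Notation V := 'rV[R]_n.
Implicit Types (u : V -> R) (x y h : V).

Definition partial (i : 'I_n) u : V -> R := fun x => 'D_(delta_mx ord0 i) u x.

Lemma diff_partial u y h : differentiable u y ->
  'D_h u y = \sum_i h ord0 i * partial i u y.
Proof.
move=> du; rewrite deriveE// {1}(row_sum_delta h) linear_sum; apply: eq_bigr => i _.
by rewrite linearZ /partial deriveE.
Qed.

Lemma is_derive_line u y h (t : R) : differentiable u (y + t *: h) ->
  is_derive t 1 (fun t : R => u (y + t *: h)) ('D_h u (y + t *: h)).
Proof.
move=> du.
have e : (fun k : R => k^-1 *: (((fun t : R => u (y + t *: h)) \o shift t) (k *: 1) - u (y + t *: h))) =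
    (fun k : R => k^-1 *: ((u \o shift (y + t *: h)) (k *: h) - u (y + t *: h))).
  apply/funext => k /=; congr (_ *: (u _ - _)).
  by rewrite [k *: 1]mulr1 scalerDl addrCA.
split; first by rewrite /derivable e; exact: diff_derivable.
by rewrite /derive e.
Qed.

Lemma mvt_line u y h : (forall x, differentiable u x) ->
  exists2 c : R, 0 <= c <= 1 & u (y + h) - u y = \sum_i h ord0 i * partial i u (y + c *: h).
Proof.
move=> du.
have [t _||c] := @MVT_segment R (fun t : R => u (y + t *: h)) (fun t => 'D_h u (y + t *: h)) 0 1 ler01.
- exact: is_derive_line.
- apply: continuous_subspaceT => t.
  apply: differentiable_continuous; apply/derivable1_diffP.
  by have [] := is_derive_line (du (y + t *: h)).
rewrite in_itv /= => c01; rewrite scale1r scale0r addr0 subr0 mulr1 => ->.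
by exists c => //; exact: diff_partial.
Qed.

Lemma lip_partial u (B : R) y h : (forall x, differentiable u x) ->
  (forall i x, `|partial i u x| <= B) -> `|u (y + h) - u y| <= n%:R * B * `|h|.
Proof.
move=> du uB; have [c _ ->] := mvt_line y h du.
apply: (le_trans (ler_norm_sum _ _ _)).
apply: (@le_trans _ _ (\sum_(i < n) B * `|h|)).
  by apply: ler_sum => i _; rewrite normrM mulrC ler_pM ?ler_normrV.
by rewrite sumr_const card_ord -[leLHS]mulr_natl mulrA.
Qed.

(** The mean value theorem is used twice: for u along the segment, and then for each first partial
    derivative. *)
Lemma taylor_partial u (B : R) y h : (forall x, differentiable u x) ->
  (forall i x, differentiable (partial i u) x) ->
  (forall i k x, `|partial k (partial i u) x| <= B) ->
  `|u (y + h) - u y - \sum_i h ord0 i * partial i u y| <= n%:R ^+ 2 * B * `|h| ^+ 2.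
Proof.
move=> du ddu uB; have [c /andP[c0 c1] ->] := mvt_line y h du.
rewrite -sumrB; apply: (le_trans (ler_norm_sum _ _ _)).
apply: (@le_trans _ _ (\sum_(i < n) `|h| * (n%:R * B * `|h|))).
  apply: ler_sum => i _; rewrite -mulrBr normrM ler_pM ?ler_normrV//.
  apply: (le_trans (lip_partial y (c *: h) (ddu i) (uB i))).
  rewrite normrZ ger0_norm// mulrCA ler_piMl//.
  rewrite mulr_ge0// mulr_ge0//; exact: le_trans (uB i i y).
by rewrite sumr_const card_ord -[leLHS]mulr_natl !expr2; lra.
Qed.

(** It is made a linear map in order to be recognised as the differential in
    [differentiable_quadratic]. *)
Definition lin_form (a : 'I_n -> R) (h : V) : R := \sum_i h ord0 i * a i.

Lemma lin_form_is_linear a : linear (lin_form a).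
Proof.
move=> c h k; rewrite /lin_form scaler_sumr -big_split /=; apply: eq_bigr => i _.
by rewrite !mxE mulrDl -mulrA.
Qed.

HB.instance Definition _ a := GRing.isLinear.Build R V R *:%R (lin_form a) (lin_form_is_linear a).

Lemma lin_form_le a h : `|lin_form a h| <= (\sum_i `|a i|) * `|h|.
Proof.
apply: (le_trans (ler_norm_sum _ _ _)); rewrite mulr_suml; apply: ler_sum => i _.
by rewrite normrM mulrC ler_wpM2l// ler_normrV.
Qed.

Lemma continuous_lin_form a : continuous (lin_form a).
Proof.
move=> x; have Fx : Filter (nbhs x) by exact: nbhs_filter.
apply/(@cvgrPdist_le _ R^o _ _ Fx) => /= e e0.
have s0 : 0 < \sum_i `|a i| + 1 by rewrite ltr_wpDl// sumr_ge0.
near=> y.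
have -> : lin_form a x - lin_form a y = lin_form a (x - y) by rewrite linearB.
apply: (le_trans (lin_form_le _ _)).
apply: (@le_trans _ _ ((\sum_i `|a i| + 1) * `|x - y|)); first by rewrite ler_wpM2r// lerDl.
rewrite mulrC -ler_pdivlMr//; near: y.
by apply: cvgr_dist_le; rewrite ?divr_gt0.
Unshelve. all: by end_near. Qed.

(** A quadratic remainder is negligible against h, so the linear form is the differential. This
    criterion replaces differentiation under the integral sign, since such remainders can be
    integrated. *)
Lemma differentiable_quadratic u x (a : 'I_n -> R) (C : R) :
  (forall h, `|u (x + h) - u x - lin_form a h| <= C * `|h| ^+ 2) ->
  differentiable u x /\ forall i, partial i u x = a i.
Proof.
move=> H.
have o (e : R) : 0 < e -> \forall h \near (0 : V), `|u (x + h) - u x - lin_form a h| <= e * `|h|.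
  move=> e0; near=> h.
  apply: (le_trans (H h)); rewrite expr2 mulrA ler_wpM2r//.
  apply: (@le_trans _ _ ((`|C| + 1) * `|h|)); first by rewrite ler_wpM2r// ler_wpDr// ler_norm.
  have c0 : 0 < `|C| + 1 by rewrite ltr_wpDl.
  rewrite mulrC -ler_pdivlMr//; near: h.
  have := @cvgr0_norm_le _ _ _ (nbhs (0 : V)) _ id (@cvg_id _ (nbhs (0 : V))) (e / (`|C| + 1)).
  by apply; rewrite divr_gt0.
have oE h : (u \o shift x - (cst (u x) + lin_form a)) h = u (x + h) - u x - lin_form a h.
  by rewrite /= !fctE /= opprD addrA [h + x]addrC.
have dE : 'd u x = lin_form a :> (V -> R).
  apply: diff_unique; first exact: continuous_lin_form.
  by apply/eqaddoP => e e0; apply: filterS (o e e0) => h; rewrite oE.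
have du : differentiable u x.
  apply/diff_locallyP; rewrite dE; split; first exact: continuous_lin_form.
  by apply/eqaddoP => e e0; apply: filterS (o e e0) => h; rewrite oE.
split => // i; rewrite /partial deriveE// dE /lin_form (bigD1 i)//= big1 ?addr0.
  by rewrite mxE !eqxx mul1r.
by move=> k ki; rewrite mxE eqxx (negbTE ki) mul0r.
Unshelve. all: by end_near. Qed.

End real_calculus.

(** * Calculus of complex-valued functions and smoothness of convolutions *)

Section complex_calculus.
Context {R : realType} {n : nat}.
Local Notation leb := (@lebesgue_rV R n).
Local Notation V := 'rV[R]_n.
Implicit Types (f g : V -> R[i]) (x y h : V).

Lemma ReB (z w : R[i]) : complex.Re (z - w) = complex.Re z - complex.Re w.
Proof. by rewrite ReD ReN. Qed.

Lemma ImB (z w : R[i]) : complex.Im (z - w) = complex.Im z - complex.Im w.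
Proof. by rewrite ImD ImN. Qed.

Definition cdifferentiable f := forall x,
  differentiable (fun y => complex.Re (f y)) x /\ differentiable (fun y => complex.Im (f y)) x.

Lemma cpartials_rcons s i f : cpartials (rcons s i) f = cpartials s (cpartial i f).
Proof. by rewrite /cpartials foldr_rcons. Qed.

Lemma smooth_cpartials s f : smooth f -> smooth (cpartials s f).
Proof.
elim/last_ind: s f => [|s i IH] f sf //; rewrite cpartials_rcons; apply: IH => t x.
by rewrite -cpartials_rcons.
Qed.

Lemma smooth_cdifferentiable f : smooth f -> cdifferentiable f.
Proof. by move=> sf x; exact: (sf [::]). Qed.

Lemma cdifferentiable_continuous f : cdifferentiable f ->
  continuous (fun y => complex.Re (f y)) /\ continuous (fun y => complex.Im (f y)).
Proof.
by move=> df; split => x; apply: differentiable_continuous; have [] := df x.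
Qed.

Lemma ReIm_ccontinuous f : continuous (fun y => complex.Re (f y)) ->
  continuous (fun y => complex.Im (f y)) -> ccontinuous f.
Proof.
move=> c1 c2 x e e0; have Fx : Filter (nbhs x) by exact: nbhs_filter.
have e2 : 0 < e / 2 by rewrite divr_gt0.
have : \forall y \near x, normc (f y - f x) < e.
  near=> y; apply: (le_lt_trans (normc_le_ReIm _)).
  rewrite ReB ImB [e]splitr; apply: ltrD; rewrite distrC; near: y.
    exact: (@cvgr_dist_lt _ R^o _ _ Fx _ _ (c1 x)).
  exact: (@cvgr_dist_lt _ R^o _ _ Fx _ _ (c2 x)).
move=> /nbhs_ballP[d /= d0 dP]; exists d => // y yd.
by apply: dP; rewrite -ball_normE /ball_ /= distrC.
Unshelve. all: by end_near. Qed.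

Lemma ReIm_cmeas f : continuous (fun y => complex.Re (f y)) ->
  continuous (fun y => complex.Im (f y)) -> cmeas f.
Proof. by move=> c1 c2; split; exact: continuous_measurable_rV. Qed.

Lemma cdifferentiable_cmeas f : cdifferentiable f -> cmeas f.
Proof. by move=> /cdifferentiable_continuous[c1 c2]; exact: ReIm_cmeas. Qed.

Lemma Re_sum (I : Type) (r : seq I) (F : I -> R[i]) :
  complex.Re (\sum_(i <- r) F i) = \sum_(i <- r) complex.Re (F i).
Proof. by apply: (big_morph (@complex.Re R) (@ReD R)). Qed.

Lemma Im_sum (I : Type) (r : seq I) (F : I -> R[i]) :
  complex.Im (\sum_(i <- r) F i) = \sum_(i <- r) complex.Im (F i).
Proof. by apply: (big_morph (@complex.Im R) (@ImD R)). Qed.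

Definition clin_form (a : 'I_n -> R[i]) h : R[i] := \sum_i (h ord0 i)%:C * a i.

Lemma Re_clin_form a h : complex.Re (clin_form a h) = lin_form (fun i => complex.Re (a i)) h.
Proof. by rewrite Re_sum; apply: eq_bigr => i _; rewrite ReM ReC ImC mul0r subr0. Qed.

Lemma Im_clin_form a h : complex.Im (clin_form a h) = lin_form (fun i => complex.Im (a i)) h.
Proof. by rewrite Im_sum; apply: eq_bigr => i _; rewrite ImM ReC ImC mul0r addr0. Qed.

Lemma ctaylor f (B : R) y h : smooth f ->
  (forall i k x, normc (cpartial k (cpartial i f) x) <= B) ->
  normc (f (y + h) - f y - clin_form (fun i => cpartial i f y) h) <= 2 * n%:R ^+ 2 * B * `|h| ^+ 2.
Proof.
move=> sf fB; apply: (le_trans (normc_le_ReIm _)).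
rewrite !ReB !ImB Re_clin_form Im_clin_form.
have d1 x := sf [::] x; have d2 i x := sf [:: i] x.
rewrite (_ : 2 * _ * B * _ = n%:R ^+ 2 * B * `|h| ^+ 2 + n%:R ^+ 2 * B * `|h| ^+ 2); last by ring.
apply: lerD; [apply: (@taylor_partial _ _ (fun y => complex.Re (f y)))|
              apply: (@taylor_partial _ _ (fun y => complex.Im (f y)))].
- by move=> x; have [] := d1 x.
- by move=> i x; have [] := d2 i x.
- by move=> i k x; apply: le_trans (fB i k x); exact: (normr_Re_le (cpartial k (cpartial i f) x)).
- by move=> x; have [] := d1 x.
- by move=> i x; have [] := d2 i x.
- by move=> i k x; apply: le_trans (fB i k x); exact: (normr_Im_le (cpartial k (cpartial i f) x)).
Qed.

Lemma cdifferentiable_quadratic f x (a : 'I_n -> R[i]) (C : R) :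
  (forall h, normc (f (x + h) - f x - clin_form a h) <= C * `|h| ^+ 2) ->
  (differentiable (fun y => complex.Re (f y)) x /\ differentiable (fun y => complex.Im (f y)) x) /\
  forall i, cpartial i f x = a i.
Proof.
move=> H.
have [|d1 p1] := @differentiable_quadratic _ _ (fun y => complex.Re (f y)) x (fun i => complex.Re (a i)) C.
  by move=> h; apply: le_trans (H h); rewrite -Re_clin_form -!ReB normr_Re_le.
have [|d2 p2] := @differentiable_quadratic _ _ (fun y => complex.Im (f y)) x (fun i => complex.Im (a i)) C.
  by move=> h; apply: le_trans (H h); rewrite -Im_clin_form -!ImB normr_Im_le.
by split => // i; apply: complex_ext; [exact: p1|exact: p2].
Qed.

Definition bounded_partials f := forall s, exists B, forall x, normc (cpartials s f x) <= B.

Lemma bounded_partials_cpartials s f : bounded_partials f -> bounded_partials (cpartials s f).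
Proof.
move=> bf t; have [B fB] := bf (t ++ s); exists B => x.
by move: (fB x); rewrite /cpartials foldr_cat.
Qed.

Lemma bounded_partials2 f : bounded_partials f ->
  exists B, forall i k x, normc (cpartial k (cpartial i f) x) <= B.
Proof.
move=> bf; have H (ik : 'I_n * 'I_n) : {B | forall x, normc (cpartial ik.2 (cpartial ik.1 f) x) <= B}.
  by apply: cid; exact: (bf [:: ik.2; ik.1]).
exists (\sum_ik `|sval (H ik)|) => i k x.
rewrite (bigD1 (i, k))//=; apply: ler_wpDr; first exact: sumr_ge0.
exact: le_trans (svalP (H (i, k)) x) (ler_norm _).
Qed.

Section convolve_smooth.
Variables (h : V -> R[i]).
Hypothesis h1 : cL1 h.

(** The Taylor remainder of g is bounded by a multiple of [|k|^2], uniformly in the base point;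
    integration against h gives a quadratic remainder for the convolution. *)
Lemma cdifferentiable_convolve g : smooth g -> bounded_partials g ->
  cdifferentiable (convolve g h) /\
  forall i, cpartial i (convolve g h) = convolve (cpartial i g) h.
Proof.
move=> sg bg; have [B gB] := bounded_partials2 bg.
have mg s : cmeas (cpartials s g).
  by apply: cdifferentiable_cmeas; apply: smooth_cdifferentiable; exact: smooth_cpartials.
have c1 s x : cL1 (fun y => cpartials s g (x - y) * h y).
  by have [C gC] := bg s; apply: (cL1_convolve_in x (mg s) gC h1).
suff H x : (differentiable (fun y => complex.Re (convolve g h y)) x /\
    differentiable (fun y => complex.Im (convolve g h y)) x) /\
    forall i, cpartial i (convolve g h) x = convolve (cpartial i g) h x.
  by split => [x|i]; [exact: (H x).1|apply/funext => x; exact: (H x).2].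
apply: (@cdifferentiable_quadratic _ x _ (2 * n%:R ^+ 2 * B * norm1 h)) => k.
pose D y := g (x - y + k) - g (x - y) - clin_form (fun i => cpartial i g (x - y)) k.
have s1 : cL1 (fun y => \sum_i (k ord0 i)%:C * (cpartial i g (x - y) * h y)).
  by apply: cL1_sum => i; apply: cL1Z; exact: (c1 [:: i]).
have E : convolve g h (x + k) - convolve g h x - clin_form (fun i => convolve (cpartial i g) h x) k =
    cint (fun y => D y * h y).
  rewrite /clin_form.
  rewrite (eq_bigr (fun i => cint (fun y => (k ord0 i)%:C * (cpartial i g (x - y) * h y)))); last first.
    by move=> i _; rewrite cintZ//; exact: (c1 [:: i]).
  rewrite -cint_sum; last by move=> i; apply: cL1Z; exact: (c1 [:: i]).
  rewrite /convolve -cintB; [|exact: (c1 [::])|exact: (c1 [::])].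
  rewrite -cintB//; last by apply: cL1B; exact: (c1 [::]).
  apply: eq_cint => y; rewrite /D /clin_form mulrBl mulrBl mulr_suml.
  congr (_ * _ - _ - _); first by rewrite addrAC.
  by apply: eq_bigr => i _; rewrite mulrA.
rewrite E; have D1 : cL1 (fun y => D y * h y).
  have := cL1B (cL1B (c1 [::] (x + k)) (c1 [::] x)) s1.
  congr cL1; apply/funext => y; rewrite /D /clin_form /= mulrBl mulrBl mulr_suml.
  congr (_ * _ - _ - _); first by rewrite addrAC.
  by apply: eq_bigr => i _; rewrite mulrA.
apply: (le_trans (normc_cint_le D1)).
apply: (@norm1_le _ _ _ (fun y => 2 * n%:R ^+ 2 * B * `|k| ^+ 2 * normc (h y))) => //.
  by move=> y; rewrite Normc.normcM ler_wpM2r ?normc_ge0//; exact: ctaylor.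
have C0 : 0 <= 2 * n%:R ^+ 2 * B * `|k| ^+ 2.
  by apply: le_trans (ctaylor x k sg gB); exact: normc_ge0.
under eq_integral do rewrite EFinM.
rewrite ge0_integralZl//; last 2 first.
  by apply/measurable_EFinP; exact: measurable_normc h1.1.
  by move=> y _; rewrite lee_fin normc_ge0.
by rewrite norm1E// -EFinM lee_fin mulrAC.
Qed.

Lemma cpartials_convolve g s : smooth g -> bounded_partials g ->
  cpartials s (convolve g h) = convolve (cpartials s g) h.
Proof.
move=> sg bg; elim: s => [//|i s IH].
rewrite [LHS]/= -/(cpartials s (convolve g h)) IH.
have [_ ->//] := @cdifferentiable_convolve (cpartials s g) (smooth_cpartials s sg) (bounded_partials_cpartials s bg).
Qed.

Lemma smooth_convolve g : smooth g -> bounded_partials g -> smooth (convolve g h).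
Proof.
move=> sg bg s x; rewrite cpartials_convolve//.
have [H _] := @cdifferentiable_convolve (cpartials s g) (smooth_cpartials s sg) (bounded_partials_cpartials s bg).
exact: H.
Qed.

End convolve_smooth.

End complex_calculus.

(** * Rapid decay from smoothness of the transform *)

Section rapid_decay.
Context {R : realType} {n : nat}.
Local Notation leb := (@lebesgue_rV R n).
Local Notation V := 'rV[R]_n.
Implicit Types (f g u : V -> R[i]) (x y h : V).

Definition csupp (c : R) u := forall xi, c < `|xi| -> u xi = 0.

Lemma csupp_cpartial c i u : csupp c u -> csupp c (cpartial i u).
Proof.
move=> cu xi cxi.
have near0 : \forall y \near xi, u y = 0.
  have Fx : Filter (nbhs xi) by exact: nbhs_filter.
  have d0 : 0 < `|xi| - c by rewrite subr_gt0.
  near=> y; apply: cu.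
  have h : `|xi - y| < `|xi| - c by near: y; exact: (@cvgr_dist_lt _ _ _ _ Fx _ _ (@cvg_id _ (nbhs xi))).
  by have := lerB_normD xi (y - xi); rewrite [xi + _]addrC subrK (distrC y xi); lra.
apply: complex_ext; rewrite /cpartial /=.
  rewrite (@near_eq_derive _ _ _ _ (cst 0)); first exact: derive_cst.
  by apply: filterS near0 => y ->.
rewrite (@near_eq_derive _ _ _ _ (cst 0)); first exact: derive_cst.
by apply: filterS near0 => y ->.
Unshelve. all: by end_near. Qed.

Lemma csupp_norm1 c u (B : R) : 0 <= c -> 0 <= B -> cmeas u -> csupp c u ->
  (forall x, normc (u x) <= B) -> cL1 u /\ norm1 u <= B * (2 * (c + 1)) ^+ n.
Proof.
move=> c0 B0 mu cu uB.
have mB := @measurable_unit_ball R n (c + 1).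
have dom x : normc (u x) <= B * \1_([set x : V | `|x| < c + 1]) x.
  rewrite indicE; have [h|h] := ltP `|x| (c + 1); first by rewrite mem_set//= mulr1.
  by rewrite cu ?Normc.normc0 ?mulr_ge0//; lra.
have I : (\int[leb]_x (B * \1_([set x : V | `|x| < c + 1]) x)%:E <= (B * (2 * (c + 1)) ^+ n)%:E)%E.
  under eq_integral do rewrite EFinM.
  rewrite ge0_integralZl ?lee_fin//; last by apply/measurable_EFinP; exact: measurable_indic.
  rewrite integral_indic// setIT EFinM lee_wpmul2l ?lee_fin//.
  by apply: lebesgue_ball_le; rewrite addr_ge0.
have u1 : cL1 u by apply: (cL1_dom mu dom); exact: le_lt_trans I (ltry _).
by split => //; exact: norm1_le u1 dom I.
Qed.

Lemma continuous_csupp_bounded c (v : V -> R) : continuous v -> (forall x, c < `|x| -> v x = 0) ->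
  exists2 B, 0 <= B & forall x, `|v x| <= B.
Proof.
move=> cv sv.
have cK : compact (cube (const_mx (- c) : V) (2 * c)) by exact: cube_compact.
have /compact_bounded[M [_ MP]] := continuous_compact (continuous_subspaceT cv) cK.
exists (`|M| + 1); first by rewrite addr_ge0.
move=> x; have [h|h] := leP `|x| c; last by rewrite sv// normr0 addr_ge0.
apply: (MP (`|M| + 1)); first by have := ler_norm M; lra.
exists x => // i; rewrite mxE; have := le_trans (ler_normrV x i) h.
by rewrite ler_norml => /andP[h1 h2]; apply/andP; split; lra.
Qed.

Lemma smooth_csupp_bounded c u : smooth u -> csupp c u -> exists2 B, 0 <= B & forall x, normc (u x) <= B.
Proof.
move=> su cu.
have [c1 c2] := cdifferentiable_continuous (smooth_cdifferentiable su).
have [|B1 B10 H1] := continuous_csupp_bounded (c := c) c1; first by move=> x h; rewrite cu.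
have [|B2 B20 H2] := continuous_csupp_bounded (c := c) c2; first by move=> x h; rewrite cu.
exists (B1 + B2); first exact: addr_ge0.
by move=> x; apply: (le_trans (normc_le_ReIm _)); exact: lerD.
Qed.

Lemma csupp_cpartials c s u : csupp c u -> csupp c (cpartials s u).
Proof. by move=> cu; elim: s => [//|i s IH]; exact: csupp_cpartial. Qed.

Lemma smooth_csupp_bounded_partials c u : smooth u -> csupp c u -> bounded_partials u.
Proof.
move=> su cu s.
have [B _ uB] := smooth_csupp_bounded (smooth_cpartials s su) (csupp_cpartials s cu).
by exists B.
Qed.

Lemma smooth_csupp_cL1 c u : 0 <= c -> smooth u -> csupp c u -> cL1 u.
Proof.
move=> c0 su cu; have [B B0 uB] := smooth_csupp_bounded su cu.
have mu := cdifferentiable_cmeas (smooth_cdifferentiable su).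
by have [] := csupp_norm1 c0 B0 mu cu uB.
Qed.

Definition ifourier u x : R[i] := cint (fun xi => u xi * chr x xi).

Lemma cL1_ichr u x : cL1 u -> cL1 (fun xi => u xi * chr x xi).
Proof.
move=> u1; apply: (cL1M_bounded (C := 1)) => // [|xi]; last by rewrite normc_chr.
exact: (@cmeas_chr _ _ _ _ (fun=> x) id).
Qed.

Lemma normc_ifourier_le u x : cL1 u -> normc (ifourier u x) <= norm1 u.
Proof.
move=> u1; apply: (le_trans (normc_cint_le (cL1_ichr x u1))).
apply: (@norm1_le _ _ _ (fun y => normc (u y))); first exact: cL1_ichr.
  by move=> y; rewrite Normc.normcM normc_chr mulr1.
by rewrite norm1E.
Qed.

(** The mean value theorem on an interval where the cosine is at least 1/2. It bounds the increment
    of a character from below through its imaginary part; the factor 1/2 is the reason for pi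
    instead of 2 pi in [ifourier_partial_le]. *)
Lemma sin_half : exists2 d : R, 0 < d & forall a, `|a| < d -> `|a| / 2 <= `|sin a|.
Proof.
have [d d0 dP] : exists2 d : R, 0 < d & forall a, `|a| < d -> 2^-1 <= cos a.
  have /cvgrPdist_lt/(_ (2^-1)) := @continuous_cos R 0.
  rewrite invr_gt0 => /(_ (ltr0Sn _ _)) /nbhs_ballP[d d0 dP]; exists d => // a ad.
  have := dP a; rewrite /ball /= sub0r normrN => /(_ ad).
  rewrite cos0 ltr_distlC => /andP[h _].
  by move: h; lra.
exists d => // a; wlog a0 : a / 0 <= a.
  move=> H; have [/H//|a0] := leP 0 a.
  by have := H (- a); rewrite oppr_ge0 sinN !normrN => /(_ (ltW a0)).
move=> ad; have [|c] := @MVT_segment R (@sin R) (@cos R) 0 a a0.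
  by apply: continuous_subspaceT; exact: continuous_sin.
rewrite in_itv /= sin0 !subr0 => /andP[c0 ca] ->.
rewrite normrM mulrC ler_wpM2r//.
have : 2^-1 <= cos c by apply: dP; rewrite ger0_norm//; apply: le_lt_trans ca _; rewrite ger0_norm in ad.
by move=> h; apply: le_trans h (ler_norm _).
Qed.

(* Integration by parts, in the form of an inequality between difference quotients. *)
Lemma ifourier_partial_le c u i x : 0 <= c -> smooth u -> csupp c u ->
  pi * `|x ord0 i| * normc (ifourier u x) <= normc (ifourier (cpartial i u) x).
Proof.
move=> c0 su cu.
have u1 := smooth_csupp_cL1 c0 su cu.
have du1 : cL1 (cpartial i u).
  by apply: (smooth_csupp_cL1 c0); [exact: (smooth_cpartials [:: i] su)|exact: csupp_cpartial].
have [B uB] := bounded_partials2 (smooth_csupp_bounded_partials su cu).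
pose C := 2 * n%:R ^+ 2 * B; pose vol : R := (2 * (c + 1 + 1)) ^+ n.
have tay (h : R) y : normc (u (y + unit_rV i h) - u y - h%:C * cpartial i u y) <= C * h ^+ 2.
  have := ctaylor y (unit_rV i h) su uB.
  have -> : clin_form (fun k => cpartial k u y) (unit_rV i h) = h%:C * cpartial i u y.
    rewrite /clin_form (bigD1 i)//= mxE mxE !eqxx mulr1 big1 ?addr0// => k ki.
    by rewrite mxE mxE eqxx (negbTE ki) mulr0 mul0r.
  move=> /le_trans; apply; rewrite -/C -(real_normK (num_real h)).
  have C0 : 0 <= C.
    have [a|a] := leP 0 B; first by rewrite !mulr_ge0// sqr_ge0.
    by have := le_lt_trans (uB i i 0) a; rewrite ltNge normc_ge0.
  by rewrite ler_wpM2l// lerXn2r ?nnegrE// norm_unit_rV.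
have C0 : 0 <= C by have := tay 1 0; rewrite expr1n mulr1; apply: le_trans; exact: normc_ge0.
have [d d0 dP] := sin_half.
set G := ifourier u x; set G' := ifourier _ x.
have key (h : R) : 0 < h -> h <= 1 -> 2 * pi * h * `|x ord0 i| < d ->
    pi * `|x ord0 i| * normc G <= normc G' + h * (C * vol).
  move=> h0 h1 hd; pose e := unit_rV i h.
  have ne : `|e| <= 1 by apply: (le_trans (norm_unit_rV _ _)); rewrite gtr0_norm.
  pose r y := u (y + e) - u y - h%:C * cpartial i u y.
  have us : cL1 (fun y => u (y + e)) by exact: cL1_shift.
  have r1 : cL1 r by apply: cL1B; [apply: cL1B|apply: cL1Z].
  have rC : norm1 r <= C * h ^+ 2 * vol.
    have [] // := @csupp_norm1 (c + 1) r (C * h ^+ 2).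
    - by rewrite addr_ge0.
    - by rewrite mulr_ge0// sqr_ge0.
    - exact: r1.1.
    - move=> y yc; rewrite /r (csupp_cpartial i cu); last by lra.
      rewrite (cu y); last by lra.
      by rewrite cu ?mulr0 ?subrr//; have := lerB_normD y e; lra.
    - by move=> y; exact: tay.
  have E : ifourier r x = (chr x (- e) - 1) * G - h%:C * G'.
    have -> : ifourier r x = cint (fun y => u (y + e) * chr x y - u y * chr x y - h%:C * (cpartial i u y * chr x y)).
      by apply: eq_cint => y; rewrite /r; ring.
    rewrite cintB; [|by apply: cL1B; exact: cL1_ichr|by apply: cL1Z; exact: cL1_ichr].
    rewrite cintB; [|exact: cL1_ichr|exact: cL1_ichr].
    rewrite cintZ; last exact: cL1_ichr.
    rewrite mulrBl mul1r; congr (_ - _ - _).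
    rewrite -cintZ; last exact: cL1_ichr.
    rewrite -(cint_shift e (f := fun y => chr x (- e) * (u y * chr x y))); last first.
      by apply: cmeasM; [exact: cmeas_cst|exact: (cL1_ichr x u1).1].
    apply: eq_cint => y; rewrite chrDr -chrN; have := chrNM x e => E1.
    transitivity (u (y + e) * chr x y * (chr (- x) e * chr x e)); first by rewrite E1 mulr1.
    by ring.
  have sinG : h * (pi * `|x ord0 i|) * normc G <= normc (chr x (- e) - 1) * normc G.
    rewrite ler_wpM2r ?normc_ge0//; apply: le_trans (normr_Im_le _).
    rewrite -chrN chrC /chr ImB /cis /= subr0.
    have -> : dotp e (- x) = - (h * x ord0 i).
      by rewrite dotp_unit_rV mxE mulrN.
    have := dP (2 * pi * - (h * x ord0 i)).
    have p0 : 0 <= 2 * pi :> R by rewrite mulr_ge0 ?pi_ge0.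
    have -> : `|2 * pi * - (h * x ord0 i)| = 2 * pi * h * `|x ord0 i|.
      by rewrite normrM (ger0_norm p0) normrN normrM (gtr0_norm h0) mulrA.
    move=> /(_ hd); apply: le_trans.
    by rewrite le_eqVlt; apply/orP; left; apply/eqP; field.
  have := normc_ifourier_le x r1; rewrite E.
  have t1 := ler_normcB ((chr x (- e) - 1) * G) (h%:C * G').
  move: t1; rewrite !Normc.normcM normc_real (gtr0_norm h0) => t1 t2.
  rewrite -(ler_pM2l h0); apply: (le_trans (y := normc (chr x (- e) - 1) * normc G)).
    by rewrite mulrA.
  rewrite mulrDr (_ : h * (h * (C * vol)) = C * h ^+ 2 * vol); last by ring.
  by move: t1 t2 rC; lra.
apply/ler_addgt0Pr => e e0.
pose q : R := C * vol + 1; have q0 : 0 < q.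
  by rewrite ltr_wpDl// mulr_ge0// exprn_ge0// mulr_ge0// !addr_ge0.
pose m : R := 2 * pi * `|x ord0 i| + 1; have m0 : 0 < m by rewrite ltr_wpDl// !mulr_ge0 ?pi_ge0.
(* The second entry keeps the phase [2 pi h |x_i|] below d, the third makes the Taylor error
   [h * (C * vol)] at most e. The summands 1 in m and q keep the denominators positive. *)
pose h := Num.min 1 (Num.min (d / 2 / m) (e / q)).
have h0 : 0 < h by rewrite !lt_min ltr01 !divr_gt0.
have h1 : h <= 1 by rewrite ge_min lexx.
have h2 : h * m <= d / 2 by rewrite -ler_pdivlMr// !ge_min lexx orbT.
have h3 : h * q <= e by rewrite -ler_pdivlMr// !ge_min lexx !orbT.
apply: (le_trans (key h h0 h1 _)).
  move: h2; rewrite /m mulrDr mulr1 => h2.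
  by rewrite (_ : _ * h * _ = h * (2 * pi * `|x ord0 i|)); [lra|ring].
by rewrite lerD2l; move: h3; rewrite /q mulrDr mulr1; lra.
Qed.

Lemma ifourier_coord_decay c u i (N : nat) : 0 <= c -> smooth u -> csupp c u ->
  exists B, forall x, (pi * `|x ord0 i|) ^+ N * normc (ifourier u x) <= B.
Proof.
move=> c0; elim: N u => [|N IH] u su cu.
  exists (norm1 u) => x; rewrite expr0 mul1r; apply: normc_ifourier_le.
  exact: (smooth_csupp_cL1 c0).
have [B HB] := IH _ (smooth_cpartials [:: i] su) (csupp_cpartial i cu).
exists B => x; apply: le_trans (HB x).
rewrite exprSr -mulrA ler_wpM2l//; first by rewrite exprn_ge0// mulr_ge0// pi_ge0.
exact: (ifourier_partial_le i x c0 su cu).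
Qed.

Definition rapid f := forall N : nat, exists B, forall x, (1 + enorm x) ^+ N * normc (f x) <= B.

(** Some coordinate of x attains its maximum norm, so bounds for powers of each single coordinate
    suffice; summing the n constants gives a bound that serves whichever coordinate it is. *)
Lemma ifourier_rapid c u : 0 <= c -> smooth u -> csupp c u -> rapid (ifourier u).
Proof.
move=> c0 su cu N.
have H (i : 'I_n) : {B | forall x, (pi * `|x ord0 i|) ^+ N * normc (ifourier u x) <= B}.
  by apply: cid; exact: (ifourier_coord_decay i N c0 su cu).
pose B := norm1 u + \sum_i `|sval (H i)|.
have B0 : 0 <= B by rewrite addr_ge0 ?norm1_ge0// sumr_ge0.
have u1 := smooth_csupp_cL1 c0 su cu.
exists ((n.+1%:R * 2) ^+ N * B) => x.
have [x1|x1] := leP `|x| 1.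
  apply: ler_pM; rewrite ?exprn_ge0 ?normc_ge0 ?addr_ge0 ?enorm_ge0//.
    rewrite lerXn2r ?nnegrE ?mulr_ge0 ?addr_ge0 ?enorm_ge0//.
    by apply: (le_trans (enorm_1_le x)); rewrite ler_wpM2l//; lra.
  by apply: (le_trans (normc_ifourier_le x u1)); rewrite lerDl sumr_ge0.
have [i xi] : exists i, `|x ord0 i| = `|x|.
  have [|[k1 k2] e] := @mx_norm_neq0 R 1 n x.
    by apply: contraTneq x1 => x0; rewrite -leNgt /Num.norm/= x0.
  by exists k2; rewrite [RHS]e (ord1 k1).
have pi1 : 1 <= pi :> R by apply: le_trans (pi_ge2 R); rewrite ler1n.
apply: (@le_trans _ _ ((n.+1%:R * 2) ^+ N * ((pi * `|x ord0 i|) ^+ N * normc (ifourier u x)))).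
  rewrite [leRHS]mulrA ler_wpM2r ?normc_ge0// -exprMn.
  have h0 : 0 <= 1 + enorm x by rewrite addr_ge0 ?enorm_ge0.
  have h : 1 + enorm x <= n.+1%:R * 2 * (pi * `|x ord0 i|).
    apply: (le_trans (enorm_1_le x)); rewrite -!mulrA ler_wpM2l// xi.
    have : `|x| <= pi * `|x| by rewrite ler_peMl.
    by lra.
  by rewrite lerXn2r// nnegrE//; exact: le_trans h.
rewrite ler_wpM2l ?exprn_ge0 ?mulr_ge0//; apply: (le_trans (svalP (H i) x)).
rewrite /B (bigD1 i)//= addrCA; apply: ler_wpDr; last exact: ler_norm.
by rewrite addr_ge0 ?norm1_ge0 ?sumr_ge0.
Qed.

Lemma rapid_cL1 f : cmeas f -> rapid f -> cL1 f.
Proof.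
move=> mf /(_ (n + 2)%N)[B fB]; apply: (cL1_decay (C := B) mf) => x.
have h0 : 0 < 1 + enorm x by rewrite ltr_pwDl ?enorm_ge0.
have h1 : normc (f x) <= B * (1 + enorm x) ^- (n + 2).
  by rewrite ler_pdivlMr ?exprn_gt0// mulrC.
apply: (le_trans h1); rewrite ler_wpM2l ?enorm_1V_le//.
by apply: le_trans (fB 0); rewrite mulr_ge0 ?normc_ge0// exprn_ge0// addr_ge0 ?enorm_ge0.
Qed.

End rapid_decay.

(** * Schwartz functions: bounds, convolution and dilation *)

Section schwartz_facts.
Context {R : realType} {n : nat}.
Local Notation leb := (@lebesgue_rV R n).
Local Notation V := 'rV[R]_n.
Implicit Types (f g h : V -> R[i]).

Lemma schwartz_norm_ge f (N : nat) s x : (size s <= N)%N ->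
  (((1 + enorm x) ^+ N * normc (cpartials s f x))%:E <= schwartz_norm N f)%E.
Proof. by move=> sN; apply: ereal_sup_ubound; exists (s, x). Qed.

Lemma schwartz_norm_ge0 f (N : nat) : (0 <= schwartz_norm N f)%E.
Proof.
apply: le_trans (@schwartz_norm_ge f N [::] 0 _) => //.
by rewrite lee_fin mulr_ge0 ?normc_ge0// exprn_ge0// addr_ge0 ?enorm_ge0.
Qed.

Lemma schwartz_normE f (N : nat) : schwartz f -> schwartz_norm N f = (fine (schwartz_norm N f))%:E.
Proof. by move=> [_ sf]; rewrite fineK// ge0_fin_numE ?schwartz_norm_ge0. Qed.

Lemma schwartz_le f (N : nat) s x : schwartz f -> (size s <= N)%N ->
  (1 + enorm x) ^+ N * normc (cpartials s f x) <= fine (schwartz_norm N f).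
Proof. by move=> sf sN; rewrite -lee_fin -schwartz_normE// schwartz_norm_ge. Qed.

Lemma schwartz_rapid f s : schwartz f -> rapid (cpartials s f).
Proof.
move=> sf N; exists (fine (schwartz_norm (maxn N (size s)) f)) => x.
apply: le_trans (schwartz_le x sf (leq_maxr N (size s))).
rewrite ler_wpM2r ?normc_ge0// ler_weXn2l ?leq_maxl//.
by rewrite lerDl enorm_ge0.
Qed.

Lemma rapid_bounded f : rapid f -> exists B, forall x, normc (f x) <= B.
Proof. by move=> /(_ 0%N)[B H]; exists B => x; have := H x; rewrite expr0 mul1r. Qed.

Lemma schwartz_bounded_partials f : schwartz f -> bounded_partials f.
Proof. by move=> sf s; apply: rapid_bounded; exact: schwartz_rapid. Qed.

Lemma schwartz_cmeas f : schwartz f -> cmeas f.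
Proof. by move=> [sf _]; apply: cdifferentiable_cmeas; exact: smooth_cdifferentiable. Qed.

Lemma schwartz_cL1 f : schwartz f -> cL1 f.
Proof.
by move=> sf; apply: rapid_cL1; [exact: schwartz_cmeas|exact: (schwartz_rapid [::])].
Qed.

Lemma rapid_decays f (k : nat) : rapid f -> exists C, decays f C k%:R.
Proof.
move=> /(_ k)[B H]; exists B => x.
have h0 : 0 < 1 + enorm x by rewrite ltr_pwDl ?enorm_ge0.
by rewrite powR_invn ?(ltW h0)// ler_pdivlMr ?exprn_gt0// mulrC.
Qed.

Lemma smooth_ccontinuous f : smooth f -> ccontinuous f.
Proof.
move=> /smooth_cdifferentiable/cdifferentiable_continuous[c1 c2].
exact: ReIm_ccontinuous.
Qed.

(** All derivatives are put on g, and Peetre's inequality splits the weight [(1 + |x|)^N] into a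
    part for g and a part that the rapid decay of h absorbs. *)
Lemma schwartz_convolve g h : schwartz g -> cmeas h -> rapid h -> schwartz (convolve g h).
Proof.
move=> sg mh rh; have h1 := rapid_cL1 mh rh.
have bg := schwartz_bounded_partials sg.
split; first exact: (smooth_convolve h1 sg.1 bg).
(* The extra n + 2 orders of decay make h integrable against the weight of order N. *)
move=> N; have [B HB] := rh (N + (n + 2))%N.
pose hN y := ((1 + enorm y) ^+ N)%:C * h y.
have e0 (y : V) : 0 < 1 + enorm y by rewrite ltr_pwDl ?enorm_ge0.
have mhN : cmeas hN.
  apply: cmeasM mh; apply: cmeas_real; apply: measurable_funX; apply: measurable_funD => //.
  by apply: continuous_measurable_rV; exact: continuous_enorm.
have nhN y : normc (hN y) = (1 + enorm y) ^+ N * normc (h y).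
  by rewrite Normc.normcM normc_real ger0_norm// exprn_ge0// ltW.
have hN1 : cL1 hN.
  apply: (cL1_decay (C := B) mhN) => y.
  apply: (@le_trans _ _ (B * (1 + enorm y) ^- (n + 2))).
    by rewrite ler_pdivlMr ?exprn_gt0// nhN mulrAC -exprD.
  rewrite ler_wpM2l ?enorm_1V_le//.
  by apply: le_trans (HB 0); rewrite mulr_ge0 ?normc_ge0// exprn_ge0// ltW.
pose A := fine (schwartz_norm N g).
have A0 : 0 <= A by apply: fine_ge0; exact: schwartz_norm_ge0.
apply: (@le_lt_trans _ _ (A * norm1 hN)%:E); last exact: ltry.
apply: ge_ereal_sup => _ [[s x] /= sN <-]; rewrite lee_fin.
rewrite cpartials_convolve//; last exact: sg.1.
have ms : cmeas (cpartials s g).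
  by apply: cdifferentiable_cmeas; apply: smooth_cdifferentiable; apply: smooth_cpartials; exact: sg.1.
have [C gC] := bg s.
have c1 := cL1_convolve_in x ms gC h1.
rewrite mulrC -ler_pdivlMr ?exprn_gt0//.
apply: (le_trans (normc_cint_le c1)).
apply: (@norm1_le _ _ _ (fun y => (A * (1 + enorm x) ^- N) * normc (hN y))) => //.
  move=> y; rewrite Normc.normcM nhN mulrA ler_wpM2r ?normc_ge0//.
  have H := schwartz_le (x - y) sg sN.
  rewrite mulrAC ler_pdivlMr ?exprn_gt0//.
  apply: (@le_trans _ _ (normc (cpartials s g (x - y)) * ((1 + enorm (x - y)) * (1 + enorm y)) ^+ N)).
    rewrite ler_wpM2l ?normc_ge0//; have hB := enorm_1B_le x y.
    by rewrite lerXn2r// nnegrE ?mulr_ge0 ?(ltW (e0 _)).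
  by rewrite exprMn mulrA ler_wpM2r ?exprn_ge0 ?(ltW (e0 _))// mulrC.
under eq_integral do rewrite EFinM.
rewrite ge0_integralZl//; last 3 first.
- by apply/measurable_EFinP; exact: measurable_normc mhN.
- by move=> y _; rewrite lee_fin normc_ge0.
- by rewrite lee_fin mulr_ge0// invr_ge0 exprn_ge0// ltW.
by rewrite norm1E// -EFinM lee_fin mulrAC.
Qed.

Lemma cpartials_dilate (c : R[i]) (t : R) s f : smooth f -> bounded_partials f ->
  cpartials s (fun x => c * f (t *: x)) =
  (fun x => c * (t ^+ size s)%:C * cpartials s f (t *: x)) /\
  cdifferentiable (cpartials s (fun x => c * f (t *: x))).
Proof.
move=> sf bf.
have step (d : R[i]) g : smooth g -> bounded_partials g ->
    (forall i, cpartial i (fun x => d * g (t *: x)) = fun x => d * t%:C * cpartial i g (t *: x)) /\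
    cdifferentiable (fun x => d * g (t *: x)).
  move=> sg bg; have [B gB] := bounded_partials2 bg.
  suff H x : (differentiable (fun y => complex.Re (d * g (t *: y))) x /\
      differentiable (fun y => complex.Im (d * g (t *: y))) x) /\
      forall i, cpartial i (fun x => d * g (t *: x)) x = d * t%:C * cpartial i g (t *: x).
    by split => [i|x]; [apply/funext => x; exact: (H x).2|exact: (H x).1].
  apply: (@cdifferentiable_quadratic _ _ _ x _ (normc d * (2 * n%:R ^+ 2 * B * t ^+ 2))) => h.
  have := ctaylor (t *: x) (t *: h) sg gB.
  have -> : d * g (t *: (x + h)) - d * g (t *: x) -
      clin_form (fun i => d * t%:C * cpartial i g (t *: x)) h =
    d * (g (t *: x + t *: h) - g (t *: x) - clin_form (fun i => cpartial i g (t *: x)) (t *: h)).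
    rewrite scalerDr !mulrBr; congr (_ - _ - _); rewrite /clin_form mulr_sumr.
    by apply: eq_bigr => i _; rewrite mxE rmorphM /=; ring.
  rewrite Normc.normcM normrZ => H; rewrite -[leRHS]mulrA ler_wpM2l ?normc_ge0//.
  by apply: (le_trans H); rewrite exprMn (real_normK (num_real t)) mulrA.
elim: s => [|i s [IH1 IH2]].
  split; last by have [] := step c f sf bf.
  by apply/funext => x /=; rewrite expr0 mulr1.
have [E1 _] := step (c * (t ^+ size s)%:C) _ (smooth_cpartials s sf) (bounded_partials_cpartials s bf).
have E : cpartials (i :: s) (fun x => c * f (t *: x)) =
    (fun x => c * (t ^+ (size s).+1)%:C * cpartials (i :: s) f (t *: x)).
  rewrite [LHS]/= -/(cpartials s _) IH1 E1; apply/funext => x.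
  by rewrite exprSr rmorphM /= mulrA.
split; first exact: E.
by rewrite E; have [] := step (c * (t ^+ (size s).+1)%:C) _ (smooth_cpartials (i :: s) sf) (bounded_partials_cpartials (i :: s) bf).
Qed.

Lemma schwartz_scale (c : R[i]) (t : R) f : 0 < t -> schwartz f -> schwartz (fun x => c * f (t *: x)).
Proof.
move=> t0 sf; have bf := schwartz_bounded_partials sf; split.
  by move=> s x; have [_] := cpartials_dilate c t s sf.1 bf; exact.
move=> N; pose m := Num.max 1 t^-1; pose M := Num.max 1 t.
have m1 : 1 <= m by rewrite le_max lexx.
have M1 : 1 <= M by rewrite le_max lexx.
have A0 : 0 <= fine (schwartz_norm N f) by apply: fine_ge0; exact: schwartz_norm_ge0.
apply: (@le_lt_trans _ _ (m ^+ N * (normc c * M ^+ N) * fine (schwartz_norm N f))%:E); last exact: ltry.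
apply: ge_ereal_sup => _ [[s x] /= sN <-]; rewrite lee_fin.
have [-> _] := cpartials_dilate c t s sf.1 bf.
have H := schwartz_le (t *: x) sf sN.
have e0 (y : V) : 0 <= 1 + enorm y by rewrite addr_ge0 ?enorm_ge0.
have h1 : 1 + enorm x <= m * (1 + enorm (t *: x)).
  rewrite enormZ gtr0_norm// mulrDr mulr1; apply: lerD => //.
  rewrite mulrA ler_peMl ?enorm_ge0// -ler_pdivrMr//.
  by rewrite div1r le_max lexx orbT.
have h2 : normc (c * (t ^+ size s)%:C) <= normc c * M ^+ N.
  rewrite Normc.normcM ler_wpM2l ?normc_ge0// normc_real normrX gtr0_norm//.
  apply: (@le_trans _ _ (M ^+ size s)).
    by rewrite lerXn2r ?nnegrE ?(ltW t0)// ?le_max ?lexx ?orbT// (le_trans ler01).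
  by rewrite ler_weXn2l.
rewrite Normc.normcM.
apply: (@le_trans _ _ ((m * (1 + enorm (t *: x))) ^+ N * (normc c * M ^+ N * normc (cpartials s f (t *: x))))).
  apply: ler_pM; rewrite ?exprn_ge0 ?mulr_ge0 ?normc_ge0//.
    by rewrite lerXn2r ?nnegrE ?mulr_ge0// (le_trans ler01).
  by rewrite ler_wpM2r ?normc_ge0.
rewrite exprMn -!mulrA ler_wpM2l ?exprn_ge0 ?(le_trans ler01)//.
rewrite mulrCA ler_wpM2l ?normc_ge0// mulrCA ler_wpM2l ?exprn_ge0 ?(le_trans ler01)//.
Qed.

Lemma schwartz_lp_dilate (phi : V -> R[i]) j : schwartz phi -> schwartz (lp_dilate phi j).
Proof. by move=> sp; apply: schwartz_scale => //; exact: exprz_gt0. Qed.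

End schwartz_facts.

Section band_limited_facts.
Context {R : realType} {n : nat}.
Local Notation leb := (@lebesgue_rV R n).
Local Notation V := 'rV[R]_n.
Variables (a b : R) (f : V -> R[i]).
Hypotheses (b0 : 0 <= b) (bf : band_limited a b f).

Lemma band_limited_cL1 : cL1 f.
Proof. by have [c1 c2 fo _ _] := bf; split => //; exact: ReIm_cmeas. Qed.

Lemma band_limited_ccontinuous : ccontinuous f.
Proof. by have [c1 c2 _ _ _] := bf; exact: ReIm_ccontinuous. Qed.

Lemma band_limited_outside xi : b < enorm xi -> fourier f xi = 0.
Proof. by have [_ _ _ _ fs] := bf => h; apply: fs; rewrite negb_and -!ltNge h orbT. Qed.

Lemma band_limited_csupp : csupp b (fourier f).
Proof.
by move=> xi h; apply: band_limited_outside; apply: lt_le_trans h (ler_norm_enorm xi).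
Qed.

Lemma band_limited_fourier_cL1 : cL1 (fourier f).
Proof.
by have [_ _ _ sf _] := bf; exact: (smooth_csupp_cL1 b0 sf band_limited_csupp).
Qed.

(** By inversion f is, up to a constant, the inverse transform of a smooth function of compact
    support. *)
Lemma band_limited_rapid : rapid f.
Proof.
move=> N; have [_ _ _ sf _] := bf.
have [B HB] := ifourier_rapid b0 sf band_limited_csupp N.
exists (normc (@inversion_cst R n) * B) => x.
rewrite (fourier_inversion x band_limited_cL1 band_limited_fourier_cL1 band_limited_ccontinuous).
rewrite [normc (inversion_cst * _)]Normc.normcM mulrCA ler_wpM2l ?normc_ge0//.
Qed.

End band_limited_facts.

(** * Littlewood-Paley blocks *)

Section zrange_facts.

Lemma mem_zrange (i : int) (M : nat) : (i \in zrange M) = (`|i| <= M%:Z)%R.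
Proof.
apply/mapP/idP => [[k]|iM].
  by rewrite mem_iota => /andP[_ kM] ->; lia.
exists (absz (i + M%:Z)); last by lia.
by rewrite mem_iota; apply/andP; split; lia.
Qed.

Lemma uniq_zrange (M : nat) : uniq (zrange M).
Proof. by rewrite map_inj_uniq ?iota_uniq// => x y; lia. Qed.

End zrange_facts.

Section band_width_facts.
Context {R : realType}.

(** The ceiling gives both ratios at most [2^M]; the strict inequality comes from m being an integer
    larger than M. *)
Lemma band_width_lt (a b c1 c2 : R) (m : int) : 0 < a -> 0 < b -> 0 < c1 -> 0 < c2 ->
  (band_width a b c1 c2)%:Z < m -> b / c1 < 2 ^ m /\ c2 / a < 2 ^ m.
Proof.
move=> a0 b0 c10 c20; rewrite /band_width; set t := Num.max _ 0 => Mm.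
have t0 : 0 <= t by rewrite /t le_max lexx orbT.
have cE : (absz (Num.ceil t))%:Z = Num.ceil t by rewrite gez0_abs// ceil_ge0// (lt_le_trans _ t0)// ltrN10.
have ln20 : 0 < ln 2 :> R by rewrite ln_gt0// ltr1n.
set M := absz _ in Mm cE.
have key x : 0 < x -> log2 x <= t -> x < 2 ^ m.
  move=> x0 xt; apply: (@le_lt_trans _ _ (2 ^+ M)).
    rewrite -ler_ln ?posrE ?exprn_gt0// lnXn// -[_ *+ M]mulr_natl -ler_pdivrMr//.
    apply: (le_trans xt); apply: (le_trans (ceil_ge t)).
    by rewrite -cE.
  rewrite -[2 ^+ M]/(2 ^ M%:Z); rewrite (_ : m = M%:Z + (m - M%:Z)); last by lia.
  rewrite expfzDr// ltr_pMr ?exprn_gt0//.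
  rewrite (_ : m - M%:Z = (absz (m - M%:Z))%:Z); last by lia.
  by rewrite -exprnP expr_gt1 ?ltr1n//; lia.
split; apply: key; rewrite ?divr_gt0//.
  by rewrite /t !le_max lexx.
by rewrite /t !le_max lexx orbT.
Qed.

End band_width_facts.

Section dilations.
Context {R : realType} {n : nat}.
Local Notation leb := (@lebesgue_rV R n).
Local Notation V := 'rV[R]_n.
Implicit Types (f g h : V -> R[i]) (j l : int).

Lemma pow2_neq0 j : (2 : R) ^ j != 0. Proof. by rewrite gt_eqF// pow2_gt0. Qed.

Lemma pow2N j : (2 : R) ^ (- j) = (2 ^ j)^-1.
Proof. by apply: (mulIf (pow2_neq0 j)); rewrite pow2VM mulVf// pow2_neq0. Qed.

Lemma cL1_dilate h j k : cL1 h -> cL1 (dilate h j k).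
Proof. by move=> h1; apply: cL1Z; exact: (cL1_affine (- intv k) (pow2_neq0 j)). Qed.

(** The transform serves here to locate the spectrum, so the factor A, a normalisation times a
    phase, is left unspecified. *)
Lemma fourier_wave h j k xi : cL1 h ->
  exists A : R[i], fourier (dilate h j k) xi = A * fourier h ((2 ^ (- j)) *: xi).
Proof.
move=> h1; pose g y := h (y + - intv k).
have g1 : cL1 g by exact: cL1_shift.
set B : R[i] := (2 `^ (j%:~R * n%:R / 2))%:C.
have m : measurable_fun setT (fun x : V => - x) by exact: measurable_rVN.
exists (B * ((`|2 ^ j| ^- n)%:C * chr (- intv k) ((2 ^ (- j)) *: xi))).
have E : fourier (dilate h j k) xi = B * fourier (fun x => g ((2 ^ j) *: x)) xi.
  rewrite !fourierE -cintZ; first by apply: eq_cint => x; rewrite /dilate mulrA.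
  apply: cL1_chr => //; have := cL1_affine 0 (pow2_neq0 j) g1.
  by congr cL1; apply/funext => x; rewrite addr0.
rewrite E fourier_dilate ?pow2_neq0// -pow2N.
rewrite (_ : fourier g _ = chr (- intv k) ((2 ^ (- j)) *: xi) * fourier h ((2 ^ (- j)) *: xi)).
  by rewrite !mulrA.
by rewrite -fourier_translate.
Qed.

Lemma fourier_lp_dilate (phi : V -> R[i]) j xi : cL1 phi ->
  fourier (lp_dilate phi j) xi = fourier phi ((2 ^ (- j)) *: xi).
Proof.
move=> h1; have m : measurable_fun setT (fun x : V => - x) by exact: measurable_rVN.
have E : fourier (lp_dilate phi j) xi = (2 ^ (j * n%:Z))%:C * fourier (fun x => phi ((2 ^ j) *: x)) xi.
  rewrite !fourierE -cintZ; first by apply: eq_cint => x; rewrite /lp_dilate mulrA.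
  apply: cL1_chr => //; have := cL1_affine 0 (pow2_neq0 j) h1.
  by congr cL1; apply/funext => x; rewrite addr0.
rewrite E fourier_dilate ?pow2_neq0// -pow2N mulrA -rmorphM /=.
rewrite gtr0_norm ?pow2_gt0// -exprz_exp mulfV ?mul1r//.
by rewrite expf_neq0// pow2_neq0.
Qed.

Lemma convolve_dilate (phi psi : V -> R[i]) (C : R) (l i : int) k x :
  cmeas phi -> (forall y, normc (phi y) <= C) -> cL1 psi ->
  convolve (lp_dilate phi (l + i)) (dilate psi l k) x =
  dilate (convolve (lp_dilate phi i) psi) l k x.
Proof.
move=> mphi phiC psi1; rewrite /dilate /convolve; set B := (_ `^ _)%:C.
pose F z := lp_dilate phi i ((2 ^ l) *: x - intv k - z) * psi z.
have F1 : cL1 F.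
  rewrite /F; under eq_fun do rewrite mulrC.
  apply: (cL1M_bounded (C := normc ((2 : R) ^ (i * n%:Z))%:C * C)) => //.
    apply: cmeasM; first exact: cmeas_cst.
    apply: (cmeas_comp mphi (h := fun z : V => (2 ^ i) *: ((2 ^ l) *: x - intv k - z))).
    by apply: measurable_rVZ; apply: measurable_rVB => //; exact: measurable_cst.
  by move=> z; rewrite Normc.normcM ler_wpM2l ?normc_ge0.
have FA := cL1_affine (- intv k) (pow2_neq0 l) F1.
transitivity (cint (fun y => B * (2 ^ (l * n%:Z))%:C * F ((2 ^ l) *: y + - intv k))).
  apply: eq_cint => y; rewrite /F /lp_dilate.
  rewrite (_ : (2 ^ l) *: x - intv k - ((2 ^ l) *: y + - intv k) = (2 ^ l) *: (x - y)); last first.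
    by rewrite scalerBr opprB addrA subrK.
  rewrite scalerA -expfzDr// [i + l]addrC mulrDl expfzDr// rmorphM /=.
  by ring.
rewrite cintZ// (cint_affine (- intv k) (pow2_neq0 l) F1.1) mulrA -[B * _ * _]mulrA -rmorphM /=.
rewrite gtr0_norm ?pow2_gt0// -exprz_exp mulfV ?mulr1//.
by rewrite expf_neq0// pow2_neq0.
Qed.

End dilations.

(** * Littlewood-Paley blocks of a single-scale sum *)

Section littlewood_paley.
Context {R : realType} {n : nat}.
Local Notation leb := (@lebesgue_rV R n).
Local Notation V := 'rV[R]_n.
Variables (a b c1 c2 : R) (psi phi : V -> R[i]).
Hypotheses (ab : 0 < a < b) (bpsi : band_limited a b psi) (lp : lp_function c1 c2 phi).
Variables (l : int) (Lam : {fset 'rV[int]_n}) (c : 'rV[int]_n -> R[i]).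

Let a0 : 0 < a. Proof. by case/andP: ab. Qed.
Let b0 : 0 < b. Proof. by case/andP: ab => /lt_trans; apply. Qed.
Let c10 : 0 < c1. Proof. by have /andP[] := lp_radii lp. Qed.
Let c20 : 0 < c2. Proof. by have /andP[h /(lt_trans h)] := lp_radii lp. Qed.
Let psi1 : cL1 psi. Proof. exact: band_limited_cL1 bpsi. Qed.
Let sphi : schwartz phi. Proof. exact: lp_schwartz lp. Qed.
Let phi1 : cL1 phi. Proof. exact: schwartz_cL1. Qed.
Let r := single_scale psi l Lam c.
Let M := band_width a b c1 c2.
Let Delta j := lp_block phi j (regular_dist r).

Lemma cL1_single_scale : cL1 r.
Proof. by apply: cL1_sum => k; apply: cL1Z; exact: cL1_dilate. Qed.

Lemma ccontinuousD (f g : V -> R[i]) : ccontinuous f -> ccontinuous g -> ccontinuous (fun x => f x + g x).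
Proof.
move=> fc gc x e e0; have e2 : 0 < e / 2 by rewrite divr_gt0.
have [d1 d10 H1] := fc x _ e2; have [d2 d20 H2] := gc x _ e2.
exists (Num.min d1 d2); first by rewrite lt_min d10.
move=> y; rewrite lt_min => /andP[h1 h2].
rewrite (_ : _ - _ = (f y - f x) + (g y - g x)); last by ring.
by apply: (le_lt_trans (le_normcD _ _)); rewrite [e]splitr ltrD ?H1 ?H2.
Qed.

Lemma ccontinuousZ (d : R[i]) (f : V -> R[i]) : ccontinuous f -> ccontinuous (fun x => d * f x).
Proof.
move=> fc x e e0; have d0 : 0 < normc d + 1 by rewrite ltr_wpDl ?normc_ge0.
have e2 : 0 < e / (normc d + 1) by rewrite divr_gt0.
have [d1 d10 H1] := fc x _ e2; exists d1 => // y /H1 h.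
rewrite -mulrBr Normc.normcM; apply: (@le_lt_trans _ _ ((normc d + 1) * normc (f y - f x))).
  by rewrite ler_wpM2r ?normc_ge0// lerDl.
by rewrite mulrC -ltr_pdivlMr.
Qed.

Lemma ccontinuous0 : ccontinuous (fun _ : V => 0 : R[i]).
Proof. by move=> x e e0; exists 1 => // y _; rewrite subrr Normc.normc0. Qed.

Lemma ccontinuous_sum (I : Type) (s : seq I) (F : I -> V -> R[i]) : (forall i, ccontinuous (F i)) ->
  ccontinuous (fun x => \sum_(i <- s) F i x).
Proof.
move=> cF; elim: s => [|i s IH].
  by under eq_fun do rewrite big_nil; exact: ccontinuous0.
by under eq_fun do rewrite big_cons; exact: ccontinuousD.
Qed.

Lemma ccontinuous_dilate (f : V -> R[i]) j k : ccontinuous f -> ccontinuous (dilate f j k).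
Proof.
move=> fc; apply: ccontinuousZ => x e e0.
have [d d0 H] := fc ((2 ^ j) *: x - intv k) e e0.
exists (d / 2 ^ j); first by rewrite divr_gt0// pow2_gt0.
move=> y; rewrite ltr_pdivlMr ?pow2_gt0// => h; apply: H.
rewrite (_ : _ - _ = (2 ^ j) *: (y - x)); first by rewrite normrZ gtr0_norm ?pow2_gt0// mulrC.
by rewrite opprB addrA subrK scalerBr.
Qed.

Lemma ccontinuous_single_scale : ccontinuous r.
Proof.
apply: ccontinuous_sum => k; apply: ccontinuousZ; apply: ccontinuous_dilate.
exact: band_limited_ccontinuous bpsi.
Qed.

Lemma fourier_sum (I : Type) (s : seq I) (F : I -> V -> R[i]) xi : (forall i, cL1 (F i)) ->
  fourier (fun x => \sum_(i <- s) F i x) xi = \sum_(i <- s) fourier (F i) xi.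
Proof.
move=> F1; have m : measurable_fun setT (fun x : V => - x) by exact: measurable_rVN.
under eq_bigr do rewrite fourierE.
rewrite fourierE -cint_sum; last by move=> i; exact: cL1_chr.
by apply: eq_cint => x; rewrite mulr_suml.
Qed.

Lemma fourierZ (d : R[i]) (f : V -> R[i]) xi : cL1 f -> fourier (fun x => d * f x) xi = d * fourier f xi.
Proof.
move=> f1; have m : measurable_fun setT (fun x : V => - x) by exact: measurable_rVN.
by rewrite !fourierE -cintZ; [apply: eq_cint => x; rewrite mulrA|exact: cL1_chr].
Qed.

Lemma fourier_single_scale_support xi :
  ~~ (2 ^ l * a <= enorm xi <= 2 ^ l * b) -> fourier r xi = 0.
Proof.
move=> h; rewrite /r /single_scale fourier_sum; last first.
  by move=> k; apply: cL1Z; exact: cL1_dilate.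
apply: big1_seq => k _; rewrite fourierZ; last exact: cL1_dilate.
have [A ->] := fourier_wave l k xi psi1.
have [_ _ _ _ ->] := bpsi; first by rewrite !mulr0.
rewrite enormZ gtr0_norm ?pow2_gt0// pow2N mulrC.
by rewrite ler_pdivlMr ?pow2_gt0// ler_pdivrMr ?pow2_gt0// mulrC [b * _]mulrC.
Qed.

Lemma lp_blockE j x : Delta j x = convolve (lp_dilate phi j) r x.
Proof. by apply: eq_cint => y; rewrite mulrC. Qed.

Lemma lp_dilate_bounded j : exists C, forall y, normc (lp_dilate phi j y) <= C.
Proof. exact: (schwartz_bounded_partials (schwartz_lp_dilate j sphi) [::]). Qed.

Lemma cL1_lp_dilate j : cL1 (lp_dilate phi j).
Proof. exact: schwartz_cL1 (schwartz_lp_dilate j sphi). Qed.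

Lemma cL1_lp_block j : cL1 (Delta j).
Proof.
have [C HC] := lp_dilate_bounded j.
rewrite (_ : Delta j = convolve (lp_dilate phi j) r); last by apply/funext => x; exact: lp_blockE.
exact: (cL1_convolve (cL1_lp_dilate j) HC cL1_single_scale).
Qed.

Lemma smooth_lp_block j : smooth (Delta j).
Proof.
rewrite (_ : Delta j = convolve (lp_dilate phi j) r); last by apply/funext => x; exact: lp_blockE.
have s := schwartz_lp_dilate j sphi.
exact: (smooth_convolve cL1_single_scale s.1 (schwartz_bounded_partials s)).
Qed.

Lemma fourier_lp_block j xi : fourier (Delta j) xi = fourier phi ((2 ^ (- j)) *: xi) * fourier r xi.
Proof.
have [C HC] := lp_dilate_bounded j.
rewrite (_ : Delta j = convolve (lp_dilate phi j) r); last by apply/funext => x; exact: lp_blockE.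
by rewrite (fourier_convolve (cL1_lp_dilate j) HC cL1_single_scale) fourier_lp_dilate.
Qed.

(** For j > l the scaled frequency is at most [2^(l-j) b], which is below c1; for j < l it is at
    least [2^(l-j) a], which is above c2. The two ratios in [band_width] are the ones that decide
    this. *)
Lemma fourier_phi_off j xi : (M%:Z < `|j - l|)%R -> 2 ^ l * a <= enorm xi <= 2 ^ l * b ->
  fourier phi ((2 ^ (- j)) *: xi) = 0.
Proof.
move=> Mj /andP[h1 h2]; apply: (lp_support lp).
rewrite enormZ gtr0_norm ?pow2_gt0// negb_and -!ltNge.
have [b1 b2] := band_width_lt a0 b0 c10 c20 Mj.
rewrite pow2N mulrC ltr_pdivrMr ?pow2_gt0// ltr_pdivlMr ?pow2_gt0//; apply/orP.
have [lj|jl] := ltP l j; [left|right].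
  move: b1; rewrite (_ : `|j - l| = j - l); last by lia.
  rewrite expfzDr// pow2N ltr_pdivlMr ?pow2_gt0// mulrAC ltr_pdivrMr// => b1.
  by apply: (le_lt_trans h2); rewrite mulrC [ltRHS]mulrC.
move: b2; rewrite (_ : `|j - l| = l - j); last by lia.
rewrite expfzDr// pow2N ltr_pdivlMr ?pow2_gt0// mulrAC ltr_pdivrMr// => b2.
exact: lt_le_trans h1.
Qed.

Lemma lp_block_off j : (M%:Z < `|j - l|)%R -> forall x, Delta j x = 0.
Proof.
move=> Mj; apply: fourier_inj0; first exact: cL1_lp_block.
  by apply: smooth_ccontinuous; exact: smooth_lp_block.
move=> xi; rewrite fourier_lp_block.
have [h|h] := boolP (2 ^ l * a <= enorm xi <= 2 ^ l * b).
  by rewrite fourier_phi_off// mul0r.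
by rewrite fourier_single_scale_support// mulr0.
Qed.

(** The partition of unity speaks of real parts over all integers. Terms off s vanish, and the
    imaginary parts are 0 because the transform of phi is real. *)
Lemma lp_partition_seq (s : seq int) xi : xi != 0 -> uniq s ->
  (forall j, j \notin s -> fourier phi ((2 ^ (- j)) *: xi) = 0) ->
  \sum_(j <- s) fourier phi ((2 ^ (- j)) *: xi) = 1.
Proof.
move=> xi0 us H; have := lp_partition lp xi0.
rewrite -(@fsbig_widen _ _ _ _ [set` s]) //; last first.
  by move=> j [_ /negP js]; exact: (congr1 (@complex.Re R) (H j js)).
rewrite -fsbig_seq// => E.
apply: complex_ext; first by rewrite Re_sum E.
by rewrite Im_sum big1// => j _; exact: lp_real lp _.
Qed.

Lemma lp_block_sum x : r x = \sum_(i <- zrange M) Delta (l + i) x.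
Proof.
apply/esym/eqP; rewrite -subr_eq0; apply/eqP.
have D1 := cL1_sum (zrange M) (fun i => cL1_lp_block (l + i)).
move: x; apply: (@fourier_inj0 _ _ (fun x => \sum_(i <- zrange M) Delta (l + i) x - r x)).
- by apply: cL1B => //; exact: cL1_single_scale.
- under eq_fun do rewrite -mulN1r; apply: ccontinuousD.
    by apply: ccontinuous_sum => i; apply: smooth_ccontinuous; exact: smooth_lp_block.
  by apply: ccontinuousZ; exact: ccontinuous_single_scale.
move=> xi; have m : measurable_fun setT (fun x : V => - x) by exact: measurable_rVN.
transitivity (fourier (fun x => \sum_(i <- zrange M) Delta (l + i) x) xi - fourier r xi).
  rewrite !fourierE -cintB; [|exact: cL1_chr|by apply: cL1_chr => //; exact: cL1_single_scale].
  by apply: eq_cint => x; rewrite mulrBl.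
rewrite fourier_sum; last by move=> i; exact: cL1_lp_block.
under eq_bigr do rewrite fourier_lp_block.
rewrite -mulr_suml.
have [h|h] := boolP (2 ^ l * a <= enorm xi <= 2 ^ l * b); last first.
  by rewrite fourier_single_scale_support// mulr0 subrr.
(* The partition of unity fails at the origin, which the annulus avoids because a is positive. *)
have xi0 : xi != 0.
  apply: contraTneq h => ->; rewrite negb_and -!ltNge.
  have -> : enorm (0 : V) = 0 by rewrite -(scale0r (0 : V)) enormZ normr0 mul0r.
  by rewrite mulr_gt0// pow2_gt0.
have := @lp_partition_seq [seq l + i | i <- zrange M] xi xi0.
rewrite map_inj_uniq ?uniq_zrange; last by move=> u v /addrI.
rewrite big_map => -> //; first by rewrite mul1r subrr.
move=> j jn; apply: fourier_phi_off h.
rewrite ltNge; apply: contra jn => jM; apply/mapP; exists (j - l); first by rewrite mem_zrange.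
by rewrite addrC subrK.
Qed.

Lemma lp_block_single_scale i :
  Delta (l + i) = single_scale (convolve (lp_dilate phi i) psi) l Lam c.
Proof.
apply/funext => x; rewrite lp_blockE /single_scale.
have [C HC] := lp_dilate_bounded (l + i).
have [C' HC'] := schwartz_bounded_partials sphi [::].
have mphi := (cL1_lp_dilate (l + i)).1.
rewrite /convolve /r /single_scale; under eq_cint do rewrite mulr_sumr.
rewrite cint_sum; last first.
  move=> k; have := cL1Z (c k) (cL1_convolve_in x mphi HC (cL1_dilate l k psi1)).
  by congr cL1; apply/funext => y; rewrite mulrCA.
apply: eq_bigr => k _.
rewrite -(convolve_dilate l i k x phi1.1 HC' psi1) /convolve -cintZ; last first.
  exact: cL1_convolve_in x mphi HC (cL1_dilate l k psi1).
by apply: eq_cint => y; rewrite mulrCA.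
Qed.

Lemma schwartz_lp_convolve i : schwartz (convolve (lp_dilate phi i) psi).
Proof.
apply: schwartz_convolve; [exact: schwartz_lp_dilate|exact: psi1.1|].
exact: (band_limited_rapid (ltW b0) bpsi).
Qed.

Lemma tempered_regular_dist (g : V -> R[i]) : cL1 g -> tempered (regular_dist g).
Proof.
move=> g1; have gh1 h : schwartz h -> cL1 (fun x => g x * h x).
  move=> sh; have [C HC] := schwartz_bounded_partials sh [::].
  exact: (cL1M_bounded g1 (schwartz_cmeas sh) HC).
split.
  move=> d g' h sg' sh; rewrite /regular_dist -cintZ; last exact: gh1.
  rewrite -cintD; [|by apply: cL1Z; exact: gh1|exact: gh1].
  by apply: eq_cint => x; ring.
exists 0%N, (norm1 g) => h sh; rewrite (schwartz_normE _ sh) -EFinM lee_fin.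
apply: (le_trans (normc_cint_le (gh1 h sh))).
apply: (@norm1_le _ _ _ (fun y => fine (schwartz_norm 0 h) * normc (g y))).
- exact: gh1.
- move=> y; rewrite Normc.normcM mulrC ler_wpM2r ?normc_ge0//.
  by have := @schwartz_le _ _ h 0 [::] y sh (leqnn 0); rewrite expr0 mul1r.
- under eq_integral do rewrite EFinM.
  have s0 : 0 <= fine (schwartz_norm 0 h) by apply: fine_ge0; exact: schwartz_norm_ge0.
  rewrite ge0_integralZl ?lee_fin//; last 2 first.
  + by apply/measurable_EFinP; exact: measurable_normc g1.1.
  + by move=> x _; rewrite lee_fin normc_ge0.
  by rewrite norm1E// -EFinM mulrC.
Qed.

End littlewood_paley.

(** * Besov norms *)

Lemma le_max_seq d (T : orderType d) (I : eqType) (x0 : T) (s : seq I) (F : I -> T) i :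
  i \in s -> (F i <= \big[Order.max/x0]_(k <- s) F k)%O.
Proof.
elim: s => // k s IH; rewrite inE big_cons le_max => /orP[/eqP->|/IH ->]; last by rewrite orbT.
by rewrite lexx.
Qed.

Section weighted_norm.
Context {R : realType} {n : nat}.
Local Notation leb := (@lebesgue_rV R n).
Local Notation V := 'rV[R]_n.
Variables (p : R) (w : V -> R).
Hypotheses (p_gt1 : 1 < p) (wn : nice_weight p w).
Implicit Types f : V -> R[i].

Let p0 : 0 < p. Proof. exact: lt_trans p_gt1. Qed.
Let mw : measurable_fun setT w. Proof. by have [] := wn. Qed.
Let w0 x : 0 <= w x. Proof. by have [_ /(_ x)/ltW] := wn. Qed.
Let Ip f := (\int[leb]_x (normc (f x) `^ p * w x)%R%:E)%E.
Let Ip0 f : (0 <= Ip f)%E.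
Proof. by apply: integral_ge0 => x _; rewrite lee_fin mulr_ge0 ?powR_ge0. Qed.

Lemma Lpw_norm_ge0 f : (0 <= Lpw_norm p w f)%E.
Proof. exact: poweR_ge0. Qed.

Lemma Lpw_normP f (t : R) : 0 <= t ->
  (Lpw_norm p w f <= t%:E)%E <-> (Ip f <= (t `^ p)%:E)%E.
Proof.
move=> t0; split => H.
  have -> : Ip f = (Lpw_norm p w f `^ p)%E.
    by rewrite /Lpw_norm -poweRrM mulVf ?gt_eqF// poweRe1//; exact: Ip0.
  rewrite -poweR_EFin; apply: gt0_ler_poweR => //; first exact: ltW.
  - by rewrite in_itv/= leey andbT Lpw_norm_ge0.
  - by rewrite in_itv/= leey andbT lee_fin.
rewrite (_ : t%:E = ((t `^ p)%:E `^ p^-1)%E); last first.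
  by rewrite poweR_EFin -powRrM mulfV ?gt_eqF// powRr1.
apply: gt0_ler_poweR => //; first by rewrite invr_ge0 ltW.
- by rewrite in_itv/= leey andbT Ip0.
- by rewrite in_itv/= leey andbT lee_fin powR_ge0.
Qed.

Lemma Lpw_norm0 : Lpw_norm p w (fun=> 0) = 0%E.
Proof.
rewrite /Lpw_norm; under eq_integral do rewrite Normc.normc0 powR0 ?gt_eqF// mul0r.
by rewrite integral0 poweR0r// invr_eq0 gt_eqF.
Qed.

Let mI f : cmeas f -> measurable_fun setT (fun x => normc (f x) `^ p * w x).
Proof.
move=> mf; apply: measurable_funM mw; apply: (measurableT_comp (measurable_powR _)).
exact: measurable_normc.
Qed.

(* Jensen's inequality replaces Minkowski's. *)
Lemma Lpw_norm_sum_le (I : Type) (s : seq I) (F : I -> V -> R[i]) (a : I -> R) (b : R) :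
  (forall i, cmeas (F i)) -> (forall i, 0 < a i) -> 0 <= b ->
  (forall i, Lpw_norm p w (F i) <= (a i * b)%:E)%E ->
  (Lpw_norm p w (fun x => \sum_(i <- s) F i x)%R <= ((\sum_(i <- s) a i) * b)%:E)%E.
Proof.
move=> mF a0 b0 H; set A := \sum_(i <- s) a i.
have A0 : 0 <= A by apply: sumr_ge0 => i _; exact: ltW.
apply/Lpw_normP; first exact: mulr_ge0.
(* Jensen's inequality with weights [a i] at the points [normc (F i x) / a i]. The i-th integral is
   then at most [A^(p-1) * a i * b^p], and the sum is exactly [(A * b)^p]. *)
pose G i x := A `^ (p - 1) * a i `^ (1 - p) * (normc (F i x) `^ p * w x).
have G0 i x : 0 <= G i x by rewrite !mulr_ge0 ?powR_ge0.
apply: (@le_trans _ _ (\int[leb]_x (\sum_(i <- s) (G i x)%:E))%E).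
  apply: ge0_le_lower_integral => x; first by rewrite lee_fin mulr_ge0 ?powR_ge0.
  rewrite sumEFin lee_fin /G.
  rewrite (eq_bigr (fun i => A `^ (p - 1) * (a i * (normc (F i x) / a i) `^ p) * w x)); last first.
    move=> i _; rewrite -[RHS]mulrA -[LHS]mulrA; congr (_ * _); rewrite mulrA; congr (_ * _).
    rewrite powRM ?normc_ge0 ?invr_ge0 ?(ltW (a0 i))// mulrCA mulrC; congr (_ * _).
    rewrite -[in RHS](powR_inv1 (ltW (a0 i))) -powRrM mulN1r.
    by rewrite powRD ?powRr1 ?(ltW (a0 i))//; apply/implyP => _; rewrite gt_eqF.
  rewrite -mulr_suml ler_wpM2r// -mulr_sumr.
  apply: (@le_trans _ _ ((\sum_(i <- s) a i * (normc (F i x) / a i)) `^ p)).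
    apply: ge0_ler_powR; rewrite ?nnegrE ?normc_ge0 ?(ltW p0)//.
      by apply: sumr_ge0 => i _; rewrite mulr_ge0 ?divr_ge0 ?normc_ge0 ?(ltW (a0 i)).
    apply: (le_trans (normc_sum _ _)); apply: ler_sum => i _.
    by rewrite mulrC divfK// gt_eqF.
  by apply: jensen_sum => // i; rewrite ?divr_ge0 ?normc_ge0 ?(ltW (a0 i)).
rewrite ge0_integral_sum//; last 2 first.
- by move=> i; apply/measurable_EFinP; apply: measurable_funM => //; exact: mI.
- by move=> i x _; rewrite lee_fin.
apply: (@le_trans _ _ (\sum_(i <- s) (A `^ (p - 1) * b `^ p * a i)%:E)%E); last first.
  rewrite sumEFin lee_fin -mulr_sumr -/A powRM// mulrAC ler_wpM2r ?powR_ge0//.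
  by rewrite mulrC mulr_powRB1.
apply: lee_sum => i _; rewrite /G; under eq_integral do rewrite EFinM.
rewrite ge0_integralZl//; last 3 first.
- by apply/measurable_EFinP; exact: mI.
- by move=> x _; rewrite lee_fin mulr_ge0 ?powR_ge0.
- by rewrite lee_fin mulr_ge0 ?powR_ge0.
have := H i; move/(Lpw_normP _ (mulr_ge0 (ltW (a0 i)) b0)) => {}H.
apply: (le_trans (lee_wpmul2l _ H)); first by rewrite lee_fin mulr_ge0 ?powR_ge0.
rewrite -EFinM lee_fin powRM ?(ltW (a0 i))// -!mulrA ler_wpM2l ?powR_ge0//.
rewrite mulrA [leRHS]mulrC ler_wpM2r ?powR_ge0//.
rewrite -powRD; last by apply/implyP => _; rewrite gt_eqF.
by rewrite subrK powRr1// ltW.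
Qed.

End weighted_norm.

Section besov_sum.
Context {R : realType}.
Variables (s q : R) (l : int) (M : nat) (e : int -> R).
Hypotheses (q0 : 0 < q) (e0 : forall j, 0 <= e j).
Hypothesis e_off : forall j, (M%:Z < `|j - l|)%R -> e j = 0.

Let Q : \bar R := ((\esum_(j in [set: int]) ((2 `^ (j%:~R * s * q))%R%:E * (e j)%:E `^ q)) `^ q^-1)%E.
Let B : R := (\sum_(i <- zrange M) 2 `^ ((l + i)%:~R * s * q) * e (l + i) `^ q) `^ q^-1.

Lemma besov_sumE : Q = B%:E.
Proof.
rewrite /Q /B -poweR_EFin; congr (_ `^ _)%E.
pose S := [seq l + i | i <- zrange M].
have uS : uniq S by rewrite map_inj_uniq ?uniq_zrange// => x y /addrI.
pose F j := ((2 `^ (j%:~R * s * q))%:E * (e j)%:E `^ q)%E.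
have F0 j : (0 <= F j)%E by rewrite mule_ge0 ?lee_fin ?powR_ge0 ?poweR_ge0.
transitivity (\esum_(j in [set` S]) F j)%E.
  rewrite [RHS]esum_mkcond; apply: eq_esum => j _; case: ifPn => // jS.
  rewrite /F e_off ?poweR0r ?mule0 ?gt_eqF// ltNge; apply: contra jS => jM.
  apply/mem_set => /=; apply/mapP; exists (j - l); first by rewrite mem_zrange.
  by rewrite addrC subrK.
rewrite esum_fset//; last exact: finite_seq.
rewrite -fsbig_seq// big_map -sumEFin; apply: eq_bigr => i _.
by rewrite /F poweR_EFin EFinM.
Qed.

Lemma besov_term j : 2 `^ (j%:~R * s) * e j <= B.
Proof.
have B0 : 0 <= B by exact: powR_ge0.
have [jM|jM] := ltP M%:Z `|j - l|; first by rewrite e_off// mulr0.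
have t0 : 0 <= 2 `^ (j%:~R * s) * e j by rewrite mulr_ge0 ?powR_ge0.
have q1 : q * q^-1 = 1 by rewrite mulfV// gt_eqF.
have -> : 2 `^ (j%:~R * s) * e j = ((2 `^ (j%:~R * s) * e j) `^ q) `^ q^-1.
  by rewrite -powRrM q1 powRr1.
apply: ge0_ler_powR; rewrite ?nnegrE ?powR_ge0 ?invr_ge0 ?(ltW q0)//.
  by apply: sumr_ge0 => i _; rewrite mulr_ge0 ?powR_ge0.
rewrite powRM ?powR_ge0// -powRrM.
rewrite (bigD1_seq (j - l)) ?uniq_zrange ?mem_zrange//= [l + _]addrC subrK lerDl.
by apply: sumr_ge0 => i _; rewrite mulr_ge0 ?powR_ge0.
Qed.

Lemma besov_sum_le (m : R) : (forall i, i \in zrange M -> e (l + i) <= m) ->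
  B <= 2 `^ (l%:~R * s) * C_band' M s q * m.
Proof.
move=> H; have m0 : 0 <= m by apply: le_trans (H 0 _); rewrite ?mem_zrange.
have q1 : q * q^-1 = 1 by rewrite mulfV// gt_eqF.
apply: (@le_trans _ _ (((2 `^ (l%:~R * s) * m) `^ q * \sum_(i <- zrange M) 2 `^ (i%:~R * s * q)) `^ q^-1)).
  apply: ge0_ler_powR; rewrite ?nnegrE ?invr_ge0 ?(ltW q0)//.
  - by apply: sumr_ge0 => i _; rewrite mulr_ge0 ?powR_ge0.
  - by rewrite mulr_ge0 ?powR_ge0// sumr_ge0// => i _; rewrite powR_ge0.
  rewrite mulr_sumr big_seq [leRHS]big_seq; apply: ler_sum => i iM.
  rewrite (powRM _ (powR_ge0 _ _) m0) -powRrM [leRHS]mulrAC -powRD; last by apply/implyP => _; rewrite pnatr_eq0.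
  rewrite -!mulrDl -intrD ler_wpM2l ?powR_ge0//.
  by apply: ge0_ler_powR; rewrite ?nnegrE ?(ltW q0)//; exact: H.
rewrite powRM ?powR_ge0 ?sumr_ge0//.
rewrite -powRrM q1 powRr1 ?mulr_ge0 ?powR_ge0//.
by rewrite mulrAC.
Qed.

End besov_sum.

Section exponent_facts.
Context {R : realType} (n : nat) (p : R).
Hypotheses (n_gt0 : (0 < n)%N) (p_gt1 : 1 < p).

Let p0 : 0 < p. Proof. exact: lt_trans p_gt1. Qed.
Let n0 : 0 < n%:R :> R. Proof. by rewrite ltr0n. Qed.

Lemma divr_conj_exp : n%:R / conj_exp p = n%:R - n%:R / p.
Proof.
have p1 : p - 1 != 0 by rewrite gt_eqF// subr_gt0.
by rewrite /conj_exp; field; rewrite p1 gt_eqF.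
Qed.

Lemma divr_exp_bounds : 0 < n%:R / p < n%:R.
Proof. by rewrite divr_gt0//= ltr_pdivrMr// ltr_pMr. Qed.

(** The lower bound is the convexity that [pow_step] needs; the upper one is the reason why decay of
    order larger than 2 n suffices for every p. *)
Lemma gamU_bounds : 1 < gamU n p < 2 * n%:R.
Proof.
have /andP[h1 h2] := divr_exp_bounds; rewrite /gamU divr_conj_exp.
have : 1 <= n%:R :> R by rewrite ler1n.
by move=> h; apply/andP; split; lra.
Qed.

Lemma gamL_bounds : 1 < gamL n p < 2 * n%:R.
Proof.
have /andP[h1 h2] := divr_exp_bounds; rewrite /gamL.
have : 1 <= n%:R :> R by rewrite ler1n.
by move=> h; apply/andP; split; lra.
Qed.

Lemma rapid_K_U (h : 'rV[R]_n -> R[i]) : rapid h ->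
  exists C, decays h C (2 * n + 1)%:R /\ gamU n p < (2 * n + 1)%:R.
Proof.
move=> rh; have [C hC] := rapid_decays (2 * n + 1) rh; exists C; split => //.
by have /andP[_ /lt_le_trans->//] := gamU_bounds; rewrite natrD natrM lerDl.
Qed.

End exponent_facts.

(** * Besov norm of a single-scale sum *)

Section besov_bounds.
Context {R : realType} {n : nat}.
Local Notation leb := (@lebesgue_rV R n).
Local Notation V := 'rV[R]_n.
Variables (p : R) (w : V -> R) (a b c1 c2 s q : R) (psi phi : V -> R[i]).
Hypotheses (n_gt0 : (0 < n)%N) (p_gt1 : 1 < p) (wn : nice_weight p w).
Hypotheses (ab : 0 < a < b) (bpsi : band_limited a b psi) (lp : lp_function c1 c2 phi).
Hypotheses (q0 : 0 < q).
Variables (l : int) (Lam : {fset 'rV[int]_n}) (c : 'rV[int]_n -> R[i]).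

Let r := single_scale psi l Lam c.
Let M := band_width a b c1 c2.
Let Delta j := lp_block phi j (regular_dist r).
Let Q := besov_norm phi s p q w (regular_dist r).
Let X := coef_norm p w l Lam c.
Let lam : R := 2 `^ (l%:~R * n%:R / 2).
Let A := Ap_const p w.

Let block_le i : (Lpw_norm p w (Delta (l + i)) <=
  K_U p (convolve (lp_dilate phi i) psi) * (A `^ p^-1 * lam)%R%:E * X)%E.
Proof.
rewrite /Delta (lp_block_single_scale bpsi lp).
have [C [hC gs]] := rapid_K_U n_gt0 p_gt1 (schwartz_rapid [::] (schwartz_lp_convolve ab bpsi lp i)).
exact: (single_scale_upper n_gt0 p_gt1 wn hC gs).
Qed.

Let K_fin i : K_U p (convolve (lp_dilate phi i) psi) = (fine (K_U p (convolve (lp_dilate phi i) psi)))%:E.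
Proof.
have [C [hC gs]] := rapid_K_U n_gt0 p_gt1 (schwartz_rapid [::] (schwartz_lp_convolve ab bpsi lp i)).
exact: (K_U_fin n_gt0 p_gt1 hC gs).
Qed.

Let e j : R := fine (Lpw_norm p w (Delta j)).

(** Finiteness of every block, from the upper estimate with a rapidly decreasing generator, turns
    the Besov norm into arithmetic of real numbers. *)
Let eE j : Lpw_norm p w (Delta j) = (e j)%:E.
Proof.
rewrite /e fineK// ge0_fin_numE ?Lpw_norm_ge0//.
have -> : j = l + (j - l) by rewrite addrC subrK.
apply: (le_lt_trans (block_le _)); rewrite K_fin /X (coef_normE wn) -!EFinM.
exact: ltry.
Qed.

Let e0 j : 0 <= e j. Proof. by apply: fine_ge0; exact: Lpw_norm_ge0. Qed.

Let e_off j : (M%:Z < `|j - l|)%R -> e j = 0.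
Proof.
move=> jM; rewrite /e (_ : Delta j = fun=> 0) ?(Lpw_norm0 w p_gt1)//.
by apply/funext => x; exact: (lp_block_off ab bpsi lp).
Qed.

Let B : R := (\sum_(i <- zrange M) 2 `^ ((l + i)%:~R * s * q) * e (l + i) `^ q) `^ q^-1.

Let QE : Q = B%:E.
Proof.
rewrite -(besov_sumE s q0 e_off) /Q /besov_norm; congr (_ `^ _)%E.
by apply: eq_esum => j _; rewrite -/(Delta j) eE.
Qed.

Lemma besov_fin : (Q < +oo)%E.
Proof. by rewrite QE ltry. Qed.

Lemma besov_block j : ((2 `^ (j%:~R * s))%R%:E * Lpw_norm p w (Delta j) <= Q)%E.
Proof. by rewrite QE eE -EFinM lee_fin; exact: besov_term. Qed.

Lemma besov_max : (Q <= (2 `^ (l%:~R * s) * C_band' M s q)%R%:E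
   * \big[maxe/0%E]_(i <- zrange M) Lpw_norm p w (Delta (l + i)%R))%E.
Proof.
have -> : \big[maxe/0%E]_(i <- zrange M) Lpw_norm p w (Delta (l + i)%R) =
    (\big[Num.max/0]_(i <- zrange M) e (l + i))%:E.
  by rewrite -EFin_bigmax; apply: eq_bigr => i _; exact: eE.
rewrite QE -EFinM lee_fin; apply: (@besov_sum_le _ s q l M e) => // i iM.
exact: (@le_max_seq _ R _ 0 _ (fun i => e (l + i))).
Qed.

Lemma besov_upper : (Q <= (C_band' M s q)%:E * K_eta M p phi psi
   * (A `^ p^-1 * 2 `^ (l%:~R * (s + n%:R / 2)))%R%:E * X)%E.
Proof.
apply: (le_trans besov_max).
have -> : 2 `^ (l%:~R * (s + n%:R / 2)) = 2 `^ (l%:~R * s) * lam.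
  by rewrite mulrDr powRD ?mulrA//; apply/implyP => _; rewrite pnatr_eq0.
(* The factors are extended reals, which form no ring, so the rearrangement is done once by hand. *)
have perm (u v K d t Y : \bar R) : ((u * v) * (K * (d * t) * Y) = v * K * (d * (u * t)) * Y)%E.
  rewrite !muleA; congr (_ * _ * _)%E.
  by rewrite -!muleA [LHS]muleC !muleA.
rewrite [in leRHS]EFinM [in leRHS]EFinM -perm -!EFinM.
apply: lee_wpmul2l; first by rewrite lee_fin mulr_ge0 ?powR_ge0.
have Y0 : (0 <= (A `^ p^-1 * lam)%:E * X)%E.
  by rewrite mule_ge0 ?lee_fin ?mulr_ge0 ?powR_ge0// poweR_ge0.
have Ke0 : (0 <= K_eta M p phi psi)%E.
  exact: bigmax_ge_id.
rewrite big_seq; apply: bigmax_le; first by rewrite -muleA mule_ge0.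
move=> i iM; apply: (le_trans (block_le i)); rewrite -!muleA.
apply: lee_wpmul2r => //.
exact: (@le_max_seq _ (\bar R) _ 0%E _ (fun i => K_U p (convolve (lp_dilate phi i) psi))).
Qed.

(** Undoing the factor [2^((l + i) s)] in each block produces a sum of [2^(-i s)], whereas C_M is
    the sum of [2^(i s)]; the index range is symmetric. *)
Lemma sum_zrange_sym (f : int -> R) : \sum_(i <- zrange M) f (- i) = \sum_(i <- zrange M) f i.
Proof.
rewrite -(big_map (fun i => - i) xpredT f); apply: perm_big; apply: uniq_perm.
- by rewrite map_inj_uniq ?uniq_zrange//; exact: oppr_inj.
- exact: uniq_zrange.
move=> i; rewrite mem_zrange; apply/mapP/idP => [[k]|iM].
  by rewrite mem_zrange => kM ->; rewrite normrN.
by exists (- i); rewrite ?opprK// mem_zrange normrN.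
Qed.

Lemma besov_lower :
  (((C_band M s)^-1 * 2 `^ (l%:~R * s))%R%:E * Lpw_norm p w r <= Q)%E.
Proof.
have B0 : 0 <= B by exact: powR_ge0.
have C0 : 0 < C_band M s.
  rewrite /C_band (bigD1_seq 0) ?uniq_zrange ?mem_zrange ?normr0//=.
  by rewrite ltr_pwDl ?powR_gt0// sumr_ge0// => i _; rewrite powR_ge0.
have rE : r = (fun x => \sum_(i <- zrange M) Delta (l + i) x).
  by apply/funext => x; exact: (lp_block_sum ab bpsi lp).
(* Each block is at most the Besov norm B divided by [2^((l + i) s)], and these numbers serve as the
   weights in [Lpw_norm_sum_le]. *)
have H : (Lpw_norm p w r <= ((\sum_(i <- zrange M) 2 `^ (- ((l + i)%:~R * s))) * B)%:E)%E.
  rewrite {1}rE; apply: (Lpw_norm_sum_le p_gt1 wn) => // i; rewrite ?powR_gt0//.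
  - by have [] := cL1_lp_block bpsi lp l Lam c (l + i).
  rewrite eE lee_fin powRN mulrC ler_pdivlMr ?powR_gt0// mulrC.
  exact: besov_term.
have E : \sum_(i <- zrange M) 2 `^ (- ((l + i)%:~R * s)) = 2 `^ (- (l%:~R * s)) * C_band M s.
  rewrite /C_band -sum_zrange_sym mulr_sumr; apply: eq_bigr => i _.
  rewrite -powRD; last by apply/implyP => _; rewrite pnatr_eq0.
  by congr (_ `^ _); rewrite intrD mulrNz; ring.
rewrite QE; apply: (le_trans (lee_wpmul2l _ H)).
  by rewrite lee_fin mulr_ge0 ?invr_ge0 ?powR_ge0// ltW.
rewrite -EFinM lee_fin E powRN le_eqVlt; apply/orP; left; apply/eqP.
have P0 : 2 `^ (l%:~R * s) != 0 :> R by rewrite gt_eqF// powR_gt0.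
by field; rewrite P0 gt_eqF.
Qed.

End besov_bounds.

(** * Comparison of 1/p with theta(p) *)

Section theta_facts.
Context {R : realType}.
Implicit Types p : R.

(** Each branch of the maximum covers one side of p = 2: below it [2 (p - 1) <= p], above it
    [1 / p <= 1 / 2]. *)
Lemma theta_ge p : 1 < p -> p^-1 <= theta p.
Proof.
move=> p1; have p0 : 0 < p by lra.
have [p2|p2] := leP p 2.
  apply: (@le_trans _ _ ((p - 1)^-1 / 2)); last by rewrite ler_wpM2r// le_max lexx orbT.
  by rewrite -invfM lef_pV2 ?posrE ?mulr_gt0//; lra.
apply: (@le_trans _ _ (1 / 2)); last by rewrite ler_wpM2r// le_max lexx.
by rewrite mul1r lef_pV2 ?posrE//; lra.
Qed.

Lemma theta_eq p : 1 < p -> p^-1 = theta p <-> p = 2.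
Proof.
move=> p1; have p0 : 0 < p by lra.
split=> [E|->]; last first.
  by rewrite /theta (_ : (2 - 1 : R) = 1) ?invr1 ?maxxx ?mul1r//; lra.
apply/eqP; apply/negPn/negP; rewrite neq_lt => /orP[p2|p2].
  have : p^-1 < (p - 1)^-1 / 2 by rewrite -invfM ltf_pV2 ?posrE ?mulr_gt0//; lra.
  by rewrite E /theta ltNge ler_wpM2r// le_max lexx orbT.
have : p^-1 < 1 / 2 by rewrite mul1r ltf_pV2 ?posrE//; lra.
by rewrite E /theta ltNge ler_wpM2r// le_max lexx.
Qed.

End theta_facts.

Section decay_norms.
Context {R : realType} {n : nat}.
Local Notation V := 'rV[R]_n.
Implicit Types (h f : V -> R[i]).

Lemma sup_decays (s : R) h :
  (ereal_sup (range (fun x : V => ((1 + enorm x) `^ s * normc (h x))%:E)) < +oo)%E ->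
  decays h (fine (ereal_sup (range (fun x : V => ((1 + enorm x) `^ s * normc (h x))%:E)))) s.
Proof.
set S := ereal_sup _ => Soo x; have e0 : 0 < 1 + enorm x by rewrite ltr_pwDl ?enorm_ge0.
have H : (((1 + enorm x) `^ s * normc (h x))%:E <= S)%E by apply: ereal_sup_ubound; exists x.
have S0 : (0 <= S)%E by apply: le_trans H; rewrite lee_fin mulr_ge0 ?powR_ge0 ?normc_ge0.
have SE : S = (fine S)%:E by rewrite fineK// ge0_fin_numE.
by move: H; rewrite {1}SE lee_fin powRN ler_pdivlMr ?powR_gt0// mulrC.
Qed.

Lemma M_norm_ge0 tau h : (0 <= M_norm tau h)%E.
Proof.
apply: le_trans (ereal_sup_ubound _); last by exists 0.
by rewrite lee_fin mulr_ge0 ?powR_ge0 ?normc_ge0.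
Qed.

Lemma L_sup_ge0 s h : (0 <= L_sup s h)%E.
Proof.
apply: le_trans (ereal_sup_ubound _); last by exists 0.
by rewrite lee_fin mulr_ge0 ?powR_ge0 ?normc_ge0.
Qed.

Lemma D_norm_ge0 s h : (0 <= D_norm s h)%E.
Proof. by apply: integral_ge0 => x _; rewrite lee_fin mulr_ge0 ?normc_ge0// addr_ge0 ?powR_ge0. Qed.

Variable p : R.
Hypotheses (n_gt0 : (0 < n)%N) (p_gt1 : 1 < p).

Lemma K_U_M_norm tau h : 0 < tau ->
  (K_U p h <= M_norm tau h * (zeta_factor (gamU n p) (1 + tau + n%:R / p))%:E)%E.
Proof.
move=> tau0; have /andP[g1 g2] := gamU_bounds n_gt0 p_gt1.
have /andP[h1 h2] := divr_exp_bounds n_gt0 p_gt1.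
have z0 : 0 < zeta_factor (gamU n p) (1 + tau + n%:R / p).
  by apply: zeta_factor_gt0; lra.
(* An infinite decay norm makes the right side infinite, because the zeta factor is positive. *)
have [Moo|] := ltP (M_norm tau h) +oo%E; last first.
  by rewrite leye_eq => /eqP ->; rewrite gt0_mulye ?lte_fin// leey.
have hC := sup_decays Moo; rewrite -/(M_norm tau h) in hC.
have s0 : 0 < 2 * n%:R + tau by lra.
have := K_env_le n_gt0 s0 hC g1; rewrite (_ : 1 + (2 * n%:R + tau) - gamU n p = 1 + tau + n%:R / p); last first.
  by rewrite /gamU divr_conj_exp//; lra.
rewrite EFinM fineK ?ge0_fin_numE ?M_norm_ge0//; apply; lra.
Qed.

Lemma K_L_decays h (C s : R) : 2 * n%:R < s -> decays h C s ->
  (K_L p h <= C%:E * (zeta_factor (gamL n p) (1 + s - n%:R - n%:R / p))%:E)%E.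
Proof.
move=> s2 hC; have /andP[g1 g2] := gamL_bounds n_gt0 p_gt1.
have n0 : 0 < n%:R :> R by rewrite ltr0n.
have s0 : 0 < s by lra.
have := K_env_le n_gt0 s0 hC g1; rewrite (_ : 1 + s - gamL n p = 1 + s - n%:R - n%:R / p); last first.
  by rewrite /gamL; lra.
by rewrite EFinM; apply; lra.
Qed.

Lemma zeta_factor_gamL_gt0 (s : R) : 2 * n%:R < s ->
  0 < zeta_factor (gamL n p) (1 + s - n%:R - n%:R / p).
Proof.
move=> s2; have /andP[g1 g2] := gamL_bounds n_gt0 p_gt1.
have /andP[h1 h2] := divr_exp_bounds n_gt0 p_gt1.
by apply: zeta_factor_gt0; lra.
Qed.

End decay_norms.

Lemma ge0_fineE {R : realType} (x : \bar R) : (0 <= x)%E -> (x < +oo)%E -> x = (fine x)%:E.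
Proof. by move=> x0 xoo; rewrite fineK// ge0_fin_numE. Qed.

Section ae_integrals.
Context {R : realType} {n : nat}.
Local Notation leb := (@lebesgue_rV R n).
Local Notation V := 'rV[R]_n.
Implicit Types (h f g : V -> R[i]).

Lemma ae_cint f g : {ae leb, forall x, f x = g x} -> cint f = cint g.
Proof.
move=> fg; apply: complex_ext; rewrite /cint /Rintegral /=; congr fine;
  by apply: ae_eq_lower_integral; apply: filterS fg => x ->.
Qed.

Lemma clmeasurable_cmeas g : clmeasurable g -> exists2 g', cmeas g' & {ae leb, forall x, g x = g' x}.
Proof.
move=> [[u mu gu] [v mv gv]]; exists (fun x => u x +i* v x); first by split.
near=> x; apply: complex_ext => /=.
  by near: x.
by near: x.
Unshelve. all: by end_near. Qed.

Lemma cmeas_clmeasurable g : cmeas g -> clmeasurable g.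
Proof.
move=> [m1 m2]; split.
  by exists (fun x => complex.Re (g x)) => //; exact: aeW.
by exists (fun x => complex.Im (g x)) => //; exact: aeW.
Qed.

End ae_integrals.

(** * Pairing with functions of weighted L^p *)

Section pairing.
Context {R : realType} {n : nat}.
Local Notation leb := (@lebesgue_rV R n).
Local Notation V := 'rV[R]_n.
Variables (p : R).
Hypotheses (n_gt0 : (0 < n)%N) (p_gt1 : 1 < p).
Implicit Types (w : V -> R) (h f g : V -> R[i]).

Let p0 : 0 < p. Proof. exact: lt_trans p_gt1. Qed.

Lemma Lpw_norm_poweR w g : (forall x, 0 < w x) ->
  (Lpw_norm p w g `^ p = \int[leb]_x (normc (g x) `^ p * w x)%R%:E)%E.
Proof.
move=> w0; rewrite /Lpw_norm -poweRrM mulVf ?gt_eqF// poweRe1//.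
by apply: integral_ge0 => x _; rewrite lee_fin mulr_ge0 ?powR_ge0 ?(ltW (w0 x)).
Qed.

Lemma pth_root_le (y W K A N : R) : 0 < W -> 0 <= K -> 0 <= A -> 0 <= N -> 0 <= y ->
  y `^ p * W <= K `^ p * A * N `^ p -> y <= K * (A `^ p^-1 * W `^ (- p^-1)) * N.
Proof.
move=> W0 K0 A0 N0 y0 H.
have pV : p * p^-1 = 1 by rewrite mulfV// gt_eqF.
have Wp : 0 < W `^ p^-1 by exact: powR_gt0.
rewrite powRN -(ler_pM2r Wp).
have -> : K * (A `^ p^-1 * (W `^ p^-1)^-1) * N * W `^ p^-1 = K * A `^ p^-1 * N.
  by field; rewrite gt_eqF.
have -> : y * W `^ p^-1 = (y `^ p * W) `^ p^-1.
  by rewrite powRM ?powR_ge0 ?(ltW W0)// -powRrM pV powRr1.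
have -> : K * A `^ p^-1 * N = (K `^ p * A * N `^ p) `^ p^-1.
  rewrite powRM ?mulr_ge0 ?powR_ge0// powRM ?powR_ge0// -!powRrM pV.
  by rewrite !powRr1.
by apply: ge0_ler_powR; rewrite ?nnegrE ?invr_ge0 ?mulr_ge0 ?powR_ge0 ?(ltW p0) ?(ltW W0).
Qed.

Lemma ae_Lpw_norm_eq w g g' : {ae leb, forall x, g x = g' x} -> Lpw_norm p w g = Lpw_norm p w g'.
Proof.
move=> gg'; apply: (f_equal (fun z => z `^ p^-1)%E); apply: ae_eq_lower_integral.
by apply: filterS gg' => x ->.
Qed.

(** The case of [single_scale_lower] with j = 0 and the one index 0, after g is replaced by a Borel
    representative; what remains is to extract the p-th root. *)
Lemma pairing_le w h g (C s : R) : nice_weight p w -> decays h C s -> 2 * n%:R < s -> in_Lpw p w g ->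
  (\int[leb]_x (normc (g x) * normc (h x))%R%:E
       <= K_L p h
          * (Ap_const p w `^ p^-1 * fine (wmass w (dyadic 0 0)) `^ (- p^-1))%R%:E
          * Lpw_norm p w g)%E.
Proof.
move=> wn hC s2 [lg gfin].
have [g' mg gg'] := clmeasurable_cmeas lg.
have w0 : forall x, 0 < w x by case: wn.
have gs : gamL n p < s by have /andP[_ /lt_trans] := gamL_bounds n_gt0 p_gt1; apply.
have NE := ae_Lpw_norm_eq w gg'.
have -> : (\int[leb]_x (normc (g x) * normc (h x))%:E)%E =
    (\int[leb]_x (normc (g' x) * normc (h x))%:E)%E.
  by apply: ae_eq_lower_integral; apply: filterS gg' => x ->.
move: gfin; rewrite NE; set N := Lpw_norm p w g' => gfin.
have N0 : (0 <= N)%E by exact: poweR_ge0.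
have NfE : N = (fine N)%:E by exact: ge0_fineE.
have FE := Lpw_norm_poweR g' w0.
have Foo : (\int[leb]_x (normc (g' x) `^ p * w x)%R%:E < +oo)%E.
  by rewrite -FE -/N NfE poweR_EFin ltry.
have := single_scale_lower n_gt0 p_gt1 wn hC gs (measurable_normc mg)
  (fun x => normc_ge0 _) Foo 0 [fset 0%R]%fset.
rewrite big_seq_fset1 -FE -/N NfE poweR_EFin.
set I := (\int[leb]_x _)%E; set I' := (\int[leb]_x _)%E.
have -> : I' = I.
  apply: eq_integral => x _; rewrite expr0z scale1r (_ : intv 0 = 0) ?subr0//.
  by apply/rowP => i; rewrite !mxE.
have W0 := wQ_gt0 p_gt1 wn 0 0; set W := wQ w 0 0 in W0 *.
have -> : fine (wmass w (dyadic 0 0)) = W by rewrite (wQE wn).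
rewrite (_ : (2 ^ (- 0)) ^+ n = 1) ?mul1r; last by rewrite oppr0 expr0z expr1n.
have s0 : 0 < s by have := ler0n R n; lra.
have KE := K_L_fin n_gt0 p_gt1 hC gs; set K := fine (K_L p h) in KE *; rewrite KE.
have K0 : 0 <= K by apply: fine_ge0; exact: (K_env_ge0 n_gt0 s0 hC).
have A0 : 0 <= Ap_const p w by apply: le_trans (Ap_const_ge1 p_gt1 wn).
set A := Ap_const p w in A0 *.
have I0 : (0 <= I)%E by apply: integral_ge0 => x _; rewrite lee_fin mulr_ge0 ?normc_ge0.
have n0 : 0 <= fine N by exact: fine_ge0.
clearbody K A N W; rewrite NfE -!EFinM.
(* The pairing is not known to be finite beforehand: an infinite value, times the positive mass of
   the unit cube, would contradict the finite bound. *)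
case: (I) I0 => [y|_|]//; last first.
  by rewrite poweRyr ?gt_eqF// gt0_mulye ?lte_fin.
by rewrite lee_fin => y0; rewrite poweR_EFin -EFinM !lee_fin; exact: pth_root_le.
Qed.

Lemma in_Ap_nice w : in_Ap p w -> exists w', [/\ nice_weight p w',
  wmass w = wmass w', Lpw_norm p w = Lpw_norm p w', coef_norm p w = coef_norm p w' &
  Ap_const p w = Ap_const p w'].
Proof.
move=> wA; have [w' wn ww'] := nice_weight_exists wA; exists w'; split.
- exact: wn.
- exact: ae_wmass.
- exact: ae_Lpw_norm.
- exact: ae_coef_norm.
- by rewrite /Ap_const (ae_Ap_sup p ww').
Qed.

Lemma pairing_lty w h g (C s : R) : in_Ap p w -> cmeas h -> decays h C s -> 2 * n%:R < s -> in_Lpw p w g ->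
  (\int[leb]_x (normc (g x * h x))%:E < +oo)%E.
Proof.
move=> wA mh hC s2 gL; have [w' [wn e1 e2 e3 e4]] := in_Ap_nice wA.
move: gL; rewrite /in_Lpw [Lpw_norm p w]e2 => gL.
under eq_integral do rewrite Normc.normcM.
apply: (le_lt_trans (pairing_le wn hC s2 gL)).
have gs : gamL n p < s by have /andP[_ /lt_trans] := gamL_bounds n_gt0 p_gt1; apply.
rewrite (K_L_fin n_gt0 p_gt1 hC gs).
have NfE : Lpw_norm p w' g = (fine (Lpw_norm p w' g))%:E.
  by apply: ge0_fineE; [exact: poweR_ge0|exact: gL.2].
by rewrite NfE -!EFinM ltry.
Qed.

(** The translation is absorbed by Peetre's inequality, the scaling by the factor
    [max(1, 2^(-j))]. *)
Lemma decays_dilate h (C s : R) j k : 0 <= s -> decays h C s -> exists C', decays (dilate h j k) C' s.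
Proof.
move=> s0 hC; have C0 := decays_ge0 hC.
pose m : R := Num.max 1 (2 ^ j)^-1; have m1 : 1 <= m by rewrite le_max lexx.
have u0 := @pow2_gt0 R j; pose B : R := 2 `^ (j%:~R * n%:R / 2).
have B0 : 0 <= B by exact: powR_ge0.
pose D := m * (1 + enorm (intv k : V)).
have e0 (y : V) : 0 < 1 + enorm y by rewrite ltr_pwDl ?enorm_ge0.
have D0 : 0 < D by rewrite mulr_gt0// (lt_le_trans _ m1).
exists (B * (C * D `^ s)) => x.
rewrite /dilate Normc.normcM normc_real ger0_norm// -/B -!mulrA ler_wpM2l//.
apply: (le_trans (hC _)); rewrite ler_wpM2l// !powRN ler_pdivlMr ?powR_gt0// mulrC.
rewrite ler_pdivrMr ?powR_gt0// -powRM ?(ltW D0) ?(ltW (e0 _))//.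
apply: ge0_ler_powR; rewrite ?nnegrE//; first exact: ltW.
  by apply: mulr_ge0; apply: ltW.
rewrite /D -mulrA; apply: (@le_trans _ _ (m * (1 + enorm ((2 ^ j) *: x)))).
  rewrite enormZ gtr0_norm// mulrDr mulr1; apply: lerD => //.
  by rewrite mulrA ler_peMl ?enorm_ge0// -ler_pdivrMr// div1r le_max lexx orbT.
rewrite ler_wpM2l ?(le_trans ler01)//.
have := enorm_1B_le ((2 ^ j) *: x) (intv k); rewrite mulrC; exact.
Qed.

Lemma schwartz_decays h (k : nat) : schwartz h -> decays h (fine (schwartz_norm k h)) k%:R.
Proof.
move=> sh x; have h0 : 0 < 1 + enorm x by rewrite ltr_pwDl ?enorm_ge0.
rewrite powR_invn ?(ltW h0)// ler_pdivlMr ?exprn_gt0// mulrC.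
exact: (schwartz_le (s := [::]) x sh).
Qed.

(** In the pairing estimate the decay constant of a Schwartz function h is one of its Schwartz
    norms, and K_L is linear in that constant; this is the required continuity bound. *)
Lemma tempered_Lpw w g : in_Ap p w -> in_Lpw p w g -> tempered (regular_dist g).
Proof.
move=> wA gL; have [w' [wn e1 e2 e3 e4]] := in_Ap_nice wA.
have [g' mg gg'] := clmeasurable_cmeas gL.1.
have Tg : regular_dist g = regular_dist g'.
  apply/funext => h; apply: ae_cint; apply: filterS gg' => x; exact: (congr1 (fun z => z * h x)).
have gL' : in_Lpw p w g'.
  split; first exact: cmeas_clmeasurable.
  by rewrite -(ae_Lpw_norm_eq w gg'); exact: gL.2.
(* The least integral order of decay above 2 n. *)
pose k := (2 * n + 1)%N; have k2 : 2 * n%:R < k%:R :> R by rewrite natrD natrM ltrDl.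
have gh1 h : schwartz h -> cL1 (fun x => g' x * h x).
  move=> sh; split; first exact: (cmeasM mg (schwartz_cmeas sh)).
  exact: (pairing_lty wA (schwartz_cmeas sh) (schwartz_decays k sh) k2 gL').
rewrite Tg; split.
  move=> d u h su sh; rewrite /regular_dist -cintZ; last exact: gh1.
  rewrite -cintD; [|by apply: cL1Z; exact: gh1|exact: gh1].
  by apply: eq_cint => x; ring.
pose Z := zeta_factor (gamL n p) (1 + k%:R - n%:R - n%:R / p).
have Z0 : 0 <= Z by apply: ltW; exact: zeta_factor_gamL_gt0.
move: gL'; rewrite /in_Lpw [Lpw_norm p w]e2 => gL'.
have NfE : Lpw_norm p w' g' = (fine (Lpw_norm p w' g'))%:E.
  by apply: ge0_fineE; [exact: poweR_ge0|exact: gL'.2].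
pose c := Ap_const p w' `^ p^-1 * fine (wmass w' (dyadic 0 0)) `^ (- p^-1).
have c0 : 0 <= c by rewrite mulr_ge0 ?powR_ge0.
exists k, (Z * c * fine (Lpw_norm p w' g')) => h sh.
apply: (@le_trans _ _ (norm1 (fun x => g' x * h x))%:E).
  by rewrite lee_fin; apply: normc_cint_le; exact: gh1.
rewrite -norm1E; last exact: gh1.
under eq_integral do rewrite Normc.normcM.
apply: (le_trans (pairing_le wn (schwartz_decays k sh) k2 gL')).
rewrite (schwartz_normE _ sh) -/c NfE -EFinM.
have S0 : 0 <= fine (schwartz_norm k h) by apply: fine_ge0; exact: schwartz_norm_ge0.
have N0 : 0 <= fine (Lpw_norm p w' g') by apply: fine_ge0; exact: poweR_ge0.
have := K_L_decays n_gt0 p_gt1 k2 (schwartz_decays k sh); rewrite -/Z => H.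
rewrite -muleA; apply: (le_trans (lee_wpmul2r _ H)).
  by rewrite -EFinM lee_fin mulr_ge0.
rewrite -!EFinM lee_fin le_eqVlt; apply/orP; left; apply/eqP.
by rewrite /=; ring.
Qed.

End pairing.

Lemma pth_root_prod {R : realType} (p u K A N : R) : 1 < p -> 0 <= u -> 0 <= K -> 0 <= A -> 0 <= N ->
  (u `^ p * (K `^ p * A * N `^ p)) `^ p^-1 = u * (K * A `^ p^-1 * N).
Proof.
move=> p1 u0 K0 A0 N0; have pV : p * p^-1 = 1 by rewrite mulfV// gt_eqF// (lt_trans _ p1).
have x1 : 0 <= K `^ p by exact: powR_ge0.
have x2 : 0 <= N `^ p by exact: powR_ge0.
rewrite powRM ?powR_ge0//; last by rewrite !mulr_ge0.
rewrite (powRM _ (mulr_ge0 x1 A0) x2) (powRM _ x1 A0) -!powRrM pV.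
by rewrite !powRr1.
Qed.

(** * Wavelet bases *)

Section wavelet_lower.
Context {R : realType} {n : nat}.
Local Notation leb := (@lebesgue_rV R n).
Local Notation V := 'rV[R]_n.
Variables (p : R).
Hypotheses (n_gt0 : (0 < n)%N) (p_gt1 : 1 < p).
Variables (L : nat) (a b A B : R) (psi psit : 'I_L -> V -> R[i]) (e : 'I_L) (tau sigma : R).
Hypothesis wp : wavelet_pair a b A B psi psit e tau sigma.

Let p0 : 0 < p. Proof. exact: lt_trans p_gt1. Qed.
Let ws : wavelet_system a b A B psi psit. Proof. by case: wp. Qed.

Lemma wavelet_radii : 0 < a < b. Proof. exact: ws_radii ws. Qed.

Let b0 : 0 <= b. Proof. by have /andP[h1 /(lt_trans h1)/ltW] := wavelet_radii. Qed.

Lemma wavelet_tau_gt0 : 0 < tau. Proof. by case: wp. Qed.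

Lemma wavelet_sigma_gt : 2 * n%:R < sigma. Proof. by case: wp. Qed.

Lemma wavelet_decays_primal : decays (psi e) (fine (M_norm tau (psi e))) (2 * n%:R + tau).
Proof. by case: wp => _ _ _ h _; exact: sup_decays h. Qed.

Lemma gamU_lt_tau : gamU n p < 2 * n%:R + tau.
Proof.
have /andP[_ h] := gamU_bounds n_gt0 p_gt1.
by have := wavelet_tau_gt0; lra.
Qed.

Lemma L_sup_le_D_norm (C : R) (f : V -> R[i]) :
  (forall x, (((1 + enorm x) `^ sigma * normc (f x))%:E <= C%:E * D_norm sigma f)%E) ->
  (L_sup sigma f <= C%:E * D_norm sigma f)%E.
Proof. by move=> H; apply: ge_ereal_sup => _ [x _ <-]. Qed.

Lemma wavelet_L_sup_lty : (L_sup sigma (psit e) < +oo)%E.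
Proof.
have s0 : 0 <= sigma by have := wavelet_sigma_gt; have := ler0n R n; lra.
have [C C0 H] := @band_limited_pointwise R n b sigma b0 s0.
have bd := ws_dual ws e.
have D0 := @D_norm_ge0 R n sigma (psit e).
have Doo : (D_norm sigma (psit e) < +oo)%E by case: wp.
apply: (@le_lt_trans _ _ (C%:E * D_norm sigma (psit e))%E).
  apply: L_sup_le_D_norm; apply: H.
  - exact: band_limited_cL1 bd.
  - exact: band_limited_ccontinuous bd.
  - exact: band_limited_fourier_cL1 bd.
  - exact: band_limited_outside bd.
by rewrite (ge0_fineE D0 Doo) -EFinM ltry.
Qed.

Lemma wavelet_decays_dual : decays (psit e) (fine (L_sup sigma (psit e))) sigma.
Proof. exact: sup_decays wavelet_L_sup_lty. Qed.

Lemma gamL_lt_sigma : gamL n p < sigma.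
Proof. by have /andP[_ h] := gamL_bounds n_gt0 p_gt1; exact: lt_trans wavelet_sigma_gt. Qed.

Variables (w : V -> R).
Hypothesis wn : nice_weight p w.
Variables (j : int) (Lam : {fset 'rV[int]_n}) (c : 'rV[int]_n -> R[i]).

Let r := single_scale (psi e) j Lam c.

Lemma wavelet_upper :
  (Lpw_norm p w r <= K_U p (psi e) * (Ap_const p w `^ p^-1 * 2 `^ (j%:~R * n%:R / 2))%R%:E
     * coef_norm p w j Lam c)%E.
Proof. exact: (single_scale_upper n_gt0 p_gt1 wn wavelet_decays_primal gamU_lt_tau). Qed.

Let psi1 : cL1 (psi e). Proof. exact: band_limited_cL1 (ws_primal ws e). Qed.
Let psit1 : cL1 (psit e). Proof. exact: band_limited_cL1 (ws_dual ws e). Qed.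

Let psit_bounded : exists C, forall x, normc (psit e x) <= C.
Proof.
exists (fine (L_sup sigma (psit e))) => x; apply: (le_trans (wavelet_decays_dual x)).
have L0 : 0 <= fine (L_sup sigma (psit e)) by apply: fine_ge0; exact: L_sup_ge0.
have e1 : 1 <= 1 + enorm x by rewrite lerDl enorm_ge0.
rewrite ler_piMr// powRN invf_le1 ?powR_gt0 ?(lt_le_trans ltr01)//.
rewrite -[leLHS](powRr0 (1 + enorm x)) ler_powR//.
by have := wavelet_sigma_gt; have := ler0n R n; lra.
Qed.

Lemma wavelet_coefficient k : k \in Lam -> inner r (dilate (psit e) j k) = c k.
Proof.
move=> kL; have [C HC] := psit_bounded.
have mt := (cL1_dilate j k psit1).1.
have c1 k' : cL1 (fun x => dilate (psi e) j k' x * conjc (dilate (psit e) j k x)).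
  apply: (cL1M_bounded (C := normc (2 `^ (j%:~R * n%:R / 2))%:C * C)).
  - exact: cL1_dilate.
  - exact: cmeas_conj.
  - by move=> x; rewrite normc_conj Normc.normcM ler_wpM2l ?normc_ge0.
have bi k' : inner (dilate (psi e) j k') (dilate (psit e) j k) = (k' == k)%:R.
  have := ws_biorthogonal ws (e, j, k') (e, j, k); rewrite /wave /= => ->.
  by rewrite !xpair_eqE !eqxx.
transitivity (\sum_(k' <- Lam) c k' * inner (dilate (psi e) j k') (dilate (psit e) j k)).
  rewrite /inner /r /single_scale; under eq_cint do rewrite mulr_suml.
  rewrite cint_sum; last first.
    move=> k'; have := cL1Z (c k') (c1 k').
    by congr cL1; apply/funext => x; rewrite mulrA.
  apply: eq_bigr => k' _; rewrite -cintZ//.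
  by apply: eq_cint => x; rewrite mulrA.
rewrite (bigD1_seq k) ?fset_uniq//= bi eqxx mulr1 big1 ?addr0// => k' kk.
by rewrite bi (negbTE kk) mulr0.
Qed.

(** Biorthogonality bounds each coefficient by [2^(j n / 2)] times the pairing of the modulus of r
    with a translate of the dual generator, and [single_scale_lower] sums these pairings. *)
Lemma wavelet_coef_le :
  (coef_norm p w j Lam c <= (fine (K_L p (psit e)) * Ap_const p w `^ p^-1
     * 2 `^ (- (j%:~R * n%:R / 2)))%R%:E * Lpw_norm p w r)%E.
Proof.
have w0 : forall x, 0 < w x by case: wn.
(* The upper estimate supplies the finiteness of the norm that the pairing bound requires. *)
have Noo : (Lpw_norm p w r < +oo)%E.
  apply: (le_lt_trans wavelet_upper).
  rewrite (K_U_fin n_gt0 p_gt1 wavelet_decays_primal gamU_lt_tau) (coef_normE wn) -!EFinM.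
  exact: ltry.
have NE := ge0_fineE (Lpw_norm_ge0 p w r) Noo.
have FE := Lpw_norm_poweR p_gt1 r w0.
set N := fine (Lpw_norm p w r) in NE.
have N0 : 0 <= N by apply: fine_ge0; exact: Lpw_norm_ge0.
have r1 : cL1 r by exact: (cL1_single_scale (ws_primal ws e) j Lam c).
rewrite NE poweR_EFin in FE.
have Foo : (\int[leb]_x (normc (r x) `^ p * w x)%R%:E < +oo)%E by rewrite -FE ltry.
have := single_scale_lower n_gt0 p_gt1 wn wavelet_decays_dual gamL_lt_sigma
  (measurable_normc r1.1) (fun x => normc_ge0 _) Foo j Lam.
rewrite -FE; set K := fine (K_L p (psit e)).
have s0 : 0 < sigma by have := wavelet_sigma_gt; have := ler0n R n; lra.
have K0 : 0 <= K by apply: fine_ge0; exact: (K_env_ge0 n_gt0 s0 wavelet_decays_dual).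
have A0 : 0 <= Ap_const p w by apply: le_trans (Ap_const_ge1 p_gt1 wn).
have [C HC] := psit_bounded.
set u : R := 2 `^ (j%:~R * n%:R / 2).
have u0 : 0 < u by exact: powR_gt0.
pose t k : R := norm1 (fun x => r x * conjc (psit e ((2 ^ j) *: x - intv k))).
have mt (k : 'rV[int]_n) : cmeas (fun x : V => psit e ((2 ^ j) *: x - intv k)).
  exact: (cmeas_affine _ _ psit1.1).
have t1 k : cL1 (fun x => r x * conjc (psit e ((2 ^ j) *: x - intv k))).
  apply: (cL1M_bounded (C := C)) => //; first exact: cmeas_conj.
  by move=> x; rewrite normc_conj.
have tE k : (\int[leb]_x (normc (r x) * normc (psit e ((2 ^ j) *: x - intv k)))%:E)%E = (t k)%:E.
  rewrite /t -norm1E//; apply: eq_integral => x _.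
  by rewrite Normc.normcM normc_conj.
have ck k : k \in Lam -> normc (c k) <= u * t k.
  move=> kL; rewrite -(wavelet_coefficient kL) /inner.
  rewrite (_ : (fun x => _) = fun x => u%:C * (r x * conjc (psit e ((2 ^ j) *: x - intv k)))); last first.
    apply/funext => x; rewrite /dilate -/u mulrCA; congr (_ * _).
    by apply: complex_ext; rewrite ?ReM ?ImM ?Re_conj ?Im_conj ?ReM ?ImM ?ReC ?ImC /=; ring.
  rewrite cintZ// Normc.normcM normc_real gtr0_norm// ler_wpM2l ?(ltW u0)//.
  exact: normc_cint_le.
rewrite (_ : (\sum_(k <- Lam) _)%E = (\sum_(k <- Lam) t k `^ p * wQ w j k)%:E); last first.
  by rewrite -sumEFin; apply: eq_bigr => k _; rewrite tE poweR_EFin EFinM.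
rewrite -EFinM lee_fin => H.
rewrite NE (coef_normE wn) -EFinM lee_fin.
set v : R := (2 ^ (- j)) ^+ n in H *.
have v0 : 0 <= v by rewrite exprn_ge0// ltW// pow2_gt0.
(* The L^2 normalisation [2^(j n / 2)] against the volume [2^(-j n)] of a dyadic cube. *)
have uv : u * v = 2 `^ (- (j%:~R * n%:R / 2)).
  rewrite /u /v -powR_intmul// -powR_mulrn ?powR_ge0// -powRrM.
  rewrite -powRD; last by apply/implyP => _; rewrite pnatr_eq0.
  by congr (_ `^ _); rewrite mulrNz; field.
have pV : p * p^-1 = 1 by rewrite mulfV// gt_eqF.
have -> : K * Ap_const p w `^ p^-1 * 2 `^ (- (j%:~R * n%:R / 2)) * N =
    (u `^ p * ((v * K) `^ p * Ap_const p w * N `^ p)) `^ p^-1.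
  rewrite -uv (pth_root_prod p_gt1) ?(ltW u0) ?mulr_ge0//.
  by ring.
apply: ge0_ler_powR; rewrite ?nnegrE ?invr_ge0 ?(ltW p0)//.
- by apply: sumr_ge0 => k _; rewrite mulr_ge0 ?powR_ge0// ltW// (wQ_gt0 p_gt1 wn).
- by rewrite mulr_ge0 ?powR_ge0// !mulr_ge0 ?powR_ge0.
apply: (@le_trans _ _ (u `^ p * \sum_(k <- Lam) t k `^ p * wQ w j k)); last first.
  by rewrite ler_wpM2l ?powR_ge0.
rewrite mulr_sumr big_seq [leRHS]big_seq; apply: ler_sum => k kL.
rewrite mulrA ler_wpM2r//; first by rewrite ltW// (wQ_gt0 p_gt1 wn).
rewrite -powRM ?(ltW u0) ?norm1_ge0//.
apply: ge0_ler_powR; rewrite ?nnegrE ?normc_ge0 ?mulr_ge0 ?norm1_ge0 ?(ltW u0) ?(ltW p0)//.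
exact: ck.
Qed.

End wavelet_lower.

(** * Transfer of constants between the two sides of an estimate *)

Section constant_arithmetic.
Context {R : realType}.
Implicit Types (r t K C A u : R) (X N : \bar R).

Lemma lower_constant r K A u X N : 0 <= K -> 0 < A -> 0 < u -> (0 <= N)%E ->
  (X <= (K * A `^ r * u^-1)%:E * N -> (K^-1 * A `^ (- r) * u)%:E * X <= N)%E.
Proof.
(* The inverse of 0 is 0 by convention, so for K = 0 the left side vanishes. *)
move=> K0 A0 u0 N0 H; have [->|Kn] := eqVneq K 0; first by rewrite invr0 !mul0r mul0e.
apply: (le_trans (lee_wpmul2l _ H)).
  by rewrite lee_fin !mulr_ge0 ?powR_ge0 ?invr_ge0// ltW.
rewrite muleA -EFinM (_ : _ * _ = 1) ?mul1e// powRN.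
by field; rewrite Kn !gt_eqF// powR_gt0.
Qed.

Lemma lower_constant_uniform r t K C A u X N : 0 <= K -> K <= C -> 0 < C -> 1 <= A -> 0 < u -> (0 <= N)%E ->
  r <= t ->
  (X <= (K * A `^ r * u^-1)%:E * N -> (C^-1 * A `^ (- t) * u)%:E * X <= N)%E.
Proof.
move=> K0 KC C0 A1 u0 N0 rt H; have A0 : 0 < A by apply: lt_le_trans A1.
apply: (le_trans (lee_wpmul2l _ H)).
  by rewrite lee_fin !mulr_ge0 ?powR_ge0 ?invr_ge0// ltW.
rewrite muleA -EFinM -[leRHS]mul1e; apply: lee_wpmul2r => //.
rewrite lee_fin powRN.
have t0 : 0 < A `^ t by exact: powR_gt0.
rewrite (_ : C^-1 / A `^ t * u * (K * A `^ r / u) = (K / C) * (A `^ r / A `^ t)); last first.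
  by field; rewrite (gt_eqF u0) (gt_eqF t0) (gt_eqF C0).
apply: mulr_ile1; rewrite ?divr_ge0 ?powR_ge0 ?(ltW C0)//; rewrite ler_pdivrMr// mul1r//.
exact: ler_powR.
Qed.

Lemma upper_constant_uniform r t K C A u X N : 0 <= K -> K <= C -> 1 <= A -> 0 <= u -> (0 <= X)%E ->
  r <= t ->
  (N <= K%:E * (A `^ r * u)%:E * X -> N <= (C * A `^ t * u)%:E * X)%E.
Proof.
move=> K0 KC A1 u0 X0 rt /le_trans; apply; apply: lee_wpmul2r => //.
rewrite -EFinM lee_fin -[leRHS]mulrA; apply: ler_pM => //.
  by rewrite mulr_ge0 ?powR_ge0.
by rewrite ler_wpM2r//; exact: ler_powR.
Qed.

End constant_arithmetic.

(** * Two-sided estimates with explicit and with uniform constants *)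

Section main_parts.
Context {R : realType} {n : nat}.
Local Notation leb := (@lebesgue_rV R n).
Local Notation V := 'rV[R]_n.
Variables (p : R).
Hypotheses (n_gt0 : (0 < n)%N) (p_gt1 : 1 < p).

Lemma wavelet_two_sided (L : nat) (a b A B : R) (psi psit : 'I_L -> V -> R[i]) (e : 'I_L) (tau sigma : R) :
  wavelet_pair a b A B psi psit e tau sigma ->
  forall w : V -> R, in_Ap p w ->
  forall (j : int) (Lam : {fset 'rV[int]_n}) (c : 'rV[int]_n -> R[i]),
  (((fine (K_L p (psit e)))^-1 * Ap_const p w `^ (- p^-1) * 2 `^ (j%:~R * n%:R / 2))%R%:E
     * coef_norm p w j Lam c <= Lpw_norm p w (single_scale (psi e) j Lam c))%E /\
  (Lpw_norm p w (single_scale (psi e) j Lam c) <= K_U p (psi e)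
     * (Ap_const p w `^ p^-1 * 2 `^ (j%:~R * n%:R / 2))%R%:E * coef_norm p w j Lam c)%E.
Proof.
move=> wp w wA j Lam c; have [w' [wn e1 e2 e3 e4]] := in_Ap_nice wA.
rewrite e2 e3 e4; split; last exact: (wavelet_upper n_gt0 p_gt1 wp wn).
have s2 := wavelet_sigma_gt wp.
have s0 : 0 < sigma by apply: le_lt_trans s2; rewrite mulr_ge0.
have A1 : 0 < Ap_const p w' by apply: lt_le_trans (Ap_const_ge1 p_gt1 wn).
have H := wavelet_coef_le n_gt0 p_gt1 wp wn j Lam c.
rewrite powRN in H; apply: (lower_constant _ A1 _ _ H).
- by apply: fine_ge0; exact: (K_env_ge0 n_gt0 s0 (wavelet_decays_dual wp)).
- exact: powR_gt0.
- exact: Lpw_norm_ge0.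
Qed.

Lemma wavelet_uniform (A B tau sigma a b Mpsi Dpsit : R) : 0 < tau -> 2 * n%:R < sigma ->
  exists c0 C0 : R, [/\ 0 < c0, 0 < C0 &
  forall (L : nat) (psi psit : 'I_L -> V -> R[i]) (e : 'I_L),
  wavelet_pair a b A B psi psit e tau sigma ->
  \big[Num.max/0]_(i < L) fine (M_norm tau (psi i)) = Mpsi ->
  \big[Num.max/0]_(i < L) fine (D_norm sigma (psit i)) = Dpsit ->
  forall w : V -> R, in_Ap p w ->
  forall (j : int) (Lam : {fset 'rV[int]_n}) (c : 'rV[int]_n -> R[i]),
    ((c0 * Ap_const p w `^ (- theta p) * 2 `^ (j%:~R * n%:R / 2))%R%:E
       * coef_norm p w j Lam c
     <= Lpw_norm p w (single_scale (psi e) j Lam c))%E /\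
    (Lpw_norm p w (single_scale (psi e) j Lam c)
     <= (C0 * Ap_const p w `^ theta p * 2 `^ (j%:~R * n%:R / 2))%R%:E
        * coef_norm p w j Lam c)%E].
Proof.
move=> tau0 sig2; have s0 : 0 < sigma by have := ler0n R n; lra.
have s1 : 0 < 2 * n%:R + tau by have := ler0n R n; lra.
have /andP[gU1 _] := @gamU_bounds R n p n_gt0 p_gt1.
have /andP[d1 d2] := divr_exp_bounds n_gt0 p_gt1.
(* The constant is fixed before any generator is given, which is what makes it uniform. At this
   point b is an arbitrary real number, hence the absolute value; it equals b as soon as a wavelet
   system is present. *)
have [Cb Cb0 HC] := @band_limited_pointwise R n `|b| sigma (normr_ge0 b) (ltW s0).
pose Zu := zeta_factor (gamU n p) (1 + tau + n%:R / p).
pose Zl := zeta_factor (gamL n p) (1 + sigma - n%:R - n%:R / p).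
have Zu0 : 0 < Zu by apply: zeta_factor_gt0; lra.
have Zl0 : 0 < Zl by exact: zeta_factor_gamL_gt0.
(* The maxima [Mpsi] and [Dpsit] are arbitrary reals here too: the absolute values and the summands
   1 make both constants positive, so that KL can be inverted. *)
pose KL := Cb * `|Dpsit| * Zl + 1; pose KU := (`|Mpsi| + 1) * Zu.
have KL0 : 0 < KL by rewrite ltr_wpDl// !mulr_ge0// ltW.
have KU0 : 0 < KU by rewrite mulr_gt0// ltr_wpDl.
have K_U_uniform (L : nat) (psi psit : 'I_L -> V -> R[i]) (e : 'I_L) :
    wavelet_pair a b A B psi psit e tau sigma ->
    \big[Num.max/0]_(i < L) fine (M_norm tau (psi i)) = Mpsi -> fine (K_U p (psi e)) <= KU.
  move=> wp HM.
  have KE := K_U_fin n_gt0 p_gt1 (wavelet_decays_primal wp) (gamU_lt_tau n_gt0 p_gt1 wp).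
  have Moo : (M_norm tau (psi e) < +oo)%E by case: wp.
  have ME := ge0_fineE (M_norm_ge0 tau (psi e)) Moo.
  have M1 : fine (M_norm tau (psi e)) <= Mpsi.
    by rewrite -HM; exact: (@le_max_seq _ R _ 0 _ (fun i => fine (M_norm tau (psi i))) e (mem_index_enum e)).
  have := K_U_M_norm n_gt0 p_gt1 (psi e) tau0.
  rewrite -/Zu [K_U _ _]KE [M_norm _ _]ME -EFinM lee_fin => /le_trans; apply.
  rewrite ler_wpM2r ?(ltW Zu0)//.
  by apply: (le_trans M1); apply: (le_trans (ler_norm _)); rewrite lerDl.
have K_L_uniform (L : nat) (psi psit : 'I_L -> V -> R[i]) (e : 'I_L) :
    wavelet_pair a b A B psi psit e tau sigma ->
    \big[Num.max/0]_(i < L) fine (D_norm sigma (psit i)) = Dpsit -> fine (K_L p (psit e)) <= KL.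
  move=> wp HD.
  have KE := K_L_fin n_gt0 p_gt1 (wavelet_decays_dual wp) (gamL_lt_sigma n_gt0 p_gt1 wp).
  have b0 : 0 < b by have /andP[h1 /(lt_trans h1)] := wavelet_radii wp.
  have bd : band_limited a b (psit e) by case: (wp) => ws _ _ _ _; exact: (ws_dual ws e).
  have Lle : (L_sup sigma (psit e) <= Cb%:E * D_norm sigma (psit e))%E.
    apply: (L_sup_le_D_norm (C := Cb)); apply: HC.
    - exact: band_limited_cL1 bd.
    - exact: band_limited_ccontinuous bd.
    - exact: band_limited_fourier_cL1 (ltW b0) bd.
    - by move=> xi; rewrite gtr0_norm//; exact: (band_limited_outside bd).
  have Doo : (D_norm sigma (psit e) < +oo)%E by case: wp.
  have DE := ge0_fineE (D_norm_ge0 sigma (psit e)) Doo.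
  have LE := ge0_fineE (L_sup_ge0 sigma (psit e)) (wavelet_L_sup_lty wp).
  have D1 : fine (D_norm sigma (psit e)) <= Dpsit.
    by rewrite -HD; exact: (@le_max_seq _ R _ 0 _ (fun i => fine (D_norm sigma (psit i))) e (mem_index_enum e)).
  move: Lle; rewrite [L_sup _ _]LE [D_norm _ _]DE -EFinM lee_fin => Lle.
  have := K_L_decays n_gt0 p_gt1 sig2 (wavelet_decays_dual wp).
  rewrite -/Zl [K_L _ _]KE -EFinM lee_fin => /le_trans; apply.
  apply: (@le_trans _ _ (Cb * `|Dpsit| * Zl)); last by rewrite lerDl.
  rewrite ler_wpM2r ?(ltW Zl0)//; apply: (le_trans Lle); rewrite ler_wpM2l//.
  by apply: (le_trans D1); exact: ler_norm.
exists KL^-1, KU; split; [by rewrite invr_gt0|exact: KU0|].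
move=> L psi psit e wp HM HD w wA j Lam c; have [w' [wn e1 e2 e3 e4]] := in_Ap_nice wA.
rewrite e2 e3 e4; set u := 2 `^ _; set X := coef_norm _ _ _ _ _; set N := Lpw_norm _ _ _.
have A1 : 1 <= Ap_const p w' by exact: (Ap_const_ge1 p_gt1 wn).
have X0 : (0 <= X)%E by exact: poweR_ge0.
have u0 : 0 < u by exact: powR_gt0.
have th := theta_ge p_gt1.
split; last first.
  have KE := K_U_fin n_gt0 p_gt1 (wavelet_decays_primal wp) (gamU_lt_tau n_gt0 p_gt1 wp).
  have H := wavelet_upper n_gt0 p_gt1 wp wn j Lam c.
  rewrite -/u -/X KE in H; apply: (upper_constant_uniform _ _ A1 (ltW u0) X0 th H).
    by apply: fine_ge0; exact: (K_env_ge0 n_gt0 s1 (wavelet_decays_primal wp)).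
  exact: (K_U_uniform _ _ _ _ wp HM).
have H := wavelet_coef_le n_gt0 p_gt1 wp wn j Lam c.
rewrite powRN -/u -/X -/N in H.
apply: (lower_constant_uniform _ _ KL0 A1 u0 _ th H).
- by apply: fine_ge0; exact: (K_env_ge0 n_gt0 s0 (wavelet_decays_dual wp)).
- exact: (K_L_uniform _ _ _ _ wp HD).
- exact: Lpw_norm_ge0.
Qed.

End main_parts.

Theorem mainTheorem6 (R : realType) (n : nat) (p : R)
    (n_gt0 : (0 < n)%N) (p_gt1 : 1 < p) :
  (* (a) *)
  (forall (L : nat) (a b A B : R) (psi psit : 'I_L -> 'rV[R]_n -> R[i])
      (e : 'I_L) (tau sigma : R),
    wavelet_pair a b A B psi psit e tau sigma ->
    [/\ forall w : 'rV[R]_n -> R, in_Ap p w ->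
          forall (j : int) (Lam : {fset 'rV[int]_n}) (c : 'rV[int]_n -> R[i]),
          (((fine (K_L p (psit e)))^-1 * Ap_const p w `^ (- p^-1)
              * 2 `^ (j%:~R * n%:R / 2))%R%:E
            * coef_norm p w j Lam c
           <= Lpw_norm p w (single_scale (psi e) j Lam c))%E /\
          (Lpw_norm p w (single_scale (psi e) j Lam c)
           <= K_U p (psi e)
              * (Ap_const p w `^ p^-1 * 2 `^ (j%:~R * n%:R / 2))%R%:E
              * coef_norm p w j Lam c)%E,
        (K_U p (psi e) <= M_norm tau (psi e)
           * (zeta_factor (gamU n p) (1 + tau + n%:R / p))%:E)%E,
        (L_sup sigma (psit e) < +oo)%E &
        (K_L p (psit e) <= L_sup sigma (psit e)
           * (zeta_factor (gamL n p) (1 + sigma - n%:R - n%:R / p))%:E)%E])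
  /\
  (p^-1 <= theta p /\ (p^-1 = theta p <-> p = 2))
  /\
  (forall A B tau sigma a b Mpsi Dpsit : R, 0 < tau -> 2 * n%:R < sigma ->
    exists c0 C0 : R, [/\ 0 < c0, 0 < C0 &
    forall (L : nat) (psi psit : 'I_L -> 'rV[R]_n -> R[i]) (e : 'I_L),
    wavelet_pair a b A B psi psit e tau sigma ->
    \big[Num.max/0]_(i < L) fine (M_norm tau (psi i)) = Mpsi ->
    \big[Num.max/0]_(i < L) fine (D_norm sigma (psit i)) = Dpsit ->
    forall w : 'rV[R]_n -> R, in_Ap p w ->
    forall (j : int) (Lam : {fset 'rV[int]_n}) (c : 'rV[int]_n -> R[i]),
      ((c0 * Ap_const p w `^ (- theta p) * 2 `^ (j%:~R * n%:R / 2))%R%:E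
         * coef_norm p w j Lam c
       <= Lpw_norm p w (single_scale (psi e) j Lam c))%E /\
      (Lpw_norm p w (single_scale (psi e) j Lam c)
       <= (C0 * Ap_const p w `^ theta p * 2 `^ (j%:~R * n%:R / 2))%R%:E
          * coef_norm p w j Lam c)%E])
  /\
  (* (b) *)
  (forall h : 'rV[R]_n -> R[i], schwartz h ->
    (forall w : 'rV[R]_n -> R, in_Ap p w ->
     forall (j : int) (Lam : {fset 'rV[int]_n}) (c : 'rV[int]_n -> R[i]),
      (Lpw_norm p w (single_scale h j Lam c)
       <= K_U p h * (Ap_const p w `^ p^-1 * 2 `^ (j%:~R * n%:R / 2))%R%:E
          * coef_norm p w j Lam c)%E) /\
    (forall tau : R, 0 < tau ->
      (K_U p h <= M_norm tau h
         * (zeta_factor (gamU n p) (1 + tau + n%:R / p))%:E)%E))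
  /\
  (* (c) *)
  (forall (h : 'rV[R]_n -> R[i]) (sigma Lh : R),
    clmeasurable h -> 2 * n%:R < sigma ->
    (forall x, normc (h x) <= Lh * (1 + enorm x) `^ (- sigma)) ->
    (forall w : 'rV[R]_n -> R, in_Ap p w ->
     forall g : 'rV[R]_n -> R[i], in_Lpw p w g ->
      (\int[lebesgue_rV n]_x (normc (g x) * normc (h x))%R%:E
       <= K_L p h
          * (Ap_const p w `^ p^-1 * fine (wmass w (dyadic 0 0)) `^ (- p^-1))%R%:E
          * Lpw_norm p w g)%E) /\
    (K_L p h <= Lh%:E
       * (zeta_factor (gamL n p) (1 + sigma - n%:R - n%:R / p))%:E)%E)
  /\
  (forall w : 'rV[R]_n -> R, in_Ap p w ->
    forall g : 'rV[R]_n -> R[i], in_Lpw p w g ->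
    [/\ forall h, schwartz h ->
          (\int[lebesgue_rV n]_x (normc (g x * h x))%:E < +oo)%E,
        tempered (regular_dist g) &
        forall (L : nat) (a b A B : R) (psi psit : 'I_L -> 'rV[R]_n -> R[i])
          (e : 'I_L) (tau sigma : R),
        wavelet_pair a b A B psi psit e tau sigma ->
        forall (j : int) (k : 'rV[int]_n),
          (\int[lebesgue_rV n]_x
             (normc (g x * conjc (dilate (psit e) j k x)))%:E < +oo)%E])
  /\
  (* (d) *)
  (forall (L : nat) (a b A B : R) (psi psit : 'I_L -> 'rV[R]_n -> R[i])
      (e : 'I_L) (tau sigma : R) (c1 c2 : R) (phi : 'rV[R]_n -> R[i])
      (w : 'rV[R]_n -> R) (s q : R) (l : int)
      (Lam : {fset 'rV[int]_n}) (c : 'rV[int]_n -> R[i]),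
    wavelet_pair a b A B psi psit e tau sigma ->
    lp_function c1 c2 phi ->
    in_Ap p w -> 0 < s -> 0 < q ->
    let M := band_width a b c1 c2 in
    let r := single_scale (psi e) l Lam c in
    let Delta j := lp_block phi j (regular_dist r) in
    let besov_r := besov_norm phi s p q w (regular_dist r) in
    (((C_band M s)^-1 * 2 `^ (l%:~R * s))%R%:E * Lpw_norm p w r <= besov_r)%E
    /\
    (besov_r
     <= (C_band' M s q)%:E * K_eta M p phi (psi e)
        * (Ap_const p w `^ p^-1 * 2 `^ (l%:~R * (s + n%:R / 2)))%R%:E
        * coef_norm p w l Lam c)%E
    /\
    in_besov phi s p q w (regular_dist r)
    /\
    (forall xi, ~~ (2 ^ l * a <= enorm xi <= 2 ^ l * b) -> fourier r xi = 0)
    /\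
    (forall x, r x = \sum_(i <- zrange M) Delta (l + i) x)
    /\
    (forall j : int, (M%:Z < `|j - l|)%R -> forall x, Delta j x = 0)
    /\
    (forall j : int,
      ((2 `^ (j%:~R * s))%R%:E * Lpw_norm p w (Delta j) <= besov_r)%E)
    /\
    (forall i : int, schwartz (convolve (lp_dilate phi i) (psi e)))
    /\
    (forall (i : int) (k : 'rV[int]_n) x,
      convolve (lp_dilate phi (l + i)) (dilate (psi e) l k) x
      = dilate (convolve (lp_dilate phi i) (psi e)) l k x)
    /\
    (besov_r
     <= (2 `^ (l%:~R * s) * C_band' M s q)%R%:E
        * \big[maxe/0%E]_(i <- zrange M) Lpw_norm p w (Delta (l + i)%R))%E).

Proof.
split; [|split; [|split; [|split; [|split; [|split]]]]].
- move=> L a b A B psi psit e tau sigma wp; split.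
  + exact: (wavelet_two_sided n_gt0 p_gt1 wp).
  + exact: (K_U_M_norm n_gt0 p_gt1 _ (wavelet_tau_gt0 wp)).
  + exact: (wavelet_L_sup_lty wp).
  + rewrite (ge0_fineE (L_sup_ge0 sigma (psit e)) (wavelet_L_sup_lty wp)).
    exact: (K_L_decays n_gt0 p_gt1 (wavelet_sigma_gt wp) (wavelet_decays_dual wp)).
- by split; [exact: theta_ge|exact: theta_eq].
- exact: (wavelet_uniform n_gt0 p_gt1).
- move=> h sh; split; last by move=> tau; exact: (K_U_M_norm n_gt0 p_gt1 h).
  move=> w wA j Lam c; have [w' [wn e1 e2 e3 e4]] := in_Ap_nice wA.
  rewrite e2 e3 e4; have [C [hC gs]] := rapid_K_U n_gt0 p_gt1 (schwartz_rapid [::] sh).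
  exact: (single_scale_upper n_gt0 p_gt1 wn hC gs).
- move=> h sigma Lh mh s2 hL; split; last exact: (K_L_decays n_gt0 p_gt1 s2 hL).
  move=> w wA g gL; have [w' [wn e1 e2 e3 e4]] := in_Ap_nice wA.
  move: gL; rewrite /in_Lpw e1 [Lpw_norm p w]e2 e4 => gL.
  exact: (pairing_le n_gt0 p_gt1 wn hL s2 gL).
- move=> w wA g gL; split.
  + move=> h sh; have k2 : 2 * n%:R < (2 * n + 1)%:R :> R by rewrite natrD natrM ltrDl.
    exact: (pairing_lty n_gt0 p_gt1 wA (schwartz_cmeas sh) (schwartz_decays (2 * n + 1) sh) k2 gL).
  + exact: (tempered_Lpw n_gt0 p_gt1 wA gL).
  + move=> L a b A B psi psit e tau sigma wp j k.
    have s2 := wavelet_sigma_gt wp.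
    have s0 : 0 <= sigma by have := ler0n R n; lra.
    have [C hC] := decays_dilate j k s0 (wavelet_decays_dual wp).
    have hC' : decays (fun x => conjc (dilate (psit e) j k x)) C sigma.
      by move=> x; rewrite normc_conj.
    have psit1 : cL1 (psit e).
      by case: (wp) => ws _ _ _ _; exact: (band_limited_cL1 (ws_dual ws e)).
    exact: (pairing_lty n_gt0 p_gt1 wA (cmeas_conj (cL1_dilate j k psit1).1) hC' s2 gL).
- move=> L a b A B psi psit e tau sigma c1 c2 phi w s q l Lam c wp lp wA s0 q0.
  have ab := wavelet_radii wp.
  have bp : band_limited a b (psi e) by case: (wp) => ws _ _ _ _; exact: (ws_primal ws e).
  have [w' [wn e1 e2 e3 e4]] := in_Ap_nice wA.
  move=> M r Delta besov_r; rewrite /besov_r /in_besov /besov_norm e2 e3 e4.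
  split; first exact: (besov_lower s n_gt0 p_gt1 wn ab bp lp q0 l Lam c).
  split; first exact: (besov_upper s n_gt0 p_gt1 wn ab bp lp q0 l Lam c).
  split.
    split; first by apply: tempered_regular_dist; exact: (cL1_single_scale bp l Lam c).
    exact: (besov_fin s n_gt0 p_gt1 wn ab bp lp q0 l Lam c).
  split; first by move=> xi; exact: (fourier_single_scale_support bp).
  split; first by move=> x; exact: (lp_block_sum ab bp lp).
  split; first by move=> j jM x; exact: (lp_block_off ab bp lp).
  split; first by move=> j; exact: (besov_block s n_gt0 p_gt1 wn ab bp lp q0 l Lam c).
  split; first by move=> i; exact: (schwartz_lp_convolve ab bp lp).
  split; last exact: (besov_max s n_gt0 p_gt1 wn ab bp lp q0 l Lam c).
  move=> i k x.
  have sphi := lp_schwartz lp.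
  have [C HC] := schwartz_bounded_partials sphi [::].
  exact: (convolve_dilate _ _ _ _ (schwartz_cmeas sphi) HC (band_limited_cL1 bp)).
Qed.
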